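(* Let $F_1,\ldots,F_r\in\mathbb{Q}[X_1,\ldots,X_s]$ be rational quadratic forms. Suppose that each form in the complex pencil of $F_1,\ldots,F_r$ has rank exceeding $2r^2+2r$, and suppose that the system $F_1=\ldots=F_r=0$ has a non-singular real zero. Let $\mathcal B$ be a box in $\mathbb{R}^s$ with sides parallel to the coordinate axes and contained in the unit box, and let $$\varrho(P)=\#\{\mathbf x\in\mathbb{Z}^s:\mathbf x\in P\mathcal B\text{ and }F_i(\mathbf x)=0\ (1\le i\le r)\}.$$ Then there exists a positive $\delta$ such that the asymptotic formula $$\varrho(P)=\mathfrak J\,\mathfrak S\,P^{s-2r}+O(P^{s-2r-\delta})$$ holds true, and the singular integral $\mathfrak J$ and the singular series $\mathfrak S$ are positive. In particular, the intersection $F_1=\ldots=F_r=0$ has a non-trivial rational zero, i.e. a zero in $\mathbb{Q}^s\setminus\{\mathbf 0\}$.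
   Context: The complex pencil of $F_1,\ldots,F_r$ is the set of forms $a_1F_1+\ldots+a_rF_r$ with $\mathbf a\in\mathbb{C}^r\setminus\{\mathbf 0\}$. The rank of a quadratic form is the rank of its symmetric coefficient matrix. A non-singular real zero is a point $\mathbf x\in\mathbb{R}^s$ with $F_1(\mathbf x)=\ldots=F_r(\mathbf x)=0$ at which the Jacobian matrix $(\partial F_i/\partial x_j(\mathbf x))_{i,j}$ has rank $r$. The unit box is $[-1,1]^s$, and $P\mathcal B=\{P\mathbf y:\mathbf y\in\mathcal B\}$. Write $e(x)=e^{2\pi i x}$. The singular integral and singular series are the usual ones of the Hardy-Littlewood circle method: after multiplying $F_1,\ldots,F_r$ by a common positive integer so that they have integer coefficients (which does not change $\varrho(P)$), $$\mathfrak J=\int_{\mathbb{R}^r}\int_{\mathcal B}e\Big(\sum_{i=1}^r\gamma_iF_i(\boldsymbol\xi)\Big)\,d\boldsymbol\xi\,d\boldsymbol\gamma,$$ $$\mathfrak S=\sum_{q=1}^\infty\ \sum_{\substack{\mathbf a\in\{1,\ldots,q\}^r\\ \gcd(a_1,\ldots,a_r,q)=1}}q^{-s}\sum_{\mathbf x\in\{1,\ldots,q\}^s}e\Big(\frac1q\sum_{i=1}^ra_iF_i(\mathbf x)\Big).$$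
   Formalization: Positivity of the singular integral, false for boxes that miss the real zeros, is claimed only when a non-singular real zero lies in the interior of the box; the asymptotic formula, positivity of the singular series and the rational zero are claimed for every box in the unit box. *)

(* Defs.v *)
From HB Require Import structures.
From mathcomp Require Import all_boot all_order all_algebra.
(* mpoly must be imported before mathcomp-analysis: in the other order their
   notations clash. *)
From mathcomp Require Import finmap complex mpoly.
From mathcomp Require Import all_classical all_reals all_analysis.

Set Implicit Arguments.
Unset Strict Implicit.
Unset Printing Implicit Defensive.

Import Order.TTheory GRing.Theory Num.Theory numFieldNormedType.Exports.

Local Open Scope classical_set_scope.
Local Open Scope ring_scope.

Section TupleLebesgueStep.
Context (R : realType) (n : nat).

Definition tcons (p : measurableTypeR R * n.-tuple R) : n.+1.-tuple R :=
  [tuple of p.1 :: p.2].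

Let measurable_tcons : measurable_fun setT tcons.
Proof. exact: (measurable_cons (f := fst) (g := snd)). Qed.

Definition tuncons (t : n.+1.-tuple R) : measurableTypeR R * n.-tuple R :=
  (thead t, [tuple of behead t]).

Let tconsK : cancel tcons tuncons.
Proof. by move=> [x t]; congr pair; apply/val_inj. Qed.

Let measurable_tuncons : measurable_fun setT tuncons.
Proof.
apply/measurable_fun_pairP; split; first exact: measurable_tnth.
apply/measurable_fun_tnthP => i.
rewrite (_ : _ \o _ = fun t : n.+1.-tuple R => tnth t (lift ord0 i)).
  exact: measurable_tnth.
by apply/funext => t /=; rewrite tnth_behead; congr tnth; apply/val_inj;
   rewrite /= inordK // ltnS.
Qed.

Variable mu : {sigma_finite_measure set (n.-tuple R) -> \bar R}.

Definition tcons_measure : set (n.+1.-tuple R) -> \bar R :=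
  pushforward (lebesgue_measure \x mu)%E tcons.

Let m := measure_function_pushforward__canonical__measure_function_Measure
  (product_measure1 (@lebesgue_measure R) mu) measurable_tcons.

HB.instance Definition _ := isMeasure.Build _ _ _ tcons_measure
  (measure0 m) (measure_ge0 m) (@measure_semi_sigma_additive _ _ _ m).

Let tcons_measure_sigma_finite : sigma_finite setT tcons_measure.
Proof.
have /sigma_finiteP[F [TF ndF Foo]] := sigma_finiteT (@lebesgue_measure R).
have /sigma_finiteP[G [TG ndG Goo]] := sigma_finiteT mu.
exists (fun k => tuncons @^-1` (F k `*` G k)).
  rewrite -preimage_bigcup -(preimage_setT tuncons); congr (_ @^-1` _).
  rewrite -setXTT TF TG predeqE => -[x y]; split.
    move=> [/= [k _ Fkx] [l _ Gly]]; exists (maxn k l) => //; split.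
    - by move: x Fkx; exact/subsetPset/ndF/leq_maxl.
    - by move: y Gly; exact/subsetPset/ndG/leq_maxr.
  by move=> [k _ []/= ? ?]; split; exists k.
move=> k; have [mF Fk] := Foo k; have [mG Gk] := Goo k; split.
  rewrite -[X in measurable X]setTI; apply: measurable_tuncons => //.
  exact: measurableX.
rewrite /tcons_measure /pushforward -comp_preimage (_ : _ \o _ = id).
  by rewrite preimage_id product_measure1E// lte_mul_pinfty// ge0_fin_numE.
by apply/funext => p; exact: tconsK.
Qed.

HB.instance Definition _ := Measure_isSigmaFinite.Build _ _ _ tcons_measure
  tcons_measure_sigma_finite.

End TupleLebesgueStep.

(* Lebesgue measure on R^n as an iterated product measure. *)
Fixpoint tuple_lebesgue (R : realType) (n : nat) :
    {sigma_finite_measure set (n.-tuple R) -> \bar R} :=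
  match n with
  | 0 => dirac ([tuple] : 0.-tuple R)
  | k.+1 => tcons_measure (tuple_lebesgue R k)
  end.

(* Pitfall: in the order on R[i], 0 < z means that z is real and positive. *)
Section ComplexIntegral.
Context d (T : measurableType d) (R : realType).
Variables (mu : {measure set T -> \bar R}) (D : set T) (f : T -> R[i]).

Definition Cintegrable : Prop :=
  mu.-integrable D (EFin \o (fun x => complex.Re (f x))) /\
  mu.-integrable D (EFin \o (fun x => complex.Im (f x))).

Definition Cintegral : R[i] :=
  ((\int[mu]_(x in D) complex.Re (f x)) +i*
   (\int[mu]_(x in D) complex.Im (f x)))%C.

End ComplexIntegral.

Definition expi2pi (R : realType) (x : R) : R[i] :=
  (cos (2 * pi * x) +i* sin (2 * pi * x))%C.

Section QuadraticForms.
Variables r s : nat.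

(* The symmetric coefficient matrix A of a quadratic form p, i.e. the one with
   p = \sum_(j, k) A j k X_j X_k: off the diagonal, the coefficient of X_j X_k
   is shared between A j k and A k j. *)
Definition qform_mx (K : fieldType) (p : {mpoly K[s]}) : 'M[K]_s :=
  \matrix_(j, k) if j == k then p@_(U_(j) + U_(k))%MM
                 else p@_(U_(j) + U_(k))%MM / 2.

Definition qform_rank (K : fieldType) (p : {mpoly K[s]}) : nat :=
  \rank (qform_mx p).

Definition qevalr (K : numFieldType) (p : {mpoly rat[s]}) (v : 'I_s -> K) : K :=
  (map_mpoly (ratr : rat -> K) p).@[v].

Definition cpencil (R : realType) (F : 'I_r -> {mpoly rat[s]})
    (a : 'I_r -> R[i]) : {mpoly R[i][s]} :=
  \sum_i a i *: map_mpoly (ratr : rat -> R[i]) (F i).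

Definition jacobian_mx (R : realType) (F : 'I_r -> {mpoly rat[s]})
    (x : s.-tuple R) : 'M[R]_(r, s) :=
  \matrix_(i, j) qevalr (F i)^`M(j) (tnth x).

Definition nonsingular_real_zero (R : realType) (F : 'I_r -> {mpoly rat[s]})
    (x : s.-tuple R) : Prop :=
  (forall i, qevalr (F i) (tnth x) = 0) /\ \rank (jacobian_mx F x) = r.

Definition integer_coeffs (F : 'I_r -> {mpoly rat[s]}) : Prop :=
  forall i, F i \is a mpolyOver s Num.int.

End QuadraticForms.

Section Boxes.
Context (R : realType) (s : nat).

(* The endpoints of each side may or may not belong to the box. *)
Definition box (I : 'I_s -> interval R) : set (s.-tuple R) :=
  [set x | forall j, tnth x j \in I j].

Definition box_interior (I : 'I_s -> interval R) : set (s.-tuple R) :=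
  [set x | forall j, [set` I j]° (tnth x j)].

Definition unit_box : set (s.-tuple R) := box (fun=> `[-1, 1]).

Definition dilate (P : R) (A : set (s.-tuple R)) : set (s.-tuple R) :=
  [set [tuple P * tnth y j | j < s] | y in A].

End Boxes.

Arguments unit_box : clear implicits.

Section CircleMethod.
Context (R : realType) (r s : nat).
Variable F : 'I_r -> {mpoly rat[s]}.

(* Number of integral zeros of F in A. The set is finite, hence fset_set is
   meaningful, as soon as A is bounded. *)
Definition count_zeros (A : set (s.-tuple R)) : nat :=
  #|` fset_set [set x : s.-tuple int |
        A [tuple (tnth x j)%:~R | j < s] /\
        forall i, (F i).@[fun j => (tnth x j)%:~R] = 0]|%fset.

Definition singular_integrand (B : set (s.-tuple R)) (g : r.-tuple R) : R[i] :=
  Cintegral (tuple_lebesgue R s) B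
    (fun xi => expi2pi (\sum_i tnth g i * qevalr (F i) (tnth xi))).

Definition singular_integral_converges (B : set (s.-tuple R)) : Prop :=
  Cintegrable (tuple_lebesgue R r) setT (singular_integrand B).

Definition singular_integral (B : set (s.-tuple R)) : R[i] :=
  Cintegral (tuple_lebesgue R r) setT (singular_integrand B).

(* The elements of {1, ..., q} are represented as k.+1 with k : 'I_q. *)
Definition singular_series_term (q : nat) : R[i] :=
  \sum_(a : r.-tuple 'I_q |
        gcdn (\big[gcdn/0]_(i < r) (tnth a i).+1)%N q == 1%N)
    q%:R ^- s *
    \sum_(x : s.-tuple 'I_q)
      expi2pi (q%:R^-1 * \sum_i (tnth a i).+1%:R *
                           qevalr (F i) (fun j => (tnth x j).+1%:R : R)).

(* R[i]^o carries the topology of the complex modulus. *)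
Definition singular_partial_sum (Q : nat) : R[i]^o :=
  \sum_(1 <= q < Q.+1) singular_series_term q.

Definition singular_series_converges : Prop := cvgn singular_partial_sum.

Definition singular_series : R[i] := limn singular_partial_sum.

End CircleMethod.

(* Main.v *)
(* Circle method in Birch's form. Weyl differencing bounds an exponential sum by
 the number of small integral points at which the linear forms of the pencil are
 almost integral; shrinking these points by the pigeonhole principle in a symplectic
 lattice, either the sum is small or its argument lies on a major arc, as the rank
 is large. On the major arcs the sum factors into Gauss sums and oscillatory
 integrals, which decay fast enough to be summed and integrated.
 Both constants are bounded below by counting approximate zeros near a nonsingular
 zero, parametrized by a contraction argument valid over R and over Q_p. Over Q_p
 such a zero comes from the isotropy of quadratic forms in five variables, by
 induction on the number of forms (more than 2n(n+1) variables), the rank condition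
 being moved from C to Q_p by embedding finitely generated subfields into C.
 The singular series is a product of local densities. *)
Require Import Defs.
From HB Require Import structures.
From mathcomp Require Import all_boot all_order all_algebra.
From mathcomp Require Import finmap complex mpoly.
From mathcomp Require Import all_classical all_reals all_analysis.
From mathcomp Require Import measurable_realfun.
From mathcomp Require Import ring lra zify.

Set Implicit Arguments.
Unset Strict Implicit.
Unset Printing Implicit Defensive.

Import Order.TTheory GRing.Theory Num.Theory numFieldNormedType.Exports.

Local Open Scope classical_set_scope.
Local Open Scope ring_scope.

Local Notation truncn := Num.truncn.
Local Notation Re := complex.Re.
Local Notation Im := complex.Im.
Local Notation choice := boolp.choice.
Local Notation pts n m := {ffun 'I_n -> 'I_m}.
Local Notation fracs M k := (fun i => (k i)%:R / M%:R).

(** For [n = r.+1] forms, a rank above [2n(n+1)] saves a factor [H ^ (n(n+1)) * sqrt H] in an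
    exponential sum off the major arcs of height [H], while the frequencies on the arcs of height
    [H] grow in number like [H ^ (n(n+1))]. The surplus [sqrt H] alone makes the minor arcs
    negligible and the singular series and the singular integral absolutely convergent. The same
    number [2n(n+1)] returns over Q_p, where it comes from the five variables of a single form.
    Frequencies are not integrated over the torus: they run over the fractions [k / M], with [M] so
    large that a value of a form divisible by [M] is zero, and divisible by every denominator of a
    major arc, so that arcs can be translated within the grid. Integrals occur only where sums are
    compared with the singular integral. The integrand of the singular integral has no definite
    sign; a Fejer average turns it into the integral of a square, to which points near a real zero
    contribute a positive amount. *)

Lemma eqle (R : numDomainType) (x y : R) : x = y -> x <= y.
Proof. by move->. Qed.

(** * Pigeonhole principles and bounded coordinates *)

Lemma pigeonhole_seq (T : Type) (K : finType) (c : T -> K) (X : seq T) :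
 (0 < #|K|)%N ->
 exists k, (size X <= #|K| * size [seq x <- X | c x == k])%N.
Proof.
move=> /card_gt0P[k0 _].
have Hsum : (\sum_k count (fun x => c x == k) X = size X)%N.
 elim: X => [|x X IH] /=; first by rewrite big1.
 rewrite big_split /= IH (bigD1 (c x)) //= eqxx big1 ?addn0 // => k.
 by rewrite eq_sym => /negbTE->.
pose m k := count (fun x => c x == k) X.
exists [arg max_(k > k0) m k]%N; case: arg_maxnP => //= k _ kmax.
rewrite -Hsum size_filter -sum_nat_const; apply: leq_sum => i _.
exact: kmax.
Qed.

Lemma size_le_card (T : eqType) (K : finType) (g : T -> K) (X : seq T) :
 uniq X -> {in X &, injective g} -> (size X <= #|K|)%N.
Proof.
move=> uX gi; rewrite -(size_map g) -(card_uniqP _) ?max_card //.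
by rewrite map_inj_in_uniq.
Qed.

(** Each interval [[-A, A]] is cut into [k] cells of side [c]; [p] selects the fullest of the
    [k ^ d] product cells. *)
Lemma cells (R : realType) (T : eqType) (d k : nat) (V : T -> 'I_d -> R)
  (X : seq T) (A c : R) :
 0 < c -> 2 * A / c < k%:R ->
 (forall x j, x \in X -> `|V x j| <= A) ->
 exists p : pred T, (size X <= k ^ d * size [seq x <- X | p x])%N /\
  forall x y j, x \in X -> y \in X -> p x -> p y ->
   `|V x j - V y j| <= c.
Proof.
move=> c0 kA HV.
(* For [k = 0] the hypothesis [2 * A / c < k] forces [A] to be negative, which leaves only an empty
   list or no coordinates. *)
case: k kA => [|k] kA.
 case: X HV => [|x X] HV; first by exists xpredT; split.
 case: d V HV => [|d] V HV; first by exists xpredT; rewrite expn0 mul1n filter_predT; split => // ? ? [].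
 have := le_trans (normr_ge0 _) (HV x ord0 (mem_head _ _)) => A0.
 by move: kA; rewrite ltNge divr_ge0 ?mulr_ge0 ?(ltW c0).
pose cl x : pts d k.+1 := [ffun j => inord (truncn ((V x j + A) / c))].
have [|q Hq] := pigeonhole_seq cl X; first by rewrite card_ffun !card_ord expn_gt0.
rewrite card_ffun !card_ord in Hq.
exists (fun x => cl x == q); split => // x y j xX yX /eqP xq /eqP yq.
have bnd z : z \in X -> 0 <= (V z j + A) / c < k.+1%:R.
 move=> /(HV _ j); rewrite ler_norml => /andP[h1 h2]; apply/andP; split.
  by apply: divr_ge0; [lra | exact: ltW].
 apply: le_lt_trans kA; rewrite ler_pM2r ?invr_gt0 //; lra.
have tr z : z \in X -> (cl z j : nat) = truncn ((V z j + A) / c).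
 move=> /bnd /andP[h1 h2]; rewrite ffunE inordK // truncn_lt_nat //.
have Hxy : truncn ((V x j + A) / c) = truncn ((V y j + A) / c) by rewrite -!tr // xq yq.
have /andP[x0 _] := bnd x xX; have /andP[y0 _] := bnd y yX.
have /andP[a1 a2] := truncn_itv x0; have /andP[b1 b2] := truncn_itv y0.
rewrite Hxy in a1 a2.
have E : V x j - V y j = ((V x j + A) / c - (V y j + A) / c) * c.
 by rewrite -mulrBl mulfVK ?gt_eqF //; ring.
rewrite E normrM (gtr0_norm c0) ger_pMl // ler_norml.
move: a2 b2; rewrite -natr1; set u := (_%:R : R) in a1 b1 *; lra.
Qed.

(** Among all choices of [\rank M] columns, one is taken whose minor in a basis of the row space is
    largest in absolute value. By Cramer's rule the coefficients of any other column are quotients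
    of two such minors, hence at most 1. *)
Lemma bounded_coords (K : realFieldType) n d (M : 'M[K]_(n, d)) :
 exists (f : 'I_(\rank M) -> 'I_d) (c : 'M[K]_(\rank M, d)),
  (forall l j, `|c l j| <= 1) /\ M = colsub f M *m c.
Proof.
have [B [MB fB]] : exists B : 'M[K]_(\rank M, d), M = col_base M *m B /\ row_full B^T.
 by exists (row_base M); rewrite mulmx_base /row_full mxrank_tr; split => //; exact: row_base_free.
move: (col_base M) MB => A; move: (\rank M) A B fB => w A B fB MB.
pose f0 : pts w d := [ffun i => fullrankfun fB i].
pose dt (f : pts w d) := `|\det (colsub f B)|.
have dt0 : dt f0 != 0.
 rewrite /dt normr_eq0 -unitfE -det_tr.
 have := fullrowsub_unit fB; rewrite unitmxE; congr (_ \is a GRing.unit).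
 congr determinant; apply/matrixP => i j; by rewrite !mxE /f0 !ffunE.
have [f _ fmax] := @arg_maxP _ _ _ f0 xpredT dt isT.
have {}fmax g : dt g <= dt f := fmax g isT.
have dtf : dt f != 0 by rewrite gt_eqF // (lt_le_trans _ (fmax f0)) // lt_def dt0 normr_ge0.
have Uf : colsub f B \in unitmx by rewrite unitmxE unitfE -normr_eq0.
pose c := invmx (colsub f B) *m B.
have Ec : colsub f B *m c = B by rewrite /c mulmxA mulmxV ?mul1mx.
have cE i k : c i (f k) = (i == k)%:R.
 have : colsub f c i k = (i == k)%:R by rewrite /c -mulmx_colsub mulVmx // mxE.
 by rewrite mxE.
clearbody c; exists f, c; split; last first.
 have -> : colsub f M = A *m colsub f B by rewrite mulmx_colsub -MB.
 by rewrite -mulmxA Ec.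
move=> l j; pose f' : pts w d := [ffun i => if i == l then j else f i].
have Edet : \det (colsub f' B) = \det (colsub f B) * c l j.
 have -> : colsub f' B = colsub f B *m colsub f' c by rewrite mulmx_colsub Ec.
 rewrite det_mulmx; congr (_ * _).
 rewrite (expand_det_col _ l).
 have cof i : cofactor (colsub f' c) i l = cofactor 1%:M i l.
  rewrite /cofactor; congr (_ * \det _); apply/matrixP => a b.
  have nl : lift l b != l by rewrite eq_sym neq_lift.
  by rewrite !mxE /f' !ffunE (negbTE nl) cE.
 rewrite (eq_bigr (fun i => c i j * (i == l)%:R)).
  rewrite (bigD1 l) //= eqxx mulr1 big1 ?addr0 // => i /negbTE->.
  by rewrite mulr0.
 move=> i _; rewrite cof mxE /f' ffunE eqxx; congr (_ * _).
 have : (\adj (1%:M : 'M[K]_w)) l i = (i == l)%:R by rewrite adj1 mxE eq_sym.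
 by rewrite mxE.
have := fmax f'; rewrite /dt Edet normrM.
by rewrite -[leRHS]mulr1 ler_pM2l // lt_def normr_ge0 andbT; exact: dtf.
Qed.

Lemma det_bound (K : realFieldType) n (A : 'M[K]_n) (c : K) :
 (forall i j, `|A i j| <= c) -> `|\det A| <= n`!%:R * c ^+ n.
Proof.
move=> hA; rewrite /determinant; apply: le_trans (ler_norm_sum _ _ _) _.
have h s : `|(-1) ^+ perm.odd_perm s * \prod_(i < n) A i (perm.fun_of_perm s i)| <= c ^+ n.
 rewrite normrM normrX normrN1 expr1n mul1r normr_prod.
 have -> : c ^+ n = \prod_(i < n) c by rewrite prodr_const card_ord.
 by apply: ler_prod => i _; rewrite normr_ge0 hA.
by rewrite -(perm.card_Sn n) mulr_natl -sumr_const; apply: ler_sum => i _; exact: h.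
Qed.

Lemma adj_bound (K : realFieldType) n (A : 'M[K]_n.+1) (c : K) :
 (forall i j, `|A i j| <= c) -> forall i j, `|\adj A i j| <= n`!%:R * c ^+ n.
Proof.
move=> hA i j; rewrite mxE /cofactor normrM normrX normrN1 expr1n mul1r.
by apply: det_bound => a b; rewrite !mxE.
Qed.

(** The points span a space of dimension at most [s - \rank A], in which as many coordinates
    determine a point; each coordinate takes at most [2 * H + 1] values. *)
Lemma int_points_kernel (s H : nat) (A : 'M[rat]_s) (X : seq 'rV[int]_s) :
 uniq X -> (forall x, x \in X -> forall j, `|x 0 j| <= H%:Z) ->
 (forall x, x \in X -> map_mx intr x *m A = 0) ->
 (size X <= (2 * H).+1 ^ (s - \rank A))%N.
Proof.
move=> uX bX kX; pose n := size X.
pose M : 'M[rat]_(n, s) := \matrix_(i < n, j < s) (X`_i 0 j)%:~R.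
have MA : M *m A = 0.
 apply/row_matrixP => i; rewrite row_mul row0 -(kX X`_i); last by apply: mem_nth.
 by congr (_ *m _); apply/rowP => j; rewrite !mxE.
have rM : (\rank M <= s - \rank A)%N.
 by have := mulmx0_rank_max MA; lia.
have [f [c [_ Mc]]] := bounded_coords M.
pose g (x : 'rV[int]_s) : pts (\rank M) (2 * H).+1 :=
 [ffun l => inord (absz (x 0 (f l) + H%:Z))].
have gi : {in X &, injective g}.
 move=> x y xX yX gxy.
 have Ex l : x 0 (f l) = y 0 (f l).
  move/ffunP/(_ l): gxy; rewrite !ffunE => /(congr1 val) /=.
  have := bX x xX (f l); have := bX y yX (f l) ; rewrite !ler_norml => /andP[h1 h2] /andP[h3 h4].
  move: (x 0 (f l)) (y 0 (f l)) h1 h2 h3 h4 => u v h1 h2 h3 h4.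
  by rewrite !inordK; lia.
 have row_of z : z \in X -> map_mx intr z = (map_mx intr (colsub f z)) *m c :> 'rV[rat]_s.
  move=> zX.
  have iz : (index z X < n)%N by rewrite index_mem.
  have -> : map_mx intr z = row (Ordinal iz) M by apply/rowP => j; rewrite !mxE /= nth_index.
  have -> : map_mx intr (colsub f z) = row (Ordinal iz) (colsub f M) :> 'rV[rat]_ _.
   by apply/rowP => j; rewrite !mxE /= nth_index.
  by rewrite -row_mul -Mc.
 have E : map_mx intr x = map_mx intr y :> 'rV[rat]_s.
  rewrite row_of // (row_of y) //; congr (map_mx _ _ *m _).
  by apply/rowP => l; rewrite !mxE Ex.
 by apply/rowP => j; apply: (@intr_inj rat); move/rowP/(_ j): E; rewrite !mxE.
apply: leq_trans (size_le_card uX gi) _.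
by rewrite card_ffun !card_ord leq_pexp2l.
Qed.

Definition polar s (C : 'M[int]_s) : 'M[int]_s := C + C^T.
Definition pencil_mx (K : nzRingType) r s (C : 'I_r -> 'M[int]_s) (b : 'I_r -> K) : 'M[K]_s :=
 \sum_i b i *: map_mx intr (polar (C i)).

Lemma pencil_mx_sym (K : comNzRingType) r s (C : 'I_r -> 'M[int]_s) (b : 'I_r -> K) :
 (pencil_mx C b)^T = pencil_mx C b.
Proof.
rewrite /pencil_mx raddf_sum; apply: eq_bigr => i _ /=.
by rewrite linearZ /= /polar map_trmx linearD /= trmxK addrC.
Qed.

(** * The alternative between few close points and a major arc *)

Section Dichotomy.
Variable R : realType.

Definition close_pt s (A : R) (L : 'M[R]_s) (e : R) (h : 'rV[int]_s) : Prop :=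
 forall j, `|(h 0 j)%:~R| <= A /\
  exists m : int, `|(map_mx intr h *m L) 0 j - m%:~R| <= e.

(** Simultaneous approximation with one denominator [q]; the fraction may be unreduced, and the
    error is measured after multiplication by [q]. *)
Definition major r (q0 e : R) (al : 'I_r -> R) : Prop :=
 exists (q : nat) (a : 'I_r -> int), (0 < q)%N /\ q%:R <= q0 /\
  forall i, `|q%:R * al i - (a i)%:~R| <= e.

Lemma entry_bound r s (C : 'I_r -> 'M[int]_s) :
 exists c : R, 1 <= c /\ forall i j k, `|(C i j k)%:~R : R| <= c.
Proof.
exists (1 + \sum_i \sum_j \sum_k `|(C i j k)%:~R|).
have S0 i j : 0 <= \sum_k `|(C i j k)%:~R : R| by apply: sumr_ge0.
have S1 i : 0 <= \sum_j \sum_k `|(C i j k)%:~R : R| by apply: sumr_ge0.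
split; first by rewrite lerDl; apply: sumr_ge0.
move=> i j k; rewrite (bigD1 i) //= (bigD1 j) //= (bigD1 k) //=.
have p1 : 0 <= \sum_(i0 | i0 != k) `|(C i j i0)%:~R : R| by apply: sumr_ge0.
have p2 : 0 <= \sum_(i0 | i0 != j) \sum_k `|(C i i0 k)%:~R : R| by apply: sumr_ge0.
have p3 : 0 <= \sum_(i0 | i0 != i) \sum_j \sum_k `|(C i0 j k)%:~R : R| by apply: sumr_ge0.
have p0 := normr_ge0 ((C i j k)%:~R : R); lra.
Qed.

(** The vectors [h *m polar (C i)] for [h] in [X], put side by side, form one rational row [Y i] per
    form. If the rows are dependent, a member of the rational pencil kills all of [X], and its rank
    bounds [size X]. Otherwise some maximal minor [Z] is a nonsingular integral matrix for which
    [al *m Z] is almost integral, and Cramer's rule yields an approximation to [al] with denominator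
    [|\det Z|]. *)
Lemma dichotomy r s (C : 'I_r.+1 -> 'M[int]_s) (rho : nat) :
 (forall b : 'I_r.+1 -> rat, (exists i, b i != 0) ->
   (rho <= \rank (pencil_mx C b))%N) ->
 exists K : R, 0 < K /\ forall (al : 'I_r.+1 -> R) (N H : R), 1 <= H -> H <= N ->
  (forall X : seq 'rV[int]_s, uniq X ->
    (forall h, h \in X -> close_pt H (pencil_mx C al) (H / N ^+ 2) h) ->
    (size X)%:R <= K * H ^+ (s - rho)) \/
  major (K * H ^+ r.+1) (K * H ^+ r.+1 / N ^+ 2) al.
Proof.
move=> hrho; have [c [c1 hc]] := entry_bound (fun i => polar (C i)).
have c0 : 0 <= c by apply: le_trans c1.
pose D := s%:R * c; have D0 : 0 <= D by rewrite mulr_ge0.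
(* The three summands serve the count in the kernel, the size of [\det Z] and the adjugate in
   Cramer's rule. *)
pose K := 3 ^+ s + (r.+1)`!%:R * D ^+ r.+1 + r.+1%:R * (r`!%:R * D ^+ r).
have K1 : 0 <= (r.+1)`!%:R * D ^+ r.+1 by rewrite mulr_ge0 ?exprn_ge0.
have K2 : 0 <= r.+1%:R * (r`!%:R * D ^+ r) by rewrite !mulr_ge0 ?exprn_ge0.
have K3 : 0 < 3 ^+ s :> R by rewrite exprn_gt0.
exists K; split; first by rewrite /K -addrA ltr_pwDl // addr_ge0.
move=> al N H H1 HN; set L := pencil_mx C al.
have H0 : 0 <= H by apply: le_trans H1.
have H3 : 1 <= 3 * H by lra.
case: (EM (forall X : seq 'rV[int]_s, uniq X ->
    (forall h, h \in X -> close_pt H L (H / N ^+ 2) h) ->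
    (size X)%:R <= K * H ^+ (s - rho))) => HX; [by left | right].
move/existsNP: HX => [X /not_implyP[uX /not_implyP[cX /negP]]].
rewrite -ltNge => nX; pose n := size X.
pose Xm : 'M[rat]_(n, s) := \matrix_(i < n, j < s) (X`_i 0 j)%:~R.
pose Y : 'M[rat]_(r.+1, n * s) := \matrix_i mxvec (Xm *m map_mx intr (polar (C i))).
have YE i k j : Y i (mxvec_index k j) = (map_mx intr (X`_k *m polar (C i))) 0 j.
 by rewrite !mxE mxvecE !mxE rmorph_sum; apply: eq_bigr => l _; rewrite !mxE rmorphM.
have rfY : row_free Y.
 apply: inj_row_free => v vY; apply/eqP/negPn/negP => v0.
 have [i vi] : exists i, v 0 i != 0.
  apply/existsP; rewrite -negb_forall; apply: contra v0 => /forallP h.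
  by apply/eqP/rowP => i; rewrite mxE; apply/eqP.
 have := hrho (v 0) (ex_intro _ i vi) => hr.
 suff : (size X <= (2 * truncn H).+1 ^ (s - \rank (pencil_mx C (v ord0))))%N.
  move=> hs; move: nX; apply/negP; rewrite -leNgt.
  apply: (@le_trans _ _ ((3 * H) ^+ (s - rho))).
   have t1 : (truncn H)%:R <= H by have /andP[] := truncn_itv H0.
   have t3 : ((2 * truncn H).+1)%:R <= 3 * H by rewrite -natr1 natrM; lra.
   apply: (@le_trans _ _ (((2 * truncn H).+1 ^ (s - \rank (pencil_mx C (v ord0))))%:R)).
    by rewrite ler_nat.
   rewrite natrX; apply: (@le_trans _ _ ((3 * H) ^+ (s - \rank (pencil_mx C (v ord0))))).
    by rewrite lerXn2r ?nnegrE ?mulr_ge0.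
   by apply: ler_weXn2l; rewrite ?leq_sub2l.
  rewrite exprMn ler_wpM2r ?exprn_ge0 //.
  apply: (@le_trans _ _ (3 ^+ s)); first by apply: ler_weXn2l; rewrite ?leq_subr // ler1n.
  by rewrite /K -addrA lerDl addr_ge0.
 apply: int_points_kernel => // x xX.
  move=> j; have [h _] := cX x xX j.
  have : (absz (x ord0 j) <= truncn H)%N.
   by rewrite truncn_ge_nat //; apply: le_trans h; rewrite -intr_norm -abszE.
  by rewrite -abszE lez_nat.
 apply/rowP => j.
 have ix : (index x X < n)%N by rewrite index_mem.
 transitivity ((v *m Y) 0 (mxvec_index (Ordinal ix) j)); last by rewrite vY !mxE.
 rewrite [LHS]mxE [RHS]mxE.
 under [RHS]eq_bigr do rewrite YE /= nth_index // mxE mxE rmorph_sum mulr_sumr /=.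
 rewrite exchange_big; apply: eq_bigr => k _ /=.
 rewrite mxE /pencil_mx summxE mulr_sumr; apply: eq_bigr => i0 _.
 by rewrite !mxE rmorphM /=; ring.
have rfT : row_full Y^T by rewrite /row_full mxrank_tr.
pose f := fullrankfun rfT; have Uf := fullrowsub_unit rfT.
have /choice[p pE] : forall k, exists p : 'I_n * 'I_s, f k = mxvec_index p.1 p.2.
 move=> k; case: (mxvec_indexP (f k)) => i j; by exists (i, j).
pose Z : 'M[int]_r.+1 := \matrix_(i, k) (X`_(p k).1 *m polar (C i)) 0 (p k).2.
have ZE : map_mx intr Z = (rowsub f Y^T)^T :> 'M[rat]_r.+1.
 by apply/matrixP => i k; rewrite [in RHS]mxE [in RHS]mxE [in RHS]mxE pE YE !mxE.
have dZ : \det Z != 0.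
 rewrite -(intr_eq0 rat) -(det_map_mx (intr : int -> rat)) ZE det_tr -unitfE -unitmxE.
 exact: Uf.
pose ZR : 'M[R]_r.+1 := map_mx intr Z.
have XinX k : X`_(p k).1 \in X by apply: mem_nth.
have ZRb i k : `|ZR i k| <= D * H.
 rewrite !mxE rmorph_sum; apply: le_trans (ler_norm_sum _ _ _) _.
 have -> : D * H = \sum_(j < s) (H * c) by rewrite sumr_const card_ord -mulr_natl /D; ring.
 apply: ler_sum => j _; rewrite rmorphM normrM; apply: ler_pM => //.
  by have [] := cX _ (XinX k) j.
 exact: hc.
have /choice[m mE] : forall k, exists m : int,
  `|(map_mx intr X`_(p k).1 *m L) 0 (p k).2 - m%:~R| <= H / N ^+ 2.
 move=> k; have [_ []] := cX _ (XinX k) (p k).2 => m hm; by exists m.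
pose av : 'rV[R]_r.+1 := \row_i al i.
have avZ k : (av *m ZR) 0 k = (map_mx intr X`_(p k).1 *m L) 0 (p k).2.
 rewrite !mxE /L /pencil_mx; under [RHS]eq_bigr do rewrite summxE mulr_sumr.
 rewrite exchange_big; apply: eq_bigr => i _ /=.
 rewrite !mxE rmorph_sum mulr_sumr; apply: eq_bigr => j _.
 by rewrite !mxE rmorphM /=; ring.
pose mv : 'rV[int]_r.+1 := \row_k m k.
(* Since [al *m ZR] is close to [mv], multiplication by the adjugate brings [\det Z * al] close to
   [a0]; the sign [sg] makes the denominator positive. *)
pose a0 := mv *m \adj Z.
pose sg : int := Num.sg (\det Z).
exists (absz (\det Z)), (fun i => sg * a0 0 i); split; first by rewrite absz_gt0.
have dZR : \det ZR = (\det Z)%:~R by rewrite det_map_mx.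
have absE : (absz (\det Z))%:R = `|\det ZR| by rewrite dZR -intr_norm -abszE.
split.
 rewrite absE; apply: le_trans (det_bound ZRb) _; rewrite exprMn mulrA.
 by rewrite ler_wpM2r ?exprn_ge0 // /K addrAC lerDr addr_ge0 // ltW.
move=> i; have -> : (absz (\det Z))%:R * al i - (sg * a0 0 i)%:~R =
  sg%:~R * (\det ZR * al i - (a0 0 i)%:~R).
 rewrite absE mulrBr rmorphM /= mulrA; congr (_ * _ - _).
 by rewrite dZR -intr_norm /sg -rmorphM /= -normrEsg.
have sg1 : `|sg%:~R : R| = 1 by rewrite -intr_norm /sg normr_sg dZ.
rewrite normrM sg1 mul1r.
have -> : \det ZR * al i - (a0 0 i)%:~R = \sum_k ((av *m ZR) 0 k - (m k)%:~R) * \adj ZR k i.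
 have -> : \det ZR * al i = (av *m ZR *m \adj ZR) 0 i by rewrite -mulmxA mul_mx_adj mul_mx_scalar !mxE.
 rewrite [X in X - _]mxE /a0 mxE rmorph_sum -sumrB; apply: eq_bigr => k _.
 have -> : \adj ZR k i = (\adj Z k i)%:~R by rewrite /ZR -map_mx_adj mxE.
 by rewrite mulrBl rmorphM /= [mv 0 k]mxE.
apply: le_trans (ler_norm_sum _ _ _) _.
have adjb := adj_bound ZRb.
apply: (@le_trans _ _ (\sum_(k < r.+1) (H / N ^+ 2 * (r`!%:R * (D * H) ^+ r)))).
 by apply: ler_sum => k _; rewrite normrM ler_pM // avZ.
rewrite sumr_const card_ord -[leLHS]mulr_natl.
have -> : r.+1%:R * (H / N ^+ 2 * (r`!%:R * (D * H) ^+ r)) =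
  (r.+1%:R * (r`!%:R * D ^+ r)) * (H ^+ r.+1 / N ^+ 2).
 by rewrite exprMn (exprS H); ring.
rewrite -[leRHS]mulrA ler_wpM2r ?divr_ge0 ?exprn_ge0 //; first by apply: le_trans HN.
by rewrite /K lerDr addr_ge0 // ltW.
Qed.

End Dichotomy.

(** * Shrinking of close points in a symplectic lattice *)

Section Shrink.
Variable R : realType.

(* Lattice points of the symplectic lattice in a small cube pair to integers of size < 1, so they span an isotropic subspace. *)
Lemma isotropic_rank (K : fieldType) n s (A B : 'M[K]_(n, s)) :
 A *m B^T = B *m A^T -> (\rank (row_mx A B) <= s)%N.
Proof.
move=> h; pose V := row_mx A B.
pose W := col_mx (B^T) (- A^T) : 'M[K]_(s + s, n).
have VW : V *m W = 0 by rewrite mul_row_col mulmxN h subrr.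
have rW : \rank W = \rank V.
 pose J := block_mx 0 1%:M (- 1%:M) 0 : 'M[K]_(s + s).
 have WJ : W = J *m V^T by rewrite /J /V tr_row_mx mul_block_col !mul0mx mul1mx mulNmx mul1mx add0r addr0.
 have uJ : J \in unitmx.
  suff : J *m (- J) = 1%:M by case/mulmx1_unit.
  rewrite /J mulmxN mulmx_block !mul0mx !mulmx0 !add0r !addr0 !mul1mx mulmx1.
  by rewrite opp_block_mx !oppr0 !opprK -scalar_mx_block.
 by rewrite WJ -mxrank_tr trmx_mul trmxK mxrankMfree // row_free_unit unitmx_tr.
have := mulmx0_rank_max VW; rewrite rW -/V; lia.
Qed.

Lemma int_norm_lt1 (z : int) : `|z%:~R : R| < 1 -> z = 0.
Proof. by rewrite -intr_norm -[1]/(1%:~R) ltr_int; lia. Qed.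
(** This plays the part of Davenport's shrinking lemma. The points [(h / N, N * (h L - m))] belong
    to a symplectic lattice because [L] is symmetric. A first pigeonhole makes their differences so
    short that the symplectic pairings, being integers, vanish. The differences then lie in an
    isotropic space, where [w <= s] of the [2s] coordinates control the others. A second pigeonhole,
    on these coordinates only, costs [(N / H) ^ s] instead of [(N / H) ^ (2s)]. *)
Lemma shrink s : exists K : R, 0 < K /\ forall (L : 'M[R]_s) (N H b : R),
 L^T = L -> 1 <= H -> H <= N -> 0 <= b ->
 (forall X : seq 'rV[int]_s, uniq X ->
   (forall h, h \in X -> close_pt H L (H / N ^+ 2) h) -> (size X)%:R <= b) ->
 forall X : seq 'rV[int]_s, uniq X ->
   (forall h, h \in X -> close_pt (4 * N) L (N^-1) h) ->
   (size X)%:R <= K * (N / H) ^+ s * b.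
Proof.
(* The pairing of two differences is a sum of [2 * s] products of size at most [t ^- 2], hence below
   1. *)
pose t : R := (2 * s).+1%:R; have t0 : 0 < t by rewrite ltr0n.
pose k0 := (8 * (2 * s).+1).+1.
pose w0 : R := s.+1%:R; have w00 : 0 < w0 by rewrite ltr0n.
pose KK : R := (k0 ^ (s + s))%:R * (2 * w0 + 1) ^+ s.
have KK0 : 0 < KK by rewrite mulr_gt0 // ?exprn_gt0 ?addr_gt0 ?mulr_gt0 // ltr0n expn_gt0.
exists KK; split => //.
move=> L N H b Lsym H1 HN b0 hb X uX hX.
have H0 := lt_le_trans ltr01 H1.
have N0 : 0 < N by apply: lt_le_trans HN.
have /choice[m mP] : forall h, exists m : 'rV[int]_s, h \in X ->
  forall j, `|(map_mx intr h *m L) 0 j - (m 0 j)%:~R| <= N^-1.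
 move=> h; case: (boolP (h \in X)) => hh; last by exists 0.
 have /choice[f fP] := fun j => (hX h hh j).2.
 by exists (\row_j f j) => _ j; rewrite mxE.
pose va (h : 'rV[int]_s) : 'rV[R]_s := N^-1 *: map_mx intr h.
pose vb (h : 'rV[int]_s) : 'rV[R]_s := N *: (map_mx intr h *m L - map_mx intr (m h)).
pose v h : 'rV[R]_(s + s) := row_mx (va h) (vb h).
have vaE h j : va h 0 j = (h 0 j)%:~R / N by rewrite !mxE mulrC.
have vbE h j : vb h 0 j = N * ((map_mx intr h *m L) 0 j - (m h 0 j)%:~R) by rewrite !mxE.
have vle h j : h \in X -> `|v h 0 j| <= 4.
 move=> hh; rewrite mxE; case: splitP => i _.
  by rewrite vaE normrM normfV (gtr0_norm N0) ler_pdivrMr //; have [] := hX h hh i.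
 rewrite vbE normrM (gtr0_norm N0); apply: (@le_trans _ _ (N * N^-1)).
  by rewrite ler_pM2l // mP.
 by rewrite divff ?gt_eqF // ler1n.
have ti0 : 0 < t^-1 by rewrite invr_gt0.
have tk0 : 2 * 4 / t^-1 < k0%:R.
 by rewrite invrK /k0 -[ltRHS]natr1 natrM /t; lra.
have [p [sp pP]] := @cells R _ (s + s) k0 (fun h j => v h 0 j) X 4 t^-1 ti0 tk0 (fun h j hh => vle h j hh).
set X1 := [seq x <- X | p x] in sp.
have uX1 : uniq X1 by rewrite filter_uniq.
have X1P h : h \in X1 -> h \in X /\ p h by rewrite mem_filter => /andP[].
have [X10|[h0 h0X1]] : X1 = [::] \/ exists h0, h0 \in X1.
 by case: (X1) => [|h l]; [left | right; exists h; rewrite mem_head].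
 rewrite X10 muln0 leqn0 in sp; rewrite (eqP sp); apply: mulr_ge0 => //.
 by rewrite mulr_ge0 ?exprn_ge0 ?divr_ge0 ?(ltW KK0) ?(ltW N0) ?(ltW H0).
have [h0X ph0] := X1P h0 h0X1.
pose u h := v h - v h0.
have ule h j : h \in X1 -> `|u h 0 j| <= t^-1.
 by move=> /X1P[hh ph]; rewrite /u !mxE; have := pP h h0 j hh h0X ph ph0; rewrite !mxE.
pose n := size X1.
pose A : 'M[R]_(n, s) := \matrix_(i < n) (va X1`_i - va h0).
pose B : 'M[R]_(n, s) := \matrix_(i < n) (vb X1`_i - vb h0).
have rowAB i : row i (row_mx A B) = u X1`_i by rewrite row_row_mx !rowK /u /v opp_row_mx add_row_mx.
have memX1 (i : 'I_n) : X1`_i \in X1 by apply: mem_nth.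
have ABs : A *m B^T = B *m A^T.
 apply/matrixP => i k; apply/eqP; rewrite -subr_eq0.
 pose di := X1`_i - h0; pose dk := X1`_k - h0.
 pose mi := m X1`_i - m h0; pose mk := m X1`_k - m h0.
 have E : (A *m B^T) i k - (B *m A^T) i k =
   ((mi *m dk^T) 0 0 - (di *m mk^T) 0 0)%:~R.
  have EA l : row l A = N^-1 *: map_mx intr (X1`_l - h0) by rewrite rowK /va -scalerBr map_mxB.
  have EB l : row l B = N *: (map_mx intr (X1`_l - h0) *m L - map_mx intr (m X1`_l - m h0)).
   rewrite rowK /vb -scalerBr !map_mxB mulmxBl; congr (_ *: _).
   move: (_ *m L) (_ *m L) (map_mx _ (m X1`_l)) (map_mx _ (m h0)) => x1 x2 x3 x4.
   by apply/rowP => j; rewrite !mxE; ring.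
  have rc (P Q : 'M[R]_(n, s)) : (P *m Q^T) i k = (row i P *m (row k Q)^T) 0 0.
   by rewrite !mxE; apply: eq_bigr => l _; rewrite !mxE.
  rewrite !rc !EA !EB -/di -/dk -/mi -/mk.
  have sc (x y : R) (p1 p2 : 'rV[R]_s) : x * y = 1 ->
    ((x *: p1) *m (y *: p2)^T) 0 0 = (p1 *m p2^T) 0 0.
   by move=> xy; rewrite !mxE; apply: eq_bigr => l _; rewrite !mxE mulrACA xy mul1r.
  rewrite !sc ?mulVf ?mulfV ?gt_eqF //.
  rewrite linearB /= mulmxBr mulmxBl trmx_mul Lsym mulmxA rmorphB /=.
  have e1 : (map_mx intr di *m (map_mx intr mk)^T) 0 0 = ((di *m mk^T) 0 0)%:~R :> R.
   by rewrite map_trmx -map_mxM mxE.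
  have e2 : (map_mx intr mi *m (map_mx intr dk)^T) 0 0 = ((mi *m dk^T) 0 0)%:~R :> R.
   by rewrite map_trmx -map_mxM mxE.
  by rewrite -e1 -e2 !mxE; ring.
 rewrite E; suff /int_norm_lt1-> : `|((mi *m dk^T) 0 0 - (di *m mk^T) 0 0)%:~R : R| < 1 by [].
 rewrite -E.
 have uA (l : 'I_n) j : `|A l j| <= t^-1.
  have := ule X1`_l (lshift s j) (memX1 l); rewrite -rowAB.
  by rewrite mxE row_mxEl.
 have uB (l : 'I_n) j : `|B l j| <= t^-1.
  have := ule X1`_l (rshift s j) (memX1 l); rewrite -rowAB.
  by rewrite mxE row_mxEr.
 have half (P Q : 'M[R]_(n, s)) : (forall l j, `|P l j| <= t^-1) -> (forall l j, `|Q l j| <= t^-1) ->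
   `|(P *m Q^T) i k| <= s%:R / t ^+ 2.
  move=> hP hQ; rewrite mxE; apply: le_trans (ler_norm_sum _ _ _) _.
  have -> : s%:R / t ^+ 2 = \sum_(j < s) (t^-1 * t^-1).
   by rewrite sumr_const card_ord -[RHS]mulr_natl -invfM -expr2.
  by apply: ler_sum => j _; rewrite normrM mxE ler_pM.
 apply: le_lt_trans (ler_normB _ _) _.
 apply: (@le_lt_trans _ _ (s%:R / t ^+ 2 + s%:R / t ^+ 2)).
  by apply: lerD; apply: half.
 rewrite -mulrDl ltr_pdivrMr ?exprn_gt0 // mul1r.
 have : t = 2 * s%:R + 1 by rewrite /t -natr1 natrM.
 have : 0 <= s%:R :> R by [].
 by move=> x0 ->; move: (s%:R : R) x0; clear; move=> x x0; nra.
have rk := isotropic_rank ABs.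
have [f [c [c1 Mc]]] := bounded_coords (row_mx A B).
move: (\rank _) rk f c c1 Mc => w ws f c c1 Mc.
(* The cells have side [H / N / w0] with [w < w0]. As the entries of [c] are at most 1, all [2s]
   coordinates then differ by at most [H / N]. *)
pose k1 := (truncn (2 * w0 * (N / H))).+1.
have NH : 1 <= N / H by rewrite ler_pdivlMr // mul1r.
have Hw0 : 0 < H / N / w0 by rewrite !divr_gt0.
have tk1 : 2 * t^-1 / (H / N / w0) < k1%:R.
 rewrite /k1; apply: (@le_lt_trans _ _ (2 * w0 * (N / H))); last exact: truncnS_gt.
 have -> : 2 * t^-1 / (H / N / w0) = (2 * w0 * (N / H)) * t^-1.
  by field; rewrite !gt_eqF.
 rewrite ler_piMr //; first by apply: mulr_ge0; [apply: mulr_ge0; rewrite ?ltW | exact: le_trans NH].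
 by rewrite invf_le1 // /t ler1n.
have [q [sq qP]] := @cells R _ w k1 (fun h j => u h 0 (f j)) X1 t^-1 _ Hw0 tk1 (fun h j hh => ule h (f j) hh).
set X2 := [seq x <- X1 | q x] in sq.
have X2P h : h \in X2 -> h \in X1 /\ q h by rewrite mem_filter => /andP[].
have k1le : k1%:R <= (2 * w0 + 1) * (N / H).
 have /truncn_itv/andP[h _] : 0 <= 2 * w0 * (N / H).
  by apply: mulr_ge0; [apply: mulr_ge0; rewrite ?ltW | exact: le_trans NH].
 by rewrite /k1 -[leLHS]natr1 [leRHS]mulrDl mul1r; apply: lerD.
have kexp : k1%:R ^+ w <= ((2 * w0 + 1) * (N / H)) ^+ s.
 apply: (@le_trans _ _ (k1%:R ^+ s)); first by apply: ler_weXn2l; rewrite ?ler1n.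
 by rewrite lerXn2r ?nnegrE // (le_trans _ k1le).
suff sX2 : (size X2)%:R <= b.
 apply: (@le_trans _ _ ((k0 ^ (s + s))%:R * (k1%:R ^+ w * b))).
  apply: (@le_trans _ _ (k0 ^ (s + s) * size X1)%:R); first by rewrite ler_nat.
  rewrite natrM ler_wpM2l //.
  apply: (@le_trans _ _ (k1 ^ w * size X2)%:R); first by rewrite ler_nat.
  by rewrite natrM natrX ler_wpM2l ?exprn_ge0.
 rewrite -!mulrA ler_wpM2l // mulrA -exprMn ler_wpM2r //.
have [X20|[h1 h1X2]] : X2 = [::] \/ exists h1, h1 \in X2.
 by case: (X2) => [|h l]; [left | right; exists h; rewrite mem_head].
 by rewrite X20.
have [h1X1 qh1] := X2P h1 h1X2.
(* Subtracting one point of the cell brings the others down to size [H], where the hypothesis counts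
   them. *)
rewrite -(size_map (fun h => h - h1)); apply: hb.
 by rewrite map_inj_uniq ?filter_uniq // => x y /addIr.
move=> _ /mapP[h hX2 ->].
have [hX1 qh] := X2P h hX2.
have ucE g : g \in X1 -> u g = \row_l u g 0 (f l) *m c.
 move=> gX; have ig : (index g X1 < n)%N by rewrite index_mem.
 have e : u g = row (Ordinal ig) (row_mx A B) by rewrite rowAB /= nth_index.
 rewrite [LHS]e {1}Mc row_mul; congr (_ *m c).
 by apply/rowP => l; rewrite mxE [in RHS]mxE e !mxE.
have dle j : `|v h 0 j - v h1 0 j| <= H / N.
 have -> : v h 0 j - v h1 0 j = u h 0 j - u h1 0 j by rewrite /u !mxE; ring.
 rewrite ucE // (ucE h1) //.
 have -> : (\row_l u h 0 (f l) *m c) 0 j - (\row_l u h1 0 (f l) *m c) 0 j =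
   \sum_l (u h 0 (f l) - u h1 0 (f l)) * c l j.
  by rewrite !mxE -sumrB; apply: eq_bigr => l _; rewrite !mxE -mulrBl.
 apply: le_trans (ler_norm_sum _ _ _) _.
 apply: (@le_trans _ _ (\sum_(l < w) (H / N / w0))).
  apply: ler_sum => l _; rewrite normrM -[leRHS]mulr1 ler_pM //.
  exact: qP.
 rewrite sumr_const card_ord -[leLHS]mulr_natl mulrCA ler_piMr ?divr_ge0 ?ltW //.
 by rewrite ltr_pdivrMr // mul1r ltr_nat ltnS.
move=> j; split.
 have := dle (lshift s j); rewrite !row_mxEl !vaE -mulrBl normrM normfV (gtr0_norm N0).
 by rewrite ler_pM2r ?invr_gt0 // !mxE rmorphB.
exists (m h 0 j - m h1 0 j).
have := dle (rshift s j); rewrite !row_mxEr !vbE -mulrBr normrM (gtr0_norm N0).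
rewrite map_mxB mulmxBl rmorphB /= => hh.
have N2 : H / N ^+ 2 = N^-1 * (H / N) by field; rewrite gt_eqF.
rewrite N2 ler_pdivlMl //; apply: le_trans hh; rewrite ler_pM2l // !mxE.
by apply: eqle; congr (`|_|); ring.
Qed.

End Shrink.

(** * Complex moduli and additive characters *)

Section ComplexAbs.
Variable R : realType.
Implicit Types (z w : R[i]) (x y : R).

(** The modulus as a real number; the norm [|z|] of [R[i]] is itself an element of [R[i]]. *)
Definition cabs z : R := Num.sqrt (Re z ^+ 2 + Im z ^+ 2).
Lemma cabsE z : `|z| = (cabs z)%:C%C. Proof. exact: normc_def. Qed.
Lemma realC_inj : injective (real_complex R). Proof. by move=> x y []. Qed.
Lemma realC_le x y : ((x%:C)%C <= (y%:C)%C) = (x <= y). Proof. exact: lecR. Qed.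
Lemma cabs_ge0 z : 0 <= cabs z. Proof. exact: sqrtr_ge0. Qed.
Lemma cabsM z w : cabs (z * w) = cabs z * cabs w.
Proof. by apply: realC_inj; rewrite rmorphM /= -!cabsE normrM. Qed.
Lemma cabsD z w : cabs (z + w) <= cabs z + cabs w.
Proof. by rewrite -realC_le rmorphD /= -!cabsE ler_normD. Qed.
Lemma cabsN z : cabs (- z) = cabs z.
Proof. by apply: realC_inj; rewrite -!cabsE normrN. Qed.
Lemma cabsB z w : cabs (z - w) <= cabs z + cabs w.
Proof. by rewrite -(cabsN w) cabsD. Qed.
Lemma cabs0 : cabs 0 = 0.
Proof. by apply: realC_inj; rewrite -cabsE normr0. Qed.
Lemma cabs1 : cabs 1 = 1.
Proof. by apply: realC_inj; rewrite -cabsE normr1. Qed.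
Lemma cabsX z n : cabs (z ^+ n) = cabs z ^+ n.
Proof. by elim: n => [|n IH]; rewrite ?expr0 ?cabs1 // !exprS cabsM IH. Qed.
Lemma cabs_real x : cabs (x%:C)%C = `|x|.
Proof. by rewrite /cabs /= expr0n /= addr0 sqrtr_sqr. Qed.
Lemma cabs_nat n : cabs n%:R = n%:R.
Proof. by rewrite -(rmorph_nat (real_complex R)) cabs_real normr_nat. Qed.
Lemma cabs_sum I (r : seq I) (P : pred I) (F : I -> R[i]) :
 cabs (\sum_(i <- r | P i) F i) <= \sum_(i <- r | P i) cabs (F i).
Proof.
elim/big_rec2: _ => [|i y z _ h]; first by rewrite cabs0.
by apply: le_trans (cabsD _ _) _; rewrite lerD2l.
Qed.
Lemma cabs_prod (I : finType) (F : I -> R[i]) : cabs (\prod_i F i) = \prod_i cabs (F i).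
Proof. by elim/big_rec2: _ => [|i y z _ <-]; rewrite ?cabs1 ?cabsM. Qed.
Lemma cabsV z : cabs z^-1 = (cabs z)^-1.
Proof.
case: (eqVneq z 0) => [->|z0]; first by rewrite invr0 cabs0 invr0.
by apply: realC_inj; rewrite fmorphV /= -!cabsE normfV.
Qed.
Lemma cabs_conj z : cabs (z^*)%C = cabs z.
Proof. by case: z => a b; rewrite /cabs /= sqrrN. Qed.
Lemma cabs_Re z : `|Re z| <= cabs z.
Proof. by rewrite -sqrtr_sqr ler_sqrt ?lerDl ?sqr_ge0 ?addr_ge0 ?sqr_ge0. Qed.
Lemma cabs_Im z : `|Im z| <= cabs z.
Proof. by rewrite -sqrtr_sqr ler_sqrt ?lerDr ?sqr_ge0 ?addr_ge0 ?sqr_ge0. Qed.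
Lemma Re_realM x z : Re (x%:C%C * z) = x * Re z. Proof. by case: z => a b /=; ring. Qed.
Lemma Im_realM x z : Im (x%:C%C * z) = x * Im z. Proof. by case: z => a b /=; ring. Qed.
Lemma cabs_le z : cabs z <= `|Re z| + `|Im z|.
Proof.
rewrite -[leRHS]ger0_norm ?addr_ge0 // -sqrtr_sqr ler_sqrt ?sqr_ge0 //.
rewrite sqrrD !real_normK ?num_real // -addrA lerD2l lerDr.
by rewrite mulrn_wge0 // mulr_ge0.
Qed.

Lemma e2piD x y : expi2pi (x + y) = expi2pi x * expi2pi y.
Proof.
by rewrite /expi2pi mulrDr cosD sinD; simpc; congr (_ +i* _)%C; rewrite addrC.
Qed.
Lemma e2pi0 : expi2pi 0 = 1 :> R[i].
Proof. by rewrite /expi2pi mulr0 cos0 sin0. Qed.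
Lemma cabs_e x : cabs (expi2pi x) = 1.
Proof. by rewrite /cabs /= cos2Dsin2 sqrtr1. Qed.
Lemma e2piN x : expi2pi (- x) = ((expi2pi x)^*)%C.
Proof. by rewrite /expi2pi mulrN cosN sinN. Qed.
Lemma e2piVN x : expi2pi x * expi2pi (- x) = 1.
Proof. by rewrite -e2piD subrr e2pi0. Qed.
Lemma e2pi1 : expi2pi 1 = 1 :> R[i].
Proof. by rewrite /expi2pi mulr1 mulr_natl cos2pi sin2pi. Qed.
Lemma e2pi_nat n : expi2pi n%:R = 1 :> R[i].
Proof. by elim: n => [|n IH]; rewrite ?e2pi0 // -natr1 e2piD IH e2pi1 mulr1. Qed.
Lemma e2pi_int (m : int) : expi2pi m%:~R = 1 :> R[i].
Proof.
case: m => n; first by rewrite -pmulrn e2pi_nat.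
by rewrite NegzE mulrNz -pmulrn e2piN e2pi_nat conjc1.
Qed.
Lemma e2piDint x (m : int) : expi2pi (x + m%:~R) = expi2pi x.
Proof. by rewrite e2piD e2pi_int mulr1. Qed.
Lemma e2pi_sum I (r : seq I) (P : pred I) (F : I -> R) :
 expi2pi (\sum_(i <- r | P i) F i) = \prod_(i <- r | P i) expi2pi (F i).
Proof. by rewrite (big_morph _ e2piD e2pi0). Qed.
Lemma e2piMn x n : expi2pi (n%:R * x) = expi2pi x ^+ n.
Proof.
elim: n => [|n IH]; first by rewrite mul0r e2pi0.
by rewrite -natr1 mulrDl mul1r e2piD IH exprSr.
Qed.

Lemma e2pi_sub1_sq x : cabs (expi2pi x - 1) ^+ 2 = 2 - 2 * cos (2 * pi * x).
Proof.
rewrite /cabs sqr_sqrtr ?addr_ge0 ?sqr_ge0 //= subr0.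
by have := cos2Dsin2 (2 * pi * x); move: (cos _) (sin _) => a b h; nra.
Qed.

Lemma e2pi_double x : cabs (expi2pi (x *+ 2) - 1) <= 2 * cabs (expi2pi x - 1).
Proof.
rewrite mulr2n e2piD -expr2 subr_sqr_1 cabsM mulrC ler_wpM2r ?cabs_ge0 //.
by apply: le_trans (cabsD _ _) _; rewrite cabs_e cabs1.
Qed.

Lemma e2pi_far x : 1 / 4 <= x -> x <= 1 / 2 -> 1 <= cabs (expi2pi x - 1).
Proof.
move=> h1 h2; have p0 := pi_gt0 R.
suff : cos (2 * pi * x) <= 0.
 have := e2pi_sub1_sq x; have := cabs_ge0 (expi2pi x - 1).
 by move: (cabs _) (cos _) => a b; nra.
have -> : 2 * pi * x = (2 * pi * x - pi / 2) + pi / 2 by ring.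
rewrite cosD cos_pihalf mulr0 sub0r sin_pihalf mulr1 oppr_le0.
by apply: sin_ge0_pi; apply/andP; split; nra.
Qed.

(** Doubling [x] at most doubles [|e(x) - 1|], and after finitely many doublings [x] lies between
    1/4 and 1/2, where the cosine is not positive and the distance is at least 1. *)
Lemma e2pi_lb x : 0 <= x -> x <= 1 / 2 -> x <= cabs (expi2pi x - 1).
Proof.
move=> x0; case: (eqVneq x 0) => [->|xn0 xh]; first by rewrite cabs_ge0.
have xp : 0 < x by rewrite lt_def xn0.
have [k hk] : exists k : nat, 1 <= x * 2 ^+ k.
 exists (truncn x^-1).+1.
 rewrite mulrC -ler_pdivrMr // mul1r; apply: ltW.
 apply: lt_le_trans (truncnS_gt _) _.
 by rewrite -natrX ler_nat ltnW // ltn_expl.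
elim: k x {x0 xn0} xp xh hk => [|k IH] x xp xh hk.
 by move: hk xh; rewrite expr0; lra.
case: (lerP (1 / 4) x) => h4.
 by apply: le_trans (e2pi_far h4 xh); lra.
have := IH (x *+ 2); have := e2pi_double x; rewrite -[x *+ 2]mulr_natl => d.
have e1 : 2 * x <= 1 / 2 by lra.
have e2 : 1 <= 2 * x * 2 ^+ k by rewrite [2 * x]mulrC -mulrA -exprS.
have e3 : 0 < 2 * x by lra.
by move=> /(_ e3 e1 e2) d2; lra.
Qed.

Lemma e2pi_norm_neg x : cabs (expi2pi (- x) - 1) = cabs (expi2pi x - 1).
Proof.
rewrite e2piN -[RHS]cabs_conj; congr cabs; case: (expi2pi x) => a b /=.
by simpc; rewrite ?oppr0.
Qed.

(** A convex set of exponents is a run, so the product with [z - 1] telescopes to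
    [z ^+ b - z ^+ a]. *)
Lemma geometric_convex (z : R[i]) (E : pred nat) n :
 cabs z = 1 -> (forall i j k, (i <= j <= k)%N -> E i -> E k -> E j) ->
 cabs (\sum_(i < n | E i) z ^+ i) * cabs (z - 1) <= 2.
Proof.
move=> z1 cE; rewrite -cabsM.
(* The clause [E n.-1 -> b = n] records that a run still open at the end stops at [n], which allows
   it to be prolonged. *)
suff [[_ ->]|[a [b [_ _ _ ->]]]] : ((forall i, (i < n)%N -> ~~ E i) /\ \sum_(i < n | E i) z ^+ i = 0)
  \/ exists a b, [/\ (a < n)%N, E a, (E n.-1 -> b = n) &
    (\sum_(i < n | E i) z ^+ i) * (z - 1) = z ^+ b - z ^+ a].
- by rewrite mul0r cabs0.
- by apply: le_trans (cabsB _ _) _; rewrite !cabsX z1 !expr1n.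
elim: n => [|n [[nE S0]|[a [b [an Ea Eb Sab]]]]]; first by left; rewrite big_ord0.
- have Sn : \sum_(i < n.+1 | E i) z ^+ i = if E n then z ^+ n else 0.
  by rewrite big_mkcond big_ord_recr /= -big_mkcond S0 add0r.
 case: (boolP (E n)) => En; last first.
  left; rewrite Sn (negbTE En); split => // i; rewrite ltnS leq_eqVlt.
  by case/orP => [/eqP->//|/nE].
 right; exists n, n.+1; split => //; rewrite Sn En exprS; ring.
right; exists a.
have Sn : \sum_(i < n.+1 | E i) z ^+ i = \sum_(i < n | E i) z ^+ i + if E n then z ^+ n else 0.
 by rewrite big_mkcond big_ord_recr /= -big_mkcond.
case: (boolP (E n)) => En.
 have bn : b = n by apply: Eb; apply: (cE a _ n) => //; lia.
 exists n.+1; split => //; first by lia.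
 by rewrite Sn En mulrDl Sab bn exprS; ring.
exists b; split => //; first by lia.
by rewrite Sn (negbTE En) addr0.
Qed.

End ComplexAbs.

(** * Integral points of a cube *)

Section Points.
Variable s : nat.

Definition pt (N : nat) (f : pts s (2 * N).+1) : 'I_s -> int :=
 fun j => (f j)%:Z - N%:Z.

Lemma pt_bound N (f : pts s (2 * N).+1) j : `|pt f j| <= N%:Z.
Proof. by rewrite /pt; have := ltn_ord (f j); move: (f j : nat) => k; lia. Qed.
Lemma pt_inj N : injective (@pt N).
Proof.
move=> f g /funeqP h; apply/ffunP => j; apply/val_inj => /=.
by have := h j; rewrite /pt; move: (f j : nat) (g j : nat) => a b; lia.
Qed.

Lemma pt_surj N (x : 'I_s -> int) : (forall j, `|x j| <= N%:Z) -> exists f : pts s (2 * N).+1, pt f = x.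
Proof.
move=> hx; exists [ffun j => inord (absz (x j + N%:Z))]; apply/funext => j.
rewrite /pt ffunE inordK; have := hx j; move: (x j) => y; lia.
Qed.

(** Differences of two points of the cube of radius [N] fill part of the cube of radius [2 * N]; the
    rest contributes nothing because [u] vanishes off the small cube. *)
Lemma sum_pt_shift (V : nmodType) N (u : ('I_s -> int) -> V) (y : 'I_s -> int) :
 (forall x, (exists j, N%:Z < `|x j|) -> u x = 0) ->
 (forall j, `|y j| <= N%:Z) ->
 \sum_(f : pts s (2 * N).+1) u (pt f) =
 \sum_(h : pts s (2 * (2 * N)).+1) u (fun j => y j + pt h j).
Proof.
move=> u0 hy.
pose P (h : pts s (2 * (2 * N)).+1) := [forall j, `|y j + pt h j| <= N%:Z].
rewrite [RHS](bigID P) /= [X in _ + X]big1 ?addr0; last first.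
 move=> h; rewrite negb_forall => /existsP[j hj]; apply: u0; exists j.
 by rewrite ltNge.
pose q (f : pts s (2 * N).+1) : pts s (2 * (2 * N)).+1 :=
 [ffun j => inord (absz (pt f j - y j + (2 * N)%:Z))].
pose p (h : pts s (2 * (2 * N)).+1) : pts s (2 * N).+1 :=
 [ffun j => inord (absz (y j + pt h j + N%:Z))].
have ptq f j : y j + pt (q f) j = pt f j.
 rewrite {1}/pt ffunE inordK; have := hy j; have := pt_bound f j;
  move: (pt f j) (y j) => a b; lia.
rewrite (reindex_onto q p) /=; last first.
 move=> h /forallP hP; apply: (@pt_inj (2 * N)); apply/funext => j.
 apply: (addrI (y j)); rewrite ptq /pt ffunE inordK; have := hP j;
  move: (y j) => b; rewrite /pt; move: (h j : nat) => a; lia.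
apply: eq_big => [f|f _]; last by congr u; apply/funext => j; rewrite ptq.
apply/esym/andP; split; first by apply/forallP => j; rewrite ptq pt_bound.
apply/eqP; apply: (@pt_inj N); apply/funext => j.
rewrite {1}/pt ffunE ptq inordK; have := pt_bound f j; move: (pt f j) => a; lia.
Qed.

End Points.

(** * Weyl differencing and Weyl's inequality *)

Section Weyl.
Variable R : realType.

Definition qf (K : comNzRingType) s (C : 'M[int]_s) (x : 'I_s -> K) : K :=
 \sum_j \sum_k (C j k)%:~R * x j * x k.

Definition phase r s (C : 'I_r -> 'M[int]_s) (al : 'I_r -> R) (x : 'I_s -> R) : R :=
 \sum_i al i * qf (C i) x.

Definition iphase r s (C : 'I_r -> 'M[int]_s) (al : 'I_r -> R) (x : 'I_s -> int) : R :=
 phase C al (fun j => (x j)%:~R).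

Definition convex_int (D : pred int) := forall a b c : int, a <= b <= c -> D a -> D c -> D b.

Definition inbox s (D : 'I_s -> pred int) (x : 'I_s -> int) := [forall j, D j (x j)].
Definition box_sum s N (D : 'I_s -> pred int) (u : ('I_s -> int) -> R[i]) : R[i] :=
 \sum_(f : pts s (2 * N).+1 | inbox D (pt f)) u (pt f).

Definition Hn (N : nat) : R := \sum_(k < N) k.+1%:R^-1.
Definition row_of s (x : 'I_s -> int) : 'rV[int]_s := \row_j x j.
Lemma qfD (K : comNzRingType) s (C : 'M[int]_s) (x y : 'I_s -> K) :
 qf C (fun j => x j + y j) = qf C x + qf C y +
  \sum_j (\sum_k y k * (polar C k j)%:~R) * x j.
Proof.
have e1 : \sum_j (\sum_k y k * (polar C k j)%:~R) * x j =
  \sum_j \sum_k ((C j k)%:~R * x j * y k + (C j k)%:~R * y j * x k).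
 transitivity (\sum_j \sum_k ((C k j)%:~R * y k * x j + (C j k)%:~R * y k * x j)).
  apply: eq_bigr => j _; rewrite mulr_suml; apply: eq_bigr => k _.
  by rewrite /polar !mxE rmorphD /=; ring.
 under eq_bigr do rewrite big_split /=.
 rewrite big_split /= exchange_big /= addrC -big_split /=; apply: eq_bigr => j _.
 by rewrite -big_split /=; apply: eq_bigr => k _; ring.
rewrite e1 /qf -!big_split /=; apply: eq_bigr => j _.
by rewrite -!big_split /=; apply: eq_bigr => k _; ring.
Qed.

Lemma iphaseD r s (C : 'I_r -> 'M[int]_s) al x h :
 iphase C al (fun j => x j + h j) = iphase C al x + iphase C al h +
  \sum_j (map_mx intr (row_of h) *m pencil_mx C al) 0 j * (x j)%:~R.
Proof.
rewrite /iphase /phase; have -> : (fun j => (x j + h j)%:~R : R) = (fun j => (x j)%:~R + (h j)%:~R).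
 by apply/funext => j; rewrite rmorphD.
under eq_bigr do rewrite qfD !mulrDr.
rewrite !big_split /=; congr (_ + _).
under eq_bigr do rewrite mulr_sumr.
rewrite exchange_big; apply: eq_bigr => j _ /=.
rewrite mxE mulr_suml; under [RHS]eq_bigr do rewrite summxE mulr_sumr mulr_suml.
rewrite [RHS]exchange_big; apply: eq_bigr => i _ /=.
rewrite mulr_suml mulr_sumr; apply: eq_bigr => k _.
by rewrite !mxE; ring.
Qed.

Lemma Hn_ge0 N : 0 <= Hn N. Proof. by apply: sumr_ge0. Qed.
Definition fcell N (x : R) : nat := truncn (N%:R * (x - (Num.floor x)%:~R)).
Lemma fcell_lt N x : (0 < N)%N -> (fcell N x < N)%N.
Proof.
move=> N0; have /andP[h1 h2] := floor_itv x; rewrite rmorphD /= in h2.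
rewrite truncn_lt_nat ?mulr_ge0 ?subr_ge0 //.
by rewrite -[ltRHS]mulr1 ltr_pM2l ?ltr0n //; lra.
Qed.

Lemma fcell_near N x y : (0 < N)%N -> fcell N x = fcell N y ->
 exists m : int, `|x - y - m%:~R| <= N%:R^-1.
Proof.
move=> N0 exy; exists (Num.floor x - Num.floor y).
have N1 : 0 < N%:R :> R by rewrite ltr0n.
have t z : (fcell N z)%:R <= N%:R * (z - (Num.floor z)%:~R) < (fcell N z)%:R + 1.
 by rewrite natr1; apply: truncn_itv; rewrite mulr_ge0 ?subr_ge0 ?floor_le_tmp // floor_le.
have /andP[a1 a2] := t x; have /andP[b1 b2] := t y; rewrite exy in a1 a2.
rewrite rmorphB /= -[leRHS]mul1r ler_pdivlMr // -[X in _ * X <= _](gtr0_norm N1) -normrM ler_norml.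
move: (_%:R : R) N1 a1 a2 b1 b2 => c _.
by move: (_%:R) (_%:~R) (_%:~R) => u v w *; apply/andP; split; lra.
Qed.

(** [minn c (N - c.+1)] is the number of whole cells between cell [c] and the nearest integer, so
    this is the usual bound [min (N, 1 / ||la||)] up to a constant. *)
Definition cellw N (c : nat) : R := 4 * N%:R / (minn c (N - c.+1)).+1%:R.
Lemma linear_sum_bound N (D : pred int) (la : R) : (0 < N)%N ->
 convex_int D ->
 cabs (\sum_(i < (2 * N).+1 | D (i%:Z - N%:Z)) expi2pi (la * (i%:Z - N%:Z)%:~R)) <=
 cellw N (fcell N la).
Proof.
move=> N0 cD; set S := \sum_(i < _ | _) _.
have N1 : 1 <= N%:R :> R by rewrite ler1n.
have S1 : cabs S <= (2 * N).+1%:R.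
 apply: le_trans (cabs_sum _ _ _) _; under eq_bigr do rewrite cabs_e.
 by rewrite sumr_const ler_nat; apply: leq_trans (max_card _) _; rewrite card_ord.
have [m mE] : exists m, m = minn (fcell N la) (N - (fcell N la).+1) by eexists.
rewrite /cellw -mE; case: m mE => [|m] mE.
 by apply: le_trans S1 _; rewrite divr1 -natr1 natrM; lra.
set z := expi2pi la : R[i].
have zS : cabs S = cabs (\sum_(i < (2 * N).+1 | D (i%:Z - N%:Z)) z ^+ i).
 rewrite -[RHS]mul1r -(cabs_e (la * - N%:R)) -cabsM mulr_sumr; congr cabs.
 apply: eq_bigr => i _; rewrite /z -e2piMn -e2piD; congr expi2pi.
 by rewrite rmorphB /= -!pmulrn; ring.
have cE i j k : (i <= j <= k)%N -> D (i%:Z - N%:Z) -> D (k%:Z - N%:Z) -> D (j%:Z - N%:Z).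
 by move=> /andP[ij jk]; apply: cD; apply/andP; split; lia.
have hS : cabs S * cabs (z - 1) <= 2.
 by rewrite zS; apply: (@geometric_convex R z (fun i => D (i%:Z - N%:Z))) => //; exact: cabs_e.
have Np : 0 < N%:R :> R by rewrite ltr0n.
have /andP[f1 f2] := floor_itv la; rewrite rmorphD /= in f2.
set y := la - (Num.floor la)%:~R.
have y0 : 0 <= y by rewrite subr_ge0.
have y1 : y < 1 by rewrite /y; lra.
have zy : z = expi2pi y by rewrite /z -[in RHS](e2piDint y (Num.floor la)) /y subrK.
have /andP[t1 t2] : (fcell N la)%:R <= N%:R * y < (fcell N la).+1%:R.
 by apply: truncn_itv; rewrite mulr_ge0.
have c1 : m.+1%:R <= (fcell N la)%:R :> R by rewrite ler_nat mE geq_minl.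
have c2 : m.+1%:R + (fcell N la).+1%:R <= N%:R :> R.
 have aux : forall a k n : nat, k = minn a (n - a.+1) -> (a < n)%N -> (k + a.+1 <= n)%N.
  by clear; lia.
 by rewrite -natrD ler_nat; apply: aux (fcell_lt la N0).
have zl : m.+1%:R <= N%:R * cabs (z - 1).
 case: (lerP y (1/2)) => yh.
  apply: le_trans (_ : N%:R * y <= _); first by apply: le_trans t1.
  by rewrite ler_pM2l // zy e2pi_lb.
 apply: le_trans (_ : N%:R * (1 - y) <= _); first by rewrite mulrBr mulr1; lra.
 rewrite ler_pM2l // zy -e2pi_norm_neg -(e2piDint _ 1) [- y + _]addrC.
 by apply: e2pi_lb; lra.
rewrite ler_pdivlMr ?ltr0n //.
have m1 : m.+2%:R <= 2 * m.+1%:R :> R by rewrite -natrM ler_nat mul2n -addnn addSn ltnS leq_addl.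
have sp := cabs_ge0 S.
have : cabs S * m.+1%:R <= 2 * N%:R.
 apply: le_trans (_ : cabs S * (N%:R * cabs (z - 1)) <= _).
  by rewrite ler_wpM2l.
 by rewrite mulrCA [leRHS]mulrC ler_pM2l.
have : cabs S * m.+2%:R <= cabs S * (2 * m.+1%:R) by rewrite ler_wpM2l.
move: (cabs S) (m.+1%:R : R) (m.+2%:R : R) => a b c; lra.
Qed.

(** Each end of the unit interval contributes one harmonic sum. *)
Lemma sum_cellw N : \sum_(c < N) cellw N c <= 8 * N%:R * Hn N.
Proof.
have h (c : 'I_N) : cellw N c <= 4 * N%:R * c.+1%:R^-1 + 4 * N%:R * (rev_ord c).+1%:R^-1.
 rewrite /cellw -mulrDr ler_wpM2l ?mulr_ge0 //.
 by rewrite /= /minn; case: ifP => _; rewrite ?lerDl ?lerDr invr_ge0.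
apply: le_trans (ler_sum _ (fun c _ => h c)) _.
rewrite big_split /= -!mulr_sumr.
rewrite [X in _ + _ * X](reindex_inj rev_ord_inj) /=.
rewrite [X in _ + _ * X](eq_bigr (fun i : 'I_N => i.+1%:R^-1)); last first.
 by move=> i _; rewrite -[in RHS](rev_ordK i).
by rewrite -/(Hn N) -mulrDl; have := Hn_ge0 N; lra.
Qed.

(** [|S| ^ 2] is a sum over differences [h] of products of linear sums in one variable, each bounded
    through the cell of its frequency. The differences sharing their cells in all coordinates
    become, after subtraction of one of them, points counted by [b]; what remains is the product of
    the sums of [cellw] over all cells. *)
Lemma weyl_differencing r s (C : 'I_r -> 'M[int]_s) (al : 'I_r -> R) N
  (D : 'I_s -> pred int) (b : R) :
 (0 < N)%N -> (forall j, convex_int (D j)) ->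
 (forall j x, D j x -> `|x| <= N%:Z) ->
 (forall X : seq 'rV[int]_s, uniq X ->
   (forall h, h \in X -> close_pt (4 * N%:R) (pencil_mx C al) (N%:R^-1) h) ->
   (size X)%:R <= b) ->
 cabs (box_sum N D (fun x => expi2pi (iphase C al x))) ^+ 2 <=
  b * (8 * N%:R * Hn N) ^+ s.
Proof.
move=> N0 cD bD hb; set S := box_sum _ _ _.
pose u (x : 'I_s -> int) : R[i] := if inbox D x then expi2pi (iphase C al x) else 0.
have SE : S = \sum_(f : pts s (2 * N).+1) u (pt f) by rewrite /S /box_sum big_mkcond.
have u0 x : (exists j, N%:Z < `|x j|) -> u x = 0.
 move=> [j hj]; rewrite /u; case: ifP => // /forallP /(_ j) /bD; by rewrite leNgt hj.
have SS : S * (S^*)%C = \sum_(h : pts s (2 * (2 * N)).+1)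
  \sum_(f : pts s (2 * N).+1) u (fun j => pt f j + pt h j) * ((u (pt f))^*)%C.
 rewrite {2}SE rmorph_sum mulr_sumr exchange_big; apply: eq_bigr => f _ /=.
 rewrite SE (sum_pt_shift u0 (y := pt f)); last by move=> j; exact: pt_bound.
 by rewrite mulr_suml.
pose la (h : 'rV[int]_s) j := (map_mx intr h *m pencil_mx C al) 0 j.
have inner (h : pts s (2 * (2 * N)).+1) :
  cabs (\sum_(f : pts s (2 * N).+1) u (fun j => pt f j + pt h j) * ((u (pt f))^*)%C)
  <= \prod_j cellw N (fcell N (la (row_of (pt h)) j)).
 (* Both a coordinate and its translate must stay in the side of the box; this set is again
    convex. *)
 pose E j : pred int := fun y => D j (y + pt h j) && D j y.
 have -> : \sum_(f : pts s (2 * N).+1) u (fun j => pt f j + pt h j) * ((u (pt f))^*)%C =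
   expi2pi (iphase C al (pt h)) * \prod_j \sum_(i < (2 * N).+1 | E j (i%:Z - N%:Z))
    expi2pi (la (row_of (pt h)) j * (i%:Z - N%:Z)%:~R).
  under [in RHS]eq_bigr do rewrite big_mkcond /=.
  rewrite bigA_distr_bigA mulr_sumr; apply: eq_bigr => f _ /=; rewrite /u.
  case: (boolP (inbox D (pt f))) => [/forallP h1|]; last first.
   rewrite negb_forall => /existsP[j /negbTE hj].
   rewrite conjc0 mulr0 (bigD1 j) //= /E -[(f j)%:Z - N%:Z]/(pt f j) hj andbF.
   by rewrite mul0r mulr0.
  case: (boolP (inbox D _)) => [/forallP h2|]; last first.
   rewrite negb_forall => /existsP[j /negbTE hj].
   by rewrite mul0r (bigD1 j) //= /E -[(f j)%:Z - N%:Z]/(pt f j) hj mul0r mulr0.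
  have cz t : expi2pi t * ((expi2pi t)^*)%C = 1 :> R[i] by rewrite -e2piN e2piVN.
  transitivity (expi2pi (iphase C al (pt h)) * expi2pi (\sum_j la (row_of (pt h)) j * (pt f j)%:~R)).
   by rewrite iphaseD !e2piD -[RHS]mul1r -(cz (iphase C al (pt f))) /la; ring.
  congr (_ * _); rewrite e2pi_sum.
  apply: eq_bigr => j _; rewrite /E -[(f j)%:Z - N%:Z]/(pt f j).
  by rewrite (h1 j) (h2 j).
 rewrite cabsM cabs_e mul1r cabs_prod; apply: ler_prod => j _.
 rewrite cabs_ge0 /=; apply: linear_sum_bound => // x y z /andP[xy yz] /andP[E1 E2] /andP[E3 E4].
 apply/andP; split; last by apply: (cD j x _ z) => //; rewrite xy.
 by apply: (cD j (x + pt h j) _ (z + pt h j)) => //; rewrite !lerD2r xy.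
have -> : cabs S ^+ 2 = cabs (S * (S^*)%C) by rewrite cabsM cabs_conj.
rewrite SS; apply: le_trans (cabs_sum _ _ _) _.
apply: le_trans (ler_sum _ (fun h _ => inner h)) _.
pose cellof (h : pts s (2 * (2 * N)).+1) : pts s N :=
 [ffun j => Ordinal (fcell_lt (la (row_of (pt h)) j) N0)].
have cw0 (c : nat) : 0 <= cellw N c by rewrite /cellw divr_ge0 ?mulr_ge0.
rewrite (partition_big cellof predT) //=.
have fiber (c : pts s N) :
  \sum_(h | cellof h == c) \prod_j cellw N (fcell N (la (row_of (pt h)) j)) <=
  b * \prod_j cellw N (c j).
 have -> : \sum_(h | cellof h == c) \prod_j cellw N (fcell N (la (row_of (pt h)) j)) =
   \sum_(h | cellof h == c) \prod_j cellw N (c j).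
  by apply: eq_bigr => h /eqP <-; apply: eq_bigr => j _; rewrite ffunE.
 rewrite sumr_const -[leLHS]mulr_natl ler_wpM2r //; first by apply: prodr_ge0.
 pose X0 := enum [pred h | cellof h == c].
 have sX : size X0 = #|[pred h | cellof h == c]| by rewrite cardE.
 rewrite -sX; case EX : X0 => [|h0 X1].
  by have := hb [::] isT; apply => h.
 have h0X : h0 \in X0 by rewrite EX mem_head.
 rewrite -EX -(size_map (fun h => row_of (pt h) - row_of (pt h0))).
 apply: hb.
  rewrite map_inj_uniq ?enum_uniq // => x y /addIr /rowP xy.
  by apply: pt_inj; apply/funext => j; have := xy j; rewrite !mxE.
 (* Each difference has size at most [2 * N], whence the [4 * N] in the hypothesis. *)
 move=> _ /mapP[h hX ->] j; split.
  rewrite !mxE rmorphB /=; apply: le_trans (ler_normB _ _) _.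
  have bd (g : pts s (2 * (2 * N)).+1) : `|(pt g j)%:~R : R| <= 2 * N%:R.
   by rewrite -intr_norm -natrM pmulrn ler_int pt_bound.
  by have := bd h; have := bd h0; lra.
 have [m hm] : exists m : int, `|la (row_of (pt h)) j - la (row_of (pt h0)) j - m%:~R| <= N%:R^-1.
  apply: fcell_near => //.
  move: hX h0X; rewrite !mem_enum !inE => /eqP e1 /eqP e2.
  have : cellof h j = cellof h0 j by rewrite e1 e2.
  by rewrite !ffunE => /(congr1 val).
 exists m; suff -> : (map_mx intr (row_of (pt h) - row_of (pt h0)) *m pencil_mx C al) 0 j =
   la (row_of (pt h)) j - la (row_of (pt h0)) j by [].
 by rewrite map_mxB mulmxBl /la !mxE.
apply: le_trans (ler_sum _ (fun c _ => fiber c)) _.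
rewrite -mulr_sumr ler_wpM2l //.
 by have := hb [::] isT; apply.
rewrite -(bigA_distr_bigA (fun (j : 'I_s) (c : 'I_N) => cellw N c)).
rewrite prodr_const card_ord lerXn2r ?nnegrE ?sum_cellw //.
 by apply: sumr_ge0.
by rewrite mulr_ge0 ?Hn_ge0 ?mulr_ge0.
Qed.

(** The factor [(N / H) ^ s] from shrinking and the factor [H ^ (s - rho)] from the rank combine to
    [N ^ s / H ^ rho]. *)
Lemma weyl_inequality r s (C : 'I_r.+1 -> 'M[int]_s) (rho : nat) :
 (forall b : 'I_r.+1 -> rat, (exists i, b i != 0) ->
   (rho <= \rank (pencil_mx C b))%N) ->
 exists K : R, 1 <= K /\ forall (al : 'I_r.+1 -> R) N (H : R) (D : 'I_s -> pred int),
  (0 < N)%N -> (forall j, convex_int (D j)) ->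
  (forall j x, D j x -> `|x| <= N%:Z) -> 1 <= H -> H <= N%:R ->
  cabs (box_sum N D (fun x => expi2pi (iphase C al x))) ^+ 2 <=
   K * N%:R ^+ (2 * s) * Hn N ^+ s / H ^+ rho \/
  major (K * H ^+ r.+1) (K * H ^+ r.+1 / N%:R ^+ 2) al.
Proof.
move=> hrho; have rs : (rho <= s)%N.
 by apply: leq_trans (hrho (fun=> 1) (ex_intro _ ord0 (oner_neq0 _))) (rank_leq_row _).
have [K1 [K10 hK1]] := @dichotomy R r s C rho hrho.
have [K2 [K20 hK2]] := @shrink R s.
pose K := 1 + K1 + K2 * K1 * 8 ^+ s.
have K3 : 0 < K2 * K1 * 8 ^+ s by rewrite !mulr_gt0 ?exprn_gt0.
have KK1 : K1 <= K by rewrite /K; lra.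
exists K; split; first by rewrite /K; lra.
move=> al N H D N0 cD bD H1 HN.
have Hp := lt_le_trans ltr01 H1.
have Np : 0 < N%:R :> R by rewrite ltr0n.
case: (hK1 al N%:R H H1 HN) => [h|[q [a [q0 [qK qa]]]]]; last first.
 right; exists q, a; split => //; split.
  by apply: le_trans qK _; rewrite ler_wpM2r // exprn_ge0 // ltW.
 move=> i; apply: le_trans (qa i) _; rewrite ler_wpM2r ?invr_ge0 ?exprn_ge0 //.
 by rewrite ler_wpM2r ?exprn_ge0 ?(ltW Hp).
left; have b0 : 0 <= K1 * H ^+ (s - rho) by rewrite mulr_ge0 ?exprn_ge0 ?ltW.
have := hK2 (pencil_mx C al) N%:R H _ (pencil_mx_sym C al) H1 HN b0 h.
move=> /(weyl_differencing (al := al) N0 cD bD) => hS; apply: le_trans hS _.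
have -> : K2 * (N%:R / H) ^+ s * (K1 * H ^+ (s - rho)) * (8 * N%:R * Hn N) ^+ s =
 (K2 * K1 * 8 ^+ s) * (N%:R ^+ (2 * s) * Hn N ^+ s / H ^+ rho).
 have -> : H ^+ rho = H ^+ s / H ^+ (s - rho).
  by apply: (canRL (mulfK (expf_neq0 _ (lt0r_neq0 Hp)))); rewrite -exprD subnKC.
 rewrite !exprMn exprVn mul2n -addnn exprD; field.
 by rewrite !expf_neq0 ?gt_eqF.
have -> : K * N%:R ^+ (2 * s) * Hn N ^+ s / H ^+ rho = K * (N%:R ^+ (2 * s) * Hn N ^+ s / H ^+ rho).
 by rewrite !mulrA.
rewrite ler_wpM2r //.
 by apply: mulr_ge0; [apply: mulr_ge0 | rewrite invr_ge0]; rewrite ?exprn_ge0 ?Hn_ge0 ?(ltW Hp).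
by rewrite /K; lra.
Qed.

End Weyl.

(** Settles signs by the shape of the expression and leaves to the caller the atoms it cannot
    settle. *)
Ltac pos := intros;
 lazymatch goal with
 | |- is_true (0 <= _ * _) => apply: mulr_ge0; pos
 | |- is_true (0 <= _ + _) => apply: addr_ge0; pos
 | |- is_true (0 <= _ ^+ _) => apply: exprn_ge0; pos
 | |- is_true (0 <= _ ^-1) => rewrite invr_ge0; pos
 | |- is_true (0 <= _ `^ _) => exact: powR_ge0
 | |- is_true (0 <= Num.sqrt _) => exact: sqrtr_ge0
 | |- is_true (0 <= cabs _) => exact: cabs_ge0
 | |- is_true (0 <= Hn _ _) => exact: Hn_ge0
 | |- is_true (0 <= `|_|) => exact: normr_ge0
 | |- is_true (0 <= \sum_(_ <- _ | _) _) => apply: sumr_ge0; pos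
 | |- is_true (0 < _ * _) => apply: mulr_gt0; pos
 | |- is_true (0 < _ ^+ _) => apply: exprn_gt0; pos
 | |- is_true (0 < _ ^-1) => rewrite invr_gt0; pos
 | |- is_true (0 < _ `^ _) => apply: powR_gt0; pos
 | |- is_true (0 < Num.sqrt _) => rewrite sqrtr_gt0; pos
 | |- is_true (0 < _ + _) => first [apply: ltr_pwDl; [solve [pos] | solve [pos]] | apply: ltr_wpDl; [solve [pos] | solve [pos]]]
 | |- is_true (0 <= _) => first [exact: ler0n | done | assumption | (apply: ltW; assumption)
   | (apply: (le_trans ler01); assumption) | (apply: (le_trans ler01); apply: ltW; assumption)
   | (apply: ltW; rewrite ltr0n; assumption) | idtac]
 | |- is_true (0 < _) => first [done | assumption | (apply: (lt_le_trans ltr01); assumption)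
   | (apply: (lt_trans ltr01); assumption) | (rewrite ltr0n; assumption) | idtac]
 | _ => idtac
 end.

(** * Real powers, logarithms and the number of major fractions *)

Section PowerBounds.
Variable R : realType.
Implicit Types (x y a b : R).

Lemma pwD x a b : 0 < x -> x `^ (a + b) = x `^ a * x `^ b.
Proof. by move=> x0; rewrite powRD //; apply/implyP => _; rewrite gt_eqF. Qed.
Lemma pw_gt0 x a : 0 < x -> 0 < x `^ a.
Proof. exact: powR_gt0. Qed.
Lemma pwN x a : 0 < x -> x `^ (- a) = (x `^ a)^-1.
Proof. by move=> _; exact: powRN. Qed.
Lemma pw_ge1 x a : 1 <= x -> 0 <= a -> 1 <= x `^ a.
Proof. by move=> x1 a0; rewrite -(powRr0 x) ler_powR. Qed.
Lemma pw_sqrt x : 0 <= x -> Num.sqrt x = x `^ 2^-1.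
Proof. by move=> x0; rewrite powR12_sqrt. Qed.
Lemma pw_nat x n : 0 <= x -> x ^+ n = x `^ n%:R.
Proof. by move=> x0; rewrite powR_mulrn. Qed.
(** From [ln y <= y - 1] at the power of [x] with exponent [a]. *)
Lemma ln_le_pw x a : 1 <= x -> 0 < a -> ln x <= x `^ a / a.
Proof.
move=> x1 a0; have x0 := lt_le_trans ltr01 x1.
rewrite ler_pdivlMr // mulrC -ln_powR.
have h := @le_ln1Dx R (x `^ a - 1); rewrite [1 + _]addrC subrK in h.
by apply: le_trans (h _) _; rewrite ?lerBlDr ?lerDl // ltrBrDr addNr pw_gt0.
Qed.

Lemma Hn_le_ln N : (0 < N)%N -> Hn R N <= 1 + ln N%:R.
Proof.
elim: N => // -[_ _|N /(_ isT) IH _].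
 by rewrite /Hn big_ord1 ln1 addr0 invr1.
rewrite /Hn big_ord_recr /= -/(Hn R N.+1).
apply: le_trans (_ : 1 + ln N.+1%:R + N.+2%:R^-1 <= _); first by rewrite lerD2r.
rewrite -addrA lerD2l.
have e : N.+1%:R = N.+2%:R * (1 + - N.+2%:R^-1) :> R.
 by rewrite mulrBr mulr1 divff ?pnatr_eq0 // -[N.+2%:R]natr1 addrK.
have h1 : -1 < - N.+2%:R^-1 :> R by rewrite ltrN2 invf_lt1 ?ltr1n.
rewrite e lnM ?posrE //; last by rewrite subr_gt0 invf_lt1 ?ltr1n.
by rewrite -addrA gerDl -lerBrDr sub0r le_ln1Dx.
Qed.

Lemma Hn_pw n a : 0 < a -> exists C : R, 1 <= C /\
 forall N, (0 < N)%N -> Num.sqrt (Hn R N ^+ n) <= C * N%:R `^ a.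
Proof.
move=> a0; pose b := a / n.+1%:R.
have b0 : 0 < b by rewrite divr_gt0.
pose c := 1 + b^-1; have c1 : 1 <= c by rewrite lerDl invr_ge0 ltW.
exists (c ^+ n); split; first by rewrite exprn_ege1.
move=> N N0; have N1 : 1 <= N%:R :> R by rewrite ler1n.
have Np : 0 < N%:R :> R by rewrite ltr0n.
have hH : Hn R N <= c * N%:R `^ b.
 apply: le_trans (Hn_le_ln N0) _; rewrite mulrDl mul1r; apply: lerD; first exact: pw_ge1 (ltW b0).
 by rewrite mulrC; exact: ln_le_pw.
have cN1 : 1 <= c * N%:R `^ b by apply: (le_trans c1); rewrite ler_peMr ?pw_ge1 ?(ltW b0) //; apply: le_trans c1.
have -> : N%:R `^ a = (N%:R `^ b) ^+ n.+1 :> R by rewrite [RHS]pw_nat ?powR_ge0 // -powRrM /b divfK.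
apply: le_trans (_ : (c * N%:R `^ b) ^+ n <= _).
 rewrite -[leRHS]ger0_norm ?exprn_ge0 ?(le_trans _ cN1) // -sqrtr_sqr.
 rewrite ler_sqrt ?sqr_ge0 // expr2 -[leLHS]mul1r; apply: ler_pM => //.
 - by rewrite exprn_ge0 ?Hn_ge0.
 - by rewrite exprn_ege1.
 - by rewrite lerXn2r ?nnegrE ?Hn_ge0 // (le_trans _ cN1).
rewrite exprMn ler_wpM2l ?exprn_ge0 ?(le_trans _ c1) //.
by apply: ler_weXn2l => //; exact: pw_ge1 (ltW b0).
Qed.

Lemma intr_gtN1 (a : int) : -1 < a%:~R :> R -> 0 <= a.
Proof. by rewrite -[-1]/((-1)%:~R) ltr_int; lia. Qed.
Lemma intr_ltS (a : int) n : a%:~R < n%:R + 1 :> R -> a <= n%:Z.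
Proof. by rewrite natr1 pmulrn ltr_int; lia. Qed.
Lemma card_interval M (c d : R) : 0 <= d ->
 #|[pred k : 'I_M | `|k%:R - c| <= d]|%:R <= 2 * d + 1.
Proof.
move=> d0; set P := [pred k : 'I_M | _].
have d2 : 0 <= 2 * d by rewrite mulr_ge0.
have /andP[t1 t2] := truncn_itv d2.
apply: le_trans (_ : (truncn (2 * d)).+1%:R <= _); last by rewrite -natr1 lerD2r.
rewrite ler_nat cardE.
pose g (k : 'I_M) : 'I_(truncn (2 * d)).+1 := inord (truncn (k%:R - (c - d))).
rewrite -[leqRHS]card_ord; apply: (@size_le_card _ _ g); first exact: enum_uniq.
have bnd (k : 'I_M) : k \in enum P -> 0 <= k%:R - (c - d) <= 2 * d.
 by rewrite mem_enum inE ler_norml => /andP[h1 h2]; apply/andP; split; lra.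
have aux (k l : 'I_M) : k \in enum P -> l \in enum P -> g k = g l -> (k <= l)%N.
 move=> kP lP /(congr1 val) /=.
 have /andP[k1 k2] := bnd k kP; have /andP[l1 l2] := bnd l lP.
 rewrite !inordK ?ltnS ?le_truncn // => e.
 have /andP[u1 u2] := truncn_itv k1; have /andP[v1 v2] := truncn_itv l1.
 rewrite -e in v1 v2; rewrite -ltnS -(ltr_nat R) -natr1.
 by move: u1 u2 v1 v2; rewrite -natr1; lra.
by move=> k l kP lP e; apply/val_inj/eqP; rewrite eqn_leq !aux.
Qed.

Lemma card_pred_sum (T I : finType) (P : pred T) (Q : I -> pred T) :
 (forall x : T, P x -> exists i, Q i x) -> (#|P| <= \sum_i #|Q i|)%N.
Proof.
move=> h; rewrite -sum1_card.
under [leqRHS]eq_bigr do rewrite -sum1_card big_mkcond /=.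
rewrite exchange_big big_mkcond /=; apply: leq_sum => x _.
case: (boolP (x \in P)) => // /h[i Qi].
have {}Qi : x \in Q i by [].
by rewrite (bigD1 i) //= Qi.
Qed.

(** The admissible [k] lie within [e * M / q] of one of the [q.+1] points [a * M / q]. The
    hypothesis [q <= e * M] absorbs the [+1] of each interval. *)
Lemma card_near_fraction M q (e : R) : (0 < q)%N -> 0 <= e -> q%:R <= e * M%:R ->
 #|[pred k : 'I_M | `[< exists a : int, `|q%:R * (k%:R / M%:R) - a%:~R| <= e >]]|%:R
  <= 6 * (e * M%:R).
Proof.
move=> q0 e0 qe; set P := [pred k : 'I_M | _].
have qp : 0 < q%:R :> R by rewrite ltr0n.
have Mp : 0 < M%:R :> R.
 have := ler0n R M; rewrite le_eqVlt => /predU1P[h|//].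
 by move: qe; rewrite -h mulr0 leNgt qp.
case: (lerP 1 e) => e1.
 apply: le_trans (_ : M%:R <= _).
  by rewrite ler_nat; apply: leq_trans (max_card _) _; rewrite card_ord.
 by nra.
pose Q (a : 'I_q.+1) := [pred k : 'I_M | `|k%:R - a%:R * M%:R / q%:R| <= e * M%:R / q%:R].
have : (#|P| <= \sum_a #|Q a|)%N.
 apply: card_pred_sum => k /asboolP[a ha].
 have kM : k%:R < M%:R :> R by rewrite ltr_nat.
 have x0 : 0 <= q%:R * (k%:R / M%:R) :> R by rewrite mulr_ge0 ?divr_ge0 // ltW.
 have x1 : q%:R * (k%:R / M%:R) < q%:R :> R by rewrite -[ltRHS]mulr1 ltr_pM2l // ltr_pdivrMr // mul1r.
 move: (ha); rewrite ler_norml => /andP[h1 h2].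
 have a0 : -1 < a%:~R :> R by lra.
 have a1 : a%:~R < q%:R + 1 :> R by lra.
 have {}a0 : 0 <= a.
  exact: intr_gtN1 a0.
 have {}a1 : (absz a < q.+1)%N by rewrite ltnS -lez_nat gez0_abs // intr_ltS.
 exists (Ordinal a1) => /=.
 have aE : a%:~R = (absz a)%:R :> R by rewrite pmulrn gez0_abs.
 have -> : k%:R - (absz a)%:R * M%:R / q%:R = (q%:R * (k%:R / M%:R) - a%:~R) * (M%:R / q%:R) :> R.
  by rewrite aE; field; rewrite !gt_eqF.
 rewrite normrM (gtr0_norm (divr_gt0 Mp qp)) -[leRHS]mulrA ler_wpM2r // divr_ge0 // ltW.
rewrite -(ler_nat R) natr_sum => /le_trans; apply.
have d0 : 0 <= e * M%:R / q%:R by rewrite divr_ge0 ?mulr_ge0 // ltW.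
have hQ (a : 'I_q.+1) : #|Q a|%:R <= 2 * (e * M%:R / q%:R) + 1 by exact: card_interval.
have : \sum_i #|Q i|%:R <= \sum_(a < q.+1) (2 * (e * M%:R / q%:R) + 1) by apply: ler_sum => a _; exact: hQ.
move/le_trans; apply.
rewrite sumr_const card_ord -[leLHS]mulr_natr -[q.+1%:R]natr1.
have -> : (2 * (e * M%:R / q%:R) + 1) * (q%:R + 1) = 2 * (e * M%:R) + 2 * (e * M%:R) / q%:R + q%:R + 1.
 by field; rewrite gt_eqF.
have h1 : 2 * (e * M%:R) / q%:R <= 2 * (e * M%:R).
 by rewrite ler_pdivrMr // ler_peMr ?mulr_ge0 ?ler1n ?(ltW Mp).
have h2 : 1 <= q%:R :> R by rewrite ler1n.
by lra.
Qed.

Lemma card_major r M (q0 e : R) : 0 <= q0 -> 0 <= e -> q0 <= e * M%:R ->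
 #|[pred k : pts r M | `[< major q0 e (fracs M k) >]]|%:R
  <= q0 * (6 * (e * M%:R)) ^+ r.
Proof.
move=> q00 e0 qe; set P := [pred k | _].
have E0 : 0 <= 6 * (e * M%:R) by rewrite mulr_ge0 ?mulr_ge0.
case: (ltrP q0 1) => q1.
 rewrite (eq_card0 (A := P)) ?mulr_ge0 ?exprn_ge0 // => k.
 apply/negbTE/asboolP => -[q [a [qp [qq _]]]].
 have h1 : 1 <= q%:R :> R by rewrite ler1n.
 lra.
pose Q (q : 'I_(truncn q0)) := [pred k : pts r M | [forall i, `[< exists a : int, `|(q : nat).+1%:R * ((k i)%:R / M%:R) - a%:~R| <= e >]]].
have : (#|P| <= \sum_q #|Q q|)%N.
 apply: card_pred_sum => k /asboolP[q [a [qp [qq qa]]]].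
 have ql : (q.-1 < truncn q0)%N by rewrite prednK // truncn_ge_nat.
 by exists (Ordinal ql) => /=; apply/forallP => i; apply/asboolP; exists (a i); rewrite prednK.
rewrite -(ler_nat R) natr_sum => /le_trans; apply.
have hq (q : 'I_(truncn q0)) : #|Q q|%:R <= (6 * (e * M%:R)) ^+ r.
 pose B := [pred k : 'I_M | `[< exists a : int, `|(q : nat).+1%:R * (k%:R / M%:R) - a%:~R| <= e >]].
 have -> : #|Q q| = (#|B| ^ #|'I_r|)%N.
  rewrite -card_ffun_on; apply: eq_card => k; rewrite inE.
  by apply: eq_forallb => i.
 rewrite card_ord natrX lerXn2r ?nnegrE //.
 apply: card_near_fraction => //; apply: le_trans qe.
 by rewrite -(truncn_ge_nat (q : nat).+1 q00).
apply: le_trans (ler_sum _ (fun q _ => hq q)) _.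
rewrite sumr_const card_ord -[leLHS]mulr_natl ler_wpM2r ?exprn_ge0 ?mulr_ge0 //.
by have /andP[] := truncn_itv q00.
Qed.

End PowerBounds.

(** * Gauss sums and minor arcs under the rank condition *)

Section WeylConsequences.
Variables (R : realType) (r s : nat) (C : 'I_r.+1 -> 'M[int]_s).

(** There are [r.+1] forms from here on, so that [2 * r.+1 * r.+2] is the threshold of the theorem;
    exponential sums involve only the rational members of the pencil. *)
Definition rank_cond := forall b : 'I_r.+1 -> rat, (exists i, b i != 0) ->
 ((2 * r.+1 * r.+2).+1 <= \rank (pencil_mx C b))%N.

Hypothesis hrank : rank_cond.

Definition esum N (D : 'I_s -> pred int) (al : 'I_r.+1 -> R) : R[i] :=
 box_sum N D (fun x => expi2pi (iphase C al x)).

Definition good_box N (D : 'I_s -> pred int) :=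
 (forall j, convex_int (D j)) /\ (forall j x, D j x -> `|x| <= N%:Z).

Lemma esum_trivial N D al : cabs (esum N D al) <= (3 * N%:R) ^+ s \/ N = 0.
Proof.
case: N => [|N]; [by right | left].
apply: le_trans (cabs_sum _ _ _) _; under eq_bigr do rewrite cabs_e.
rewrite sumr_const; apply: le_trans (_ : ((2 * N.+1).+1 ^ s)%:R <= _).
 by rewrite ler_nat; apply: leq_trans (max_card _) _; rewrite card_ffun !card_ord.
by rewrite natrX lerXn2r ?nnegrE ?mulr_ge0 // -natrM ler_nat; lia.
Qed.

(** Taking a square root halves the exponent [2n(n+1) + 1], [n = r.+1], and leaves the surplus
    [Num.sqrt H]. *)
Lemma weyl_sqrt : exists K : R, 1 <= K /\ forall al N (H : R) D,
  (0 < N)%N -> good_box N D -> 1 <= H -> H <= N%:R ->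
  cabs (esum N D al) <=
   K * N%:R ^+ s * Num.sqrt (Hn R N ^+ s) / (H ^+ (r.+1 * r.+2) * Num.sqrt H) \/
  major (K * H ^+ r.+1) (K * H ^+ r.+1 / N%:R ^+ 2) al.
Proof.
have [K [K1 hK]] := @weyl_inequality R r s C _ hrank.
have Kp := lt_le_trans ltr01 K1.
exists K; split => // al N H D N0 [cD bD] H1 HN.
have Hp : 0 <= H by apply: le_trans H1.
have [h|] := hK al N H D N0 cD bD H1 HN; [left | by right].
rewrite -[leLHS]ger0_norm ?cabs_ge0 // -sqrtr_sqr.
set X := K * N%:R ^+ s * _ / _.
have X0 : 0 <= X.
 by rewrite /X; pos.
rewrite -[leRHS]ger0_norm // -sqrtr_sqr ler_sqrt ?sqr_ge0 //.
apply: le_trans h _.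
have -> : X ^+ 2 = K ^+ 2 * (N%:R ^+ (2 * s) * Hn R N ^+ s / H ^+ (2 * r.+1 * r.+2).+1).
 rewrite /X -mulnA; move: (r.+1 * r.+2)%N => m.
 rewrite exprMn exprVn [in (_ * Num.sqrt H) ^+ 2]exprMn !exprMn !sqr_sqrtr ?exprn_ge0 ?Hn_ge0 //.
 by rewrite -!exprM -exprSr ![(_ * 2)%N]mulnC !mulrA.
have -> : K * N%:R ^+ (2 * s) * Hn R N ^+ s / H ^+ (2 * r.+1 * r.+2).+1 =
  K * (N%:R ^+ (2 * s) * Hn R N ^+ s / H ^+ (2 * r.+1 * r.+2).+1) by rewrite !mulrA.
apply: ler_wpM2r; first by pos.
by rewrite expr2 ler_peMr // ltW.
Qed.

Definition gauss_box q : 'I_s -> pred int := fun _ x => 1 <= x <= q%:Z.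
Lemma good_gauss_box q : good_box q (gauss_box q).
Proof.
split=> [j a b c /andP[ab bc] /andP[h1 h2] /andP[h3 h4]|j x /andP[h1 h2]]; last by lia.
by apply/andP; split; lia.
Qed.

Definition coprime_tuple q (a : 'I_r.+1 -> int) :=
 forall d : nat, (d %| q)%N -> (forall i, (d %| absz (a i))%N) -> d = 1%N.

(** When [H] is about [q ^ (1/n)], [n = r.+1], the surplus [sqrt H] is a power of [q] with exponent
    [1 / (2n)], twice [delta0]; one half is spent on the logarithms. *)
Definition delta0 : R := (4 * r.+1%:R)^-1.
Lemma delta0_gt0 : 0 < delta0. Proof. by rewrite invr_gt0 mulr_gt0. Qed.
(** The height is chosen with [K * H ^+ r.+1 = q / 2]. If the frequencies were major they would be
    close to a fraction with denominator [q' < q], so close that both fractions agree, against the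
    coprimality of [a] and [q]. *)
Lemma gauss_bound : exists K : R, 1 <= K /\ forall q (a : 'I_r.+1 -> int),
 (0 < q)%N -> coprime_tuple q a ->
 cabs (esum q (gauss_box q) (fun i => (a i)%:~R / q%:R)) <=
  K * q%:R ^+ s * q%:R `^ (- (r.+2%:R + delta0)).
Proof.
have d0 := delta0_gt0.
have [K [K1 hK]] := weyl_sqrt; have [Ch [Ch1 hCh]] := Hn_pw s d0.
have Kp := lt_le_trans ltr01 K1.
pose E := r.+2%:R + delta0; have E0 : 0 <= E by rewrite addr_ge0 // ltW.
pose K2 := 2 * K; have K21 : 1 <= K2 by rewrite /K2; lra.
have K2p := lt_le_trans ltr01 K21.
pose A := 3 ^+ s * K2 `^ E; pose B := K * Ch * (K2 ^+ r.+2 * K2 `^ (2 * delta0)).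
have A1 : 1 <= A.
 have h3 : 1 <= 3 ^+ s :> R by rewrite exprn_ege1 // ler1n.
 by apply: (le_trans h3); rewrite ler_peMr ?pw_ge1 // (le_trans ler01).
have B0 : 0 <= B by rewrite /B; pos.
exists (A + B); split; first by apply: (le_trans A1); rewrite lerDl.
move=> q a q0 cop.
have qp : 0 < q%:R :> R by rewrite ltr0n.
have q1 : 1 <= q%:R :> R by rewrite ler1n.
rewrite -/E -mulrA.
have qq0 : 0 <= q%:R ^+ s * q%:R `^ (- E) :> R by rewrite mulr_ge0 ?powR_ge0 ?exprn_ge0.
(* Below [K2] no height [H >= 1] is available; the trivial bound and the constant [A] cover these
   [q]. *)
case: (ltrP q%:R K2) => qK.
 case: (esum_trivial q (gauss_box q) (fun i => (a i)%:~R / q%:R)) => [h|e]; last by rewrite e in q0.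
 apply: le_trans h _; apply: le_trans (_ : A * (q%:R ^+ s * q%:R `^ (- E)) <= _); last first.
  by rewrite ler_wpM2r // lerDl.
 rewrite exprMn /A -mulrA ler_wpM2l ?exprn_ge0 // mulrCA ler_peMr ?exprn_ge0 //.
 rewrite pwN // -[leLHS](divff (lt0r_neq0 (pw_gt0 E qp))) ler_wpM2r ?invr_ge0 ?powR_ge0 //.
 by apply: ge0_ler_powR; rewrite ?nnegrE ?(ltW qp) ?(ltW K2p) ?(ltW qK).
pose H := (q%:R / K2) `^ (r.+1%:R^-1).
have qK1 : 1 <= q%:R / K2 by rewrite ler_pdivlMr // mul1r.
have qKp : 0 < q%:R / K2 by apply: lt_le_trans qK1.
have H1 : 1 <= H by apply: pw_ge1; rewrite ?invr_ge0.
have Hr : H ^+ r.+1 = q%:R / K2 by rewrite pw_nat ?powR_ge0 // -powRrM mulVf ?pnatr_eq0 // powRr1 // ltW.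
have Hq : H <= q%:R.
 apply: le_trans (_ : q%:R / K2 <= _).
  by rewrite -Hr; apply: ler_eXnr.
 by rewrite ler_pdivrMr // ler_peMr // ltW.
case: (hK (fun i => (a i)%:~R / q%:R) q H _ q0 (good_gauss_box q) H1 Hq) => [h|]; last first.
 move=> [q' [a' [q'0 [q'K q'a]]]]; exfalso.
 have e1 : K * H ^+ r.+1 = q%:R / 2 by rewrite Hr /K2; field; rewrite gt_eqF.
 rewrite e1 in q'K q'a.
 have lt1 : (q' < q)%N.
  by rewrite -(ltr_nat R); apply: le_lt_trans q'K _; rewrite ltr_pdivrMr // ltr_pMr //; lra.
 have eqa i : (q'%:Z * a i = a' i * q%:Z).
  apply/eqP; rewrite -subr_eq0; apply/eqP; apply: (@int_norm_lt1 R).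
  have := q'a i; set x := (a i)%:~R : R.
  have -> : (q'%:Z * a i - a' i * q%:Z)%:~R = (q'%:R * (x / q%:R) - (a' i)%:~R) * q%:R :> R.
   by rewrite rmorphB !rmorphM /= -!pmulrn -/x; field; rewrite gt_eqF.
  rewrite normrM (gtr0_norm qp) => h; apply: le_lt_trans (_ : 2^-1 < 1); last by lra.
  apply: le_trans (ler_wpM2r (ltW qp) h) _.
  by apply: eqle; field; rewrite gt_eqF.
 have dv i : (q %| q' * absz (a i))%N.
  have e := congr1 absz (eqa i); rewrite !abszM !absz_nat in e.
  by apply/dvdnP; exists (absz (a' i)).
 pose g := gcdn q q'; have g0 : (0 < g)%N by rewrite gcdn_gt0 q0.
 have gq : (g %| q)%N := dvdn_gcdl q q'.
 have e : (q %/ g)%N = 1%N.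
  apply: cop; first exact: dvdn_div.
  move=> i; have h : (q %/ g * g %| q' %/ g * absz (a i) * g)%N.
   by rewrite divnK // mulnAC divnK ?dvdn_gcdr.
  have c : coprime (q %/ g) (q' %/ g).
   by rewrite /coprime -(eqn_pmul2r g0) muln_gcdl !divnK ?dvdn_gcdr // mul1n.
  by move: h; rewrite dvdn_pmul2r // Gauss_dvdr.
 have qg : q = g by rewrite -(divnK gq) e mul1n.
 have : (q <= q')%N by apply: dvdn_leq => //; rewrite qg; apply: dvdn_gcdr.
 by rewrite leqNgt lt1.
apply: le_trans h _; apply: le_trans (_ : B * (q%:R ^+ s * q%:R `^ (- E)) <= _); last first.
 by rewrite ler_wpM2r // lerDr (le_trans _ A1).
have den : H ^+ (r.+1 * r.+2) * Num.sqrt H = (q%:R / K2) ^+ r.+2 * (q%:R / K2) `^ (2 * delta0).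
 rewrite exprM Hr pw_sqrt ?powR_ge0 // /H -powRrM; congr (_ * _ `^ _).
 rewrite /delta0; have := pnatr_eq0 R r.+1; move: (r.+1%:R : R) => x x0; field.
 by rewrite x0.
rewrite den.
have e2 : (q%:R / K2) ^+ r.+2 * (q%:R / K2) `^ (2 * delta0) =
 (q%:R `^ E * q%:R `^ delta0) / (K2 ^+ r.+2 * K2 `^ (2 * delta0)).
 rewrite powRM ?invr_ge0 ?(ltW qp) ?(ltW K2p) // exprMn exprVn.
 rewrite -[K2^-1](powR_inv1 (ltW K2p)) -powRrM mulN1r pwN // /E pwD // -pw_nat ?(ltW qp) //.
 have -> : 2 * delta0 = delta0 + delta0 by ring.
 by rewrite (pwD delta0 delta0 qp) (pwD delta0 delta0 K2p) !invfM; ring.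
have K20 : 0 < K2 ^+ r.+2 * K2 `^ (2 * delta0) by rewrite mulr_gt0 ?exprn_gt0 ?pw_gt0.
rewrite e2 invf_div pwN // /B.
have p1 := pw_gt0 E qp; have p2 := pw_gt0 delta0 qp.
have -> : K * q%:R ^+ s * Num.sqrt (Hn R q ^+ s) * (K2 ^+ r.+2 * K2 `^ (2 * delta0) / (q%:R `^ E * q%:R `^ delta0)) =
 (K * q%:R ^+ s * (K2 ^+ r.+2 * K2 `^ (2 * delta0)) / q%:R `^ E) * (Num.sqrt (Hn R q ^+ s) / q%:R `^ delta0).
 by rewrite invfM; ring.
have -> : K * Ch * (K2 ^+ r.+2 * K2 `^ (2 * delta0)) * (q%:R ^+ s / q%:R `^ E) =
 (K * q%:R ^+ s * (K2 ^+ r.+2 * K2 `^ (2 * delta0)) / q%:R `^ E) * Ch by ring.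
apply: ler_wpM2l; first by pos.
by rewrite ler_pdivrMr // hCh.
Qed.

Definition majorb (K H : R) (N : nat) (al : 'I_r.+1 -> R) : bool :=
 `[< major (K * H ^+ r.+1) (K * H ^+ r.+1 / N%:R ^+ 2) al >].

(** One factor [H ^+ r.+1] comes from the denominator and one from each of the [r.+1] frequencies.
    Their product is what [weyl_sqrt] saves apart from its surplus. *)
Lemma card_majorb (K H : R) N M : 1 <= K -> 1 <= H -> (0 < N)%N -> (N ^ 2 <= M)%N ->
 #|[pred k : pts r.+1 M | majorb K H N (fracs M k)]|%:R <=
  K ^+ r.+2 * 6 ^+ r.+1 * H ^+ (r.+1 * r.+2) * (M%:R / N%:R ^+ 2) ^+ r.+1.
Proof.
move=> K1 H1 N0 NM; have Np : 0 < N%:R :> R by rewrite ltr0n.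
pose q0 := K * H ^+ r.+1; have q00 : 0 <= q0 by rewrite /q0; pos.
have MN : 1 <= M%:R / N%:R ^+ 2 :> R by rewrite ler_pdivlMr ?exprn_gt0 // mul1r -natrX ler_nat.
have := @card_major R r.+1 M q0 (q0 / N%:R ^+ 2) q00 _ _.
move=> /(_ ltac:(pos)) /(_ ltac:(by rewrite mulrAC -mulrA ler_peMr)) h.
apply: le_trans h _.
have -> : q0 * (6 * (q0 / N%:R ^+ 2 * M%:R)) ^+ r.+1 = q0 ^+ r.+2 * 6 ^+ r.+1 * (M%:R / N%:R ^+ 2) ^+ r.+1.
 have gen : forall x n y : R, x * (6 * (x / n * y)) ^+ r.+1 = x ^+ r.+2 * 6 ^+ r.+1 * (y / n) ^+ r.+1.
  move=> x n y; have -> : x / n * y = x * (y / n) by ring.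
  by rewrite !exprMn (exprS x r.+1); ring.
 exact: gen.
apply: eqle.
by rewrite /q0 exprMn -exprM; move: (r.+1 * r.+2)%N => m; ring.
Qed.

(** The minor fractions are layered by the heights [h j = H0 * 4 ^ j]: those major at [h j.+1] but
    not at [h j] are counted by [card_majorb] and bounded by [weyl_sqrt]. All powers of [h j] cancel
    up to the surplus, so the layers form a geometric series. At the height [N ^ (2 / (n+1))],
    [n = r.+1], the saving reaches [N ^ (2n)] and all remaining fractions can be counted
    trivially. *)
Lemma minor_arcs : exists K K' : R, [/\ 1 <= K, 1 <= K' & forall N M (H0 : R) D,
 (0 < N)%N -> (N ^ 2 <= M)%N -> good_box N D -> 1 <= H0 -> H0 <= N%:R `^ (2 / r.+2%:R) ->
 \sum_(k : pts r.+1 M | ~~ majorb K H0 N (fracs M k))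
   cabs (esum N D (fracs M k)) <=
 K' * M%:R ^+ r.+1 * N%:R ^+ s / N%:R ^+ (2 * r.+1) * Num.sqrt (Hn R N ^+ s) / Num.sqrt H0].
Proof.
have [K [K1 hK]] := weyl_sqrt; have Kp := lt_le_trans ltr01 K1.
pose m := (r.+1 * r.+2)%N.
pose c1 := K ^+ r.+2 * 6 ^+ r.+1 * 4 ^+ m * K.
have c10 : 0 <= c1 by rewrite /c1; pos.
exists K, (1 + 2 * c1 + K * 4 ^+ m); split => //.
 by rewrite -addrA lerDl; pos.
move=> N M H0 D N0 NM gD H01 H0T; set T := N%:R `^ _ in H0T.
have Np : 0 < N%:R :> R by rewrite ltr0n.
have N1 : 1 <= N%:R :> R by rewrite ler1n.
have H0p := lt_le_trans ltr01 H01.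
have T1 : 1 <= T by apply: le_trans H0T.
have TN : T <= N%:R.
 rewrite -[leRHS]powRr1 ?(ltW Np) // ler_powR // ler_pdivrMr // mul1r.
 by rewrite ler_nat.
have Tr : T ^+ r.+2 = N%:R ^+ 2 by rewrite !pw_nat ?powR_ge0 ?(ltW Np) // -powRrM divfK ?pnatr_eq0.
have Tm : T ^+ m = N%:R ^+ (2 * r.+1) by rewrite /m mulnC exprM Tr -exprM.
pose S (k : pts r.+1 M) := cabs (esum N D (fracs M k)).
pose maj H (k : pts r.+1 M) := majorb K H N (fracs M k).
(* Heights grow by 4 so that their square roots double. *)
pose h j := H0 * 4 ^+ j.
have hp j : 1 <= h j by rewrite (le_trans H01) // /h ler_peMr ?(ltW H0p) // exprn_ege1 // ler1n.
have hS j : h j.+1 = 4 * h j by rewrite /h exprS mulrCA.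
pose sq := Num.sqrt (Hn R N ^+ s); have sq0 : 0 <= sq by apply: sqrtr_ge0.
pose W := (M%:R / N%:R ^+ 2) ^+ r.+1 * N%:R ^+ s * sq.
have W0 : 0 <= W by rewrite /W; pos.
have bad H k : 1 <= H -> H <= N%:R -> ~~ maj H k ->
  S k <= K * N%:R ^+ s * sq / (H ^+ m * Num.sqrt H).
 move=> H1 HN /asboolP nm.
 by have [//|] := hK (fracs M k) N H D N0 gD H1 HN.
have step j : h j <= N%:R ->
  \sum_(k | ~~ maj (h j) k && maj (h j.+1) k) S k <= c1 * W / Num.sqrt (h j).
 move=> hjN; have hj0 : 0 < h j by apply: lt_le_trans (hp j).
 apply: le_trans (_ : \sum_(k | ~~ maj (h j) k && maj (h j.+1) k) K * N%:R ^+ s * sq / (h j ^+ m * Num.sqrt (h j)) <= _).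
  by apply: ler_sum => k /andP[k1 _]; apply: bad.
 rewrite sumr_const -[leLHS]mulr_natl.
 have cm := card_majorb K1 (hp j.+1) N0 NM.
 apply: le_trans (_ : (K ^+ r.+2 * 6 ^+ r.+1 * h j.+1 ^+ m * (M%:R / N%:R ^+ 2) ^+ r.+1) * (K * N%:R ^+ s * sq / (h j ^+ m * Num.sqrt (h j))) <= _).
  apply: ler_wpM2r; first by pos.
  apply: le_trans cm; rewrite ler_nat; apply: subset_leq_card.
  by apply/fintype.subsetP => k /andP[].
 rewrite hS exprMn; apply: eqle.
 have s0 : Num.sqrt (h j) != 0 by rewrite gt_eqF // sqrtr_gt0.
 have m0 : h j ^+ m != 0 by rewrite expf_neq0 // gt_eqF.
 have n0 : N%:R != 0 :> R by rewrite gt_eqF.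
 rewrite /c1 /W; move: (h j ^+ m) (Num.sqrt (h j)) s0 m0 (4 ^+ m) => x y y0 x0 z.
 by move: (_ ^+ r.+1) => w; field; rewrite y0.
have [J [hJ hJT]] : exists J, h J <= T /\ T < h J.+1.
 have ex : exists j, T < h j.+1.
  exists (truncn T); apply: lt_le_trans (truncnS_gt _) _.
  rewrite /h -[leLHS]mul1r; apply: ler_pM => //.
  by rewrite -natrX ler_nat ltnW // ltn_expl.
 case: (ex_minnP ex) => J hJ Jmin; exists J; split => //.
 case: J Jmin hJ => [|J] Jmin hJ; first by rewrite /h expr0 mulr1.
 by rewrite leNgt; apply/negP => /Jmin; rewrite ltnn.
have hle j : (j <= J)%N -> h j <= T.
 move=> jJ; apply: le_trans hJ; rewrite /h ler_wpM2l ?(ltW H0p) //.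
 by apply: ler_weXn2l => //; rewrite ler1n.
(* [2 - 2 / 2 ^+ j] is the sum of the first [j] terms of the geometric series of ratio 1/2. *)
have ladder j : (j <= J)%N -> \sum_(k | ~~ maj H0 k && maj (h j) k) S k <=
  c1 * W / Num.sqrt H0 * (2 - 2 / 2 ^+ j).
 elim: j => [_|j IH jJ].
  rewrite big_pred0 ?expr0 ?divr1 ?subrr ?mulr0 // => k.
  by rewrite /h expr0 mulr1 andNb.
 have jJ' := ltnW jJ.
 apply: le_trans (_ : \sum_(k | ~~ maj H0 k && maj (h j) k) S k + \sum_(k | ~~ maj (h j) k && maj (h j.+1) k) S k <= _).
  rewrite big_mkcond [X in X + _]big_mkcond [X in _ + X]big_mkcond -big_split /=.
  apply: ler_sum => k _; have := cabs_ge0 (esum N D (fracs M k)); rewrite -/(S k).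
  by case: (maj H0 k); case: (maj (h j) k); case: (maj (h j.+1) k) => /=; clear; lra.
 apply: le_trans (lerD (IH jJ') (step j (le_trans (hle j jJ') TN))) _.
 have -> : Num.sqrt (h j) = Num.sqrt H0 * 2 ^+ j.
  have -> : h j = H0 * (2 ^+ j) ^+ 2.
   by rewrite /h -exprM mulnC exprM; congr (_ * _ ^+ j); ring.
  by rewrite sqrtrM ?(ltW H0p) // sqrtr_sqr ger0_norm //; pos.
 apply: eqle; rewrite exprS.
 have s0 : Num.sqrt H0 != 0 by rewrite gt_eqF // sqrtr_gt0.
 have t0 : 2 ^+ j != 0 :> R by rewrite expf_neq0.
 by move: (2 ^+ j) t0 (Num.sqrt H0) s0 => x x0 y y0; field; rewrite ?y0 ?x0.
have ladJ := ladder J (leqnn J).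
have top : \sum_(k | ~~ maj (h J) k) S k <= K * 4 ^+ m * W / Num.sqrt H0.
 have B : K * N%:R ^+ s * sq / (h J ^+ m * Num.sqrt (h J)) <= K * N%:R ^+ s * sq * (4 ^+ m / (N%:R ^+ (2 * r.+1) * Num.sqrt H0)).
  apply: ler_wpM2l; first by pos.
  have hJ0 : 0 < h J by apply: lt_le_trans (hp J).
  have X1 : 0 < h J ^+ m * Num.sqrt (h J) by pos.
  have X2 : 0 < N%:R ^+ (2 * r.+1) * Num.sqrt H0 by pos.
  rewrite -[leLHS]mul1r ler_pdivrMr // mulrAC ler_pdivlMr // mul1r -Tm mulrA -exprMn.
  apply: ler_pM; [by pos | by pos | | ].
   by apply: lerXn2r; rewrite ?nnegrE; [pos | pos | rewrite -hS ltW].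
  by apply: ler_wsqrtr; rewrite /h ler_peMr ?(ltW H0p) // exprn_ege1 // ler1n.
 apply: le_trans (_ : \sum_(k | ~~ maj (h J) k) K * N%:R ^+ s * sq * (4 ^+ m / (N%:R ^+ (2 * r.+1) * Num.sqrt H0)) <= _).
  by apply: ler_sum => k kb; apply: le_trans (bad _ _ (hp J) (le_trans hJ TN) kb) B.
 rewrite sumr_const -[leLHS]mulr_natl.
 apply: le_trans (_ : M%:R ^+ r.+1 * (K * N%:R ^+ s * sq * (4 ^+ m / (N%:R ^+ (2 * r.+1) * Num.sqrt H0))) <= _).
  apply: ler_wpM2r; first by pos.
  rewrite -natrX ler_nat; apply: leq_trans (max_card _) _.
  by rewrite card_ffun !card_ord.
 apply: eqle; rewrite /W exprMn exprVn -exprM.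
 have s0 : Num.sqrt H0 != 0 by rewrite gt_eqF // sqrtr_gt0.
 have n0 : N%:R ^+ (2 * r.+1) != 0 :> R by rewrite expf_neq0 // gt_eqF.
 by move: (N%:R ^+ (2 * r.+1)) n0 (Num.sqrt H0) s0 => x x0 y y0; field; rewrite y0.
apply: le_trans (_ : \sum_(k | ~~ maj H0 k && maj (h J) k) S k + \sum_(k | ~~ maj (h J) k) S k <= _).
 rewrite big_mkcond [X in X + _]big_mkcond [X in _ + X]big_mkcond -big_split /=.
 apply: ler_sum => k _; rewrite -/(maj H0 k) -/(S k); have := cabs_ge0 (esum N D (fracs M k)); rewrite -/(S k).
 by case: (maj H0 k); case: (maj (h J) k) => /=; clear; lra.
have WE : W = M%:R ^+ r.+1 * N%:R ^+ s / N%:R ^+ (2 * r.+1) * sq.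
 rewrite /W exprMn exprVn -exprM; ring.
have WH0 : 0 <= W / Num.sqrt H0 by pos.
apply: le_trans (_ : (1 + 2 * c1 + K * 4 ^+ m) * (W / Num.sqrt H0) <= _); last first.
 by rewrite WE; apply: eqle; rewrite -/sq; ring.
have j2 : c1 * W / Num.sqrt H0 * (2 - 2 / 2 ^+ J) <= c1 * W / Num.sqrt H0 * 2.
 by apply: ler_wpM2l; [pos | rewrite gerBl; pos].
have e1 : c1 * W / Num.sqrt H0 * 2 = (2 * c1) * (W / Num.sqrt H0) by ring.
have e2 : K * 4 ^+ m * W / Num.sqrt H0 = (K * 4 ^+ m) * (W / Num.sqrt H0) by ring.
rewrite e1 in j2; rewrite e2 in top.
move: (W / Num.sqrt H0) WH0 (K * 4 ^+ m) (2 * c1) j2 top ladJ => w w0 u v; lra.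
Qed.

End WeylConsequences.

Lemma measurable_EFin (R : realType) d (T : measurableType d) (f : T -> R) :
 measurable_fun setT f -> measurable_fun setT (EFin \o f).
Proof. by move=> mf; apply/measurable_EFinP. Qed.

(** * Integrals over boxes and their Riemann sums *)

Section TupleIntegral.
Variable R : realType.
Local Notation leb := (@lebesgue_measure R).
Local Notation Lb := (@tuple_lebesgue R).

Lemma measurable_tcons_fun n : measurable_fun setT (@tcons R n).
Proof. exact: (measurable_cons (f := fst) (g := snd)). Qed.
Lemma integral_tupleS n (f : n.+1.-tuple R -> R) :
 measurable_fun setT f -> (Lb n.+1).-integrable setT (EFin \o f) ->
 (\int[Lb n.+1]_t (f t)%:E = \int[leb]_x \int[Lb n]_t (f (tcons (x, t)))%:E)%E.
Proof.
move=> mf fi; have mfE := measurable_EFin mf.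
have mft := measurableT_comp mfE (@measurable_tcons_fun n).
have fti : (leb \x Lb n)%E.-integrable setT ((EFin \o f) \o @tcons R n).
 apply/integrableP; split => //; move/integrableP: fi => [_].
 have mabs : measurable_fun setT (abse \o (EFin \o f)) by exact: measurableT_comp.
 have := @ge0_integral_pushforward _ _ _ _ R _ (measurable_tcons_fun (n:=n)) (leb \x Lb n)%E setT _ measurableT mabs (fun x _ => abse_ge0 _).
 by rewrite preimage_setT => <-.
have := @integral_pushforward _ _ _ _ R _ (measurable_tcons_fun (n:=n)) (leb \x Lb n)%E setT _ mfE.
rewrite preimage_setT => /(_ fti measurableT) => e.
have {}e : (\int[Lb n.+1]_t (f t)%:E = \int[(leb \x Lb n)]_x ((EFin \o f) \o @tcons R n) x)%E by exact: e.
by rewrite e -integral12_prod_meas1.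
Qed.

Definition tbox n (J : 'I_n.+1 -> interval R) := fun j : 'I_n => J (lift ord0 j).
Lemma box_tcons n (J : 'I_n.+1 -> interval R) x (t : n.-tuple R) :
 box J (tcons (x, t)) <-> x \in J ord0 /\ box (tbox J) t.
Proof.
split=> [h|[h1 h2] j].
 split; first by have := h ord0; rewrite tnth0.
 by move=> j; have := h (lift ord0 j); rewrite tnthS.
by case: (unliftP ord0 j) => [k|] ->; [rewrite tnthS; exact: h2 | rewrite tnth0].
Qed.

Lemma box0 (J : 'I_0 -> interval R) : box J = setT.
Proof. by apply/seteqP; split => // t _ []. Qed.
Lemma measurable_box n (J : 'I_n -> interval R) : measurable (box J).
Proof.
have -> : box J = \bigcap_(j in [set: 'I_n]) ((fun t : n.-tuple R => tnth t j) @^-1` [set` J j]).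
 by apply/seteqP; split => [t h j _|t h j]; [exact: h | exact: (h j I)].
apply: fin_bigcap_measurable => // j _.
rewrite -[X in measurable X]setTI; apply: measurable_tnth => //.
Qed.

Lemma tuple_lebesgueS_box n (J : 'I_n.+1 -> interval R) :
 (Lb n.+1 (box J) = leb [set` J ord0] * Lb n (box (tbox J)))%E.
Proof.
rewrite -(product_measure1E leb (Lb n)); [|exact: measurable_itv|exact: measurable_box].
rewrite /= /tcons_measure /pushforward; congr (product_measure1 _ _ _).
by apply/seteqP; split => -[x t] /=; rewrite box_tcons.
Qed.

Definition in_cube n (X : R) (t : n.-tuple R) := forall j, `|tnth t j| <= X.
Definition box_le n (X : R) (J : 'I_n -> interval R) := forall j x, x \in J j -> `|x| <= X.
Lemma lebesgue_itv_le (I : interval R) (X : R) : 0 <= X -> (forall x, x \in I -> `|x| <= X) ->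
 (leb [set` I] <= (2 * X)%:E)%E.
Proof.
move=> X0 h; apply: (@le_trans _ _ (leb [set` `[-X, X]])).
 apply: le_measure; rewrite ?inE; [exact: measurable_itv | exact: measurable_itv|].
 by move=> x /= /h; rewrite in_itv /= ler_norml.
rewrite lebesgue_measure_itv /= lte_fin; case: ifP => _; last by rewrite lee_fin mulr_ge0.
by rewrite -EFinB lee_fin; lra.
Qed.

Lemma Lb_box_le n X (J : 'I_n -> interval R) : 0 <= X -> box_le X J ->
 (Lb n (box J) <= ((2 * X) ^+ n)%:E)%E.
Proof.
move=> X0; elim: n J => [|n IH] J hJ.
 by rewrite expr0 box0 /= diracE mem_set.
rewrite tuple_lebesgueS_box exprS EFinM; apply: lee_pmul => //.
 by apply: lebesgue_itv_le => // x; exact: hJ.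
by apply: IH => j x; exact: hJ.
Qed.

Definition bounded_on n (A : set (n.-tuple R)) (K : R) (f : n.-tuple R -> R) :=
 forall t, A t -> `|f t| <= K.

Lemma integrable_box n X K (J : 'I_n -> interval R) (f : n.-tuple R -> R) :
 0 <= X -> box_le X J -> measurable_fun setT f -> bounded_on (box J) K f ->
 (Lb n).-integrable (box J) (EFin \o f).
Proof.
move=> X0 hJ mf bf; apply: measurable_bounded_integrable => //.
- exact: measurable_box.
- by apply: le_lt_trans (Lb_box_le X0 hJ) _; rewrite ltry.
- exact: measurable_funTS.
exists K; split; first exact: num_real.
by move=> M KM t At; apply: le_trans (bf t At) (ltW KM).
Qed.

Lemma Rintegral_box_le n X K (J : 'I_n -> interval R) (f : n.-tuple R -> R) :
 0 <= X -> 0 <= K -> box_le X J -> measurable_fun setT f -> bounded_on (box J) K f ->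
 `|\int[Lb n]_(t in box J) f t| <= (2 * X) ^+ n * K.
Proof.
move=> X0 K0 hJ mf bf; have mB := measurable_box J.
have fi := integrable_box X0 hJ mf bf.
apply: le_trans (le_normr_Rintegral mB fi) _.
have Lfin : (Lb n (box J) < +oo)%E by apply: le_lt_trans (Lb_box_le X0 hJ) _; rewrite ltry.
apply: le_trans (_ : \int[Lb n]_(t in box J) K <= _).
 apply: le_Rintegral => //.
 - apply: (@integrable_box n X K) => //; first exact: measurableT_comp.
  by move=> t At; rewrite normr_id; exact: bf.
 - by apply: (@integrable_box n X K) => // t _; rewrite ger0_norm.
rewrite Rintegral_cst // mulrC ler_wpM2r //.
have L0 : (0 <= Lb n (box J))%E by exact: measure_ge0.
rewrite -lee_fin fineK ?ge0_fin_numE //.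
exact: Lb_box_le.
Qed.

Lemma Rintegral_boxS n X K (J : 'I_n.+1 -> interval R) (f : n.+1.-tuple R -> R) :
 0 <= X -> box_le X J -> measurable_fun setT f -> bounded_on (box J) K f ->
 \int[Lb n.+1]_(t in box J) f t =
 \int[leb]_(x in [set` J ord0]) \int[Lb n]_(t in box (tbox J)) f (tcons (x, t)).
Proof.
move=> X0 hJ mf bf; have mB := measurable_box J.
have fi := integrable_box X0 hJ mf bf.
have hJ' : box_le X (tbox J) by move=> j x; exact: hJ.
rewrite Rintegral_mkcond /Rintegral.
have mg : measurable_fun setT (f \_ (box J)).
 by apply/(measurable_restrictT _ mB); exact: measurable_funTS.
rewrite integral_tupleS //; last first.
 rewrite (_ : EFin \o _ = (EFin \o f) \_ (box J)); last by rewrite restrict_EFin.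
 by apply/(integrable_mkcond _ mB).
rewrite [in RHS]integral_mkcond; congr fine; apply: eq_integral => x _ /=.
rewrite patchE; case: ifPn => xJ; last first.
 rewrite (eq_integral (fun=> 0%E)) ?integral0 // => t _.
 rewrite patchE; case: ifPn => // /set_mem /box_tcons[xJ' _].
 by move/negP: xJ; case; rewrite inE.
have fx : (Lb n).-integrable (box (tbox J)) (EFin \o (fun t => f (tcons (x, t)))).
 apply: (@integrable_box n X K) => //.
  apply: (measurableT_comp mf); apply: (measurableT_comp (@measurable_tcons_fun n)).
  exact: measurable_pair1 || exact: pair1_measurable || (apply/measurable_fun_pairP; split; [exact: measurable_cst | exact: measurable_id]).
 by move=> t At; apply: bf; apply/box_tcons; split => //; rewrite inE in xJ.
rewrite fineK; last by apply: integrable_fin_num => //; exact: measurable_box.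
rewrite [RHS]integral_mkcond; apply: eq_integral => t _ /=.
rewrite !patchE; rewrite inE in xJ.
by case: (boolP (t \in box (tbox J))) => [/set_mem tB|/negP tB]; case: ifPn => //=;
  [move=> /negP; case; apply/mem_set/box_tcons | move=> /set_mem/box_tcons[_ /mem_set]].
Qed.

Lemma measurable_inner n (f : n.+1.-tuple R -> R) x :
 measurable_fun setT f -> measurable_fun setT (fun t : n.-tuple R => f (tcons (x, t))).
Proof.
move=> mf; apply: (measurableT_comp mf); apply: (measurableT_comp (@measurable_tcons_fun n)).
by apply/measurable_fun_pairP; split; [exact: measurable_cst | exact: measurable_id].
Qed.

Lemma Rintegral_small (A : set R) (a tau K : R) (g : R -> R) :
 measurable A -> 0 <= tau -> 0 <= K -> (forall x, A x -> a <= x < a + tau) ->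
 measurable_fun A g -> (forall x, A x -> `|g x| <= K) ->
 leb.-integrable A (EFin \o g) /\ `|\int[leb]_(x in A) g x| <= tau * K.
Proof.
move=> mA t0 K0 hA mg bg.
have lA : (leb A <= tau%:E)%E.
 apply: (@le_trans _ _ (leb [set` `[a, a + tau]])).
  by apply: le_measure; rewrite ?inE // => x /hA /andP[h1 h2] /=; rewrite in_itv /= h1 (ltW h2).
 rewrite lebesgue_measure_itv /= lte_fin; case: ifP => _; last by rewrite lee_fin.
 by rewrite -EFinB lee_fin; lra.
have lfin : (leb A < +oo)%E by apply: le_lt_trans lA _; rewrite ltry.
have gi (h : R -> R) : measurable_fun A h -> (forall x, A x -> `|h x| <= K) -> leb.-integrable A (EFin \o h).
 move=> mh bh; apply: measurable_bounded_integrable => //.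
 by exists K; split; [exact: num_real | move=> M KM t At; apply: le_trans (bh t At) (ltW KM)].
split; first exact: gi.
have H1 := @le_normr_Rintegral _ (measurableTypeR R) R leb A g mA (gi g mg bg).
apply: (le_trans H1).
apply: le_trans (_ : \int[leb]_(t in A) K <= _).
 apply: le_Rintegral => //.
 - by apply: gi; [exact: measurableT_comp | move=> x Ax; rewrite normr_id; exact: bg].
 - by apply: gi => // x Ax; rewrite ger0_norm.
rewrite Rintegral_cst // mulrC ler_wpM2r //.
have L0 : (0 <= leb A)%E by exact: measure_ge0.
by rewrite -lee_fin fineK ?ge0_fin_numE.
Qed.

Section Riemann1.
Variables (X M L tau : R) (f : R -> R).
Hypotheses (X0 : 0 <= X) (M0 : 0 <= M) (L0 : 0 <= L) (t0 : 0 < tau).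
Hypothesis f_bd : forall x, `|x| <= X -> `|f x| <= M.
Hypothesis f_lip : forall x y, `|x| <= X -> `|y| <= X -> `|f x - f y| <= L * `|x - y|.

Let inX (A : set R) := forall x, A x -> `|x| <= X.
Lemma lip_measurable (A : set R) : measurable A -> inX A -> measurable_fun A f.
Proof.
move=> mA AX; apply: (@measurable_funS _ _ _ _ [set` `[-X, X]]) => //.
 by move=> x /AX; rewrite /= in_itv /= ler_norml.
apply: subspace_continuous_measurable_fun => //.
apply/subspace_continuousP => x; rewrite /= in_itv /= -ler_norml => hx.
apply/cvgrPdist_lt => e e0.
have L1 : 0 < L + 1 by rewrite ltr_wpDl.
rewrite near_withinE; near=> y => hy.
have hy' : `|y| <= X by move: hy; rewrite /= in_itv /= -ler_norml.
apply: le_lt_trans (f_lip hx hy') _.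
apply: (@le_lt_trans _ _ ((L + 1) * `|x - y|)); first by rewrite ler_wpM2r // lerDl.
rewrite mulrC -ltr_pdivlMr //.
near: y; apply: cvgr_dist_lt; first exact: cvg_id.
by rewrite divr_gt0.
Unshelve. all: by end_near. Qed.

Definition rsum1 (A : set R) (c : R) m :=
 tau * \sum_(i < m) (if c + tau * i%:R \in A then f (c + tau * i%:R) else 0).

Lemma rsum1S A c m : rsum1 A c m.+1 = tau * (if c \in A then f c else 0) + rsum1 A (c + tau) m.
Proof.
rewrite /rsum1 big_ord_recl mulr0 addr0 mulrDr; congr (_ + _ * _); apply: eq_bigr => i _.
have -> : c + tau * (lift ord0 i)%:R = c + tau + tau * i%:R.
 by rewrite /lift /= /bump leq0n natrD mulrDr mulr1 addrA.
by [].
Qed.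

Lemma rsum1_eq (A A' : set R) c m : (forall x, c <= x -> A x <-> A' x) -> rsum1 A c m = rsum1 A' c m.
Proof.
move=> h; rewrite /rsum1; congr (_ * _); apply: eq_bigr => i _.
have hx : c <= c + tau * i%:R by rewrite lerDl mulr_ge0 // ltW.
have -> : (c + tau * i%:R \in A) = (c + tau * i%:R \in A').
 by apply/idP/idP; rewrite !inE => /(h _ hx).
by [].
Qed.

Lemma rsum1_empty A c m : A = set0 -> rsum1 A c m = 0.
Proof. by move=> ->; rewrite /rsum1 big1 ?mulr0 // => i _; rewrite memNset. Qed.
Let lowpart (A : set R) c := A `&` [set x | x < c].
Let uppart (A : set R) c := A `&` [set x | c <= x].
Lemma part_measurable A c : measurable A -> measurable (lowpart A c) /\ measurable (uppart A c).
Proof.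
move=> mA; split; apply: measurableI => //.
 rewrite (_ : [set x | x < c] = [set` `]-oo, c[]); first exact: measurable_itv.
 by apply/seteqP; split => x /=; rewrite in_itv.
rewrite (_ : [set x | c <= x] = [set` `[c, +oo[]); first exact: measurable_itv.
by apply/seteqP; split => x /=; rewrite in_itv /= andbT.
Qed.

Lemma inX_integrable A : measurable A -> inX A -> leb.-integrable A (EFin \o f).
Proof.
move=> mA AX; have X1 : 0 <= 2 * X + 1 by rewrite addr_ge0 ?mulr_ge0.
apply: (proj1 (@Rintegral_small A (- X) (2 * X + 1) M f mA X1 M0 _ _ _)).
- by move=> x /AX; rewrite ler_norml => /andP[h1 h2]; apply/andP; split=> //; lra.
- exact: lip_measurable.
- by move=> x /AX; exact: f_bd.
Qed.

Lemma Rintegral_split A c : measurable A -> inX A ->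
 \int[leb]_(x in A) f x = \int[leb]_(x in lowpart A c) f x + \int[leb]_(x in uppart A c) f x.
Proof.
move=> mA AX; have [ml mu] := part_measurable c mA.
have e : A = lowpart A c `|` uppart A c.
 apply/seteqP; split => [x Ax|x [[]|[]] //].
 by case: (ltP x c) => h; [left|right].
rewrite {1}e Rintegral_setU //.
 by rewrite -e; exact: inX_integrable.
apply/disj_setPS => x [[_ /= h1] [_ /= h2]].
by move: (lt_le_trans h1 h2); rewrite ltxx.
Qed.

Lemma first_cell A c : measurable A -> inX A -> A c -> (forall x, A x -> c <= x < c + tau) ->
 `|tau * f c - \int[leb]_(x in A) f x| <= L * tau ^+ 2 + tau * M.
Proof.
move=> mA AX Ac hA.
have mf := lip_measurable mA AX; have fi := inX_integrable mA AX.
have lA : (leb A <= tau%:E)%E.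
 apply: (@le_trans _ _ (leb [set` `[c, c + tau]])).
  by apply: le_measure; rewrite ?inE // => x /hA /andP[h1 h2] /=; rewrite in_itv /= h1 (ltW h2).
 rewrite lebesgue_measure_itv /= lte_fin; case: ifP => _; last by rewrite lee_fin ltW.
 by rewrite -EFinB lee_fin; lra.
have A0 : (0 <= leb A)%E by exact: measure_ge0.
have Afin : leb A \is a fin_num by rewrite ge0_fin_numE //; apply: le_lt_trans lA _; rewrite ltry.
set l := fine (leb A).
have l0 : 0 <= l by rewrite -lee_fin fineK.
have lt : l <= tau by rewrite -lee_fin fineK.
have ci : leb.-integrable A (EFin \o (fun=> f c)).
 apply: (proj1 (@Rintegral_small A c tau M (fun=> f c) mA (ltW t0) M0 hA _ _)) => // x _.
 exact: f_bd (AX _ Ac).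
have -> : tau * f c - \int[leb]_(x in A) f x = (tau - l) * f c + \int[leb]_(x in A) (f c - f x).
 rewrite RintegralB // Rintegral_cst // -/l; ring.
apply: le_trans (ler_normD _ _) _; rewrite addrC lerD //.
 have [||_] := @Rintegral_small A c tau (L * tau) (fun x => f c - f x) mA (ltW t0) (mulr_ge0 L0 (ltW t0)) hA;
  last by rewrite mulrCA -expr2.
  by apply: measurable_funB.
 move=> x Ax; apply: le_trans (f_lip (AX _ Ac) (AX _ Ax)) _; apply: ler_wpM2l => //.
 by move: (hA x Ax) => /andP[h1 h2]; rewrite ler_norml; lra.
rewrite normrM ler_pM //; last exact: f_bd (AX _ Ac).
by rewrite ger0_norm; lra.
Qed.

Lemma full_cell A c : measurable A -> inX A -> (forall x, A x <-> c <= x < c + tau) ->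
 `|tau * f c - \int[leb]_(x in A) f x| <= L * tau ^+ 2.
Proof.
move=> mA AX hA.
have Ac : A c by apply/hA; rewrite lexx ltrDl.
have mf := lip_measurable mA AX; have fi := inX_integrable mA AX.
have hA' x : A x -> c <= x < c + tau by move/hA.
have lA : leb A = tau%:E.
 have -> : A = [set` `[c, c + tau[].
  by apply/seteqP; split => x /=; rewrite in_itv /=; move/hA.
 by rewrite lebesgue_measure_itv /= lte_fin ltrDl t0 -EFinB addrAC subrr add0r.
have ci : leb.-integrable A (EFin \o (fun=> f c)).
 apply: (proj1 (@Rintegral_small A c tau M (fun=> f c) mA (ltW t0) M0 hA' _ _)) => // x _.
 exact: f_bd (AX _ Ac).
have -> : tau * f c - \int[leb]_(x in A) f x = \int[leb]_(x in A) (f c - f x).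
 rewrite RintegralB // Rintegral_cst ?lA ?ltry //=; by congr (_ - _); rewrite mulrC lA.
have [||_] := @Rintegral_small A c tau (L * tau) (fun x => f c - f x) mA (ltW t0) (mulr_ge0 L0 (ltW t0)) hA';
 last by rewrite mulrCA -expr2.
 by apply: measurable_funB.
move=> x Ax; apply: le_trans (f_lip (AX _ Ac) (AX _ Ax)) _; apply: ler_wpM2l => //.
by move: (hA' x Ax) => /andP[h1 h2]; rewrite ler_norml; lra.
Qed.

Lemma Rintegral_cell A c : measurable A -> inX A -> (forall x, A x -> c <= x < c + tau) ->
 `|\int[leb]_(x in A) f x| <= tau * M.
Proof.
move=> mA AX hA; apply: (proj2 (@Rintegral_small A c tau M f mA (ltW t0) M0 hA _ _)).
 exact: lip_measurable.
by move=> x /AX; exact: f_bd.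
Qed.

Let tM : 0 <= tau * M. Proof. by rewrite mulr_ge0 // ltW. Qed.
Let tL : 0 <= L * tau ^+ 2. Proof. by rewrite mulr_ge0 // sqr_ge0. Qed.
Let mL m : 0 <= m%:R * (L * tau ^+ 2). Proof. by rewrite mulr_ge0. Qed.
Let stepS m : m.+1%:R * (L * tau ^+ 2) = m%:R * (L * tau ^+ 2) + L * tau ^+ 2.
Proof. by rewrite -natr1; ring. Qed.
Lemma rsum1_upper A c m : rsum1 A c m = rsum1 (uppart A c) c m.
Proof. by apply: rsum1_eq => x hx; split => [Ax|[]]. Qed.
Lemma upper_interval A c : is_interval A -> is_interval (uppart A c).
Proof.
move=> iA u v [Au /= hu] [Av /= hv] z hz; split => /=; first exact: iA Au Av _ hz.
by case/andP: hz => h1 _; exact: le_trans h1.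
Qed.

(** When the grid starts inside the interval, every cell that meets it is full except possibly the
    last, which costs [tau * M]; a full cell costs only its Lipschitz error. *)
Lemma riemann1_start m A c : measurable A -> inX A -> is_interval A ->
 (forall x, A x -> c <= x < c + tau * m%:R) -> A = set0 \/ A c ->
 `|rsum1 A c m - \int[leb]_(x in A) f x| <= m%:R * (L * tau ^+ 2) + tau * M.
Proof.
elim: m A c => [|m IH] A c mA AX iA hA st.
 have A0 : A = set0.
  by rewrite -subset0 => x /hA /andP[h1 h2]; move: (le_lt_trans h1 h2); rewrite mulr0 addr0 ltxx.
 by rewrite A0 rsum1_empty // Rintegral_set0 subrr normr0 mul0r add0r.
have := tM; have := tL; have := mL m => mLm tL' tM'.
case: st => [A0|Ac].
 by rewrite A0 rsum1_empty // Rintegral_set0 subrr normr0 addr_ge0 // mulr_ge0.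
have [ml mu] := part_measurable (c + tau) mA.
rewrite rsum1S mem_set // (Rintegral_split (c + tau) mA AX).
rewrite rsum1_upper.
case: (pselect (uppart A (c + tau) = set0)) => U0.
 rewrite U0 rsum1_empty // Rintegral_set0 !addr0 stepS.
 apply: le_trans (first_cell ml _ _ _) _.
 - by move=> x []/AX.
 - by split => //=; rewrite ltrDl.
 - by move=> x [/hA/andP[-> _]] /=.
 - by rewrite lerD2r lerDr.
have [y [Ay /= hy]] : (uppart A (c + tau)) !=set0 by apply/set0P/eqP.
have sub x : c <= x -> x <= c + tau -> A x.
 by move=> h1 h2; apply: (iA c y Ac Ay); rewrite h1 (le_trans h2 hy).
have := IH (uppart A (c + tau)) (c + tau) mu (fun x h => AX x h.1) _ _ _.
move=> /(_ _ _ _) H.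
rewrite opprD addrACA stepS.
apply: le_trans (ler_normD _ _) _; rewrite -addrA addrA [_ + L * _]addrC -addrA lerD //.
 apply: full_cell => //; first by move=> x []/AX.
 move=> x; split => [[/hA/andP[-> _]] //|/andP[h1 h2]]; split => //; apply: sub => //; exact: ltW.
apply: H.
- exact: upper_interval.
- move=> x [/hA/andP[_ h] /= h']; rewrite h' /= (lt_le_trans h) // -natr1; lra.
- by right; split => /=; [apply: sub; rewrite ?lexx // lerDl ltW | ].
Qed.

(** The only further partial cell is the one in which the interval begins. *)
Lemma riemann1 m A c : measurable A -> inX A -> is_interval A ->
 (forall x, A x -> c <= x < c + tau * m%:R) ->
 `|rsum1 A c m - \int[leb]_(x in A) f x| <= m%:R * (L * tau ^+ 2) + 2 * (tau * M).
Proof.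
have tM' := tM; have tL' := tL; elim: m A c => [|m IH] A c mA AX iA hA.
 by apply: le_trans (riemann1_start mA AX iA hA _) _; [left; rewrite -subset0 => x /hA /andP[h1 h2]; move: (le_lt_trans h1 h2); rewrite mulr0 addr0 ltxx | lra].
have mL' := mL m; case: (pselect (A c)) => Ac.
 by apply: le_trans (riemann1_start mA AX iA hA (or_intror Ac)) _; lra.
have [ml mu] := part_measurable (c + tau) mA.
have iu := upper_interval (c := c + tau) iA.
have uX : inX (uppart A (c + tau)) by move=> x []/AX.
have lX : inX (lowpart A (c + tau)) by move=> x []/AX.
have hu x : uppart A (c + tau) x -> c + tau <= x < c + tau + tau * m%:R.
 by move=> [/hA/andP[_ h] /= h']; rewrite h' /= (lt_le_trans h) // -natr1; lra.
rewrite rsum1S memNset // mulr0 add0r (Rintegral_split (c + tau) mA AX).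
rewrite rsum1_upper.
case: (pselect (lowpart A (c + tau) = set0)) => L00.
 rewrite L00 Rintegral_set0 add0r stepS.
 by apply: le_trans (IH _ _ mu uX iu hu) _; lra.
have [y [Ay /= hy]] : (lowpart A (c + tau)) !=set0 by apply/set0P/eqP.
rewrite stepS opprD [- _ + - _]addrC addrA.
apply: le_trans (ler_normB _ _) _.
have h1 : `|\int[leb]_(x in lowpart A (c + tau)) f x| <= tau * M.
 by apply: (@Rintegral_cell _ c) => // x [/hA/andP[-> _]].
have h2 : `|rsum1 (uppart A (c + tau)) (c + tau) m - \int[leb]_(x in uppart A (c + tau)) f x|
  <= m%:R * (L * tau ^+ 2) + tau * M.
 apply: riemann1_start => //.
 case: (pselect (uppart A (c + tau) = set0)) => U0; [by left | right].
 have [z [Az /= hz]] : (uppart A (c + tau)) !=set0 by apply/set0P/eqP.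
 by split => //=; apply: (iA y z) => //; rewrite (ltW hy) hz.
by apply: le_trans (lerD h2 h1) _; lra.
Qed.

End Riemann1.

Lemma sum_ffunS (V : zmodType) n (T : finType) (F : {ffun 'I_n.+1 -> T} -> V) :
 \sum_p F p = \sum_(i : T) \sum_(p : {ffun 'I_n -> T}) F [ffun j => oapp p i (unlift ord0 j)].
Proof.
rewrite pair_big /=.
pose h (z : T * {ffun 'I_n -> T}) := [ffun j => oapp z.2 z.1 (unlift ord0 j)].
pose g (p : {ffun 'I_n.+1 -> T}) := (p ord0, [ffun j => p (lift ord0 j)]).
rewrite (reindex h) //; exists g => [[i p]|p] _; rewrite /g /h /=.
 rewrite ffunE unlift_none /=; congr pair; apply/ffunP => j.
 by rewrite !ffunE liftK.
apply/ffunP => j; rewrite ffunE; case: (unliftP ord0 j) => [k|] -> /=; by rewrite ?ffunE.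
Qed.

Definition lat n (c : 'I_n -> R) (tau : R) m (p : pts n m) : n.-tuple R :=
 [tuple c j + tau * (p j)%:R | j < n].

Definition inb n (J : 'I_n -> interval R) (t : n.-tuple R) := [forall j, tnth t j \in J j].
Lemma inbP n (J : 'I_n -> interval R) t : reflect (box J t) (inb J t).
Proof. by apply: (iffP forallP). Qed.
Lemma lat_cons n (c : 'I_n.+1 -> R) tau m (i : 'I_m) (p : pts n m) :
 lat c tau [ffun j => oapp p i (unlift ord0 j)] =
 tcons (c ord0 + tau * i%:R, lat (fun j => c (lift ord0 j)) tau p).
Proof.
apply: eq_from_tnth => j; rewrite tnth_mktuple ffunE.
by case: (unliftP ord0 j) => [k|] -> /=; [rewrite tnthS tnth_mktuple | rewrite tnth0].
Qed.

Lemma inb_tcons n (J : 'I_n.+1 -> interval R) x (t : n.-tuple R) :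
 inb J (tcons (x, t)) = (x \in J ord0) && inb (tbox J) t.
Proof. by apply/inbP/andP => [/box_tcons[? /inbP]|[? /inbP ?]]; [|apply/box_tcons]. Qed.
Definition lip_on n (X L : R) (f : n.-tuple R -> R) := forall t u, in_cube X t -> in_cube X u ->
 `|f t - f u| <= L * \sum_j `|tnth t j - tnth u j|.

(** Induction on the dimension. The inner integral [Phi] is bounded and Lipschitz in the first
    coordinate, so [riemann1] applies to it; replacing it by the inner Riemann sums adds the
    inductive error over at most [Y / tau] slices of thickness [tau]. *)
Lemma riemann n (X Y M L tau : R) m (c : 'I_n -> R) (J : 'I_n -> interval R) (f : n.-tuple R -> R) :
 0 <= X -> 1 <= Y -> 2 * X <= Y -> 0 < tau -> tau * m%:R <= Y -> 0 <= M -> 0 <= L ->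
 box_le X J -> (forall j x, x \in J j -> c j <= x < c j + tau * m%:R) ->
 measurable_fun setT f -> bounded_on (in_cube (n:=n) X) M f -> lip_on X L f ->
 `|tau ^+ n * \sum_(p : pts n m) (if inb J (lat c tau p) then f (lat c tau p) else 0)
  - \int[Lb n]_(t in box J) f t| <= n%:R * Y ^+ n * (Y * L + 2 * M) * tau.
Proof.
move=> X0 Y1 XY t0 tm M0 L0; have Y0 : 0 <= Y by exact: le_trans Y1.
elim: n c J f => [|n IH] c J f hJ hc mf bf lf.
 have t0E (t : 0.-tuple R) : t = [tuple] by exact: tuple0.
 have b0 t : inb J t by apply/forallP => -[].
 rewrite box0 expr0 mul1r !mul0r.
 rewrite (eq_bigr (fun=> f [tuple])); last by move=> p _; rewrite b0 (t0E (lat _ _ _)).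
 rewrite sumr_const card_ffun !card_ord expn0 mulr1n.
 rewrite /Rintegral integral_dirac //; last exact: measurable_EFin.
 by rewrite diracE mem_set // mul1e /= subrr normr0.
pose J' := tbox J; pose c' := fun j => c (lift ord0 j).
pose Phi x := \int[Lb n]_(t in box J') f (tcons (x, t)).
pose Sx x := tau ^+ n * \sum_(p : pts n m)
  (if inb J' (lat c' tau p) then f (tcons (x, lat c' tau p)) else 0).
have hJ' : box_le X J' by move=> j x; exact: hJ.
have cube x (t : n.-tuple R) : `|x| <= X -> in_cube X t -> in_cube X (tcons (x, t)).
 by move=> hx ht j; case: (unliftP ord0 j) => [k|] ->; [rewrite tnthS | rewrite tnth0].
have boxcube (t : n.-tuple R) : box J' t -> in_cube X t by move=> h j; exact: hJ' (h j).
have Xn0 : 0 <= (2 * X) ^+ n by rewrite exprn_ge0 // mulr_ge0.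
have XYn : (2 * X) ^+ n <= Y ^+ n by rewrite lerXn2r // nnegrE ?mulr_ge0.
have E : tau ^+ n.+1 * (\sum_(p : pts n.+1 m)
   (if inb J (lat c tau p) then f (lat c tau p) else 0)) =
  tau * \sum_(i < m) (if c ord0 + tau * i%:R \in [set` J ord0] then Sx (c ord0 + tau * i%:R) else 0).
 rewrite sum_ffunS exprS -mulrA; congr (_ * _); rewrite mulr_sumr; apply: eq_bigr => i _.
 have -> : (c ord0 + tau * i%:R \in [set` J ord0]) = (c ord0 + tau * i%:R \in J ord0).
  by apply/idP/idP => [/set_mem|/mem_set].
 rewrite /Sx; case: ifPn => hi; last first.
  by rewrite big1 ?mulr0 // => p _; rewrite lat_cons inb_tcons (negbTE hi).
 by congr (_ * _); apply: eq_bigr => p _; rewrite lat_cons inb_tcons hi.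
have IHx x : `|x| <= X -> `|Sx x - Phi x| <= n%:R * Y ^+ n * (Y * L + 2 * M) * tau.
 move=> hx; apply: (IH c' J' (fun t => f (tcons (x, t)))) => //.
 - by move=> j y; exact: hc.
 - exact: measurable_inner.
 - by move=> t ht; apply: bf; exact: cube.
 - move=> t u ht hu; apply: le_trans (lf _ _ (cube x t hx ht) (cube x u hx hu)) _.
  rewrite big_ord_recl !tnth0 subrr normr0 add0r; apply: ler_wpM2l => //.
  by apply: ler_sum => j _; rewrite !tnthS.
have mi x : measurable_fun setT (fun t : n.-tuple R => f (tcons (x, t))) by exact: measurable_inner.
have Phib x : `|x| <= X -> `|Phi x| <= (2 * X) ^+ n * M.
 move=> hx; apply: Rintegral_box_le => // t /boxcube ht.
 by apply: bf; exact: cube.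
have ib x : `|x| <= X -> (Lb n).-integrable (box J') (EFin \o (fun t => f (tcons (x, t)))).
 move=> hx; apply: (@integrable_box n X M) => // t /boxcube ht.
 by apply: bf; exact: cube.
have Phil x y : `|x| <= X -> `|y| <= X -> `|Phi x - Phi y| <= ((2 * X) ^+ n * L) * `|x - y|.
 move=> hx hy; rewrite /Phi -RintegralB; [|exact: measurable_box|exact: ib|exact: ib].
 rewrite -mulrA; apply: Rintegral_box_le => //; first by rewrite mulr_ge0.
  by apply: measurable_funB.
 move=> t /boxcube ht; apply: le_trans (lf _ _ (cube x t hx ht) (cube y t hy ht)) _.
 rewrite big_ord_recl !tnth0 big1 ?addr0 // => j _.
 by rewrite !tnthS subrr normr0.
rewrite E (Rintegral_boxS X0 hJ mf (K := M)); last by move=> t ht; apply: bf => j; exact: hJ (ht j).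
have := @riemann1 X ((2 * X) ^+ n * M) ((2 * X) ^+ n * L) tau Phi X0 (mulr_ge0 Xn0 M0) (mulr_ge0 Xn0 L0)
 t0 Phib Phil m [set` J ord0] (c ord0) (measurable_itv _) (fun x h => hJ ord0 x h)
 (@interval_is_interval _ _) (fun x h => hc ord0 x h).
rewrite /rsum1 => H1.
set A := tau * \sum_(i < m) _; set B := Rintegral _ _ _.
set D := tau * \sum_(i < m) (if c ord0 + tau * i%:R \in [set` J ord0] then Phi (c ord0 + tau * i%:R) else 0) in H1.
have H2 : `|A - D| <= Y * (n%:R * Y ^+ n * (Y * L + 2 * M) * tau).
 have E0 : 0 <= n%:R * Y ^+ n * (Y * L + 2 * M) * tau.
  by rewrite mulr_ge0 ?(ltW t0) // mulr_ge0 // ?addr_ge0 ?mulr_ge0 ?exprn_ge0.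
 rewrite /A /D -mulrBr -sumrB normrM gtr0_norm //.
 apply: le_trans (ler_wpM2l (ltW t0) (ler_norm_sum _ _ _)) _.
 apply: (@le_trans _ _ (tau * \sum_(i < m) (n%:R * Y ^+ n * (Y * L + 2 * M) * tau))).
  apply: ler_wpM2l; first exact: ltW.
  apply: ler_sum => i _; case: ifPn => hi; last by rewrite subrr normr0.
  by apply: IHx; apply: (hJ ord0); rewrite inE in hi.
 by rewrite sumr_const card_ord -[X in tau * X]mulr_natl mulrA ler_wpM2r.
have -> : A - B = (A - D) + (D - B) by rewrite addrA subrK.
apply: le_trans (ler_normD _ _) _; apply: le_trans (lerD H2 H1) _.
have Yn : Y ^+ n <= Y ^+ n.+1 by rewrite exprS ler_peMl // exprn_ge0.
have -> : n.+1%:R * Y ^+ n.+1 * (Y * L + 2 * M) * tau =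
 Y * (n%:R * Y ^+ n * (Y * L + 2 * M) * tau) + Y ^+ n.+1 * ((Y * L + 2 * M) * tau).
 by rewrite -natr1 exprS; ring.
rewrite lerD2l.
have -> : m%:R * ((2 * X) ^+ n * L * tau ^+ 2) + 2 * (tau * ((2 * X) ^+ n * M)) =
 (2 * X) ^+ n * (((tau * m%:R) * L + 2 * M) * tau) by ring.
apply: ler_pM => //.
- by rewrite !mulr_ge0 ?(ltW t0) // addr_ge0 ?mulr_ge0 ?(ltW t0).
- exact: le_trans XYn Yn.
- by apply: ler_wpM2r; [exact: ltW | rewrite lerD2r; apply: ler_wpM2r].
Qed.

End TupleIntegral.

(** * Iterated sums over lists of integers *)

Section IteratedSums.
Variable V : zmodType.

Definition icons n (x : int) (t : 'I_n -> int) : 'I_n.+1 -> int :=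
 fun j => oapp t x (unlift ord0 j).

(** With a list as range, sums over points can be permuted, filtered or split into residue classes
    one coordinate at a time. *)
Fixpoint nsum (X : seq int) n : (('I_n -> int) -> V) -> V :=
 match n with
 | 0 => fun u => u (fun=> 0)
 | k.+1 => fun u => \sum_(x <- X) nsum X (fun t => u (icons x t))
 end.

Lemma eq_nsum X n (u v : ('I_n -> int) -> V) : u =1 v -> nsum X u = nsum X v.
Proof. by move=> h; congr nsum; apply/funext. Qed.
Lemma nsum_ffun n m (phi : 'I_m -> int) (u : ('I_n -> int) -> V) :
 \sum_(p : pts n m) u (fun j => phi (p j)) = nsum [seq phi i | i <- enum 'I_m] u.
Proof.
elim: n u => [|n IH] u /=.
 rewrite (eq_bigr (fun=> u (fun=> 0))); last by move=> p _; congr u; apply/funext => -[].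
 by rewrite sumr_const card_ffun !card_ord expn0.
rewrite sum_ffunS big_map -big_enum /=; apply: eq_bigr => i _; rewrite -IH; apply: eq_bigr => p _.
congr u; apply/funext => j; rewrite /icons ffunE; by case: unliftP.
Qed.

Lemma nsum_perm X X' n (u : ('I_n -> int) -> V) : perm_eq X X' -> nsum X u = nsum X' u.
Proof.
move=> h; elim: n u => [|n IH] u //=.
by rewrite (perm_big _ h); apply: eq_bigr => x _; exact: IH.
Qed.

Lemma nsum0 X n : nsum X (fun _ : 'I_n -> int => 0) = 0 :> V.
Proof. by elim: n => [|n IH] //=; rewrite big1. Qed.
Lemma nsum_filter X (p : pred int) n (u : ('I_n -> int) -> V) :
 (forall x, u x != 0 -> forall j, p (x j)) -> nsum X u = nsum [seq x <- X | p x] u.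
Proof.
elim: n u => [|n IH] u h //=; rewrite big_filter [LHS](bigID p) /= [X in _ + X]big1 ?addr0.
 apply: eq_bigr => x px; apply: IH => t ht j.
 by have := h _ ht (lift ord0 j); rewrite /icons liftK.
move=> x px; rewrite -[RHS](nsum0 X n); apply: eq_nsum => t; apply/eqP/negPn/negP => /h /(_ ord0).
by rewrite /icons unlift_none /= (negbTE px).
Qed.

Lemma nsum_supp X X' n (u : ('I_n -> int) -> V) : uniq X -> uniq X' ->
 (forall x, u x != 0 -> forall j, (x j \in X) && (x j \in X')) -> nsum X u = nsum X' u.
Proof.
move=> uX uX' h.
rewrite (nsum_filter X (p := mem X')); last by move=> x /h hx j; case/andP: (hx j).
rewrite (nsum_filter X' (p := mem X)); last by move=> x /h hx j; case/andP: (hx j).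
apply: nsum_perm; apply: uniq_perm; rewrite ?filter_uniq // => x.
by rewrite !mem_filter /= andbC.
Qed.

Lemma nsum_sum (I : Type) (rr : seq I) X n (F : I -> ('I_n -> int) -> V) :
 \sum_(i <- rr) nsum X (F i) = nsum X (fun x => \sum_(i <- rr) F i x).
Proof.
elim: n F => [|n IH] F //=; rewrite exchange_big /=; apply: eq_bigr => x _; exact: IH.
Qed.

Lemma nsum_split X Y Z q n (u : ('I_n -> int) -> V) :
 perm_eq X [seq q * y + z | z <- Z, y <- Y] ->
 nsum X u = nsum Z (fun z => nsum Y (fun y => u (fun j => q * y j + z j))).
Proof.
move=> h; elim: n u => [|n IH] u /=.
 by congr u; apply/funext => -[].
rewrite (perm_big _ h) big_allpairs_dep /=; apply: eq_bigr => z _.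
rewrite (eq_bigr (fun y => nsum Z (fun z' => nsum Y (fun y' =>
  u (icons (q * y + z) (fun j => q * y' j + z' j)))))); last by move=> y _; exact: IH.
rewrite nsum_sum; apply: eq_nsum => z'; apply: eq_bigr => y _; apply: eq_nsum => y'.
congr u; apply/funext => j; rewrite /icons; by case: unliftP.
Qed.

Lemma sum_period (v : int -> V) M (c : int) : (forall k, v (k + M%:Z) = v k) ->
 \sum_(k < M) v (c + k%:Z) = \sum_(k < M) v k%:Z.
Proof.
have step (w : int -> V) : (forall k, w (k + M%:Z) = w k) ->
  \sum_(k < M) w (1 + k%:Z) = \sum_(k < M) w k%:Z.
 case: M => [|M] hw; first by rewrite !big_ord0.
 rewrite big_ord_recr big_ord_recl /= addrC; congr (_ + _).
  by rewrite -[RHS]hw; congr w; lia.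
have nat_case (n : nat) (w : int -> V) : (forall k, w (k + M%:Z) = w k) ->
  \sum_(k < M) w (n%:Z + k%:Z) = \sum_(k < M) w k%:Z.
 elim: n w => [|n IH] w hw; first by apply: eq_bigr => k _; rewrite add0r.
 rewrite -(IH w hw) -(step (fun k => w (n%:Z + k))); last by move=> k; rewrite addrA hw.
 by apply: eq_bigr => k _; congr w; lia.
move=> hv; have hvc d k : v (d + (k + M%:Z)) = v (d + k) by rewrite addrA hv.
case: (lerP 0 c) => c0.
 by case: c c0 => [k|k] // _; exact: (nat_case k v hv).
rewrite -[LHS](nat_case (absz c) (fun k => v (c + k))) //.
by apply: eq_bigr => k _; congr v; lia.
Qed.

Definition residues (M : nat) : seq int := [seq (nat_of_ord i)%:Z | i <- enum 'I_M].
Lemma nsum_period n (u : ('I_n -> int) -> V) M (c : 'I_n -> int) :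
 (forall x y : 'I_n -> int, (forall j, exists m : int, x j = y j + m * M%:Z) -> u x = u y) ->
 nsum (residues M) (fun k => u (fun j => c j + k j)) = nsum (residues M) u.
Proof.
elim: n u c => [|n IH] u c h /=; first by congr u; apply/funext => -[].
pose W (x : int) := nsum (residues M) (fun t => u (icons x t)).
have Wper k : W (k + M%:Z) = W k.
 apply: eq_nsum => t; apply: h => j; rewrite /icons; case: unliftP => [i|] _ /=.
  by exists 0; rewrite mul0r addr0.
 by exists 1; rewrite mul1r.
transitivity (\sum_(k < M) W (c ord0 + k%:Z)).
 rewrite big_map -big_enum /=; apply: eq_bigr => i _.
 rewrite /W -[RHS](IH _ (fun j => c (lift ord0 j))); last first.
  move=> x y hxy; apply: h => j; rewrite /icons; case: unliftP => [k|] _ /=; first by have [m ->] := hxy k; exists m; rewrite ?addrA.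
  by exists 0; rewrite mul0r addr0.
 apply: eq_nsum => t; congr u; apply/funext => j; rewrite /icons.
 by case: unliftP => [k|] ->.
by rewrite sum_period // big_map -big_enum.
Qed.

End IteratedSums.

(** * Oscillatory integrals of the forms over a box *)

Section Oscillatory.
Variables (R : realType) (n s : nat) (C : 'I_n -> 'M[int]_s).
Local Notation leb := (@lebesgue_measure R).
Local Notation Lb := (@tuple_lebesgue R).

Definition osc (g : 'I_n -> R) (t : s.-tuple R) : R := phase C g (tnth t).
Definition csize : R := \sum_i \sum_j \sum_k `|(C i j k)%:~R|.
Lemma csize_ge0 : 0 <= csize. Proof. by rewrite /csize; pos. Qed.
Lemma qf_bound i (x : 'I_s -> R) X : (forall j, `|x j| <= X) -> `|qf (C i) x| <= csize * X ^+ 2.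
Proof.
move=> hx.
apply: (@le_trans _ _ ((\sum_j \sum_k `|(C i j k)%:~R|) * X ^+ 2)); last first.
 apply: ler_wpM2r; first exact: sqr_ge0.
 by rewrite /csize [leRHS](bigD1 i) //= lerDl; pos.
apply: le_trans (ler_norm_sum _ _ _) _; rewrite mulr_suml; apply: ler_sum => j _.
apply: le_trans (ler_norm_sum _ _ _) _; rewrite mulr_suml; apply: ler_sum => k _.
by rewrite !normrM -mulrA expr2; apply: ler_wpM2l => //; apply: ler_pM.
Qed.

Lemma qf_lip i (x y : 'I_s -> R) X : 0 <= X -> (forall j, `|x j| <= X) -> (forall j, `|y j| <= X) ->
 `|qf (C i) x - qf (C i) y| <= 2 * csize * X * \sum_j `|x j - y j|.
Proof.
move=> X0 hx hy; set T := \sum_j `|x j - y j|.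
have hT j : `|x j - y j| <= T by rewrite /T (bigD1 j) //= lerDl; pos.
apply: (@le_trans _ _ ((\sum_j \sum_k `|(C i j k)%:~R|) * (2 * X * T))); last first.
 have -> : 2 * csize * X * T = csize * (2 * X * T) by ring.
 apply: ler_wpM2r; first by rewrite /T; pos.
 by rewrite /csize [leRHS](bigD1 i) //= lerDl; pos.
rewrite /qf -sumrB; apply: le_trans (ler_norm_sum _ _ _) _; rewrite mulr_suml; apply: ler_sum => j _.
rewrite -sumrB; apply: le_trans (ler_norm_sum _ _ _) _; rewrite mulr_suml; apply: ler_sum => k _.
have -> : (C i j k)%:~R * x j * x k - (C i j k)%:~R * y j * y k =
 (C i j k)%:~R * (x j * (x k - y k) + y k * (x j - y j)) :> R by ring.
rewrite normrM; apply: ler_wpM2l => //.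
apply: le_trans (ler_normD _ _) _; rewrite !normrM.
have -> : 2 * X * T = X * T + X * T by ring.
by apply: lerD; apply: ler_pM.
Qed.

Lemma osc_bound g t X : in_cube X t -> `|osc g t| <= csize * X ^+ 2 * \sum_i `|g i|.
Proof.
move=> ht; apply: le_trans (ler_norm_sum _ _ _) _; rewrite mulr_sumr; apply: ler_sum => i _.
by rewrite normrM mulrC; apply: ler_wpM2r => //; exact: qf_bound.
Qed.

Lemma osc_lip g t u X : 0 <= X -> in_cube X t -> in_cube X u ->
 `|osc g t - osc g u| <= 2 * csize * X * (\sum_i `|g i|) * \sum_j `|tnth t j - tnth u j|.
Proof.
move=> X0 ht hu; rewrite /osc /phase -sumrB; apply: le_trans (ler_norm_sum _ _ _) _.
rewrite mulrAC mulr_sumr; apply: ler_sum => i _; rewrite -mulrBr normrM.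
apply: le_trans (ler_wpM2l _ (qf_lip i X0 ht hu)) _ => //.
by apply: eqle; ring.
Qed.

Lemma measurable_osc g : measurable_fun setT (osc g).
Proof.
rewrite /osc /phase /qf; apply: measurable_sum => i; apply: measurable_funM => //.
apply: measurable_sum => j; apply: measurable_sum => k.
by apply: measurable_funM; [apply: measurable_funM => //|]; exact: measurable_tnth.
Qed.

Lemma measurable_osc_g t : measurable_fun setT (fun g : n.-tuple R => osc (tnth g) t).
Proof.
rewrite /osc /phase; apply: measurable_sum => i; apply: measurable_funM => //.
exact: measurable_tnth.
Qed.

Lemma cos_lip (x y : R) : `|cos x - cos y| <= `|x - y|.
Proof.
wlog xy : x y / x <= y.
 by move=> W; case: (leP x y) => [|/ltW] /W //; rewrite distrC [in X in _ <= X]distrC.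
case: (ltgtP x y) xy => // [xy _|-> _]; last by rewrite !subrr.
have [c _ e] := @MVT R cos (fun z => - sin z) x y xy (fun z _ => is_derive_cos z)
 (continuous_subspaceT (@continuous_cos R)).
rewrite distrC e normrM normrN [in leRHS]distrC ler_piMl //.
by rewrite ler_norml sin_geN1 sin_le1.
Qed.

Lemma sin_lip (x y : R) : `|sin x - sin y| <= `|x - y|.
Proof.
wlog xy : x y / x <= y.
 by move=> W; case: (leP x y) => [|/ltW] /W //; rewrite distrC [in X in _ <= X]distrC.
case: (ltgtP x y) xy => // [xy _|-> _]; last by rewrite !subrr.
have [c _ e] := @MVT R sin cos x y xy (fun z _ => is_derive_sin z)
 (continuous_subspaceT (@continuous_sin R)).
rewrite distrC e normrM [in leRHS]distrC ler_piMl //.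
by rewrite ler_norml cos_geN1 cos_le1.
Qed.

Section TrigIntegral.
Variables (J : 'I_s -> interval R) (h : R -> R).
Hypothesis hJ : box_le 1 J.
Hypothesis h_bd : forall x, `|h x| <= 1.
Hypothesis h_lip : forall x y, `|h x - h y| <= `|x - y|.
Hypothesis h_meas : measurable_fun setT h.

(** [h] stands for the cosine and for the sine, so that both parts of the complex integral are
    treated at once as real integrals. *)
Definition hosc (g : 'I_n -> R) (t : s.-tuple R) : R := h (2 * pi * osc g t).
Definition hint (g : 'I_n -> R) : R := \int[Lb s]_(t in box J) hosc g t.
Lemma pi2_ge0 : 0 <= 2 * pi :> R. Proof. by rewrite mulr_ge0 // pi_ge0. Qed.
Lemma measurable_hosc g : measurable_fun setT (hosc g).
Proof. by apply: (measurableT_comp h_meas); apply: measurable_funM => //; exact: measurable_osc. Qed.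
Lemma measurable_hosc_g t : measurable_fun setT (fun g : n.-tuple R => hosc (tnth g) t).
Proof. by apply: (measurableT_comp h_meas); apply: measurable_funM => //; exact: measurable_osc_g. Qed.
Lemma hosc_lip g : lip_on 1 (4 * pi * csize * \sum_i `|g i|) (hosc g).
Proof.
move=> t u ht hu; apply: le_trans (h_lip _ _) _; rewrite -mulrBr normrM (ger0_norm pi2_ge0).
apply: le_trans (ler_wpM2l pi2_ge0 (osc_lip g ler01 ht hu)) _.
by apply: eqle; ring.
Qed.

Lemma hint_le g : `|hint g| <= 2 ^+ s.
Proof.
have := @Rintegral_box_le R s 1 1 J (hosc g) ler01 ler01 hJ (measurable_hosc g) (fun t _ => h_bd _).
by rewrite !mulr1.
Qed.

Lemma hosc_int g : (Lb s).-integrable (box J) (EFin \o hosc g).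
Proof. by apply: (@integrable_box R s 1 1) => //; [exact: measurable_hosc | move=> t _; exact: h_bd]. Qed.
Lemma hint_lip g g' : `|hint g - hint g'| <= 2 ^+ s * (2 * pi * csize) * \sum_i `|g i - g' i|.
Proof.
rewrite /hint -RintegralB; [|exact: measurable_box|exact: hosc_int|exact: hosc_int].
have K0 : 0 <= 2 * pi * csize * \sum_i `|g i - g' i|.
 by rewrite mulr_ge0 ?(mulr_ge0 pi2_ge0 csize_ge0) //; pos.
rewrite -mulrA -[2 ^+ s](_ : (2 * 1) ^+ s = _); last by rewrite mulr1.
apply: Rintegral_box_le => //.
 by apply: measurable_funB; exact: measurable_hosc.
move=> t ht; apply: le_trans (h_lip _ _) _; rewrite -mulrBr normrM (ger0_norm pi2_ge0) -mulrA.
apply: ler_wpM2l; first exact: pi2_ge0.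
have -> : osc g t - osc g' t = osc (fun i => g i - g' i) t.
 by rewrite /osc /phase -sumrB; apply: eq_bigr => i _; rewrite mulrBl.
have := @osc_bound (fun i => g i - g' i) t 1 (fun j => hJ (ht j)).
by rewrite expr1n mulr1.
Qed.

(** The constant of [riemann] for [X = 1], [Y = 8] and [M = 1]; the length 8 accommodates the grids
    of all later applications. *)
Definition rcst : R := s%:R * 8 ^+ s * (32 * pi * csize + 2).
Lemma rcst_ge0 : 0 <= rcst.
Proof. by rewrite /rcst; pos; [exact: pi_ge0 | exact: csize_ge0]. Qed.
Lemma hint_riemann g tau m (c : 'I_s -> R) : 0 < tau -> tau * m%:R <= 8 ->
 (forall j x, x \in J j -> c j <= x < c j + tau * m%:R) ->
 `|tau ^+ s * (\sum_(p : pts s m) (if inb J (lat c tau p) then hosc g (lat c tau p) else 0))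
  - hint g| <= rcst * (1 + \sum_i `|g i|) * tau.
Proof.
move=> t0 tm hc; have G0 : 0 <= \sum_i `|g i| by pos.
have L0 : 0 <= 4 * pi * csize * \sum_i `|g i| by pos; [exact: pi_ge0 | exact: csize_ge0].
have c0 := csize_ge0; have p0 := pi_ge0 R.
have h14 : 1 <= 8 :> R by rewrite ler1n.
have h24 : 2 * 1 <= 8 :> R by rewrite mulr1 ler_nat.
apply: le_trans (@riemann R s 1 8 1 _ tau m c J (hosc g) ler01 h14 h24 t0 tm ler01 L0 hJ hc (measurable_hosc g)
 (fun t _ => h_bd _) (hosc_lip g)) _.
apply: ler_wpM2r; first exact: ltW.
rewrite /rcst -mulrA -[leRHS]mulrA -[leRHS]mulrA.
apply: ler_wpM2l => //; apply: ler_wpM2l; first by pos.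
have -> : (32 * pi * csize + 2) * (1 + \sum_i `|g i|) =
 8 * (4 * pi * csize * \sum_i `|g i|) + 2 * 1 + (32 * pi * csize + 2 * \sum_i `|g i|) by ring.
by rewrite lerDl; pos.
Qed.

(** Pointwise limit of Riemann sums, which are finite sums of functions measurable in [g]. *)
Lemma measurable_hint : measurable_fun setT (fun g : n.-tuple R => hint (tnth g)).
Proof.
pose a m (g : n.-tuple R) := m.+1%:R^-1 ^+ s * (\sum_(p : pts s (8 * m.+1))
 (if inb J (lat (fun=> -1) m.+1%:R^-1 p) then hosc (tnth g) (lat (fun=> -1) m.+1%:R^-1 p) else 0)).
apply: (@measurable_fun_cvg _ _ _ setT a) => [m|g _].
 apply: measurable_funM => //; apply: measurable_sum => p.
 by case: (inb J _) => //; exact: measurable_hosc_g.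
set K := rcst * (1 + \sum_i `|tnth g i|).
have bd m : `|a m g - hint (tnth g)| <= K * m.+1%:R^-1.
 have tm : m.+1%:R^-1 * (8 * m.+1)%:R = 8 :> R by rewrite natrM mulrCA mulVf ?mulr1 // pnatr_eq0.
 apply: hint_riemann; rewrite ?tm ?invr_gt0 // => j x /hJ; rewrite ler_norml => /andP[h1 h2].
 by rewrite h1 /=; apply: le_lt_trans h2 _; rewrite -subr_gt0; have -> : -1 + 8 - 1 = 6 :> R by ring.
have K0 : 0 < K + 1 by rewrite ltr_wpDl // /K mulr_ge0 ?rcst_ge0 // addr_ge0 //; pos.
apply/cvgrPdist_le => e e0; near=> m.
rewrite distrC; apply: le_trans (bd m) _.
apply: (@le_trans _ _ ((K + 1) * m.+1%:R^-1)); first by rewrite ler_wpM2r // ?invr_ge0 // lerDl.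
rewrite -ler_pdivlMl // mulrC.
near: m; apply: (cvgr_le 0); first exact: cvge_harmonic || exact: cvg_harmonic.
exact: divr_gt0.
Unshelve. all: by end_near. Qed.

End TrigIntegral.

Section ComplexIg.
Variable J : 'I_s -> interval R.
Hypothesis hJ : box_le 1 J.

Let cosb (x : R) : `|cos x| <= 1. Proof. by rewrite ler_norml cos_geN1 cos_le1. Qed.
Let sinb (x : R) : `|sin x| <= 1. Proof. by rewrite ler_norml sin_geN1 sin_le1. Qed.
Let cosm : measurable_fun setT (@cos R). Proof. exact: continuous_measurable_fun (@continuous_cos R). Qed.
Let sinm : measurable_fun setT (@sin R). Proof. exact: continuous_measurable_fun (@continuous_sin R). Qed.
Definition Ig (g : 'I_n -> R) : R[i] := (hint J cos g +i* hint J sin g)%C.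
Lemma Ig_le g : cabs (Ig g) <= 2 * 2 ^+ s.
Proof.
apply: le_trans (cabs_le _) _; rewrite mulr_natl mulr2n /Ig /=.
by apply: lerD; apply: hint_le.
Qed.

Lemma Ig_lip g g' : cabs (Ig g - Ig g') <= 2 * (2 ^+ s * (2 * pi * csize)) * \sum_i `|g i - g' i|.
Proof.
apply: le_trans (cabs_le _) _; rewrite -mulrA mulr_natl mulr2n /Ig /=.
by apply: lerD; apply: hint_lip => //; [exact: cos_lip | exact: sin_lip].
Qed.

Lemma Ig_riemann g tau m (c : 'I_s -> R) : 0 < tau -> tau * m%:R <= 8 ->
 (forall j x, x \in J j -> c j <= x < c j + tau * m%:R) ->
 cabs ((tau ^+ s)%:C%C * (\sum_(p : pts s m | inb J (lat c tau p)) expi2pi (osc g (lat c tau p)))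
  - Ig g) <= 2 * rcst * (1 + \sum_i `|g i|) * tau.
Proof.
move=> t0 tm hc.
have [hc1 hs1] := (hint_riemann hJ cosb cos_lip cosm g t0 tm hc, hint_riemann hJ sinb sin_lip sinm g t0 tm hc).
apply: le_trans (cabs_le _) _.
have -> : 2 * rcst * (1 + \sum_i `|g i|) * tau = rcst * (1 + \sum_i `|g i|) * tau +
  rcst * (1 + \sum_i `|g i|) * tau by ring.
rewrite !raddfB /= Re_realM Im_realM !raddf_sum /=.
apply: lerD; rewrite big_mkcond; [exact: hc1 | exact: hs1].
Qed.

Lemma measurable_IgRe : measurable_fun setT (fun g : n.-tuple R => Re (Ig (tnth g))).
Proof. exact: measurable_hint cosb cos_lip cosm. Qed.
Lemma measurable_IgIm : measurable_fun setT (fun g : n.-tuple R => Im (Ig (tnth g))).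
Proof. exact: measurable_hint sinb sin_lip sinm. Qed.

End ComplexIg.

End Oscillatory.

Lemma qf_intr (K : comNzRingType) s (C : 'M[int]_s) (x : 'I_s -> int) :
 qf C (fun j => (x j)%:~R : K) = (qf C x)%:~R.
Proof.
rewrite /qf rmorph_sum; apply: eq_bigr => j _; rewrite rmorph_sum; apply: eq_bigr => k _.
by rewrite !rmorphM /= intz.
Qed.

Lemma qfZ (K : comNzRingType) s (C : 'M[int]_s) (c : K) (x : 'I_s -> K) :
 qf C (fun j => c * x j) = c ^+ 2 * qf C x.
Proof.
rewrite /qf mulr_sumr; apply: eq_bigr => j _; rewrite mulr_sumr; apply: eq_bigr => k _; ring.
Qed.

Lemma qf_modq s (C : 'M[int]_s) (q : int) (x y : 'I_s -> int) :
 exists m : int, qf C (fun j => q * y j + x j) = qf C x + q * m.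
Proof.
exists (q * qf C y + \sum_j (\sum_k y k * (polar C k j)%:~R) * x j).
have -> : (fun j => q * y j + x j) = (fun j => x j + q * y j) by apply/funext => j; rewrite addrC.
rewrite qfD qfZ mulrDr addrA mulrA -expr2; congr (_ + _ + _).
rewrite mulr_sumr; apply: eq_bigr => j _; rewrite mulrA mulr_sumr; congr (_ * _).
by apply: eq_bigr => k _; rewrite mulrA.
Qed.

(** * The exponential sum near a rational point *)

Section MajorPoint.
Variables (R : realType) (n s : nat) (C : 'I_n -> 'M[int]_s).

Lemma iphase_modq (q : nat) (a : 'I_n -> int) (x y : 'I_s -> int) : (0 < q)%N ->
 expi2pi (iphase C (fun i => (a i)%:~R / q%:R) (fun j => q%:Z * y j + x j)) =
 expi2pi (iphase C (fun i => (a i)%:~R / q%:R) x) :> R[i].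
Proof.
move=> q0; have qn : q%:R != 0 :> R by rewrite pnatr_eq0 -lt0n.
have /choice[m hm] : forall i, exists m : int, qf (C i) (fun j => q%:Z * y j + x j) = qf (C i) x + q%:Z * m.
 by move=> i; exact: qf_modq.
have -> : iphase C (fun i => (a i)%:~R / q%:R) (fun j => q%:Z * y j + x j) =
 iphase C (fun i => (a i)%:~R / q%:R) x + (\sum_i a i * m i)%:~R :> R.
 rewrite /iphase /phase rmorph_sum -big_split /=; apply: eq_bigr => i _.
 rewrite qf_intr hm qf_intr rmorphD !rmorphM /= mulrDr; congr (_ + _).
 rewrite -pmulrn; field. exact: qn.
exact: e2piDint.
Qed.

Variable J : 'I_s -> interval R.
Hypothesis hJ : box_le 1 J.

Definition Dbox (P : R) : 'I_s -> pred int := fun j x => (x%:~R / P) \in J j.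
Lemma good_Dbox P : 1 <= P -> (forall j, convex_int (Dbox P j)) /\
 (forall j x, Dbox P j x -> `|x| <= (truncn P)%:Z).
Proof.
move=> P1; have P0 := lt_le_trans ltr01 P1.
split=> j.
 move=> a b c /andP[ab bc] ha hc.
 have := @interval_is_interval _ (J j) _ _ ha hc (b%:~R / P); apply.
 by rewrite !ler_pM2r ?invr_gt0 // !ler_int ab.
move=> x /hJ; rewrite normrM normfV (gtr0_norm P0) ler_pdivrMr // mul1r => h.
have : (absz x)%:R <= P by rewrite natr_absz intr_norm.
by rewrite -truncn_ge_nat ?(ltW P0) // => h'; rewrite -lez_nat abszE in h'.
Qed.

Lemma box_sum_nsum N (D : 'I_s -> pred int) (u : ('I_s -> int) -> R[i]) :
 box_sum N D u = nsum [seq (nat_of_ord i)%:Z - N%:Z | i <- enum 'I_(2 * N).+1]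
   (fun x => if inbox D x then u x else 0).
Proof.
rewrite /box_sum big_mkcond /=.
by rewrite -(nsum_ffun (fun i : 'I_(2 * N).+1 => (nat_of_ord i)%:Z - N%:Z)).
Qed.

Lemma gauss_nsum q (u : ('I_s -> int) -> R[i]) :
 box_sum q (gauss_box q) u = nsum [seq (nat_of_ord i).+1%:Z | i <- enum 'I_q] u.
Proof.
rewrite box_sum_nsum.
have e : nsum [seq (nat_of_ord i).+1%:Z | i <- enum 'I_q] u =
 nsum [seq (nat_of_ord i).+1%:Z | i <- enum 'I_q] (fun x => if inbox (gauss_box q) x then u x else 0).
 rewrite -(nsum_ffun (fun i : 'I_q => (nat_of_ord i).+1%:Z)) -(nsum_ffun (fun i : 'I_q => (nat_of_ord i).+1%:Z)).
 apply: eq_bigr => p _; rewrite ifT //; apply/forallP => j; rewrite /gauss_box.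
 by have := ltn_ord (p j); move: (p j : nat) => k; lia.
rewrite e; apply: nsum_supp.
- by rewrite map_inj_uniq ?enum_uniq // => i j h; apply/val_inj => /=; lia.
- by rewrite map_inj_uniq ?enum_uniq // => i j h; apply/val_inj => /=; lia.
move=> x; case: ifP; rewrite ?eqxx // => /forallP hx _ j.
have := hx j; rewrite /gauss_box; move: (x j) => y /andP[y1 y2]; apply/andP; split; apply/mapP.
 have h : (absz (y + q%:Z)%R < (2 * q).+1)%N by lia.
 by exists (Ordinal h); rewrite ?mem_enum //=; lia.
have h : (absz (y - 1)%R < q)%N by lia.
by exists (Ordinal h); rewrite ?mem_enum //=; lia.
Qed.

Lemma residue_range q N : (0 < q)%N -> let h := (N %/ q).+2 in
 let RY := [seq q%:Z * y + z | z <- [seq (nat_of_ord i).+1%:Z | i <- enum 'I_q],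
        y <- [seq (nat_of_ord i)%:Z - h%:Z | i <- enum 'I_(2 * h)]] in
 uniq RY /\ forall x : int, `|x| <= N%:Z -> x \in RY.
Proof.
move=> q0 h RY; split.
 apply: allpairs_uniq.
 - by rewrite map_inj_uniq ?enum_uniq // => i j e; apply/val_inj => /=; lia.
 - by rewrite map_inj_uniq ?enum_uniq // => i j e; apply/val_inj => /=; lia.
 move=> [z y] [z' y'] /allpairsP[[a b] /= [/mapP[i _ ->] _ [-> ->]]] /allpairsP[[a' b'] /= [/mapP[i' _ ->] _ [-> ->]]].
 have := ltn_ord i; have := ltn_ord i'; move: (i : nat) (i' : nat) => k k' hk hk' e.
 have eb : b = b' by nia.
 by rewrite eb in e *; congr pair; lia.
move=> x hx; apply/allpairsP.
have hN : (N < h * q)%N by rewrite /h -ltn_divLR.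
have qz : q%:Z != 0 by lia.
have e1 := divz_eq (x - 1) q%:Z.
have m0 := modz_ge0 (x - 1) qz; have m1 := ltz_pmod (x - 1) (d := q%:Z) (ltac:(lia)).
set y := ((x - 1) %/ q%:Z)%Z in e1; set z := ((x - 1) %% q%:Z)%Z in e1 m0 m1.
have hz : (absz z < q)%N by lia.
have hhq : (h * q)%:Z = h%:Z * q%:Z by rewrite PoszM.
have yl : - h%:Z <= y by nia.
have yu : y < h%:Z by nia.
have hy : (absz (y + h%:Z)%R < 2 * h)%N by lia.
exists (z + 1, y); split => /=.
- by apply/mapP; exists (Ordinal hz); rewrite ?mem_enum //=; lia.
- by apply/mapP; exists (Ordinal hy); rewrite ?mem_enum //=; lia.
- lia.
Qed.

(** On a class [x = q * y + z] the phase at [a / q] depends on [z] only, and the sum over [y] is a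
    Riemann sum of step [q / P] for the oscillatory integral, the same for every class up to the
    error. Summation over [z] produces the Gauss sum. *)
Lemma major_point P q (a : 'I_n -> int) (be : 'I_n -> R) :
 1 <= P -> (0 < q)%N -> (q <= truncn P)%N ->
 cabs (box_sum (truncn P) (Dbox P) (fun x => expi2pi (iphase C (fun i => (a i)%:~R / q%:R + be i) x))
   - ((P / q%:R) ^+ s)%:C%C *
    box_sum q (gauss_box q) (fun x => expi2pi (iphase C (fun i => (a i)%:~R / q%:R) x)) *
    Ig C J (fun i => P ^+ 2 * be i))
  <= 2 * rcst R C * (1 + P ^+ 2 * \sum_i `|be i|) * (q%:R * P ^+ s / P).
Proof.
move=> P1 q0 qN; have P0 := lt_le_trans ltr01 P1.
have qr0 : 0 < q%:R :> R by rewrite ltr0n.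
have [_ DN] := good_Dbox P1.
set N := truncn P in qN DN *.
have NP : N%:R <= P by rewrite /N truncn_le ltW.
have [uRY memRY] := residue_range N q0.
(* The quotients [y] run from [-h] to [h - 1]; the two extra steps make room for the residues
   [1, ..., q] and the ends of the box. *)
set h := (N %/ q).+2 in uRY memRY.
set Z := [seq (nat_of_ord i).+1%:Z | i <- enum 'I_q] in uRY memRY.
set Y := [seq (nat_of_ord i)%:Z - h%:Z | i <- enum 'I_(2 * h)] in uRY memRY.
pose tau : R := q%:R / P.
pose eA x : R[i] := expi2pi (iphase C (fun i => (a i)%:~R / q%:R) x).
pose c (z : 'I_s -> int) j : R := ((z j)%:~R - q%:R * h%:R) / P.
pose g i : R := P ^+ 2 * be i.
have t0 : 0 < tau by exact: divr_gt0.
have hhN : (q * h <= N + q + q)%N by rewrite /h !mulnS mulnC; have := leq_trunc_div N q; lia.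
(* As [q * h <= N + 2 * q <= 3 * N], the grid has length at most 6, within what [Ig_riemann]
   allows. *)
have tm : tau * (2 * h)%:R <= 8.
 rewrite /tau mulrAC -natrM ler_pdivrMr //.
 apply: (@le_trans _ _ (8 * N%:R)); last by rewrite ler_wpM2l.
 by rewrite -natrM ler_nat; lia.
have latE z (p : pts s (2 * h)) j : tnth (lat (c z) tau p) j =
  (q%:Z * ((p j)%:Z - h%:Z) + z j)%:~R / P.
 rewrite tnth_mktuple /c /tau rmorphD rmorphM rmorphB /= -!pmulrn; field.
 exact: lt0r_neq0.
have zq (z : pts s q) j x : x \in J j -> c (fun j => (z j).+1%:Z) j <= x < c (fun j => (z j).+1%:Z) j + tau * (2 * h)%:R.
 move=> /hJ; rewrite ler_norml => /andP[h1 h2].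
 have Pq : P <= q%:R * h%:R - q%:R.
  have : P < (q * h - q)%:R; last by rewrite natrB ?natrM ?leq_pmulr // => /ltW.
  apply: lt_le_trans (truncnS_gt P) _; rewrite ler_nat -/N.
  have : (N < (N %/ q).+1 * q)%N by rewrite -ltn_divLR.
  by rewrite /h mulSn !mulnS [(_ %/ _ * q)%N]mulnC; move: (q * _)%N => w; clear; lia.
 have z1 : 1 <= (z j).+1%:R :> R by rewrite ler1n.
 have z2 : (z j).+1%:R <= q%:R :> R by rewrite ler_nat ltn_ord.
 rewrite /c /tau -!pmulrn; apply/andP; split.
  by apply: le_trans h1; rewrite ler_pdivrMr // mulN1r; lra.
 apply: le_lt_trans h2 _.
 have -> : ((z j).+1%:R - q%:R * h%:R) / P + q%:R / P * (2 * h)%:R = ((z j).+1%:R + q%:R * h%:R) / P :> R.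
  by rewrite natrM; field; rewrite lt0r_neq0.
 by rewrite ltr_pdivlMr // mul1r; lra.
have -> : box_sum N (Dbox P) (fun x => expi2pi (iphase C (fun i => (a i)%:~R / q%:R + be i) x)) =
 \sum_(z : pts s q) eA (fun j => (z j).+1%:Z) *
  \sum_(p : pts s (2 * h) | inb J (lat (c (fun j => (z j).+1%:Z)) tau p))
    expi2pi (osc C g (lat (c (fun j => (z j).+1%:Z)) tau p)).
 rewrite box_sum_nsum (@nsum_supp _ _ [seq q%:Z * y + z | z <- Z, y <- Y]) //; last 2 first.
 - by rewrite map_inj_uniq ?enum_uniq // => i j e; apply/val_inj => /=; lia.
 - move=> x; case: ifP => [/forallP hx _ j|]; last by rewrite eqxx.
  have xN := DN j _ (hx j); rewrite memRY // andbT; apply/mapP.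
  have hy : (absz (x j + N%:Z)%R < (2 * N).+1)%N by lia.
  by exists (Ordinal hy); rewrite ?mem_enum //=; lia.
 rewrite (nsum_split _ (perm_refl _)) -(nsum_ffun (fun i : 'I_q => (nat_of_ord i).+1%:Z)); apply: eq_bigr => z _.
 rewrite -(nsum_ffun (fun i : 'I_(2 * h) => (nat_of_ord i)%:Z - h%:Z)) mulr_sumr [RHS]big_mkcond; apply: eq_bigr => p _.
 set zz := fun j => (z j).+1%:Z; set x := fun j => _ + _.
 have xE j : tnth (lat (c zz) tau p) j = (x j)%:~R / P by rewrite latE.
 have -> : inb J (lat (c zz) tau p) = inbox (Dbox P) x.
  by apply: eq_forallb => j; rewrite xE.
 case: ifP => // _; rewrite /eA -(iphase_modq a zz (fun j => (p j)%:Z - h%:Z) q0) -/x -e2piD; congr expi2pi.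
 rewrite /osc /iphase /phase -big_split; apply: eq_bigr => i _ /=; rewrite mulrDl; congr (_ + _).
 have -> : tnth (lat (c zz) tau p) = fun j => P^-1 * (x j)%:~R by apply/funext => j; rewrite xE mulrC.
 by rewrite qfZ /g; field; rewrite lt0r_neq0.
rewrite gauss_nsum -(nsum_ffun (fun i : 'I_q => (nat_of_ord i).+1%:Z) (fun x => expi2pi (iphase C (fun i => (a i)%:~R / q%:R) x))).
rewrite mulr_sumr mulr_suml -sumrB; apply: le_trans (cabs_sum _ _ _) _.
have G1 : \sum_i `|g i| = P ^+ 2 * \sum_i `|be i|.
 rewrite mulr_sumr; apply: eq_bigr => i _; rewrite /g normrM ger0_norm //; exact: sqr_ge0.
apply: (@le_trans _ _ (\sum_(z : pts s q) (P / q%:R) ^+ s * (2 * rcst R C * (1 + \sum_i `|g i|) * tau))).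
 apply: ler_sum => z _; rewrite -/(eA _).
 set A := eA _; set S := \sum_(p | _) _.
 have H := @Ig_riemann R n s C J hJ g tau (2 * h) _ t0 tm (zq z); rewrite -/S in H.
 have -> : A * S - ((P / q%:R) ^+ s)%:C%C * A * Ig C J g =
   A * (((P / q%:R) ^+ s)%:C%C * ((tau ^+ s)%:C%C * S - Ig C J g)).
  have uv : ((P / q%:R) ^+ s)%:C%C * (tau ^+ s)%:C%C = 1 :> R[i].
   rewrite -rmorphM /= -exprMn.
   have -> : P / q%:R * tau = 1 by rewrite /tau; field; rewrite lt0r_neq0 //= lt0r_neq0.
   by rewrite expr1n.
  rewrite mulrBr [_ * (_ * S)]mulrA uv mul1r; set u := (_ ^+ s)%:C%C; ring.
 rewrite cabsM cabs_e mul1r cabsM cabs_real ger0_norm; last by pos.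
 by apply: ler_wpM2l => //; pos.
rewrite sumr_const card_ffun !card_ord -[leLHS]mulr_natl natrX G1 /tau.
apply: eqle; rewrite expr_div_n; field.
by rewrite expf_neq0 lt0r_neq0 //= lt0r_neq0.
Qed.

End MajorPoint.

(** * Decay of the oscillatory integral *)

Section Decay.
Variables (R : realType) (r s : nat) (C : 'I_r.+1 -> 'M[int]_s).
Hypothesis hrank : rank_cond C.
Variable J : 'I_s -> interval R.
Hypothesis hJ : box_le 1 J.

Lemma Ig_point N (be : 'I_r.+1 -> R) : (0 < N)%N ->
 cabs (Ig C J (fun i => N%:R ^+ 2 * be i)) <=
  cabs (esum C N (Dbox J N%:R) be) / N%:R ^+ s +
  2 * rcst R C * (1 + N%:R ^+ 2 * \sum_i `|be i|) / N%:R.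
Proof.
move=> N0; have Nr : 0 < N%:R :> R by rewrite ltr0n.
have N1 : 1 <= N%:R :> R by rewrite ler1n.
have tN : truncn (N%:R : R) = N by exact: natrK.
have := @major_point R r.+1 s C J hJ N%:R 1 (fun=> 0) be N1 isT; rewrite tN => /(_ N0).
have -> : box_sum 1 (gauss_box 1) (fun x => expi2pi (iphase C (fun i => 0%:~R / 1%:R) x)) = 1 :> R[i].
 rewrite gauss_nsum -(nsum_ffun (fun i : 'I_1 => (nat_of_ord i).+1%:Z)
  (fun x => expi2pi (iphase C (fun i => 0%:~R / 1%:R) x))).
 rewrite (eq_bigr (fun=> 1)).
  by rewrite sumr_const card_ffun !card_ord exp1n.
 move=> p _; rewrite /iphase /phase big1 ?e2pi0 // => i _; by rewrite mul0r mul0r.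
rewrite mulr1 !divr1 mul1r.
have -> : box_sum N (Dbox J N%:R) (fun x => expi2pi (iphase C (fun i => 0%:~R + be i) x)) =
 esum C N (Dbox J N%:R) be.
 rewrite /esum; congr box_sum; apply/funext => x; congr (expi2pi (iphase _ _ _)).
 by apply/funext => i; rewrite add0r.
set A := esum _ _ _ _; set I0 := Ig _ _ _ => H.
have Ns : 0 < N%:R ^+ s :> R by rewrite exprn_gt0.
have : cabs ((N%:R ^+ s)%:C%C * I0) <= cabs A + 2 * rcst R C * (1 + N%:R ^+ 2 * \sum_i `|be i|) * (N%:R ^+ s / N%:R).
 have -> : (N%:R ^+ s)%:C%C * I0 = A - (A - (N%:R ^+ s)%:C%C * I0) by ring.
 by apply: le_trans (cabsB _ _) _; rewrite lerD2l.
rewrite cabsM cabs_real ger0_norm ?(ltW Ns) // => H2.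
rewrite -(ler_pM2l Ns); apply: le_trans H2 _; apply: eqle.
by field; rewrite (lt0r_neq0 Nr) (lt0r_neq0 Ns).
Qed.

(** The integral is compared with an exponential sum of length [N], about [G ^ (n+2)] with
    [n = r.+1], at the frequencies [g / N ^ 2]; so long a sum makes the error of the comparison
    harmless. At the height with [K * H ^ n = G / (2n)] these frequencies are not major: the
    numerators would vanish, and every [|g i|] would be at most [G / (2n)], against their sum
    [G]. *)
Lemma Ig_decay : exists K : R, 1 <= K /\ forall g : 'I_r.+1 -> R,
 cabs (Ig C J g) <= K / (1 + \sum_i `|g i|) ^+ r.+2.
Proof.
have [K [K1 HK]] := weyl_sqrt R hrank.
pose n := r.+1%:R : R.
have n1 : 1 <= n by rewrite /n ler1n.
have n0 := lt_le_trans ltr01 n1.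
have K0 := lt_le_trans ltr01 K1.
(* Since [N <= 2 * G ^+ r.+3], the logarithms cost at most a constant times the power [1 / (2n)] of
   [G], which is what [sqrt H] gains. *)
pose a : R := (2 * n * (r.+3)%:R)^-1.
have a0 : 0 < a by rewrite /a invr_gt0; pos.
have [L [L1 HL]] := Hn_pw s a0.
have L0 := lt_le_trans ltr01 L1.
pose G0 := 2 * n * K.
have G01 : 2 <= G0 by rewrite /G0 -mulrA ler_peMr // -[1]mulr1 ler_pM.
pose c1 := K * L * 2 `^ a * G0 `^ ((2 * n)^-1) * G0 ^+ r.+2.
pose c2 := 4 * rcst R C.
have c10 : 0 <= c1 by rewrite /c1; pos; exact: le_trans G01.
have rc0 := rcst_ge0 R C.
have c20 : 0 <= c2 by rewrite /c2; pos.
have big : forall g : 'I_r.+1 -> R, G0 <= \sum_i `|g i| -> cabs (Ig C J g) <= (c1 + c2) / (\sum_i `|g i|) ^+ r.+2.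
 move=> g; set G := \sum_i `|g i| => hG.
 have G2 : 2 <= G by exact: le_trans hG.
 have Gp : 0 < G by exact: lt_le_trans G2.
 have G1 : 1 <= G by apply: le_trans G2; rewrite ler1n.
 pose N := (truncn (G ^+ r.+3)).+1.
 have NG : G ^+ r.+3 <= N%:R by apply: ltW; exact: truncnS_gt.
 have Gk k : 1 <= G ^+ k by exact: exprn_ege1.
 have NG2 : N%:R <= 2 * G ^+ r.+3.
  rewrite /N -natr1 mulr_natl mulr2n lerD // truncn_le; exact: le_trans (Gk _).
 have N0 : (0 < N)%N by [].
 have Nr : 0 < N%:R :> R by rewrite ltr0n.
 pose X := G / G0.
 have G0p : 0 < G0 by exact: lt_le_trans G01.
 have X1 : 1 <= X by rewrite /X ler_pdivlMr // mul1r.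
 have X0 := lt_le_trans ltr01 X1.
 pose H := X `^ n^-1.
 have H1 : 1 <= H by apply: pw_ge1 => //; rewrite invr_ge0 ltW.
 have H0 := lt_le_trans ltr01 H1.
 have HX : H ^+ r.+1 = X by rewrite pw_nat ?(ltW H0) // /H -powRrM mulVf ?powRr1 ?(ltW X0) // lt0r_neq0.
 have GN : G <= N%:R by apply: le_trans NG; rewrite exprS ler_peMr ?(ltW Gp) //.
 have XG : X <= G by rewrite /X ler_pdivrMr // ler_peMr ?(ltW Gp) // (le_trans _ G01) // ler1n.
 have HN : H <= N%:R.
  apply: le_trans (le_trans XG GN); rewrite -HX exprS ler_peMr ?(ltW H0) // exprn_ege1 //.
 have N1r : 1 <= N%:R :> R by rewrite ler1n.
 have [DN1 DN2] := good_Dbox hJ N1r.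
 have tN : truncn (N%:R : R) = N by exact: natrK.
 rewrite tN in DN2.
 pose be i := g i / N%:R ^+ 2.
 have gbe : g = fun i => N%:R ^+ 2 * be i.
  by apply/funext => i; rewrite /be mulrC divfK // expf_neq0 // lt0r_neq0.
 have Gbe : N%:R ^+ 2 * \sum_i `|be i| = G.
  rewrite mulr_sumr; apply: eq_bigr => i _; rewrite /be normrM normfV (ger0_norm (sqr_ge0 _)).
  by rewrite mulrC divfK // expf_neq0 // lt0r_neq0.
 rewrite {1}gbe; apply: le_trans (Ig_point be N0) _; rewrite Gbe [leRHS]mulrDl; apply: lerD.
  have KHn : K * H ^+ r.+1 = G / (2 * n) by rewrite HX /X /G0; field; rewrite !lt0r_neq0.
  case: (HK be N H _ N0 (conj DN1 DN2) H1 HN)  => [h|[q [z [q0 [hq hz]]]]].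
   have Ns : 0 < N%:R ^+ s :> R by rewrite exprn_gt0.
   rewrite ler_pdivrMr //; apply: le_trans h _.
   rewrite exprM HX (pw_sqrt (ltW H0)) /H -powRrM.
   have hS : Num.sqrt (Hn R N ^+ s) <= L * (2 `^ a * G `^ ((2 * n)^-1)).
    apply: le_trans (HL _ N0) _; apply: ler_wpM2l; first exact: ltW.
    have -> : G `^ (2 * n)^-1 = (G ^+ r.+3) `^ a.
     rewrite pw_nat ?(ltW Gp) // -powRrM; congr (_ `^ _); rewrite /a; field.
     by rewrite lt0r_neq0 //= pnatr_eq0.
    rewrite -powRM ?exprn_ge0 ?(ltW Gp) //.
    by apply: ge0_ler_powR; rewrite ?nnegrE ?(ltW a0) ?(ltW Nr) //; pos.
   have GX : G = G0 * X by rewrite /X mulrC divfK // lt0r_neq0.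
   have eX : n^-1 * 2^-1 = (2 * n)^-1 by rewrite invfM mulrC.
   have GXp : G `^ ((2 * n)^-1) = G0 `^ ((2 * n)^-1) * X `^ ((2 * n)^-1) by rewrite {1}GX powRM // ltW.
   rewrite GXp in hS; rewrite eX.
   have XE : X = G / G0 by [].
   set Y := X `^ _ in hS *; have Y0 : 0 < Y by exact: pw_gt0.
   have Xr : 0 < X ^+ r.+2 by rewrite exprn_gt0.
   rewrite ler_pdivrMr; last exact: mulr_gt0.
   have -> : c1 / G ^+ r.+2 * N%:R ^+ s * (X ^+ r.+2 * Y) = K * N%:R ^+ s * (L * (2 `^ a * (G0 `^ (2 * n)^-1 * Y))).
    rewrite /c1 XE expr_div_n; field.
    by rewrite !expf_neq0 ?lt0r_neq0.
   by apply: ler_wpM2l => //; pos.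
  have N2 : 0 < N%:R ^+ 2 :> R by rewrite exprn_gt0.
  have qr1 : 1 <= q%:R :> R by rewrite ler1n.
  have gq i : q%:R * be i = q%:R * g i / N%:R ^+ 2 by rewrite /be mulrA.
  have gG i : `|g i| <= G by rewrite /G (bigD1 i) //= lerDl; pos.
  have KHG : K * H ^+ r.+1 <= G / 2.
   by rewrite KHn; apply: ler_wpM2l; [exact: ltW | rewrite lef_pV2 ?posrE ?mulr_gt0 // ler_peMr].
  (* The frequencies and the errors are both small because [N ^ 2] exceeds [G ^ 2]. *)
  have z0 i : z i = 0.
   apply: (@int_norm_lt1 R).
   have -> : (z i)%:~R = q%:R * be i - (q%:R * be i - (z i)%:~R) by ring.
   apply: le_lt_trans (ler_normB _ _) _.
   apply: (@le_lt_trans _ _ ((G / 2) * G / N%:R ^+ 2 + (G / 2) / N%:R ^+ 2)).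
    apply: lerD; last by apply: le_trans (hz i) _; apply: ler_wpM2r; rewrite ?invr_ge0 ?(ltW N2).
    rewrite gq normrM normfV (gtr0_norm N2) normrM ger0_norm //.
    apply: ler_wpM2r; rewrite ?invr_ge0 ?(ltW N2) //; apply: ler_pM => //.
    exact: le_trans hq KHG.
   rewrite -mulrDl ltr_pdivrMr // mul1r.
   apply: (@le_lt_trans _ _ (G ^+ 2)); first by rewrite expr2; nra.
   rewrite ltrXn2r // ?nnegrE ?(ltW Gp) ?(ltW Nr) //.
   apply: lt_le_trans NG; rewrite exprS ltr_pMr // (lt_le_trans _ (_ : G <= _)) //.
    by apply: lt_le_trans G2; rewrite ltr1n.
   by rewrite exprS ler_peMr ?(ltW Gp).
  have gi i : `|g i| <= G / (2 * n).
   have := hz i; rewrite z0 subr0 gq normrM normfV (gtr0_norm N2) ler_pM2r ?invr_gt0 // KHn.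
   rewrite normrM (ger0_norm (ler0n _ _)); apply: le_trans.
   by rewrite ler_peMl.
  have : G <= G / 2.
   apply: le_trans (ler_sum _ (fun i _ => gi i)) _; rewrite sumr_const card_ord -[leLHS]mulr_natl -/n.
   by apply: eqle; field; rewrite lt0r_neq0.
  by rewrite leNgt ltr_pdivrMr // ltr_pMr // ltr1n.
 rewrite ler_pdivrMr //.
 apply: (@le_trans _ _ (2 * rcst R C * (2 * G))).
  apply: ler_wpM2l; first by pos.
  by rewrite mulr_natl mulr2n lerD2r.
 have -> : 2 * rcst R C * (2 * G) = c2 / G ^+ r.+2 * G ^+ r.+3.
  by rewrite /c2 [G ^+ r.+3]exprS; field; rewrite expf_neq0 // lt0r_neq0.
 by apply: ler_wpM2l => //; pos.
pose B : R := 2 * 2 ^+ s.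
exists (1 + (c1 + c2) * 2 ^+ r.+2 + B * (1 + G0) ^+ r.+2).
have B0 : 0 <= B by rewrite /B; pos.
have G0p : 0 <= G0 by exact: le_trans G01.
split; first by rewrite -addrA lerDl; pos.
move=> g; set G := \sum_i `|g i|.
have Gp : 0 <= G by rewrite /G; pos.
have den : 0 < (1 + G) ^+ r.+2 by pos.
rewrite ler_pdivlMr //; case: (lerP G0 G) => hG.
 have G1 : 1 <= G by apply: le_trans hG; apply: le_trans G01; rewrite ler1n.
 have Gpp := lt_le_trans ltr01 G1.
 apply: (@le_trans _ _ ((c1 + c2) / G ^+ r.+2 * (2 * G) ^+ r.+2)).
  apply: ler_pM; [by pos | by pos | exact: big |].
  by apply: lerXn2r; rewrite ?nnegrE; [by pos | by pos | rewrite mulr_natl mulr2n lerD2r].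
 have -> : (c1 + c2) / G ^+ r.+2 * (2 * G) ^+ r.+2 = (c1 + c2) * 2 ^+ r.+2.
  by rewrite exprMn; field; rewrite expf_neq0 // lt0r_neq0.
 rewrite [1 + _]addrC -addrA lerDl; pos.
apply: (@le_trans _ _ (B * (1 + G0) ^+ r.+2)).
 apply: ler_pM; [by pos | by pos | exact: Ig_le |].
 by apply: lerXn2r; rewrite ?nnegrE; [by pos | by pos | rewrite lerD2l ltW].
by rewrite lerDr; pos.
Qed.

End Decay.

(** * Integrability and tails from polynomial decay *)

Section Tail.
Variables (R : realType) (n : nat).
Local Notation leb := (@lebesgue_measure R).
Local Notation Lb := (@tuple_lebesgue R).

Definition cube (X : R) : 'I_n -> interval R := fun=> `[- X, X].
Lemma cubeP X (t : n.-tuple R) : box (cube X) t <-> in_cube X t.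
Proof. by split=> h j; have := h j; rewrite /= in_itv /= ler_norml. Qed.
Lemma box_le_cube X : box_le X (cube X).
Proof. by move=> j x; rewrite in_itv /= ler_norml. Qed.

Variables (K : R) (f : n.-tuple R -> R).
Hypothesis K0 : 0 <= K.
Hypothesis mf : measurable_fun setT f.
Hypothesis fK : forall g, `|f g| <= K / (1 + \sum_i `|tnth g i|) ^+ n.+1.

Let absf (g : n.-tuple R) : R := `|f g|.
Let mabs : measurable_fun setT absf.
Proof. exact: measurableT_comp. Qed.
Lemma shell_le X (S : set (n.-tuple R)) : 0 < X -> measurable S ->
 (forall g, S g -> in_cube (2 * X) g /\ ~ in_cube X g) ->
 (\int[Lb n]_(g in S) (absf g)%:E <= (K * 4 ^+ n / X)%:E)%E.
Proof.
move=> X0 mS hS; have mB := measurable_box (cube (2 * X)).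
have SB : S `<=` box (cube (2 * X)) by move=> g /hS[h _]; apply/cubeP.
have bd g : S g -> `|f g| <= K / X ^+ n.+1.
 move=> /hS[_ h]; apply: le_trans (fK g) _; apply: ler_wpM2l => //.
 have [j hj] : exists j, X < `|tnth g j|.
  by apply/not_existsP => h'; apply: h => j; rewrite leNgt; apply/negP.
 have hX : X <= 1 + \sum_i `|tnth g i|.
  by apply: le_trans (ltW hj) _; rewrite (bigD1 j) //= addrCA lerDl; pos.
 have s0 : 0 < 1 + \sum_i `|tnth g i| by exact: lt_le_trans hX.
 rewrite lef_pV2 ?posrE ?exprn_gt0 //; apply: lerXn2r => //; rewrite nnegrE ?(ltW X0) ?(ltW s0) //.
have mu_le : (Lb n S <= ((4 * X) ^+ n)%:E)%E.
 apply: (@le_trans _ _ (Lb n (box (cube (2 * X))))).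
  by apply: le_measure; rewrite ?inE.
 have X20 : 0 <= 2 * X by rewrite mulr_ge0 // ltW.
 have := @Lb_box_le R n (2 * X) (cube (2 * X)) X20 (@box_le_cube _).
 by rewrite mulrA -natrM.
have KX : 0 <= K / X ^+ n.+1 by rewrite divr_ge0 // exprn_ge0 // ltW.
apply: (@le_trans _ _ (\int[Lb n]_(g in S) `|(f g)%:E|)%E); first exact: lexx.
apply: le_trans (_ : ((K / X ^+ n.+1)%:E * Lb n S <= _)%E).
 apply: integral_le_bound => //.
 - apply: measurable_funTS; exact: measurable_EFin.
 - by apply: aeW => g Sg; rewrite lee_fin; exact: bd.
apply: le_trans (lee_wpmul2l _ mu_le) _; first by rewrite lee_fin.
rewrite -EFinM lee_fin; apply: eqle.
by rewrite exprMn exprS; field; rewrite expf_neq0 lt0r_neq0.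
Qed.

Let outside X : set (n.-tuple R) := ~` box (cube X).
Let shell X k : set (n.-tuple R) := box (cube (X * 2 ^+ k.+1)) `\` box (cube (X * 2 ^+ k)).
Lemma outside_shells X : 0 < X -> outside X = \bigcup_k shell X k.
Proof.
move=> X0; have mono k l : (k <= l)%N -> X * 2 ^+ k <= X * 2 ^+ l.
 by move=> kl; apply: ler_wpM2l; [exact: ltW | rewrite ler_eXn2l // ltr1n].
apply/seteqP; split => [g hg|g [k _ [_ h]]]; last first.
 by move/cubeP => hc; apply: h; apply/cubeP => j; apply: le_trans (hc j) _; have := mono 0%N k isT; rewrite expr0 mulr1.
pose Z := \sum_i `|tnth g i|.
have Z0 : 0 <= Z by rewrite /Z; pos.
pose N := truncn (Z / X).
have ex : exists k, `[< in_cube (X * 2 ^+ k) g >].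
 exists N.+1; apply/asboolP => j; apply: (@le_trans _ _ Z).
  by rewrite /Z (bigD1 j) //= lerDl; pos.
 have : Z / X <= 2 ^+ N.+1.
  apply: le_trans (ltW (truncnS_gt _)) _; rewrite -natrX ler_nat; exact: ltnW (ltn_expl _ _).
 by rewrite ler_pdivrMr // mulrC.
case: (ex_minnP ex) => k /asboolP hk hmin.
case: k hk hmin => [|k] hk hmin.
 by exfalso; apply: hg; apply/cubeP; rewrite expr0 mulr1 in hk.
exists k => //; split; first by apply/cubeP.
by move/cubeP/asboolP/hmin; rewrite ltnn.
Qed.

(** The complement of a cube is cut into shells whose radii double. At radius [Y] the volume is of
    order [Y ^ n] and the integrand of order [Y ^ -(n+1)], so the shells form a geometric series. *)
Lemma tail_le X : 0 < X -> (\int[Lb n]_(g in outside X) (absf g)%:E <= (2 * K * 4 ^+ n / X)%:E)%E.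
Proof.
move=> X0; rewrite (outside_shells X0).
have mS k : measurable (shell X k) by apply: measurableD; exact: measurable_box.
have Xk k : 0 < X * 2 ^+ k by rewrite mulr_gt0 // exprn_gt0.
rewrite ge0_integral_bigcup //; last 3 first.
- by apply: measurable_funTS; apply: measurable_EFin.
- by move=> g _; rewrite lee_fin normr_ge0.
- apply/trivIsetP => i j _ _; wlog ij : i j / (i < j)%N.
  move=> W; rewrite neq_ltn => /orP[ij|ij]; first by apply: W => //; rewrite ltn_eqF.
  by rewrite setIC; apply: W => //; rewrite ltn_eqF.
 move=> _; rewrite -subset0 => g [[/cubeP h1 _] [_ h2]]; apply: h2; apply/cubeP => k.
 apply: le_trans (h1 k) _; apply: ler_wpM2l; [exact: ltW | by rewrite ler_eXn2l // ltr1n].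
apply: le_trans (_ : \sum_(k <oo) ((2 * K * 4 ^+ n / X) / (2 ^ k.+1)%:R)%:E <= _)%E; last first.
 by apply: epsilon_trick0; rewrite divr_ge0 ?(ltW X0) //; pos.
apply: lee_nneseries => [k _ _|k _].
 by apply: integral_ge0 => g _; rewrite lee_fin normr_ge0.
apply: le_trans (shell_le (Xk k) (mS k) _) _.
 move=> g [/cubeP h1 h2]; split; first by rewrite mulrCA -exprS.
 by move/cubeP.
rewrite lee_fin natrX exprS; apply: eqle; field.
by rewrite expf_neq0 ?pnatr_eq0 // lt0r_neq0.
Qed.

Lemma decay_integrable : (Lb n).-integrable setT (EFin \o f).
Proof.
apply/integrableP; split; first exact: measurable_EFin.
have mB := measurable_box (cube 1).
rewrite -(setUv (box (cube 1))) ge0_integral_setU //; last 2 first.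
- by rewrite setUv; apply: measurable_EFin.
- by apply/disj_setPS => g [].
have H1 : ((Lb n).-integrable (box (cube 1)) (EFin \o f)).
 apply: (@integrable_box R n 1 K) => //; first exact: box_le_cube.
 move=> g _; apply: le_trans (fK g) _; rewrite ler_pdivrMr ?ler_peMr //.
  by rewrite exprn_ege1 // lerDl; pos.
 by rewrite exprn_gt0 // ltr_pwDl //; pos.
apply: lte_add_pinfty; first by case/integrableP: H1.
 by apply: le_lt_trans (tail_le ltr01) _; rewrite ltry.
by apply: measurableC.
Qed.

Lemma Rintegral_compl (D : set (n.-tuple R)) (B : \bar R) : measurable D ->
 (\int[Lb n]_(g in ~` D) (absf g)%:E <= B)%E -> B \is a fin_num ->
 `|\int[Lb n]_(g in setT) f g - \int[Lb n]_(g in D) f g| <= fine B.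
Proof.
move=> mD hB Bfin; have fi := decay_integrable.
have mC : measurable (~` D) by exact: measurableC.
have e : \int[Lb n]_(g in setT) f g = \int[Lb n]_(g in D) f g + \int[Lb n]_(g in ~` D) f g.
 rewrite -[in LHS](setUv D) Rintegral_setU //.
  by rewrite setUv.
 by apply/disj_setPS => g [].
rewrite e addrAC subrr add0r.
have fo : (Lb n).-integrable (~` D) (EFin \o f) by apply: integrableS fi.
apply: le_trans (le_normr_Rintegral mC fo) _.
have fin : (\int[Lb n]_(g in ~` D) (absf g)%:E)%E \is a fin_num.
 rewrite ge0_fin_numE; last by apply: integral_ge0 => g _; rewrite lee_fin normr_ge0.
 by apply: le_lt_trans hB _; rewrite ltey_eq Bfin.
by rewrite /Rintegral -lee_fin !fineK.
Qed.

Lemma tail_approx (D : set (n.-tuple R)) X : 0 < X -> measurable D -> box (cube X) `<=` D ->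
 `|\int[Lb n]_(g in setT) f g - \int[Lb n]_(g in D) f g| <= 2 * K * 4 ^+ n / X.
Proof.
move=> X0 mD hD; apply: (@Rintegral_compl D (2 * K * 4 ^+ n / X)%:E) => //.
apply: le_trans (tail_le X0); apply: ge0_subset_integral.
- exact: measurableC.
- by apply: measurableC; exact: measurable_box.
- by apply: measurable_funTS; apply: measurable_EFin.
- by move=> g _; rewrite lee_fin normr_ge0.
- exact: subsetC.
Qed.

Lemma tail_bounded : exists B : R, 0 <= B /\ forall D : set (n.-tuple R), measurable D ->
 `|\int[Lb n]_(g in setT) f g - \int[Lb n]_(g in D) f g| <= B.
Proof.
have /integrableP[_ hfin] := decay_integrable.
pose B := (\int[Lb n]_(g in setT) `|(EFin \o f) g|)%E.
have B0 : (0 <= B)%E by apply: integral_ge0 => g _; exact: abse_ge0.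
have Bfin : B \is a fin_num by rewrite ge0_fin_numE.
exists (fine B); split; first by rewrite -lee_fin fineK.
move=> D mD; apply: (@Rintegral_compl D B) => //.
apply: ge0_subset_integral => //.
- exact: measurableC.
- by apply: measurable_EFin.
- by move=> g _; rewrite lee_fin normr_ge0.
Qed.

End Tail.

(** * The singular integral and its Riemann sums *)

Section SingularIntegral.
Variables (R : realType) (r s : nat) (C : 'I_r.+1 -> 'M[int]_s).
Hypothesis hrank : rank_cond C.
Variable J : 'I_s -> interval R.
Hypothesis hJ : box_le 1 J.
Local Notation n := r.+1.
Local Notation Lb := (@tuple_lebesgue R).

Let IRe (g : n.-tuple R) := Re (Ig C J (tnth g)).
Let IIm (g : n.-tuple R) := Im (Ig C J (tnth g)).
Lemma IRe_decay : exists K : R, [/\ 0 <= K,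
 (forall g, `|IRe g| <= K / (1 + \sum_i `|tnth g i|) ^+ n.+1) &
 (forall g, `|IIm g| <= K / (1 + \sum_i `|tnth g i|) ^+ n.+1)].
Proof.
have [K [K1 HK]] := Ig_decay hrank hJ.
exists K; split; [by apply: le_trans K1| |] => g; apply: le_trans (HK (tnth g)); [exact: cabs_Re | exact: cabs_Im].
Qed.

Let mRe : measurable_fun setT IRe. Proof. exact: measurable_IgRe. Qed.
Let mIm : measurable_fun setT IIm. Proof. exact: measurable_IgIm. Qed.
Lemma IRe_integrable : (Lb n).-integrable setT (EFin \o IRe).
Proof. have [K [K0 h _]] := IRe_decay; exact: decay_integrable K0 mRe h. Qed.
Lemma IIm_integrable : (Lb n).-integrable setT (EFin \o IIm).
Proof. have [K [K0 _ h]] := IRe_decay; exact: decay_integrable K0 mIm h. Qed.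
Definition sintegral : R[i] := ((\int[Lb n]_(g in setT) IRe g) +i* (\int[Lb n]_(g in setT) IIm g))%C.
Definition sintegral_box (J' : 'I_n -> interval R) : R[i] :=
 ((\int[Lb n]_(g in box J') IRe g) +i* (\int[Lb n]_(g in box J') IIm g))%C.
Definition sintegral_cube (X : R) : R[i] := sintegral_box (cube X).
Lemma sintegral_tail : exists K : R, 1 <= K /\ forall X J', 0 < X -> box (cube (n:=n) X) `<=` box J' ->
 cabs (sintegral - sintegral_box J') <= K / X.
Proof.
have [K [K0 h1 h2]] := IRe_decay.
exists (1 + 4 * K * 4 ^+ n); split; first by rewrite lerDl; pos.
move=> X J' X0 hJ'; apply: le_trans (cabs_le _) _; rewrite /sintegral /sintegral_box /=.
have mB := measurable_box J'.
apply: le_trans (lerD (tail_approx K0 mRe h1 X0 mB hJ') (tail_approx K0 mIm h2 X0 mB hJ')) _.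
rewrite -mulrDl ler_pM2r ?invr_gt0 //.
have -> : 2 * K * 4 ^+ n + 2 * K * 4 ^+ n = 4 * K * 4 ^+ n by ring.
by rewrite lerDr.
Qed.

Lemma sintegral_bounded : exists K : R, 0 <= K /\ forall J', cabs (sintegral - sintegral_box J') <= K.
Proof.
have [K [K0 h1 h2]] := IRe_decay.
have [B1 [B10 H1]] := tail_bounded K0 mRe h1; have [B2 [B20 H2]] := tail_bounded K0 mIm h2.
exists (B1 + B2); split; first exact: addr_ge0.
move=> J'; apply: le_trans (cabs_le _) _; rewrite /sintegral /sintegral_box /=.
have mB := measurable_box J'; apply: lerD; [exact: H1 | exact: H2].
Qed.

Definition box_riemann (K : R) (J' : 'I_n -> interval R) := forall X tau m Y (c : 'I_n -> R),
 0 <= X -> 0 < tau -> 2 * X <= Y -> 1 <= Y -> tau * m%:R <= Y -> box_le X J' ->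
 (forall j x, x \in J' j -> c j <= x < c j + tau * m%:R) ->
 cabs ((tau ^+ n)%:C%C * (\sum_(p : pts n m | inb J' (lat c tau p))
       Ig C J (tnth (lat c tau p))) - sintegral_box J')
  <= K * Y ^+ n.+1 * tau.

Lemma sintegral_riemann_box : exists K : R, 0 <= K /\ forall J', box_riemann K J'.
Proof.
pose M : R := 2 * 2 ^+ s; pose L : R := 2 * (2 ^+ s * (2 * pi * csize R C)).
have M0 : 0 <= M by rewrite /M; pos.
have L0 : 0 <= L by rewrite /L; pos; [exact: pi_ge0 | exact: csize_ge0].
exists (2 * (n%:R * (L + 2 * M))); split; first by pos.
move=> J' X tau m Y c X0 t0 XY Y1 tY hJ' hc.
have Y0 : 0 <= Y by exact: le_trans Y1.
have fb (h : n.-tuple R -> R) : (forall g, `|h g| <= cabs (Ig C J (tnth g))) -> bounded_on (in_cube X) M h.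
 by move=> hh t _; apply: le_trans (hh t) _; exact: Ig_le.
have bRe := fb IRe (fun g => cabs_Re _); have bIm := fb IIm (fun g => cabs_Im _).
have lRe : lip_on X L IRe.
 move=> t u _ _; rewrite /IRe -raddfB; apply: le_trans (cabs_Re _) _; exact: Ig_lip.
have lIm : lip_on X L IIm.
 move=> t u _ _; rewrite /IIm -raddfB; apply: le_trans (cabs_Im _) _; exact: Ig_lip.
have HR := @riemann R n X Y M L tau m c J' IRe X0 Y1 XY t0 tY M0 L0 hJ' hc mRe bRe lRe.
have HI := @riemann R n X Y M L tau m c J' IIm X0 Y1 XY t0 tY M0 L0 hJ' hc mIm bIm lIm.
have bnd : n%:R * Y ^+ n * (Y * L + 2 * M) * tau <= n%:R * (L + 2 * M) * Y ^+ n.+1 * tau.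
 apply: ler_wpM2r; first exact: ltW.
 have -> : n%:R * (L + 2 * M) * Y ^+ n.+1 = n%:R * Y ^+ n * (Y * L + Y * (2 * M)) by rewrite exprS; ring.
 apply: ler_wpM2l; first by pos.
 by rewrite lerD2l ler_peMl //; pos.
apply: le_trans (cabs_le _) _.
rewrite !raddfB /= Re_realM Im_realM !raddf_sum /=.
have -> : 2 * (n%:R * (L + 2 * M)) * Y ^+ n.+1 * tau =
 n%:R * (L + 2 * M) * Y ^+ n.+1 * tau + n%:R * (L + 2 * M) * Y ^+ n.+1 * tau by ring.
by rewrite -!big_mkcond in HR HI; apply: lerD; [exact: le_trans HR bnd | exact: le_trans HI bnd].
Qed.

(** The grid is indexed by the centred integers [p i - m], in the same way as the fractions of a
    translated major arc. *)
Definition cube_riemann (K : R) := forall X tau m Y, 0 <= X -> 0 < tau -> X < tau * m%:R ->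
 2 * X <= Y -> 1 <= Y -> tau * (2 * m)%:R <= Y ->
 cabs ((tau ^+ n)%:C%C * (\sum_(p : pts n (2 * m) |
      [forall i, `|tau * ((p i)%:Z - m%:Z)%:~R| <= X])
       Ig C J (fun i => tau * ((p i)%:Z - m%:Z)%:~R)) - sintegral_cube X)
  <= K * Y ^+ n.+1 * tau.

Lemma sintegral_riemann : exists K : R, 0 <= K /\ cube_riemann K.
Proof.
have [K [K0 HK]] := sintegral_riemann_box; exists K; split => // X tau m Y X0 t0 Xm XY Y1 tY.
pose c : 'I_n -> R := fun=> - (tau * m%:R).
have hc (j : 'I_n) x : x \in cube X j -> c j <= x < c j + tau * (2 * m)%:R.
 rewrite in_itv /= /c natrM => /andP[h1 h2]; apply/andP; split.
  by apply: le_trans h1; rewrite lerN2 ltW.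
 by apply: le_lt_trans h2 _; move: Xm; set u := tau * m%:R; rewrite (_ : tau * (2 * m%:R) = u + u); [lra | rewrite /u; ring].
have latE (p : pts n (2 * m)) i : tnth (lat c tau p) i = tau * ((p i)%:Z - m%:Z)%:~R.
 by rewrite tnth_mktuple /c rmorphB /= -!pmulrn; ring.
have E : \sum_(p : pts n (2 * m) | inb (cube X) (lat c tau p)) Ig C J (tnth (lat c tau p)) =
 \sum_(p : pts n (2 * m) | [forall i, `|tau * ((p i)%:Z - m%:Z)%:~R| <= X])
       Ig C J (fun i => tau * ((p i)%:Z - m%:Z)%:~R).
 apply: eq_big => p; first by apply: eq_forallb => i; rewrite latE in_itv /= ler_norml.
 by move=> _; congr (Ig C J _); apply/funext => i; rewrite latE.
rewrite -E; exact: (HK (cube X) X tau (2 * m)%N Y c X0 t0 XY Y1 tY (@box_le_cube _ _ X) hc).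
Qed.

End SingularIntegral.

(** * Limits with rates and tails of the zeta series *)

Section ComplexLimits.
Variable R : realType.

Lemma real_cauchy (u : nat -> R) (b : nat -> R) :
 (forall m k, (k <= m)%N -> `|u m - u k| <= b k) -> (forall e, 0 < e -> exists k, b k < e) ->
 exists l : R, (u @ \oo --> l).
Proof.
move=> hu hb; exists (lim (u @ \oo)).
apply/cauchy_cvgP; apply: cauchy_exP => e e0.
have [k hk] := hb e e0; exists (u k).
exists k => // m /= km; rewrite /ball /= distrC.
exact: le_lt_trans (hu m k km) hk.
Qed.

Lemma complex_cauchy (u : nat -> R[i]^o) (b : nat -> R) :
 (forall m k, (k <= m)%N -> cabs (u m - u k) <= b k) -> (forall e, 0 < e -> exists k, b k < e) ->
 exists l : R[i]^o, (u @ \oo --> l) /\ forall k, cabs (l - u k) <= b k.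
Proof.
move=> hu hb.
have [x hx] : exists x : R, (fun m => Re (u m)) @ \oo --> x.
 apply: (real_cauchy (b := b)) => // m k km; rewrite -raddfB.
 exact: le_trans (cabs_Re _) (hu m k km).
have [y hy] : exists y : R, (fun m => Im (u m)) @ \oo --> y.
 apply: (real_cauchy (b := b)) => // m k km; rewrite -raddfB.
 exact: le_trans (cabs_Im _) (hu m k km).
have near e : 0 < e -> \forall m \near \oo, cabs ((x +i* y)%C - u m) < e.
 move=> e0; have e2 : 0 < e / 2 by rewrite divr_gt0.
 have /cvgrPdist_lt/(_ _ e2) h1 := hx; have /cvgrPdist_lt/(_ _ e2) h2 := hy.
 near=> m; apply: le_lt_trans (cabs_le _) _.
 rewrite [e]splitr; apply: ltrD; [near: m; move: h1 | near: m; move: h2];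
  by apply: filterS => m; case: (u m).
exists (x +i* y)%C; split.
 apply/cvgrPdist_lt => e e0.
 have er : e = (Re e)%:C%C.
  by case: e e0 => a c; rewrite ltcE /= => /andP[/eqP -> _].
 have e1 : 0 < Re e by move: e0; rewrite er ltcR.
 by apply: filterS (near _ e1) => m h; rewrite cabsE er ltcR.
move=> k; apply/ler_addgt0Pr => e e0.
have [m [km hm]] : exists m, (k <= m)%N /\ cabs ((x +i* y)%C - u m) < e.
 have [M _ hM] := near e e0; exists (maxn k M); split; first exact: leq_maxl.
 by apply: hM => /=; exact: leq_maxr.
have -> : (x +i* y)%C - u k = ((x +i* y)%C - u m) + (u m - u k) by rewrite addrA subrK.
by apply: le_trans (cabsD _ _) _; rewrite addrC lerD ?hu // ltW.
Unshelve. all: by end_near. Qed.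

(** A telescoping comparison with an integral. It amounts to [1 + d / q <= (q / (q - 1)) ^ d], which
    follows from [ln (1 - 1 / q) <= - 1 / q]. *)
Lemma zeta_step (d : R) q : 0 < d -> (1 < q)%N ->
 q%:R `^ (- (1 + d)) <= d^-1 * (q.-1%:R `^ (- d) - q%:R `^ (- d)).
Proof.
move=> d0 q1; have q0 : 0 < q%:R :> R by rewrite ltr0n; lia.
have p0 : 0 < q.-1%:R :> R by rewrite ltr0n; lia.
have qp : q%:R = q.-1%:R + 1 :> R by rewrite natr1 prednK //; lia.
pose x : R := q%:R / q.-1%:R.
have x0 : 0 < x by rewrite divr_gt0.
have -> : q.-1%:R `^ (- d) = q%:R `^ (- d) * x `^ d.
 rewrite /x powRM ?invr_ge0 ?(ltW q0) ?(ltW p0) // !pwN // mulrA mulVf ?mul1r; last by rewrite lt0r_neq0 // pw_gt0.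
 apply: (mulfI (lt0r_neq0 (pw_gt0 d p0))).
 by rewrite mulfV ?lt0r_neq0 ?pw_gt0 // -powRM ?invr_ge0 ?(ltW p0) // mulfV ?powR1 // lt0r_neq0.
have hx : 1 + d / q%:R <= x `^ d.
 rewrite /powR gt_eqF //; apply: le_trans (expR_ge1Dx _); rewrite lerD2l; apply: ler_wpM2l; first exact: ltW.
 have -> : x = (1 + - q%:R^-1)^-1.
  have -> : 1 + - q%:R^-1 = q.-1%:R / q%:R :> R.
   by rewrite (_ : q.-1%:R = q%:R - 1) ?mulrBl ?mulfV ?mul1r ?(lt0r_neq0 q0) // qp addrK.
  by rewrite invf_div.
 have h1 : -1 < - q%:R^-1 :> R by rewrite ltrN2 invf_lt1 // ltr1n.
 have h2 : 0 < 1 + - q%:R^-1 :> R by rewrite -[ltLHS](subrr 1) ltrD2l.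
 by rewrite lnV ?posrE // lerNr; exact: le_ln1Dx.
rewrite opprD pwD // (pwN 1 q0) powRr1 ?(ltW q0) // [leLHS]mulrC.
have y0 : 0 < q%:R `^ (- d) by exact: pw_gt0.
have -> : d^-1 * (q%:R `^ (- d) * x `^ d - q%:R `^ (- d)) = q%:R `^ (- d) * (d^-1 * (x `^ d - 1)) by ring.
rewrite ler_pM2l //.
by rewrite ler_pdivlMl // lerBrDl.
Qed.

Lemma zeta_tail (d : R) (k m : nat) : 0 < d -> (0 < k)%N -> (k <= m)%N ->
 \sum_(k.+1 <= q < m.+1) q%:R `^ (- (1 + d)) <= d^-1 * k%:R `^ (- d).
Proof.
move=> d0 k0 km.
apply: (@le_trans _ _ (d^-1 * (k%:R `^ (- d) - m%:R `^ (- d)))); last first.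
 by rewrite ler_pM2l ?invr_gt0 // gerBl powR_ge0.
elim: m km => [|m IH]; first by rewrite leqn0 => /eqP k00; rewrite k00 in k0.
rewrite leq_eqVlt => /orP[/eqP ->|km]; first by rewrite big_geq // subrr mulr0.
rewrite big_nat_recr //=; apply: le_trans (lerD (IH km) (@zeta_step d m.+1 d0 _)) _; first by lia.
by rewrite -mulrDr /= addrA subrK.
Qed.

Lemma zeta_sum (d : R) (m : nat) : 0 < d ->
 \sum_(1 <= q < m.+1) q%:R `^ (- (1 + d)) <= 1 + d^-1.
Proof.
move=> d0; case: m => [|m]; first by rewrite big_geq // addr_ge0 // invr_ge0 ltW.
rewrite big_ltn // powR1 lerD2l; apply: le_trans (zeta_tail d0 (k := 1) _ _) _ => //.
by rewrite powR1 mulr1.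
Qed.

End ComplexLimits.

(** * Absolute convergence of the singular series *)

Section SingularSeries.
Variables (R : realType) (r s : nat) (C : 'I_r.+1 -> 'M[int]_s).
Hypothesis hrank : rank_cond C.
Local Notation n := r.+1.

Definition cop q (a : 'I_n -> 'I_q) : bool := gcdn (\big[gcdn/0]_(i < n) (a i).+1)%N q == 1%N.
Lemma copP q (a : 'I_n -> 'I_q) : (0 < q)%N -> reflect (coprime_tuple q (fun i => (a i).+1%:Z)) (cop a).
Proof.
move=> q0; apply: (iffP eqP) => [h d dq da|h].
 have : (d %| 1)%N; last by rewrite dvdn1 => /eqP.
 rewrite -h dvdn_gcd dq andbT; apply/dvdn_biggcdP => i _; exact: da.
apply: h; first exact: dvdn_gcdr.
move=> i; apply: dvdn_trans (dvdn_gcdl _ _) _; by apply: (@biggcdn_inf _ i).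
Qed.

Definition gsum q (a : pts n q) : R[i] :=
 esum C q (gauss_box q) (fun i => (a i).+1%:R / q%:R).

Definition Aq q : R[i] := \sum_(a : pts n q | cop a) (q%:R ^- s) * gsum a.

Local Notation d0 := (delta0 R r).

Lemma gsum_bound : exists K : R, 1 <= K /\ forall q (a : pts n q), (0 < q)%N -> cop a ->
 cabs (q%:R ^- s * gsum a) <= K * q%:R `^ (- (r.+2%:R + d0)).
Proof.
have [K [K1 HK]] := gauss_bound R hrank; exists K; split=> // q a q0 ha.
have /(copP _ q0) hc := ha.
have := HK q _ q0 hc; rewrite /= => H.
have qs : 0 < q%:R ^+ s :> R by rewrite exprn_gt0 // ltr0n.
rewrite cabsM cabsV cabsX cabs_nat mulrC ler_pdivrMr //.
apply: le_trans H _; by rewrite le_eqVlt mulrAC eqxx.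
Qed.

(** There are at most [q ^ n] numerators, each contributing at most [q ^ -(n + 1 + delta0)] up to a
    constant, with [n = r.+1]. *)
Lemma Aq_abs_bound : exists K : R, 1 <= K /\ forall q, (0 < q)%N ->
 \sum_(a : pts n q | cop a) cabs (q%:R ^- s * gsum a) <= K * q%:R `^ (- (1 + d0)).
Proof.
have [K [K1 HK]] := gsum_bound; exists K; split=> // q q0.
apply: (@le_trans _ _ (\sum_(a : pts n q) K * q%:R `^ (- (r.+2%:R + d0)))).
 rewrite [leRHS](bigID (fun a : pts n q => cop a)) /= -[leLHS]addr0; apply: lerD.
  by apply: ler_sum => a; exact: HK.
 by apply: sumr_ge0 => a _; rewrite mulr_ge0 ?powR_ge0 // (le_trans _ K1).
rewrite sumr_const card_ffun !card_ord -[leLHS]mulr_natl mulrCA.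
apply: ler_wpM2l; first exact: le_trans K1.
have qr : 0 < q%:R :> R by rewrite ltr0n.
rewrite natrX pw_nat ?(ltW qr) // -pwD //; apply: eqle; congr (_ `^ _).
by rewrite -natr1; ring.
Qed.

Lemma Aq_bound : exists K : R, 1 <= K /\ forall q, (0 < q)%N -> cabs (Aq q) <= K * q%:R `^ (- (1 + d0)).
Proof.
have [K [K1 HK]] := Aq_abs_bound; exists K; split=> // q q0.
exact: le_trans (cabs_sum _ _ _) (HK q q0).
Qed.

Definition Spart (Q : nat) : R[i]^o := \sum_(1 <= q < Q.+1) Aq q.
Lemma sseries_cvg : exists l : R[i]^o, (Spart @ \oo --> l) /\
 exists K : R, 1 <= K /\ forall Q, (0 < Q)%N -> cabs (l - Spart Q) <= K * Q%:R `^ (- d0).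
Proof.
have [K [K1 HK]] := Aq_bound.
have dp := delta0_gt0 R r.
(* [zeta_tail] needs [k] positive, so [k = 0] takes the bound for the whole series. *)
pose b k : R := if k is k'.+1 then K * d0^-1 * k%:R `^ (- d0) else K * (1 + d0^-1).
have K0 : 0 <= K by exact: le_trans K1.
have bd m k : (k <= m)%N -> cabs (Spart m - Spart k) <= b k.
 move=> km.
 have -> : Spart m - Spart k = \sum_(k.+1 <= q < m.+1) Aq q.
  by rewrite /Spart (big_cat_nat (n := k.+1)) //= addrAC subrr add0r.
 apply: le_trans (cabs_sum _ _ _) _.
 apply: (@le_trans _ _ (K * \sum_(k.+1 <= q < m.+1) q%:R `^ (- (1 + d0)))).
  rewrite mulr_sumr big_nat_cond [leRHS]big_nat_cond; apply: ler_sum => q /andP[/andP[h _] _].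
  by apply: HK; lia.
 case: k km => [|k] km.
  by apply: ler_wpM2l => //; exact: zeta_sum.
 by rewrite /b -mulrA; apply: ler_wpM2l => //; exact: zeta_tail.
have [|l [hl hb]] := complex_cauchy bd.
 move=> e e0; pose c := K * d0^-1.
 have c0 : 0 < c by rewrite /c mulr_gt0 ?invr_gt0 // (lt_le_trans _ K1).
 pose x : R := (2 * c / e) `^ d0^-1.
 pose k := (truncn x).+1.
 exists k; rewrite /b -/c /=.
 have xk : x <= k%:R by apply: ltW; exact: truncnS_gt.
 have ce : 0 < 2 * c / e by rewrite divr_gt0 // mulr_gt0.
 have x0 : 0 < x by exact: pw_gt0.
 have kr : 0 < k%:R :> R by rewrite ltr0n.
 rewrite pwN // ltr_pdivrMr ?pw_gt0 //.
 have : 2 * c / e <= k%:R `^ d0.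
  have -> : 2 * c / e = x `^ d0 by rewrite /x -powRrM mulVf ?lt0r_neq0 // powRr1 // ltW.
  by apply: ge0_ler_powR; rewrite ?nnegrE ?(ltW dp) ?(ltW x0) ?(ltW kr).
 rewrite ler_pdivrMr // [leRHS]mulrC => h; apply: (lt_le_trans _ h).
 by rewrite mulr_natl mulr2n ltrDl.
exists l; split=> //; exists (1 + K * d0^-1); split.
 by rewrite lerDl mulr_ge0 // invr_ge0 ltW.
case=> // Q _; apply: le_trans (hb Q.+1) _; rewrite /b.
by apply: ler_wpM2r; [exact: powR_ge0 | rewrite lerDr].
Qed.

End SingularSeries.

(** * Orthogonality on a finite grid of frequencies *)

Section Orthogonality.
Variables (R : realType) (n s : nat) (C : 'I_n -> 'M[int]_s).

Lemma e2pi_neq1 (x : R) : 0 < `|x| -> `|x| <= 1 / 2 -> expi2pi x != 1.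
Proof.
move=> x0 x1; rewrite -subr_eq0.
have h : `|x| <= cabs (expi2pi x - 1).
 case: (lerP 0 x) => hx; first by rewrite ger0_norm // in x0 x1 *; exact: e2pi_lb.
 rewrite ltr0_norm // in x0 x1 *; rewrite -e2pi_norm_neg; apply: e2pi_lb => //; exact: ltW.
apply/eqP => e; rewrite e cabs0 in h.
by move: (lt_le_trans x0 h); rewrite ltxx.
Qed.

Lemma geometric_int M (c : int) : (0 < M)%N -> 2 * `|c| <= M%:Z ->
 \sum_(k < M) expi2pi (k%:R / M%:R * c%:~R) = (if c == 0 then M%:R else 0) :> R[i].
Proof.
move=> M0 cM; have Mr : 0 < M%:R :> R by rewrite ltr0n.
case: eqP => [->|/eqP c0].
 rewrite (eq_bigr (fun=> 1)); last by move=> k _; rewrite mulr0 e2pi0.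
 by rewrite sumr_const card_ord.
pose z : R[i] := expi2pi (c%:~R / M%:R).
rewrite (eq_bigr (fun k : 'I_M => z ^+ k)); last first.
 by move=> k _; rewrite /z -e2piMn; congr expi2pi; field; rewrite lt0r_neq0.
have zM : z ^+ M = 1 by rewrite /z -e2piMn mulrC divfK ?lt0r_neq0 // e2pi_int.
have z1 : z != 1.
 apply: e2pi_neq1; first by rewrite normr_gt0 mulf_neq0 ?intr_eq0 // invr_neq0 // lt0r_neq0.
 rewrite normrM normfV (gtr0_norm Mr) ler_pdivrMr // mulrAC ler_pdivlMr //.
 by have := cM; rewrite -(ler_int R) intrM intr_norm mul1r mulrC.
have : (z - 1) * \sum_(k < M) z ^+ k = 0 by rewrite -subrX1 zM subrr.
by move/eqP; rewrite mulf_eq0 subr_eq0 (negbTE z1) /= => /eqP.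
Qed.

Lemma orthogonality M (c : 'I_n -> int) : (0 < M)%N -> (forall i, 2 * `|c i| <= M%:Z) ->
 \sum_(k : pts n M) expi2pi (\sum_i (k i)%:R / M%:R * (c i)%:~R) =
 (if [forall i, c i == 0] then M%:R ^+ n else 0) :> R[i].
Proof.
move=> M0 hc.
rewrite (eq_bigr (fun k : pts n M => \prod_i expi2pi ((k i)%:R / M%:R * (c i)%:~R))); last first.
 by move=> k _; rewrite e2pi_sum.
rewrite -(bigA_distr_bigA (fun i (k : 'I_M) => expi2pi (k%:R / M%:R * (c i)%:~R))) /=.
rewrite (eq_bigr (fun i => if c i == 0 then M%:R else 0)); last by move=> i _; exact: geometric_int.
case: forallP => [h|/forallP].
 rewrite (eq_bigr (fun=> M%:R)); last by move=> i _; rewrite h.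
 by rewrite prodr_const card_ord.
rewrite negb_forall => /existsP[i hi].
by rewrite (bigD1 i) //= (negbTE hi) mul0r.
Qed.

Definition zcount N (D : 'I_s -> pred int) : nat :=
 #|[pred f : pts s (2 * N).+1 | inbox D (pt f) && [forall i, qf (C i) (pt f) == 0]]|.

(** At points of size [N] the forms have size at most [M / 2], so a value divisible by [M] is zero,
    and the sum over the grid detects zeros exactly. *)
Lemma zcount_esum N M (D : 'I_s -> pred int) : (0 < M)%N -> 2 * csize R C * N%:R ^+ 2 <= M%:R ->
 \sum_(k : pts n M) box_sum N D (fun x => expi2pi (iphase C (fracs M k) x))
  = M%:R ^+ n * (zcount N D)%:R :> R[i].
Proof.
move=> M0 hM; rewrite /box_sum exchange_big /=.
transitivity (\sum_(f : pts s (2 * N).+1 | inbox D (pt f))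
  (if [forall i, qf (C i) (pt f) == 0] then M%:R ^+ n else 0) : R[i]).
 apply: eq_bigr => f _; rewrite -orthogonality //.
  apply: eq_bigr => k _; congr expi2pi; rewrite /iphase /phase; apply: eq_bigr => i _.
  by rewrite qf_intr.
 move=> i; rewrite -(ler_int R) intrM intr_norm -qf_intr; apply: le_trans hM.
 rewrite -mulrA; apply: ler_wpM2l => //; apply: qf_bound => j.
 by rewrite -intr_norm -[N%:R]/(N%:Z%:~R) ler_int pt_bound.
rewrite -big_mkcondr /= sumr_const -[LHS]mulr_natr; congr (_ * _%:R).
Qed.

End Orthogonality.

(** * Frequencies near reduced fractions *)

Section NearFractions.
Variables (R : realType) (r : nat).
Local Notation n := r.+1.

(** The integer [z] places the arc around [a / q] modulo 1. *)
Definition near_frac (e : R) (M q : nat) (a k : 'I_n -> int) : bool :=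
 `[< forall i, exists z : int, `|q%:R * ((k i)%:~R / M%:R) - (a i)%:~R - q%:R * z%:~R| <= e >].

Lemma reduced_fraction (q0 : nat) (a0 : 'I_n -> int) : (0 < q0)%N ->
 exists (d q : nat) (a : pts n q) (z : 'I_n -> int),
  [/\ (0 < d)%N, (0 < q)%N, q0 = (d * q)%N, coprime_tuple q (fun i => (a i).+1%:Z) &
    forall i, a0 i = d%:Z * ((a i).+1%:Z + q%:Z * z i)].
Proof.
move=> q00; pose d := gcdn (\big[gcdn/0]_(i < n) absz (a0 i))%N q0.
have d0 : (0 < d)%N by rewrite gcdn_gt0 q00 orbT.
have dq : (d %| q0)%N by exact: dvdn_gcdr.
have da i : (d %| absz (a0 i))%N.
 by apply: dvdn_trans (dvdn_gcdl _ _) _; apply: (@biggcdn_inf _ i).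
pose q := (q0 %/ d)%N.
have qE : q0 = (d * q)%N by rewrite mulnC divnK.
have q1 : (0 < q)%N by rewrite divn_gt0 // dvdn_leq.
have /choice[a1 ha1] : forall i, exists b : int, a0 i = d%:Z * b.
 move=> i; have /dvdzP[c ->] : (d%:Z %| a0 i)%Z by exact: da.
 by exists c; rewrite mulrC.
have qz : q%:Z != 0 by lia.
(* The division is applied to [a1 i - 1] because numerators are represented in [1, ..., q]. *)
have hz i : (absz ((a1 i - 1) %% q%:Z)%Z < q)%N.
 have m0 := modz_ge0 (a1 i - 1) qz; have m1 := ltz_pmod (a1 i - 1) (d := q%:Z) (ltac:(lia)).
 by move: m0 m1; move: ((a1 i - 1) %% q%:Z)%Z => w; lia.
pose a := [ffun i => Ordinal (hz i)].
pose z i := ((a1 i - 1) %/ q%:Z)%Z.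
have aE i : (a i).+1%:Z + q%:Z * z i = a1 i.
 rewrite ffunE /z /=; have e1 := divz_eq (a1 i - 1) q%:Z.
 have m0 := modz_ge0 (a1 i - 1) qz.
 move: e1 m0; move: ((a1 i - 1) %% q%:Z)%Z ((a1 i - 1) %/ q%:Z)%Z => u v; lia.
exists d, q, a, z; split => //; last by move=> i; rewrite aE -ha1.
move=> c cq ca.
have cd : (d * c %| d)%N.
 rewrite {2}/d dvdn_gcd qE dvdn_pmul2l // cq andbT.
 apply/dvdn_biggcdP => i _; rewrite ha1 abszM /= dvdn_pmul2l // -aE.
 have : (c%:Z %| (a i).+1%:Z + q%:Z * z i)%Z.
  by apply: rpredD; [exact: ca | apply: dvdz_mulr; exact: cq].
 by [].
have := dvdn_leq d0 cd; have c0 : (0 < c)%N by exact: dvdn_gt0 q1 cq.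
by case: c c0 {cq ca cd} => [|[|c]] // _; rewrite !mulnS; move: (d * c)%N => w; lia.
Qed.

Lemma near_exists (Q e : R) M (k : 'I_n -> int) : 0 <= e ->
 major Q e (fun i => (k i)%:~R / M%:R) ->
 exists q (a : pts n q), [/\ (0 < q)%N, q%:R <= Q,
  coprime_tuple q (fun i => (a i).+1%:Z) & near_frac e M q (fun i => (a i).+1%:Z) k].
Proof.
move=> e0 [q0 [a0 [q00 [hq ha]]]].
have [d [q [a [z [d0 q1 qE ca aE]]]]] := reduced_fraction a0 q00.
have d1 : 1 <= d%:R :> R by rewrite ler1n.
exists q, a; split => //.
 by apply: le_trans hq; rewrite ler_nat qE leq_pmull.
apply/asboolP => i; exists (z i).
have := ha i; rewrite aE qE natrM rmorphM rmorphD rmorphM /=.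
have -> : d%:R * q%:R * ((k i)%:~R / M%:R) - d%:R * ((a i).+1%:R + q%:R * (z i)%:~R) =
 d%:R * (q%:R * ((k i)%:~R / M%:R) - (a i).+1%:R - q%:R * (z i)%:~R) :> R by ring.
by rewrite normrM ger0_norm //; apply: le_trans; rewrite ler_peMl.
Qed.

Lemma near_major (Q e : R) M (k : 'I_n -> int) q a : (0 < q)%N -> q%:R <= Q ->
 near_frac e M q a k -> major Q e (fun i => (k i)%:~R / M%:R).
Proof.
move=> q0 hq /asboolP/choice[z hz]; exists q, (fun i => a i + q%:Z * z i); split=> //; split => // i.
by rewrite rmorphD rmorphM /= opprD addrA.
Qed.

(** If two fractions are close to the same frequency, the numerator of their difference is an
    integer of size at most [2 * e * Q < 1]; the fractions agree, and coprimality identifies their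
    terms. *)
Lemma near_unique (Q e : R) M (k : 'I_n -> int) q (a : pts n q) q' (a' : pts n q') :
 0 <= e -> 2 * e * Q < 1 -> (0 < q)%N -> (0 < q')%N -> q%:R <= Q -> q'%:R <= Q ->
 coprime_tuple q (fun i => (a i).+1%:Z) -> coprime_tuple q' (fun i => (a' i).+1%:Z) ->
 near_frac e M q (fun i => (a i).+1%:Z) k -> near_frac e M q' (fun i => (a' i).+1%:Z) k ->
 q = q' /\ forall i, (a i : nat) = (a' i : nat).
Proof.
move=> e0 eQ q0 q'0 hq hq' ca ca' /asboolP/choice[z hz] /asboolP/choice[z' hz'].
have E i : ((a i).+1%:Z + q%:Z * z i) * q'%:Z = ((a' i).+1%:Z + q'%:Z * z' i) * q%:Z.
 apply/eqP; rewrite -subr_eq0; apply/eqP; apply: (@int_norm_lt1 R).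
 rewrite rmorphB !rmorphM !rmorphD !rmorphM /=.
 have hzi := hz i; have hzi' := hz' i; rewrite -!pmulrn in hzi hzi' *.
 set x := (k i)%:~R / M%:R in hzi hzi'.
 have -> : ((a i).+1%:R + q%:R * (z i)%:~R) * q'%:R - ((a' i).+1%:R + q'%:R * (z' i)%:~R) * q%:R =
  q%:R * (q'%:R * x - (a' i).+1%:R - q'%:R * (z' i)%:~R) -
  q'%:R * (q%:R * x - (a i).+1%:R - q%:R * (z i)%:~R) :> R by ring.
 apply: le_lt_trans (ler_normB _ _) _; rewrite !normrM !(ger0_norm (ler0n _ _)).
 apply: le_lt_trans eQ; have -> : 2 * e * Q = Q * e + Q * e by ring.
 by apply: lerD; apply: ler_pM.
have dvd p p' (b : 'I_n -> int) (w : 'I_n -> int) : (0 < p)%N -> coprime_tuple p b ->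
  (forall i, (p%:Z %| (b i + p%:Z * w i) * p'%:Z)%Z) -> (p %| p')%N.
 move=> p0 cb h.
 pose g := gcdn p p'; have g0 : (0 < g)%N by rewrite gcdn_gt0 p0.
 have pg : p = ((p %/ g) * g)%N by rewrite divnK // dvdn_gcdl.
 have p'g : p' = ((p' %/ g) * g)%N by rewrite divnK // dvdn_gcdr.
 have cop : coprime (p %/ g) (p' %/ g) by rewrite /coprime -(eqn_pmul2r g0) muln_gcdl -pg -p'g mul1n.
 have e1 : (p %/ g)%N = 1%N.
  apply: cb; first by rewrite {2}pg dvdn_mulr.
  move=> i; have := h i; rewrite dvdzE abszM /= {1}pg p'g mulnA dvdn_pmul2r -?p'g //.
  rewrite Gauss_dvdl // => h'.
  have : ((p %/ g)%N%:Z %| b i + p%:Z * w i)%Z by [].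
  have h3 : ((p %/ g)%N%:Z %| p%:Z * w i)%Z.
   by apply: dvdz_mulr; rewrite dvdzE /= {2}pg; exact: dvdn_mulr.
  by move=> h2; have := rpredB h2 h3; rewrite addrK.
 by rewrite pg e1 mul1n dvdn_gcdr.
have qq' : q = q'.
 apply/eqP; rewrite eqn_dvd; apply/andP; split.
  by apply: (dvd q q' _ z q0 ca) => i; rewrite E dvdz_mull.
 by apply: (dvd q' q _ z' q'0 ca') => i; rewrite -E dvdz_mull.
subst q'; split => // i.
have qn0 : q%:Z != 0 by lia.
have e1 := mulIf qn0 (E i).
have := ltn_ord (a i); have := ltn_ord (a' i).
move: e1; move: (a i : nat) (a' i : nat) (z i) (z' i) => u u' v v' e1 h1 h2.
have e2 : u%:Z - u'%:Z = q%:Z * (v' - v).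
 by rewrite mulrBr; lia.
clear -e2 h1 h2; move: (v' - v) e2 => w e2.
have [w1|[w1|w1]] : (w <= -1) \/ (w = 0) \/ (1 <= w) by lia.
- have : q%:Z * w <= - q%:Z by nia.
 by lia.
- by rewrite w1 mulr0 in e2; lia.
- have : q%:Z <= q%:Z * w by nia.
 by lia.
Qed.

(** As [q] divides [M], the point [a / q] lies on the grid, and a translation brings the arc to the
    centre [m] of the index range; there [e < 1 / 2] excludes every integer [z] but one. *)
Lemma near_shift (e : R) m M q (a p : 'I_n -> int) : (0 < q)%N -> 0 <= e -> e < 1 / 2 -> (0 < m)%N ->
 M = (2 * m)%N -> (q %| M)%N -> (forall i, 0 <= p i <= M%:Z) ->
 near_frac e M q a (fun i => (a i * (M %/ q)%N%:Z - m%:Z) + p i) =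
 [forall i, `|q%:R * ((p i - m%:Z)%:~R / M%:R)| <= e].
Proof.
move=> q0 e0 e2 m0 Mm qM hp.
have qr : 0 < q%:R :> R by rewrite ltr0n.
have q1 : 1 <= q%:R :> R by rewrite ler1n.
have mr : 0 < m%:R :> R by rewrite ltr0n.
have Mr : 0 < M%:R :> R by rewrite ltr0n Mm muln_gt0.
have Mr2 : M%:R = 2 * m%:R :> R by rewrite Mm natrM.
have Mq : M%:R = (M %/ q)%:R * q%:R :> R by rewrite -natrM divnK.
have E i z : q%:R * ((a i * (M %/ q)%N%:Z - m%:Z + p i)%:~R / M%:R) - (a i)%:~R - q%:R * z%:~R =
  q%:R * ((p i - m%:Z)%:~R / M%:R) - q%:R * z%:~R :> R.
 congr (_ - _).
 have -> : (a i * (M %/ q)%N%:Z - m%:Z + p i)%:~R = (a i)%:~R * (M %/ q)%:R - m%:R + (p i)%:~R :> R.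
  by rewrite rmorphD rmorphB rmorphM.
 have -> : (p i - m%:Z)%:~R = (p i)%:~R - m%:R :> R by rewrite rmorphB.
 rewrite !Mq.
 have Mq0 : (M %/ q)%:R != 0 :> R.
  by apply/eqP => h0; move: Mr; rewrite Mq h0 mul0r ltxx.
 by field; rewrite Mq0 lt0r_neq0.
apply/asboolP/forallP => [h i|h i].
 have [z] := h i; rewrite E.
 have b : `|q%:R * ((p i - m%:Z)%:~R / M%:R)| <= q%:R / 2 :> R.
  rewrite normrM (gtr0_norm qr); apply: ler_wpM2l; first exact: ltW.
  rewrite normrM normfV (gtr0_norm Mr) ler_pdivrMr // Mr2 mulrA mulVf ?pnatr_eq0 // mul1r.
  rewrite -intr_norm -[m%:R]/(m%:Z%:~R) ler_int; have := hp i; lia.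
 case: (eqVneq z 0) => [->|z0]; first by rewrite mulr0 subr0.
 have z1 : 1 <= `|z%:~R| :> R by rewrite -intr_norm -[1]/(1%:~R) ler_int; lia.
 move=> h1; exfalso; have : q%:R <= q%:R / 2 + e.
  apply: (@le_trans _ _ `|q%:R * z%:~R : R|); first by rewrite normrM (gtr0_norm qr) ler_peMr // ltW.
  have -> : q%:R * z%:~R = q%:R * ((p i - m%:Z)%:~R / M%:R) - (q%:R * ((p i - m%:Z)%:~R / M%:R) - q%:R * z%:~R) :> R by ring.
  by apply: le_trans (ler_normB _ _) _; exact: lerD.
 by move: e2 q1; clear; move: (q%:R : R) => x; lra.
by exists 0; rewrite E mulr0 subr0.
Qed.

Lemma card_ffun_near (c d : R) M : 0 <= d ->
 #|[pred k : pts n M | [forall i, `|(k i)%:R - c| <= d]]|%:R <= (2 * d + 1) ^+ n.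
Proof.
move=> d0; have h := card_interval M c d0.
rewrite (eq_card (_ : _ =i ffun_on [pred k : 'I_M | `|k%:R - c| <= d])).
 by rewrite card_ffun_on card_ord natrX; apply: lerXn2r => //; rewrite nnegrE ?addr_ge0 ?mulr_ge0.
by move=> k; apply/forallP/ffun_onP => h' i; have := h' i; rewrite ?inE.
Qed.

End NearFractions.

Section SumNear.
Variables (R : realType) (r : nat).
Local Notation n := r.+1.

Lemma sum_near (V : zmodType) (Q e : R) M (k : 'I_n -> int) (F : V) : 0 <= e -> 2 * e * Q < 1 -> 0 <= Q ->
 \sum_(1 <= q < (truncn Q).+1) \sum_(a : pts n q | cop a)
   (if near_frac e M q (fun i => (a i).+1%:Z) k then F else 0) =
 (if `[< major Q e (fun i => (k i)%:~R / M%:R) >] then F else 0).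
Proof.
move=> e0 eQ Q0; case: asboolP => [h|h]; last first.
 rewrite big_nat_cond big1 // => q /andP[/andP[q0 qQ] _]; rewrite big1 // => a _.
 case: ifP => // ha; exfalso; apply: h; apply: near_major ha => //.
 by rewrite -truncn_ge_nat.
have [q [a [q0 hq ca ha]]] := near_exists e0 h.
have qin : q \in index_iota 1 (truncn Q).+1 by rewrite mem_index_iota q0 ltnS truncn_ge_nat.
rewrite (bigD1_seq q) ?iota_uniq //= (bigD1 a) /=; last by apply/copP.
rewrite ha big1 ?addr0 => [|b /andP[cb ba]]; last first.
 case: ifP => // hb; exfalso; move/eqP: ba; apply.
 have [_ eab] := near_unique e0 eQ q0 q0 hq hq (elimT (copP b q0) cb) ca hb ha.
 by apply/ffunP => i; apply/val_inj; exact: eab.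
rewrite big_nat_cond big1 ?addr0 // => q' /andP[/andP[q'0 q'Q] qq']; rewrite big1 // => b cb.
case: ifP => // hb; exfalso; move/eqP: qq'; apply.
have hq' : q'%:R <= Q by rewrite -truncn_ge_nat.
by have [e1 _] := near_unique e0 eQ q'0 q0 hq' hq (elimT (copP b q'0) cb) ca hb ha.
Qed.

End SumNear.

Lemma inv_pow_split (R : realType) (t m p : R) k : t != 0 -> t * m = p -> m ^- k = t ^+ k / p ^+ k.
Proof. by move=> t0 <-; rewrite exprMn invfM mulrA mulfV ?mul1r // expf_neq0. Qed.

(** * The sum over a single major arc *)

Section Arcs.
Variables (R : realType) (r s : nat) (C : 'I_r.+1 -> 'M[int]_s).
Local Notation n := r.+1.
Variable J : 'I_s -> interval R.
Hypothesis hJ : box_le 1 J.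

Lemma esum_period N D (al : 'I_n -> R) (w : 'I_n -> int) :
 esum C N D (fun i => al i + (w i)%:~R) = esum C N D al.
Proof.
rewrite /esum; congr box_sum; apply/funext => x.
rewrite -(e2piDint (iphase C al x) (\sum_i w i * qf (C i) x)); congr expi2pi.
rewrite /iphase /phase rmorph_sum -big_split; apply: eq_bigr => i _ /=.
by rewrite mulrDl qf_intr rmorphM.
Qed.

Lemma arc_sum P m q e (a : 'I_n -> int) : (0 < q)%N -> (0 < m)%N -> (q %| 2 * m)%N -> 0 <= e -> e < 1 / 2 ->
 0 < P ->
 let N := truncn P in let M := (2 * m)%N in
 \sum_(k : pts n M) (if near_frac e M q a (fun i => (k i)%:Z)
   then esum C N (Dbox J P) (fracs M k) else 0) =
 \sum_(p : pts n M | [forall i, `|P ^+ 2 / M%:R * ((p i)%:Z - m%:Z)%:~R| <= P ^+ 2 * e / q%:R])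
   esum C N (Dbox J P) (fun i => (a i)%:~R / q%:R + ((p i)%:Z - m%:Z)%:~R / M%:R) :> R[i].
Proof.
move=> q0 m0 qM e0 e2 P0 N M.
have qr : 0 < q%:R :> R by rewrite ltr0n.
have M0 : (0 < M)%N by rewrite /M muln_gt0.
have Mr : 0 < M%:R :> R by rewrite ltr0n.
pose Phi (k : 'I_n -> int) : R[i] := if near_frac e M q a k
   then esum C N (Dbox J P) (fun i => (k i)%:~R / M%:R) else 0.
have Pper (x y : 'I_n -> int) : (forall j, exists w : int, x j = y j + w * M%:Z) -> Phi x = Phi y.
 move=> /choice[w hw].
 have xE i : (x i)%:~R / M%:R = (y i)%:~R / M%:R + (w i)%:~R :> R.
  rewrite hw rmorphD rmorphM /= mulrDl mulfK //; exact: lt0r_neq0.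
 rewrite /Phi; have -> : near_frac e M q a x = near_frac e M q a y.
  apply/asboolP/asboolP => h i; have [z hz] := h i.
   exists (z - w i); move: hz; rewrite xE rmorphB /=; congr (is_true (`| _ | <= _)); ring.
  by exists (z + w i); move: hz; rewrite xE rmorphD /=; congr (is_true (`| _ | <= _)); ring.
 case: ifP => // _; rewrite -[RHS](esum_period _ _ _ w); congr esum; apply/funext => i; exact: xE.
pose c i : int := a i * (M %/ q)%N%:Z - m%:Z.
transitivity (\sum_(k : pts n M) Phi (fun i => (k i)%:Z)); first by [].
rewrite (nsum_ffun (fun i : 'I_M => (nat_of_ord i)%:Z) Phi) -(nsum_period c Pper).
rewrite -(nsum_ffun (fun i : 'I_M => (nat_of_ord i)%:Z) (fun k => Phi (fun j => c j + k j))) [RHS]big_mkcond.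
apply: eq_bigr => p _; rewrite /Phi /c near_shift //; last first.
 by move=> i; have := ltn_ord (p i); move: (p i : nat) => u; lia.
have -> : [forall i, `|q%:R * (((p i)%:Z - m%:Z)%:~R / M%:R)| <= e] =
 [forall i, `|P ^+ 2 / M%:R * ((p i)%:Z - m%:Z)%:~R| <= P ^+ 2 * e / q%:R].
 apply: eq_forallb => i; rewrite ler_pdivlMr // -[q%:R in RHS](ger0_norm (ltW qr)) -normrM.
 have P2 : 0 < P ^+ 2 by rewrite exprn_gt0.
 have -> : P ^+ 2 / M%:R * ((p i)%:Z - m%:Z)%:~R * q%:R = P ^+ 2 * (q%:R * (((p i)%:Z - m%:Z)%:~R / M%:R)) by ring.
 by rewrite [in RHS]normrM (gtr0_norm P2) ler_pM2l.
case: ifP => // _; congr esum; apply/funext => i.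
have Mq : M%:R = (M %/ q)%:R * q%:R :> R by rewrite -natrM divnK.
have Mq0 : (M %/ q)%:R != 0 :> R.
 by apply/eqP => h0; move: Mr; rewrite Mq h0 mul0r ltxx.
have -> : (a i * (M %/ q)%N%:Z - m%:Z + (p i)%:Z)%:~R = (a i)%:~R * (M %/ q)%:R + ((p i)%:Z - m%:Z)%:~R :> R.
 by rewrite rmorphD rmorphB rmorphM /= rmorphB /= -addrA [- _ + _]addrC.
by rewrite mulrDl; congr (_ + _); rewrite Mq; field; rewrite Mq0 lt0r_neq0.
Qed.

Definition gsumz q (a : 'I_n -> int) : R[i] := esum C q (gauss_box q) (fun i => (a i)%:~R / q%:R).
Lemma arc_approx P m q e (a : 'I_n -> int) : (0 < q)%N -> (0 < m)%N -> (q %| 2 * m)%N -> 0 <= e -> e < 1 / 2 ->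
 1 <= P -> (q <= truncn P)%N ->
 let N := truncn P in let M := (2 * m)%N in
 let X := P ^+ 2 * e / q%:R in let tau := P ^+ 2 / M%:R in
 is_true (cabs (\sum_(k : pts n M) (if near_frac e M q a (fun i => (k i)%:Z)
   then esum C N (Dbox J P) (fracs M k) else 0) -
  ((P / q%:R) ^+ s)%:C%C * gsumz q a * \sum_(p : pts n M |
      [forall i, `|tau * ((p i)%:Z - m%:Z)%:~R| <= X])
       Ig C J (fun i => tau * ((p i)%:Z - m%:Z)%:~R))
  <= (2 * (X / tau) + 1) ^+ n * (2 * rcst R C * (1 + n%:R * X) * (q%:R * P ^+ s / P))).
Proof.
move=> q0 m0 qM e0 e2 P1 qN.
move=> N M.
move=> X.
move=> tau.
have P0 := lt_le_trans ltr01 P1.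
have qr : 0 < q%:R :> R by rewrite ltr0n.
have M0 : (0 < M)%N by rewrite /M muln_gt0.
have Mr : 0 < M%:R :> R by rewrite ltr0n.
have t0 : 0 < tau by rewrite /tau divr_gt0 // exprn_gt0.
have X0 : 0 <= X by rewrite /X; pos.
have rc0 := rcst_ge0 R C.
rewrite arc_sum // mulr_sumr -sumrB.
apply: le_trans (cabs_sum _ _ _) _.
set B := 2 * rcst R C * (1 + n%:R * X) * (q%:R * P ^+ s / P).
have B0 : 0 <= B by rewrite /B; pos.
apply: (@le_trans _ _ (\sum_(p : pts n M | [forall i, `|tau * ((p i)%:Z - m%:Z)%:~R| <= X]) B)).
 apply: ler_sum => p /forallP hp.
 have gE : (fun i => tau * ((p i)%:Z - m%:Z)%:~R) = fun i : 'I_n => P ^+ 2 * (((p i)%:Z - m%:Z)%:~R / M%:R).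
  by apply/funext => i; rewrite /tau mulrAC -mulrA.
 rewrite gE; apply: le_trans (major_point C hJ a _ P1 q0 qN) _.
 have S0 : P ^+ 2 * (\sum_i `|((p i)%:Z - m%:Z)%:~R / M%:R : R|) <= n%:R * X.
  rewrite mulr_sumr; apply: (@le_trans _ _ (\sum_(i < n) X)); last by rewrite sumr_const card_ord mulr_natl.
  apply: ler_sum => i _; apply: le_trans (hp i).
  by rewrite -{1}(ger0_norm (sqr_ge0 P)) -normrM mulrA mulrAC.
 rewrite /B; apply: ler_wpM2r; first by pos.
 by apply: ler_wpM2l; [pos | rewrite lerD2l].
rewrite sumr_const -[leLHS]mulr_natl; apply: ler_wpM2r => //.
have := @card_ffun_near R r m%:R (X / tau) M (divr_ge0 X0 (ltW t0)).
apply: le_trans; rewrite ler_nat; apply: subset_leq_card; apply/fintype.subsetP => p.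
rewrite !inE => /forallP hp; apply/forallP => i; rewrite ler_pdivlMr // mulrC -[tau in X in X <= _](gtr0_norm t0) -normrM.
by have := hp i; rewrite rmorphB.
Qed.

(** Three errors add up: the approximation of each exponential sum on the arc, the Riemann sum of
    [Ig] over the arc, and the tail of the singular integral beyond the radius [X]. *)
Lemma arc_final K1 K2 :
 cube_riemann C J K1 ->
 (forall X, 0 < X -> cabs (sintegral C J - sintegral_cube C J X) <= K2 / X) ->
 forall P m q e (a : 'I_n -> int), (0 < q)%N -> (0 < m)%N -> (q %| 2 * m)%N -> 0 < e -> e < 1 / 2 ->
 1 <= P -> (q <= truncn P)%N ->
 let N := truncn P in let M := (2 * m)%N in
 let X := P ^+ 2 * e / q%:R in let tau := P ^+ 2 / M%:R in
 tau <= X ->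
 let W := P ^+ s / P ^+ (2 * n) in let g := q%:R ^- s * gsumz q a in
 is_true (cabs (M%:R ^- n * (\sum_(k : pts n M) (if near_frac e M q a (fun i => (k i)%:Z)
   then esum C N (Dbox J P) (fracs M k) else 0)) - W%:C%C * g * sintegral C J)
 <= W * ((3 * X) ^+ n * (2 * rcst R C * (1 + n%:R * X) * (q%:R / P))
   + cabs g * (K1 * (1 + P ^+ 2) ^+ n.+1 * tau + K2 / X))).
Proof.
move=> H1 H2 P m q e a q0 m0 qM e0 e2 P1 qN N M X tau tX W g.
have P0 := lt_le_trans ltr01 P1.
have qr : 0 < q%:R :> R by rewrite ltr0n.
have q1 : 1 <= q%:R :> R by rewrite ler1n.
have M0 : (0 < M)%N by rewrite /M muln_gt0.
have Mr : 0 < M%:R :> R by rewrite ltr0n.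
have t0 : 0 < tau by rewrite /tau divr_gt0 // exprn_gt0.
have P2 : 0 < P ^+ 2 by rewrite exprn_gt0.
have X0 : 0 < X by rewrite /X divr_gt0 // mulr_gt0.
have W0 : 0 < W by rewrite /W divr_gt0 // exprn_gt0.
have rc0 := rcst_ge0 R C.
have := arc_approx a q0 m0 qM (ltW e0) e2 P1 qN; rewrite /= -/N -/M -/X -/tau.
set S := \sum_(k : pts n M) _; set T := \sum_(p | _) _ => HA.
have Xe : X <= P ^+ 2 * e by rewrite /X ler_pdivrMr // ler_peMr // mulr_ge0 // ltW.
have tm : tau * m%:R = P ^+ 2 / 2.
 by rewrite /tau /M natrM; field; rewrite ?pnatr_eq0 -?lt0n.
have Xt : X < tau * m%:R by rewrite tm; apply: le_lt_trans Xe _; rewrite ltr_pM2l // -[2^-1]mul1r.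
have tM : tau * M%:R = P ^+ 2 by rewrite /tau divfK // lt0r_neq0.
have XY : 2 * X <= 1 + P ^+ 2.
 apply: (@le_trans _ _ (P ^+ 2)); last by rewrite lerDr.
 by have := ltW Xt; rewrite tm ler_pdivlMr // mulrC.
have Y1 : 1 <= 1 + P ^+ 2 by rewrite lerDl ltW.
have tY : tau * (2 * m)%:R <= 1 + P ^+ 2 by rewrite -/M tM lerDr.
have := H1 X tau m (1 + P ^+ 2) (ltW X0) t0 Xt XY Y1 tY; rewrite -/T => HT.
have HX := H2 X X0.
have {HT HX} HI : cabs ((tau ^+ n)%:C%C * T - sintegral C J) <= K1 * (1 + P ^+ 2) ^+ n.+1 * tau + K2 / X.
 have -> : (tau ^+ n)%:C%C * T - sintegral C J = ((tau ^+ n)%:C%C * T - sintegral_cube C J X) -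
   (sintegral C J - sintegral_cube C J X) by ring.
 by apply: le_trans (cabsB _ _) _; exact: lerD.
have cM : M%:R ^- n = ((M%:R ^- n : R))%:C%C :> R[i] by rewrite fmorphV rmorphXn /= rmorph_nat.
have cq : q%:R ^- s = ((q%:R ^- s : R))%:C%C :> R[i] by rewrite fmorphV rmorphXn /= rmorph_nat.
have E1 : M%:R ^- n * S - W%:C%C * g * sintegral C J =
  M%:R ^- n * (S - ((P / q%:R) ^+ s)%:C%C * gsumz q a * T) +
  W%:C%C * g * ((tau ^+ n)%:C%C * T - sintegral C J).
 have e1 : M%:R ^- n * ((P / q%:R) ^+ s)%:C%C = W%:C%C * q%:R ^- s * (tau ^+ n)%:C%C :> R[i].
  rewrite cM cq -!rmorphM; congr (_%:C)%C; rewrite /W /tau expr_div_n [(P ^+ 2 / _) ^+ n]expr_div_n -exprM.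
  by field; rewrite !expf_neq0 ?lt0r_neq0.
 rewrite mulrBr 2![M%:R ^- n * (_ * _)]mulrA e1 /g.
 set A := W%:C%C; set Bq := q%:R ^- s; set G := gsumz q a; set Z := sintegral C J; set tn := (tau ^+ n)%:C%C; set MS := M%:R ^- n * S.
 ring.
rewrite E1 [leRHS]mulrDr; apply: le_trans (cabsD _ _) _; apply: lerD; last first.
 rewrite cabsM [cabs (_ * g)]cabsM cabs_real (gtr0_norm W0) -[leLHS]mulrA; apply: ler_wpM2l; first exact: ltW.
 by apply: ler_wpM2l; [exact: cabs_ge0 | exact: HI].
rewrite cabsM cabsV cabsX cabs_nat.
have Mn : 0 < M%:R ^+ n :> R by rewrite exprn_gt0.
apply: (@le_trans _ _ (M%:R ^- n * ((2 * (X / tau) + 1) ^+ n * (2 * rcst R C * (1 + n%:R * X) * (q%:R * P ^+ s / P))))).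
 by apply: ler_wpM2l => //; rewrite invr_ge0 ltW.
have -> : M%:R ^- n * ((2 * (X / tau) + 1) ^+ n * (2 * rcst R C * (1 + n%:R * X) * (q%:R * P ^+ s / P))) =
 W * ((tau * (2 * (X / tau) + 1)) ^+ n * (2 * rcst R C * (1 + n%:R * X) * (q%:R / P))).
 have -> : M%:R ^- n = tau ^+ n / P ^+ (2 * n) :> R.
  by rewrite exprM; apply: inv_pow_split => //; exact: lt0r_neq0.
 set U := 2 * (X / tau) + 1; set V := 2 * rcst R C * (1 + n%:R * X); clearbody tau U V.
 by rewrite /W [(tau * U) ^+ _]exprMn; move: (tau ^+ n) (U ^+ n) (P ^+ s) (P ^+ (2 * n))^-1 P^-1 => t1 u1 p1 p2 p3; ring.
apply: ler_wpM2l; first exact: ltW.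
apply: ler_wpM2r; first by pos.
have tt : tau * (2 * (X / tau) + 1) = 2 * X + tau by field; rewrite lt0r_neq0.
have a0 : 0 <= 2 * X + tau := addr_ge0 (mulr_ge0 (ler0n _ 2) (ltW X0)) (ltW t0).
have a1 : 2 * X + tau <= 3 * X by rewrite (_ : 3 * X = 2 * X + X) ?lerD2l //; ring.
rewrite tt; apply: lerXn2r => //; rewrite nnegrE //; exact: le_trans a0 a1.
Qed.

End Arcs.

(** * The sum over all major arcs *)

Section MajorTotal.
Variables (R : realType) (r s : nat) (C : 'I_r.+1 -> 'M[int]_s).
Hypothesis hrank : rank_cond C.
Local Notation n := r.+1.
Variable J : 'I_s -> interval R.
Hypothesis hJ : box_le 1 J.
Local Notation d0 := (delta0 R r).

Lemma scale_bounds (P Q : R) q : 1 <= P -> 1 <= Q -> (0 < q)%N -> q%:R <= Q ->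
 let X := P ^+ 2 * (Q / (truncn P)%:R ^+ 2) / q%:R in
 [/\ 0 < X, X <= 4 * Q & Q / q%:R <= X].
Proof.
move=> P1 Q1 q0 qQ X; pose N := truncn P.
have P0 := lt_le_trans ltr01 P1.
have Q0 := lt_le_trans ltr01 Q1.
have qr : 0 < q%:R :> R by rewrite ltr0n.
have N1 : 1 <= N%:R :> R by rewrite ler1n truncn_gt0.
have N0 : 0 < N%:R :> R by exact: lt_le_trans N1.
have NP : N%:R <= P by rewrite /N truncn_le ltW.
have PN : P <= 2 * N%:R.
 apply: ltW; apply: lt_le_trans (truncnS_gt P) _; rewrite -/N -natr1 mulr_natl mulr2n lerD2l //.
have N2 : 0 < N%:R ^+ 2 :> R by rewrite exprn_gt0.
have PN2 : P ^+ 2 / N%:R ^+ 2 <= 4.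
 rewrite ler_pdivrMr //; have -> : 4 * N%:R ^+ 2 = (2 * N%:R) ^+ 2 :> R by ring.
 by apply: lerXn2r => //; rewrite nnegrE ?mulr_ge0 ?(ltW P0) ?(ltW N0).
have PN1 : 1 <= P ^+ 2 / N%:R ^+ 2.
 by rewrite ler_pdivlMr // mul1r; apply: lerXn2r => //; rewrite nnegrE ?(ltW P0) ?(ltW N0).
have XE : X = P ^+ 2 / N%:R ^+ 2 * (Q / q%:R) by rewrite /X -/N; ring.
have Qq : 0 < Q / q%:R by rewrite divr_gt0.
split; rewrite XE.
- by rewrite mulr_gt0 // (lt_le_trans _ PN1).
- apply: ler_pM => //; [exact: le_trans PN1 | exact: ltW |].
 by rewrite ler_pdivrMr // ler_peMr ?(ltW Q0) // ler1n.
- by rewrite ler_peMl // ltW.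
Qed.

(** Turns the tail error [q / Q] of an arc into a saving in [Q] alone, at the cost of a power of [q]
    that the convergent singular series can bear. *)
Lemma ratio_pow (q Q d : R) : 0 < q -> q <= Q -> 0 <= d -> d <= 1 -> q / Q <= q `^ d * Q `^ (- d).
Proof.
move=> q0 qQ d1 d2; have Q0 : 0 < Q by exact: lt_le_trans qQ.
have x0 : 0 < q / Q by rewrite divr_gt0.
have x1 : q / Q <= 1 by rewrite ler_pdivrMr // mul1r.
have -> : q `^ d * Q `^ (- d) = (q / Q) `^ d.
 rewrite pwN // powRM ?invr_ge0 ?(ltW q0) ?(ltW Q0) //; congr (_ * _).
 apply: (mulfI (lt0r_neq0 (pw_gt0 d Q0))).
 by rewrite mulfV ?lt0r_neq0 ?pw_gt0 // -powRM ?invr_ge0 ?(ltW Q0) // mulfV ?powR1 // lt0r_neq0.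
rewrite -{1}[q / Q]powRr1 ?(ltW x0) // /powR !gt_eqF // ler_expR ler_wnM2r //.
by rewrite ln_le0.
Qed.

Lemma major_total : exists c : R, 0 <= c /\ forall P Q (B : R), 1 <= P -> 1 <= Q ->
 2 * Q ^+ 2 < (truncn P)%:R ^+ 2 ->
 exists M : nat, [/\ (0 < M)%N, B <= M%:R &
 let N := truncn P in
 let W := P ^+ s / P ^+ (2 * n) in
 is_true (cabs (M%:R ^- n * (\sum_(k : pts n M)
  (if `[< major Q (Q / N%:R ^+ 2) (fracs M k) >]
   then esum C N (Dbox J P) (fracs M k) else 0))
  - W%:C%C * Spart R C (truncn Q) * sintegral C J) <=
 W * (c * (Q ^+ (2 * n + 3) / P + Q `^ (- (d0 / 2)))))].
Proof.
have [K1 [K10 HK1]] := sintegral_riemann C hJ.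
have [K2 [K21 HK2]] := sintegral_tail hrank hJ.
have [K3 [K31 HK3]] := Aq_abs_bound R hrank.
have rc0 := rcst_ge0 R C.
have dp := delta0_gt0 R r.
pose c3 : R := 12 ^+ n * (2 * rcst R C * (1 + 4 * n%:R)).
pose c4 : R := K3 * (1 + (d0 / 2)^-1).
have K20 : 0 <= K2 by exact: le_trans K21.
have K30 : 0 <= K3 by exact: le_trans K31.
have c30 : 0 <= c3 by rewrite /c3; pos.
have c40 : 0 <= c4 by rewrite /c4; pos; rewrite ?invr_ge0; apply: ltW; rewrite divr_gt0.
exists (c3 + c4 * (1 + K2)); split; first by pos.
move=> P Q B P1 Q1 QN.
pose N := truncn P.
have P0 := lt_le_trans ltr01 P1.
have Q0 := lt_le_trans ltr01 Q1.
have N1 : 1 <= N%:R :> R by rewrite ler1n truncn_gt0.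
have N0 : 0 < N%:R :> R by exact: lt_le_trans N1.
have N2 : 0 < N%:R ^+ 2 :> R by rewrite exprn_gt0.
pose e := Q / N%:R ^+ 2.
have e0 : 0 < e by rewrite /e divr_gt0.
have eQ : 2 * e * Q < 1.
 have -> : 2 * e * Q = 2 * Q ^+ 2 / N%:R ^+ 2 by rewrite /e; ring.
 by rewrite ltr_pdivrMr // mul1r.
have e2 : e < 1 / 2.
 rewrite ltr_pdivlMr // mulrC; apply: le_lt_trans eQ.
 by rewrite ler_peMr // mulr_ge0 // ltW.
have QN1 : Q <= N%:R.
 rewrite -(@ler_pXn2r _ 2) // ?nnegrE ?(ltW Q0) ?(ltW N0) //.
 by apply: le_trans (ltW QN); rewrite ler_peMl // ?ler1n // sqr_ge0.
pose Qn := truncn Q.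
have QnN : (Qn <= N)%N by rewrite -(ler_nat R); apply: le_trans QN1; rewrite truncn_le ltW.
(* Besides exceeding [B], the modulus must keep the step of the grid below the radius of each arc
   and the error of each Riemann sum below [1 / P]. *)
pose b := Num.max B (N%:R ^+ 2 + K1 * (1 + P ^+ 2) ^+ n.+1 * P ^+ 2 * P).
pose t := (truncn b).+1.
(* The factorial makes [M] divisible by every denominator up to [Q]. *)
pose m := (Qn`! * t)%N.
have m0 : (0 < m)%N by rewrite muln_gt0 fact_gt0.
pose M := (2 * m)%N.
have Mb : b <= M%:R.
 apply: (@le_trans _ _ t%:R); first by apply: ltW; exact: truncnS_gt.
 by rewrite ler_nat /M /m mulnA leq_pmull // muln_gt0 fact_gt0.
have M0 : (0 < M)%N by rewrite muln_gt0.
have Mr : 0 < M%:R :> R by rewrite ltr0n.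
exists M; split => //; first by apply: le_trans Mb; rewrite /b le_max lexx.
have Mb2 : N%:R ^+ 2 + K1 * (1 + P ^+ 2) ^+ n.+1 * P ^+ 2 * P <= M%:R.
 by apply: le_trans Mb; rewrite /b le_max lexx orbT.
move=> /=; rewrite -/N -/e; set W := P ^+ s / P ^+ (2 * n).
pose E (k : pts n M) := esum C N (Dbox J P) (fun i => (k i)%:R / M%:R : R).
have -> : \sum_(k : pts n M) (if `[< major Q e (fracs M k) >]
   then esum C N (Dbox J P) (fracs M k) else 0) =
 \sum_(1 <= q < Qn.+1) \sum_(a : pts n q | cop a) \sum_(k : pts n M)
  (if near_frac e M q (fun i => (a i).+1%:Z) (fun i => (k i)%:Z) then E k else 0).
 transitivity (\sum_(k : pts n M) \sum_(1 <= q < Qn.+1) \sum_(a : pts n q | cop a)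
  (if near_frac e M q (fun i => (a i).+1%:Z) (fun i => (k i)%:Z) then E k else 0)).
  by apply: eq_bigr => k _; rewrite sum_near // ltW.
 by rewrite exchange_big; apply: eq_bigr => q _; rewrite exchange_big.
have -> : W%:C%C * Spart R C Qn * sintegral C J =
  \sum_(1 <= q < Qn.+1) \sum_(a : pts n q | cop a) W%:C%C * (q%:R ^- s * gsum R C a) * sintegral C J.
 rewrite /Spart mulr_sumr mulr_suml; apply: eq_bigr => q _.
 by rewrite /Aq mulr_sumr mulr_suml.
have W0 : 0 < W by rewrite /W divr_gt0 // exprn_gt0.
rewrite mulr_sumr -sumrB.
apply: le_trans (cabs_sum _ _ _) _.
apply: (@le_trans _ _ (\sum_(1 <= q < Qn.+1) W * (c3 * Q ^+ (2 * n + 2) / P + K3 * q%:R `^ (- (1 + d0 / 2)) * (P^-1 + K2 * Q `^ (- (d0 / 2)))))).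
 rewrite big_nat_cond [leRHS]big_nat_cond; apply: ler_sum => q /andP[/andP[q0 qQn] _].
 have qQ : q%:R <= Q by rewrite -truncn_ge_nat // ltW.
 have qr : 0 < q%:R :> R by rewrite ltr0n.
 have qN : (q <= N)%N by exact: leq_trans QnN.
 have qM : (q %| M)%N.
  by rewrite /M /m mulnCA; apply: dvdn_mulr; apply: dvdn_fact; rewrite q0.
 have [X0 X4 XQ] := scale_bounds P1 Q1 q0 qQ; rewrite -/N -/e in X0 X4 XQ.
 have tX : P ^+ 2 / M%:R <= P ^+ 2 * e / q%:R.
  rewrite -mulrA; apply: ler_wpM2l; first exact: sqr_ge0.
  rewrite ler_pdivlMr // ler_pdivrMl //.
  apply: (@le_trans _ _ (N%:R ^+ 2 * e)); first by rewrite /e mulrC divfK // lt0r_neq0.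
  apply: ler_wpM2r; first exact: ltW.
  by apply: le_trans Mb2; rewrite lerDl; pos.
 rewrite mulr_sumr -sumrB; apply: le_trans (cabs_sum _ _ _) _.
 set X := P ^+ 2 * e / q%:R in X0 X4 XQ tX.
 have tau1 : K1 * (1 + P ^+ 2) ^+ n.+1 * (P ^+ 2 / M%:R) <= P^-1.
  rewrite mulrA ler_pdivrMr // ler_pdivlMl // mulrC.
  by apply: le_trans Mb2; rewrite lerDr sqr_ge0.
 apply: (@le_trans _ _ (\sum_(a : pts n q | cop a) W * ((12 * Q) ^+ n * (2 * rcst R C * (1 + n%:R * (4 * Q)) * (Q / P))
   + cabs (q%:R ^- s * gsum R C a) * (P^-1 + K2 * (q%:R / Q))))).
  apply: ler_sum => a _.
  have := arc_final hJ HK1 (fun X X0 => HK2 X _ X0 (fun t h => h)) (fun i => (a i).+1%:Z) q0 m0 qM e0 e2 P1 qN tX.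
  rewrite -/N -/M -/X => H; apply: le_trans H _.
  apply: ler_wpM2l; first exact: ltW.
  apply: lerD.
   apply: ler_pM; [by pos | by pos | |].
    apply: lerXn2r; rewrite ?nnegrE; [by pos | by pos |].
    by rewrite (_ : 12 * Q = 3 * (4 * Q)) ?ler_pM2l //; ring.
   apply: ler_pM; [by pos | by pos | |].
    by apply: ler_wpM2l; [pos | rewrite lerD2l; apply: ler_wpM2l].
   by apply: ler_wpM2r => //; rewrite invr_ge0 ltW.
  apply: ler_wpM2l; first exact: cabs_ge0.
  apply: lerD => //; apply: ler_wpM2l => //.
  rewrite -[q%:R / Q]invf_div lef_pV2 ?posrE //.
  by rewrite divr_gt0.
 rewrite -mulr_sumr; apply: ler_wpM2l; first exact: ltW.
 rewrite big_split /=; apply: lerD.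
  rewrite sumr_const -[leLHS]mulr_natl.
  apply: (@le_trans _ _ (Q ^+ n * ((12 * Q) ^+ n * (2 * rcst R C * (1 + n%:R * (4 * Q)) * (Q / P))))).
   apply: ler_wpM2r; first by pos.
   apply: (@le_trans _ _ (q%:R ^+ n)); last by apply: lerXn2r; rewrite ?nnegrE //; exact: ltW.
   rewrite -natrX ler_nat -[X in (_ <= X ^ _)%N]card_ord -[X in (_ <= _ ^ X)%N](card_ord n) -card_ffun.
   exact: max_card.
  have -> : c3 * Q ^+ (2 * n + 2) / P = Q ^+ n * ((12 * Q) ^+ n * (2 * rcst R C * ((1 + 4 * n%:R) * Q) * (Q / P))).
   rewrite /c3 addnC mul2n -addnn !exprD [(12 * Q) ^+ n]exprMn.
   by move: (12 ^+ n) (Q ^+ n) => u v; rewrite expr2; ring.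
  apply: ler_wpM2l; first by pos.
  apply: ler_wpM2l; first by pos.
  apply: ler_wpM2r; first by pos.
  apply: ler_wpM2l; first by pos.
  by rewrite (_ : (1 + 4 * n%:R) * Q = Q + n%:R * (4 * Q)) ?lerD2r //; ring.
 rewrite -mulr_suml.
 apply: (@le_trans _ _ (K3 * q%:R `^ (- (1 + d0)) * (P^-1 + K2 * (q%:R / Q)))).
  apply: ler_wpM2r; last exact: HK3.
  by pos.
 have q1 : 1 <= q%:R :> R by rewrite ler1n.
 have d21 : d0 / 2 <= 1.
  have d1 : d0 <= 1 / 4 by rewrite /delta0 mul1r lef_pV2 ?posrE ?mulr_gt0 // ler_peMr // ler1n.
  by lra.
 have dp2 : 0 < d0 / 2 by rewrite divr_gt0.
 have ed : q%:R `^ (- (1 + d0)) * q%:R `^ (d0 / 2) = q%:R `^ (- (1 + d0 / 2)) :> R.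
  by rewrite -pwD //; congr (_ `^ _); rewrite {1}[d0]splitr; ring.
 have ed2 : q%:R `^ (- (1 + d0)) <= q%:R `^ (- (1 + d0 / 2)) :> R.
  by apply: ler_powR => //; rewrite lerN2 lerD2l ler_pdivrMr // ler_peMr ?(ltW dp) // ler1n.
 rewrite -!mulrA; apply: ler_wpM2l => //; rewrite !mulrDr; apply: lerD.
  by apply: ler_wpM2r => //; rewrite invr_ge0 ltW.
 rewrite mulrCA [leRHS]mulrCA; apply: ler_wpM2l => //.
 apply: le_trans (ler_wpM2l (powR_ge0 _ _) (ratio_pow qr qQ (ltW dp2) d21)) _.
 by rewrite mulrA ed.
rewrite -mulr_sumr; apply: ler_wpM2l; first exact: ltW.
pose Z : R := \sum_(1 <= q < Qn.+1) q%:R `^ (- (1 + d0 / 2)).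
have sumE (A B' : R) : \sum_(1 <= q < Qn.+1) (A + K3 * q%:R `^ (- (1 + d0 / 2)) * B') = Qn%:R * A + K3 * Z * B'.
 by rewrite big_split /= sumr_const_nat subn1 /= -[_ *+ Qn]mulr_natl /Z mulr_sumr mulr_suml.
rewrite sumE.
have hZ : Z <= 1 + (d0 / 2)^-1 by apply: zeta_sum; rewrite divr_gt0.
have Z0 : 0 <= Z by apply: sumr_ge0 => q _; exact: powR_ge0.
have P1Q : P^-1 <= Q ^+ (2 * n + 3) / P by rewrite ler_peMl ?invr_ge0 ?(ltW P0) // exprn_ege1.
set y := Q `^ (- (d0 / 2)); have y0 : 0 <= y by exact: powR_ge0.
set x := Q ^+ (2 * n + 3) / P in P1Q *; have x0 : 0 <= x by rewrite /x; pos.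
have L1 : Qn%:R * (c3 * Q ^+ (2 * n + 2) / P) <= c3 * x.
 have -> : c3 * x = Q * (c3 * Q ^+ (2 * n + 2) / P).
  by rewrite /x addn3 addn2 [Q ^+ _.+3]exprS; ring.
 by apply: ler_wpM2r; [pos | rewrite truncn_le ltW].
have L2 : K3 * Z * (P^-1 + K2 * y) <= c4 * (1 + K2) * (x + y).
 rewrite -[leRHS]mulrA; apply: ler_pM; [by pos | by pos | by apply: ler_wpM2l |].
 have -> : (1 + K2) * (x + y) = (x + K2 * y) + (y + K2 * x) by ring.
 by rewrite -[leLHS]addr0; apply: lerD; [rewrite lerD2r | pos].
apply: le_trans (lerD L1 L2) _.
have -> : (c3 + c4 * (1 + K2)) * (x + y) = (c3 * x + c4 * (1 + K2) * (x + y)) + c3 * y by ring.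
by rewrite lerDl mulr_ge0.
Qed.

End MajorTotal.

(** * The asymptotic formula *)

Section Asymptotic.
Variables (R : realType) (r s : nat) (C : 'I_r.+1 -> 'M[int]_s).
Hypothesis hrank : rank_cond C.
Local Notation n := r.+1.
Variable J : 'I_s -> interval R.
Hypothesis hJ : box_le 1 J.
Local Notation d0 := (delta0 R r).

Lemma many_variables : (2 * n < s)%N.
Proof.
have ex : exists i : 'I_n, (fun _ : 'I_n => 1 : rat) i != 0 by exists ord0.
have h := leq_trans (hrank ex) (rank_leq_row _).
exact: leq_ltn_trans (leq_pmulr _ (ltn0Sn _)) h.
Qed.

Lemma pw_shift (P : R) x : 1 <= P -> 0 <= x -> x <= 1 ->
 (truncn P)%:R `^ (- x) <= 2 * P `^ (- x).
Proof.
move=> P1 x0 x1; have P0 := lt_le_trans ltr01 P1.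
have N1 : 1 <= (truncn P)%:R :> R by rewrite ler1n truncn_gt0.
have N0 : 0 < (truncn P)%:R :> R by exact: lt_le_trans N1.
have PN : P <= 2 * (truncn P)%:R.
 apply: ltW; apply: lt_le_trans (truncnS_gt P) _; rewrite -natr1 mulr_natl mulr2n lerD2l //.
rewrite !pwN // ler_pdivlMr ?pw_gt0 // ler_pdivrMl ?pw_gt0 //.
apply: (@le_trans _ _ ((2 * (truncn P)%:R) `^ x)).
 by apply: ge0_ler_powR => //; rewrite nnegrE ?mulr_ge0 // ltW.
rewrite powRM // mulrC; apply: ler_wpM2l; first exact: powR_ge0.
by rewrite -[leRHS]powRr1 //; apply: ler_powR => //; rewrite ler1n.
Qed.

(** The height [H0 = N ^ eta] separates the arcs. The minor arcs save [sqrt H0]; the major arcs have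
    denominators up to [Q = K * H0 ^ n] and an error made of [Q ^ (2n+3) / P] and a negative power
    of [Q]. The partial sum of the singular series up to [Q] is then completed. *)
Lemma asymptotic_formula (S : R[i]) K4 :
 1 <= K4 -> (forall Q, (0 < Q)%N -> cabs (S - Spart R C Q) <= K4 * Q%:R `^ (- d0)) ->
 exists delta c : R, [/\ 0 < delta, 0 <= c & forall P : R, 1 <= P ->
  let W := P ^+ s / P ^+ (2 * n) in
  is_true (cabs ((zcount C (truncn P) (Dbox J P))%:R - W%:C%C * S * sintegral C J) <= c * W * P `^ (- delta))].
Proof.
move=> K41 HS.
have [K [K' [K1 K'1 HK]]] := minor_arcs R hrank.
have [c [c0 Hc]] := major_total hrank hJ.
have dp := delta0_gt0 R r.
pose nr : R := n%:R.
have n1 : 1 <= nr by rewrite ler1n.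
have n0 := lt_le_trans ltr01 n1.
(* With this exponent [Q ^+ (2 * n + 3)] has the order of [N ^ (1/4)], well below [P]. *)
pose eta : R := (4 * nr * (2 * n + 3)%:R)^-1.
have e0 : 0 < eta by rewrite /eta invr_gt0; pos.
have e4 : 0 < eta / 4 by rewrite divr_gt0.
(* The logarithms may take [N ^ (eta / 4)], half of the exponent saved by [sqrt H0]. *)
have [L [L1 HL]] := Hn_pw s e4.
pose dl := eta * d0 / 4.
have dl0 : 0 < dl by rewrite /dl divr_gt0 // mulr_gt0.
have d1 : d0 <= 1 / 4 by rewrite /delta0 mul1r lef_pV2 ?posrE ?mulr_gt0 // ler_peMr // ler1n.
have eta1 : eta * nr * (2 * n + 3)%:R = 1 / 4.
 by rewrite /eta; field; rewrite !lt0r_neq0 // ltr0n addn_gt0 orbT.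
have n23 : 1 <= (2 * n + 3)%:R :> R by rewrite ler1n addn_gt0 orbT.
have eta2 : eta * nr <= 1 / 4 by rewrite -eta1 ler_peMr // mulr_ge0 ?(ltW e0) ?(ltW n0).
have eta3 : eta <= 1 / 4 by apply: le_trans eta2; rewrite ler_peMr // ltW.
have dl1 : dl <= eta / 4.
 rewrite /dl ler_pM2r ?invr_gt0 // ler_piMr ?(ltW e0) //; lra.
have dl2 : dl <= eta * nr * (d0 / 2).
 have -> : eta * nr * (d0 / 2) = dl * (2 * nr) by rewrite /dl; field.
 by rewrite ler_peMr ?(ltW dl0) //; lra.
have dl3 : dl <= 3 / 4 by lra.
have dl4 : dl <= 1 by lra.
have K0 := lt_le_trans ltr01 K1.
have K40 : 0 <= K4 by exact: le_trans K41.
have L0 : 0 <= L by exact: le_trans L1.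
have K'0 : 0 <= K' by exact: le_trans K'1.
pose Jc := sintegral C J; pose aJ := cabs Jc; pose aS := cabs S.
have aJ0 : 0 <= aJ by exact: cabs_ge0.
have aS0 : 0 <= aS by exact: cabs_ge0.
pose cL : R := K' * L + c * (K ^+ (2 * n + 3) + 1) + K4 * 2 * aJ.
have cL0 : 0 <= cL by rewrite /cL; pos.
pose P0 : R := 2 * K ^+ 2 + 2.
have P00 : 1 <= P0 by rewrite /P0; have := exprn_ge0 2 (ltW K0); lra.
pose cS : R := (3 ^+ s + aS * aJ) * P0 ^+ (2 * n + 1).
have cS0 : 0 <= cS by rewrite /cS; pos.
exists dl, (cL * 2 + cS); split=> //; first by pos.
move=> P P1 W; pose N := truncn P.
have Pp := lt_le_trans ltr01 P1.
have N1 : 1 <= N%:R :> R by rewrite ler1n truncn_gt0.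
have N0 : 0 < N%:R :> R by exact: lt_le_trans N1.
have NN : (0 < N)%N by rewrite truncn_gt0.
have NP : N%:R <= P by rewrite /N truncn_le ltW.
have W0 : 0 < W by rewrite /W divr_gt0 // exprn_gt0.
have Pd : 0 <= P `^ (- dl) by exact: powR_ge0.
set Z := (zcount C N (Dbox J P))%:R.
(* For bounded [N] the trivial bound suffices, with the constant [cS]. *)
have [big|small] := ltP (2 * K ^+ 2) N%:R; last first.
 have PP0 : P <= P0.
  apply: ltW; apply: lt_le_trans (truncnS_gt P) _; rewrite -/N -natr1 /P0; lra.
 have zb : cabs Z <= 3 ^+ s * P ^+ s.
  rewrite /Z cabs_nat -exprMn.
  apply: (@le_trans _ _ ((2 * N).+1 ^ s)%:R).
   rewrite ler_nat -[X in (_ <= X ^ _)%N]card_ord -[X in (_ <= _ ^ X)%N](card_ord s) -card_ffun; exact: max_card.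
  rewrite natrX; apply: lerXn2r; rewrite ?nnegrE; [by [] | by rewrite mulr_ge0 // ltW |].
  by rewrite -natr1 natrM; lra.
 have pp : P ^+ (2 * n) <= P0 ^+ (2 * n + 1) * P `^ (- dl).
  rewrite pwN // ler_pdivlMr ?pw_gt0 //.
  apply: (@le_trans _ _ (P ^+ (2 * n + 1))); last by apply: lerXn2r => //; rewrite nnegrE ?(ltW Pp) // (le_trans _ P00).
  rewrite exprD expr1; apply: ler_wpM2l; first by rewrite exprn_ge0 // ltW.
  by rewrite -[leRHS]powRr1 ?(ltW Pp) //; apply: ler_powR.
 apply: le_trans (cabsB _ _) _.
 rewrite !cabsM cabs_real (gtr0_norm W0) -/aS -/aJ.
 apply: (@le_trans _ _ (cS * W * P `^ (- dl))); last first.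
  by apply: ler_wpM2r => //; apply: ler_wpM2r; [exact: ltW | rewrite lerDr mulr_ge0].
 have PsW : P ^+ s = W * P ^+ (2 * n) by rewrite /W divfK // expf_neq0 // lt0r_neq0.
 apply: (@le_trans _ _ ((3 ^+ s + aS * aJ) * W * P ^+ (2 * n))); last first.
  have -> : cS * W * P `^ (- dl) = (3 ^+ s + aS * aJ) * W * (P0 ^+ (2 * n + 1) * P `^ (- dl)) by rewrite /cS; ring.
  by apply: ler_wpM2l => //; pos.
 have P2n : 1 <= P ^+ (2 * n) by exact: exprn_ege1.
 have -> : (3 ^+ s + aS * aJ) * W * P ^+ (2 * n) = 3 ^+ s * (W * P ^+ (2 * n)) + W * aS * aJ * P ^+ (2 * n) by ring.
 apply: lerD; first by rewrite -PsW.
 by rewrite ler_peMr //; pos.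
pose H0 : R := N%:R `^ eta.
have H01 : 1 <= H0 by apply: pw_ge1 => //; exact: ltW.
have H00 := lt_le_trans ltr01 H01.
have H0N : H0 <= N%:R `^ (2 / r.+2%:R).
 apply: ler_powR => //; apply: (@le_trans _ _ (nr^-1)).
  by rewrite -[leRHS]mul1r ler_pdivlMr //; lra.
 by rewrite ler_pdivlMr // ler_pdivrMl // /nr -natr1 mulr_natr mulr2n; lra.
pose Q := K * H0 ^+ n.
have H0n : H0 ^+ n = N%:R `^ (eta * nr) by rewrite pw_nat ?(ltW H00) // -powRrM.
have Hn1 : 1 <= H0 ^+ n by exact: exprn_ege1.
have Q1 : 1 <= Q by rewrite /Q -[1]mulr1; apply: ler_pM.
have Qp := lt_le_trans ltr01 Q1.
have QN : 2 * Q ^+ 2 < N%:R ^+ 2.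
 have h1 : (H0 ^+ n) ^+ 2 <= N%:R.
  rewrite H0n pw_nat ?powR_ge0 // -powRrM -[leRHS]powRr1 ?(ltW N0) //.
  by apply: ler_powR => //; lra.
 rewrite /Q exprMn mulrA; apply: le_lt_trans (_ : 2 * K ^+ 2 * N%:R < _).
  by apply: ler_wpM2l => //; rewrite mulr_ge0 // sqr_ge0.
 by rewrite [ltRHS]expr2 ltr_pM2r.
have [M [M0 BM HM]] := Hc P Q (N%:R ^+ 2 + 2 * csize R C * N%:R ^+ 2) P1 Q1 QN.
move: HM => /=; rewrite -/N -/W => HM.
have Mr : 0 < M%:R :> R by rewrite ltr0n.
have cs0 := csize_ge0 R C.
have NM : (N ^ 2 <= M)%N.
 by rewrite -(ler_nat R) natrX; apply: le_trans BM; rewrite lerDl; pos.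
have CM : 2 * csize R C * N%:R ^+ 2 <= M%:R.
 by apply: le_trans BM; rewrite lerDr sqr_ge0.
have gD : good_box N (Dbox J P) by exact: good_Dbox.
have Hmin := HK N M H0 (Dbox J P) NN NM gD H01 H0N.
have Hz := zcount_esum (Dbox J P) M0 CM.
pose E (k : pts n M) := esum C N (Dbox J P) (fun i => (k i)%:R / M%:R : R).
pose maj (k : pts n M) := majorb K H0 N (fracs M k).
have ZE : Z = M%:R ^- n * (\sum_(k | maj k) E k) + M%:R ^- n * (\sum_(k | ~~ maj k) E k).
 rewrite -mulrDr; have -> : \sum_(k | maj k) E k + \sum_(k | ~~ maj k) E k = \sum_k E k by rewrite [RHS](bigID maj).
 have Hz' : \sum_k E k = M%:R ^+ n * Z := Hz.
 by rewrite Hz' mulrA mulVf ?mul1r // expf_neq0 // pnatr_eq0 -lt0n.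
rewrite -big_mkcond in HM.
have {HM} HM : cabs (M%:R ^- n * (\sum_(k | maj k) E k) - W%:C%C * Spart R C (truncn Q) * Jc) <=
 W * (c * (Q ^+ (2 * n + 3) / P + Q `^ (- (d0 / 2)))) by exact: HM.
have Nx (x : R) : dl <= x -> N%:R `^ (- x) <= N%:R `^ (- dl) by move=> hx; apply: ler_powR => //; rewrite lerN2.
have QP : Q ^+ (2 * n + 3) / P <= K ^+ (2 * n + 3) * N%:R `^ (- dl).
 rewrite /Q exprMn -mulrA; apply: ler_wpM2l; first by rewrite exprn_ge0 // ltW.
 rewrite H0n pw_nat ?powR_ge0 // -powRrM eta1.
 apply: (@le_trans _ _ (N%:R `^ (1 / 4) / N%:R)).
  by apply: ler_wpM2l; [exact: powR_ge0 | rewrite lef_pV2].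
 have -> : N%:R `^ (1 / 4) / N%:R = N%:R `^ (- (3 / 4)) :> R.
  have p1 : N%:R `^ 1 = N%:R :> R by rewrite powRr1 // ltW.
  have -> : N%:R `^ (1 / 4) = N%:R `^ (- (3 / 4)) * N%:R `^ 1 :> R.
   by rewrite -pwD //; congr (_ `^ _); lra.
  by rewrite p1 mulfK // lt0r_neq0.
 exact: Nx.
have Qd x : 0 <= x -> dl <= eta * nr * x -> Q `^ (- x) <= N%:R `^ (- dl).
 move=> x0 hx; apply: (@le_trans _ _ (N%:R `^ (- (eta * nr * x)))); last exact: Nx.
 rewrite !pwN // lef_pV2 ?posrE ?pw_gt0 // powRrM -H0n.
 apply: ge0_ler_powR => //; rewrite ?nnegrE ?(ltW Qp) //; first by rewrite exprn_ge0 // ltW.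
 by rewrite /Q ler_peMl // exprn_ge0 // ltW.
have dp2 : 0 <= d0 / 2 by rewrite divr_ge0 // ltW.
have HM2 : cabs (M%:R ^- n * (\sum_(k | maj k) E k) - W%:C%C * Spart R C (truncn Q) * Jc) <=
 W * (c * (K ^+ (2 * n + 3) + 1) * N%:R `^ (- dl)).
 apply: le_trans HM _; apply: ler_wpM2l; first exact: ltW.
 rewrite -[leRHS]mulrA; apply: ler_wpM2l => //; rewrite mulrDl mul1r; apply: lerD => //.
 exact: Qd.
have Q2 : Q <= 2 * (truncn Q)%:R.
 apply: ltW; apply: lt_le_trans (truncnS_gt Q) _; rewrite -natr1 mulr_natl mulr2n lerD2l //.
 by rewrite ler1n truncn_gt0.
have HS2 : cabs (W%:C%C * (S - Spart R C (truncn Q)) * Jc) <= W * (K4 * 2 * aJ * N%:R `^ (- dl)).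
 rewrite !cabsM cabs_real (gtr0_norm W0) -mulrA; apply: ler_wpM2l; first exact: ltW.
 rewrite -/aJ mulrAC; apply: ler_wpM2r => //.
 have TQ : (0 < truncn Q)%N by rewrite truncn_gt0.
 apply: le_trans (HS _ TQ) _; rewrite -mulrA; apply: ler_wpM2l => //.
 have d01 : d0 <= 1 by lra.
 apply: le_trans (pw_shift Q1 (ltW dp) d01) _; apply: ler_wpM2l => //.
 apply: Qd; first exact: ltW.
 apply: le_trans dl2 _; apply: ler_wpM2l; first by rewrite mulr_ge0 // ltW.
 by lra.
(* The exponent [s - 2n] is positive by [many_variables], so passing from [N] to [P] only increases
   the power. *)
have Wmin : N%:R ^+ s / N%:R ^+ (2 * n) <= W.
 have e1 (x : R) : 0 < x -> x ^+ s / x ^+ (2 * n) = x ^+ (s - 2 * n).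
  by move=> x0; rewrite -{1}(subnK (ltnW many_variables)) exprD mulfK // expf_neq0 // lt0r_neq0.
 by rewrite /W !e1 //; apply: lerXn2r => //; rewrite nnegrE ltW.
have Hmin2 : cabs (M%:R ^- n * (\sum_(k | ~~ maj k) E k)) <= W * (K' * L * N%:R `^ (- dl)).
 rewrite cabsM cabsV cabsX cabs_nat.
 apply: (@le_trans _ _ (M%:R ^- n * (K' * M%:R ^+ n * N%:R ^+ s / N%:R ^+ (2 * n) * Num.sqrt (Hn R N ^+ s) / Num.sqrt H0))).
  apply: ler_wpM2l; first by rewrite invr_ge0 exprn_ge0.
  exact: le_trans (cabs_sum _ _ _) Hmin.
 have Mn : 0 < M%:R ^+ n :> R by rewrite exprn_gt0.
 have sH : 0 < Num.sqrt H0 by rewrite sqrtr_gt0.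
 have -> : M%:R ^- n * (K' * M%:R ^+ n * N%:R ^+ s / N%:R ^+ (2 * n) * Num.sqrt (Hn R N ^+ s) / Num.sqrt H0) =
  (N%:R ^+ s / N%:R ^+ (2 * n)) * (K' * (Num.sqrt (Hn R N ^+ s) / Num.sqrt H0)).
  move: (M%:R ^+ n) Mn => mm Mn; move: (N%:R ^+ s) (N%:R ^+ (2 * n))^-1 (Num.sqrt (Hn R N ^+ s)) (Num.sqrt H0)^-1 => a1 a2 a3 a4.
  by rewrite !mulrA; field; rewrite lt0r_neq0.
 have b0 : 0 <= K' * (Num.sqrt (Hn R N ^+ s) / Num.sqrt H0).
  by apply: mulr_ge0 => //; apply: divr_ge0; exact: sqrtr_ge0.
 apply: ler_pM; [by pos | exact: b0 | exact: Wmin |].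
 rewrite -[leRHS]mulrA; apply: ler_wpM2l => //.
 rewrite ler_pdivrMr //; apply: le_trans (HL N NN) _; rewrite -mulrA; apply: ler_wpM2l => //.
 rewrite pw_sqrt ?(ltW H00) // -powRrM -pwD //; apply: ler_powR => //; lra.
have -> : Z - W%:C%C * S * Jc = M%:R ^- n * (\sum_(k | ~~ maj k) E k) +
  ((M%:R ^- n * (\sum_(k | maj k) E k) - W%:C%C * Spart R C (truncn Q) * Jc) -
  (W%:C%C * (S - Spart R C (truncn Q)) * Jc)).
 rewrite ZE; set a := M%:R ^- n * _; set b := M%:R ^- n * _; set w := W%:C%C; ring.
apply: le_trans (cabsD _ _) _; apply: le_trans (lerD Hmin2 (le_trans (cabsB _ _) (lerD HM2 HS2))) _.
have -> : W * (K' * L * N%:R `^ (- dl)) + (W * (c * (K ^+ (2 * n + 3) + 1) * N%:R `^ (- dl)) + W * (K4 * 2 * aJ * N%:R `^ (- dl))) =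
 W * cL * N%:R `^ (- dl) by rewrite /cL; ring.
have -> : (cL * 2 + cS) * W * P `^ (- dl) = W * cL * (2 * P `^ (- dl)) + cS * W * P `^ (- dl) by ring.
rewrite -[leLHS]addr0; apply: lerD; last by pos.
apply: ler_wpM2l; first by pos.
exact: pw_shift P1 (ltW dl0) dl4.
Qed.

End Asymptotic.

(** * Approximate zeros over a complete valued field *)

Section Valued.
Variable R : realType.

(** The common ground of the reals and of Q_p: a multiplicative absolute value with the plain
    triangle inequality. Completeness is stated for sequences with geometrically decreasing steps,
    which is what a contraction by 1/2 produces. *)
Record valued (K : fieldType) (nu : K -> R) : Prop := Valued {
 val_eq0 : forall x, nu x = 0 <-> x = 0;
 val_ge0 : forall x, 0 <= nu x;
 valM : forall x y, nu (x * y) = nu x * nu y;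
 valD : forall x y, nu (x + y) <= nu x + nu y;
 val_complete : forall (u : nat -> K) (A : R), (forall k, nu (u k.+1 - u k) <= A / 2 ^+ k) ->
  exists l, forall k, nu (l - u k) <= 2 * A / 2 ^+ k }.

Variables (K : fieldType) (nu : K -> R).
Hypothesis hv : valued nu.

Lemma val0 : nu 0 = 0. Proof. exact/(val_eq0 hv). Qed.
Lemma val1 : nu 1 = 1.
Proof.
have h : nu 1 * nu 1 = nu 1 by rewrite -(valM hv) mul1r.
have n0 : nu 1 != 0 by apply/eqP => /(val_eq0 hv)/eqP; rewrite oner_eq0.
by apply: (mulfI n0); rewrite h mulr1.
Qed.

Lemma valN x : nu (- x) = nu x.
Proof.
have h : nu (-1) * nu (-1) = 1 by rewrite -(valM hv) mulrNN mul1r val1.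
have h1 : nu (-1) = 1.
 apply/eqP; rewrite -(@eqrXn2 _ 2) ?(val_ge0 hv) // expr1n expr2 h //.
by rewrite -mulN1r (valM hv) h1 mul1r.
Qed.

Lemma valB x y : nu (x - y) <= nu x + nu y.
Proof. by rewrite -(valN y); exact: (valD hv). Qed.
Lemma valBC x y : nu (x - y) = nu (y - x). Proof. by rewrite -valN opprB. Qed.
Lemma val_sum I (r : seq I) (P : pred I) (F : I -> K) :
 nu (\sum_(i <- r | P i) F i) <= \sum_(i <- r | P i) nu (F i).
Proof.
elim/big_rec2: _ => [|i x y _ h]; first by rewrite val0.
by apply: le_trans (valD hv _ _) _; rewrite lerD2l.
Qed.

Lemma valV x : nu x^-1 = (nu x)^-1.
Proof.
case: (eqVneq x 0) => [->|x0]; first by rewrite invr0 val0 invr0.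
have n0 : nu x != 0 by apply/eqP => /(val_eq0 hv)/eqP; rewrite (negbTE x0).
by apply: (mulfI n0); rewrite -(valM hv) !mulfV // val1.
Qed.

Definition vle m n (u : 'M[K]_(m, n)) (c : R) := forall i j, nu (u i j) <= c.
Lemma vleD m n (u v : 'M[K]_(m, n)) a b : vle u a -> vle v b -> vle (u + v) (a + b).
Proof. by move=> hu hv' i j; rewrite mxE; apply: le_trans (valD hv _ _) _; exact: lerD. Qed.
Lemma vleB m n (u v : 'M[K]_(m, n)) a b : vle u a -> vle v b -> vle (u - v) (a + b).
Proof. by move=> hu hv' i j; rewrite !mxE; apply: le_trans (valB _ _) _; exact: lerD. Qed.
Lemma vleM m n p (u : 'M[K]_(m, n)) (v : 'M[K]_(n, p)) a b : 0 <= a -> vle u a -> vle v b ->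
 vle (u *m v) (n%:R * (a * b)).
Proof.
move=> a0 hu hv' i j; rewrite mxE; apply: le_trans (val_sum _ _ _) _.
apply: (@le_trans _ _ (\sum_(k < n) a * b)); last by rewrite sumr_const card_ord mulr_natl.
apply: ler_sum => k _; rewrite (valM hv); apply: ler_pM => //; exact: (val_ge0 hv).
Qed.

Lemma vle_trans m n (u : 'M[K]_(m, n)) a b : vle u a -> a <= b -> vle u b.
Proof. by move=> hu ab i j; exact: le_trans (hu i j) ab. Qed.
Lemma vle_ex m n (u : 'M[K]_(m, n)) : exists c, 1 <= c /\ vle u c.
Proof.
exists (1 + \sum_i \sum_j nu (u i j)); split.
 by rewrite lerDl; apply: sumr_ge0 => i _; apply: sumr_ge0 => j _; exact: (val_ge0 hv).
move=> i j; rewrite (bigD1 i) //= (bigD1 j) //=.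
have h1 : 0 <= \sum_(j0 < n | j0 != j) nu (u i j0) by apply: sumr_ge0 => k _; exact: (val_ge0 hv).
have h2 : 0 <= \sum_(i0 < m | i0 != i) \sum_j0 nu (u i0 j0).
 by apply: sumr_ge0 => k _; apply: sumr_ge0 => l _; exact: (val_ge0 hv).
by lra.
Qed.

Lemma vle_family (I : finType) m n (Q : I -> 'M[K]_(m, n)) : exists c, 1 <= c /\ forall i, vle (Q i) c.
Proof.
have /choice[c hc] : forall i, exists c, 1 <= c /\ vle (Q i) c by move=> i; exact: vle_ex.
have c0 i : 0 <= c i by apply: le_trans (hc i).1.
exists (1 + \sum_i c i); split; first by rewrite lerDl sumr_ge0.
move=> i; apply: vle_trans (hc i).2 _; rewrite (bigD1 i) //=.
have : 0 <= \sum_(j | j != i) c j by apply: sumr_ge0.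
lra.
Qed.

Lemma val_small x : (forall e, 0 < e -> nu x <= e) -> x = 0.
Proof.
move=> h; apply/(val_eq0 hv)/eqP; rewrite eq_le (val_ge0 hv) andbT.
by apply/ler_addgt0Pr => e e0; rewrite add0r; exact: h.
Qed.

Lemma half_pow_small (A e : R) : 0 < e -> exists k, A / 2 ^+ k <= e.
Proof.
move=> e0; exists (truncn (A / e)).+1.
rewrite ler_pdivrMr ?exprn_gt0 // mulrC -ler_pdivrMr //.
apply: le_trans (ltW (truncnS_gt _)) _; rewrite -natrX ler_nat; exact: ltnW (ltn_expl _ _).
Qed.

Lemma banach n (Phi : 'rV[K]_n -> 'rV[K]_n) (rho : R) : 0 <= rho ->
 (forall u, vle u rho -> vle (Phi u) rho) ->
 (forall u v d, vle u rho -> vle v rho -> vle (u - v) d -> vle (Phi u - Phi v) (d / 2)) ->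
 exists u, vle u rho /\ Phi u = u.
Proof.
move=> r0 hb hc.
pose u k := iter k Phi 0.
have ub k : vle (u k) rho.
 elim: k => [|k IH]; [by move=> i j; rewrite mxE val0 | exact: hb].
have ud k : vle (u k.+1 - u k) (2 * rho / 2 ^+ k).
 elim: k => [|k IH].
  by rewrite expr0 divr1 mulr_natl mulr2n; apply: vleB; exact: ub.
 have := hc _ _ _ (ub k.+1) (ub k) IH; rewrite exprS invfM [2^-1 * _]mulrC mulrA; exact.
have /choice[l hl] : forall j : 'I_n, exists l, forall k, nu (l - u k 0 j) <= 2 * (2 * rho) / 2 ^+ k.
 by move=> j; apply: (val_complete hv) => k; have := ud k 0 j; rewrite !mxE.
pose L : 'rV[K]_n := \row_j l j.
have hL k : vle (L - u k) (2 * (2 * rho) / 2 ^+ k) by move=> i j; rewrite !mxE !ord1; exact: hl.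
have Lb : vle L rho.
 move=> i j; apply/ler_addgt0Pr => e e0; have [k hk] := half_pow_small (2 * (2 * rho)) e0.
 have -> : L i j = (L - u k) i j + u k i j by rewrite !mxE subrK.
 apply: le_trans (valD hv _ _) _; rewrite addrC; apply: lerD; first exact: ub.
 exact: le_trans (hL k i j) hk.
exists L; split=> //; apply/matrixP => i j; apply/eqP; rewrite -subr_eq0; apply/eqP; apply: val_small => e e0.
have e2 : 0 < e / 2 by rewrite divr_gt0.
have [k hk] := half_pow_small (2 * (2 * rho)) e2.
have h1 := hc _ _ _ Lb (ub k) (hL k) i j; have h2 := hL k.+1 i j.
have -> : Phi L i j - L i j = (Phi L - Phi (u k)) i j - (L - u k.+1) i j.
 by rewrite !mxE /=; ring.
apply: le_trans (valB _ _) _; rewrite [e]splitr; apply: lerD.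
 apply: le_trans h1 _; apply: le_trans hk; rewrite ler_pdivrMr // ler_peMr ?ler1n //.
 by rewrite divr_ge0 ?mulr_ge0 // exprn_ge0.
apply: le_trans h2 _; apply: le_trans hk; apply: ler_wpM2l; first by rewrite !mulr_ge0.
by rewrite lef_pV2 ?posrE ?exprn_gt0 // ler_eXn2l // ltr1n.
Qed.

Definition bil s (A : 'M[K]_s) (x y : 'rV[K]_s) : K := (x *m A *m y^T) 0 0.
Definition qd s (A : 'M[K]_s) (x : 'rV[K]_s) : K := bil A x x.
Lemma bilDl s (A : 'M[K]_s) x y z : bil A (x + y) z = bil A x z + bil A y z.
Proof. by rewrite /bil !mulmxDl mxE. Qed.
Lemma bilDr s (A : 'M[K]_s) x y z : bil A z (x + y) = bil A z x + bil A z y.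
Proof. by rewrite /bil linearD /= mulmxDr mxE. Qed.
Lemma bilZl s (A : 'M[K]_s) a x z : bil A (a *: x) z = a * bil A x z.
Proof. by rewrite /bil -!scalemxAl mxE. Qed.
Lemma bilZr s (A : 'M[K]_s) a x z : bil A z (a *: x) = a * bil A z x.
Proof. by rewrite /bil linearZ /= -!scalemxAr mxE. Qed.
Lemma bilNr s (A : 'M[K]_s) x z : bil A z (- x) = - bil A z x.
Proof. by rewrite -scaleN1r bilZr mulN1r. Qed.
Lemma bil_tr s (A : 'M[K]_s) x z : bil A^T x z = bil A z x.
Proof. by rewrite /bil -[in RHS](trmxK (z *m A *m x^T)) [in RHS]mxE !trmx_mul trmxK mulmxA. Qed.
Lemma bilA s (A B : 'M[K]_s) x z : bil (A + B) x z = bil A x z + bil B x z.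
Proof. by rewrite /bil mulmxDr mulmxDl mxE. Qed.
Lemma bil_le s (A : 'M[K]_s) c : vle A c -> 0 <= c -> forall x y a b, 0 <= a -> vle x a -> vle y b -> 0 <= b ->
 nu (bil A x y) <= s%:R ^+ 2 * c * a * b.
Proof.
move=> hA c0 x y a b a0 hx hy b0.
have h1 := vleM a0 hx hA.
have ac : 0 <= s%:R * (a * c) by rewrite !mulr_ge0.
have hy' : vle y^T b by move=> i j; rewrite mxE.
have := vleM ac h1 hy' 0 0; rewrite /bil => h; apply: le_trans h _.
by apply: eqle; ring.
Qed.

Definition pol s (A : 'M[K]_s) := A + A^T.
Lemma qdD s (A : 'M[K]_s) x y : qd A (x + y) = qd A x + bil (pol A) x y + qd A y.
Proof. by rewrite /qd bilDl !bilDr bilA bil_tr; ring. Qed.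
Lemma qd_near_zero s (A : 'M[K]_s) y z : qd A z = 0 -> qd A y = bil A y (y - z) + bil A (y - z) z.
Proof.
move=> z0; have bN : bil A (- z) z = - qd A z by rewrite -scaleN1r bilZl mulN1r.
by rewrite bilDr bilNr bilDl bN z0 /qd; ring.
Qed.

Lemma qd_int s (C : 'M[int]_s) (x : 'rV[K]_s) : qd (map_mx intr C) x = qf C (x 0).
Proof.
rewrite /qd /bil /qf mxE [RHS]exchange_big /=; apply: eq_bigr => k _.
rewrite !mxE mulr_suml; apply: eq_bigr => j _; rewrite !mxE; ring.
Qed.

Definition jac n s (A : 'I_n -> 'M[K]_s) (x : 'rV[K]_s) : 'M[K]_(n, s) := \matrix_(i, j) (x *m pol (A i)) 0 j.

Section SolveNear.
Variables (n s : nat) (A : 'I_n -> 'M[K]_s) (x : 'rV[K]_s) (W : 'M[K]_(n, s)).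
Hypothesis hW : forall i u, bil (pol (A i)) x (u *m W) = u 0 i.

(** Newton's method with the derivative frozen at [x], where [W] is a right inverse of the Jacobian
    matrix. The equation for [u] takes the form [u = t - qd (x + h) - bil (pol A) h (u W) - qd (u
    W)]; the right side is a contraction because its linear part in [u] has the small factor [h] and
    the rest is quadratic. *)
Lemma solve_near : exists e : R, 0 < e /\ forall (eta : R) (h : 'rV[K]_s) (t : 'I_n -> K),
 0 <= eta -> eta <= e -> vle h e -> (forall i, nu (qd (A i) (x + h) - t i) <= eta) ->
 exists u, vle u (2 * eta) /\ forall i, qd (A i) (x + h + u *m W) = t i.
Proof.
have [cW [cW1 hcW]] := vle_ex W.
have [cA [cA1 hA]] := vle_family A; have [cP [cP1 hP]] := vle_family (fun i => pol (A i)).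
pose c : R := cW + cA + cP; have c0 : 0 <= c by rewrite /c; lra.
have wc : vle W c by apply: vle_trans hcW _; rewrite /c; lra.
have Ac i : vle (A i) c by apply: vle_trans (hA i) _; rewrite /c; lra.
have Pc i : vle (pol (A i)) c by apply: vle_trans (hP i) _; rewrite /c; lra.
pose D : R := 1 + s%:R ^+ 2 * c * (n%:R * c) ^+ 2 + s%:R ^+ 2 * c * (n%:R * c).
have t1 : 0 <= s%:R ^+ 2 * c * (n%:R * c) ^+ 2 by pos.
have t2 : 0 <= s%:R ^+ 2 * c * (n%:R * c) by pos.
have D0 : 0 < D by rewrite /D; lra.
have D1 : s%:R ^+ 2 * c * (n%:R * c) ^+ 2 <= D by rewrite /D; lra.
have D2 : s%:R ^+ 2 * c * (n%:R * c) <= D by rewrite /D; lra.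
have uW (u : 'rV[K]_n) a : 0 <= a -> vle u a -> vle (u *m W) (n%:R * (a * c)) by move=> a0 hu; exact: vleM.
have bW i y z a b : 0 <= a -> 0 <= b -> vle y a -> vle z b -> nu (bil (A i) (y *m W) (z *m W)) <= D * (a * b).
 move=> a0 b0 hy hz.
 have ha : 0 <= n%:R * (a * c) by pos.
 have hb : 0 <= n%:R * (b * c) by pos.
 apply: le_trans (bil_le (Ac i) c0 ha (uW y a a0 hy) (uW z b b0 hz) hb) _.
 have -> : s%:R ^+ 2 * c * (n%:R * (a * c)) * (n%:R * (b * c)) = s%:R ^+ 2 * c * (n%:R * c) ^+ 2 * (a * b) by ring.
 by apply: ler_wpM2r => //; pos.
have pW i h z a b : 0 <= a -> 0 <= b -> vle h a -> vle z b -> nu (bil (pol (A i)) h (z *m W)) <= D * (a * b).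
 move=> a0 b0 hh hz.
 have hb : 0 <= n%:R * (b * c) by pos.
 apply: le_trans (bil_le (Pc i) c0 a0 hh (uW z b b0 hz) hb) _.
 have -> : s%:R ^+ 2 * c * a * (n%:R * (b * c)) = s%:R ^+ 2 * c * (n%:R * c) * (a * b) by ring.
 by apply: ler_wpM2r => //; pos.
(* With [D * e = 1/16] the map keeps the ball of radius [2 * eta] stable ([1 + 1/8 + 1/4 <= 2]) and
   contracts by [5/16]. *)
pose e := (16 * D)^-1.
have e0 : 0 < e by rewrite /e invr_gt0 mulr_gt0.
have De : D * e = 1 / 16 by rewrite /e; field; rewrite lt0r_neq0.
exists e; split=> // eta h t eta0 eta1 hh ht.
pose Phi (u : 'rV[K]_n) : 'rV[K]_n := \row_i (t i - qd (A i) (x + h) - bil (pol (A i)) h (u *m W) - qd (A i) (u *m W)).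
have rho0 : 0 <= 2 * eta by rewrite mulr_ge0.
have Deta : D * eta <= 1 / 16 by rewrite -De; apply: ler_wpM2l => //; exact: ltW.
have hb u : vle u (2 * eta) -> vle (Phi u) (2 * eta).
 move=> hu i j; rewrite !mxE.
 have h1 := pW j h u e (2 * eta) (ltW e0) rho0 hh hu.
 have h2 := bW j u u (2 * eta) (2 * eta) rho0 rho0 hu hu.
 have h0 := ht j; rewrite valBC in h0.
 apply: le_trans (valB _ _) _; apply: le_trans (lerD (le_trans (valB _ _) (lerD h0 h1)) h2) _.
 have -> : D * (e * (2 * eta)) = (D * e) * (2 * eta) by ring.
 have -> : D * (2 * eta * (2 * eta)) = (D * eta) * (4 * eta) by ring.
 have := ler_wpM2r (mulr_ge0 (ler0n R 4) eta0) Deta.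
 rewrite De; lra.
have hc u v d : vle u (2 * eta) -> vle v (2 * eta) -> vle (u - v) d -> vle (Phi u - Phi v) (d / 2).
 move=> hu hv' hd i j; have d0 : 0 <= d.
  by have := hd i j; apply: le_trans; exact: (val_ge0 hv).
 rewrite !mxE.
 have -> : t j - qd (A j) (x + h) - bil (pol (A j)) h (u *m W) - qd (A j) (u *m W) -
  (t j - qd (A j) (x + h) - bil (pol (A j)) h (v *m W) - qd (A j) (v *m W)) =
  - bil (pol (A j)) h ((u - v) *m W) - (bil (A j) (u *m W) ((u - v) *m W) + bil (A j) ((u - v) *m W) (v *m W)).
  by rewrite /qd !mulmxBl -!scaleN1r !bilDr !bilDl !bilZr !bilZl; ring.
 have h1 := pW j h (u - v) e d (ltW e0) d0 hh hd.
 have h2 := bW j u (u - v) (2 * eta) d rho0 d0 hu hd.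
 have h3 := bW j (u - v) v d (2 * eta) d0 rho0 hd hv'.
 apply: le_trans (valB _ _) _; rewrite valN.
 apply: le_trans (lerD h1 (le_trans (valD hv _ _) (lerD h2 h3))) _.
 have -> : D * (e * d) = (D * e) * d by ring.
 have -> : D * (2 * eta * d) = (D * eta) * (2 * d) by ring.
 have -> : D * (d * (2 * eta)) = (D * eta) * (2 * d) by ring.
 have := ler_wpM2r (mulr_ge0 (ler0n R 2) d0) Deta.
 rewrite De; lra.
have [u [hu Pu]] := banach rho0 hb hc.
exists u; split=> // i.
have := congr1 (fun w : 'rV[K]_n => w 0 i) Pu; rewrite mxE => e1.
rewrite qdD [bil _ (x + h) _]bilDl hW -e1; ring.
Qed.

End SolveNear.

(** Independent columns, indexed by [f], are inverted, and [W] is zero in all others: a correction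
    along [W] leaves the free coordinates unchanged. *)
Lemma pivot_inverse n s (N : 'M[K]_(n, s)) : \rank N = n ->
 exists (f : 'I_n -> 'I_s) (W : 'M[K]_(n, s)), [/\ injective f,
  (forall i u, (u *m W *m N^T) 0 i = (u : 'rV[K]_n) 0 i) &
  forall k j, (forall i, f i != j) -> W k j = 0].
Proof.
move=> rN; have rf : row_full N^T by rewrite /row_full mxrank_tr rN.
pose f := fullrankfun rf.
have fu : rowsub f N^T \in unitmx by exact: fullrowsub_unit.
pose V := invmx (rowsub f N^T).
exists f, (V *m (\matrix_(i, j) (f i == j)%:R)); split.
- exact: fullrankfun_inj.
- move=> i u.
 have E : (\matrix_(i0 < n, j < s) (f i0 == j)%:R) *m N^T = rowsub f N^T.
  apply/matrixP => a b; rewrite !mxE (bigD1 (f a)) //= !mxE eqxx mul1r big1 ?addr0 //.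
  by move=> k /negbTE hk; rewrite !mxE eq_sym hk mul0r.
 by rewrite -!mulmxA E mulVmx // mulmx1.
- move=> k j hj; rewrite mxE big1 // => i _; rewrite mxE (negbTE (hj i)) mulr0 //.
Qed.

End Valued.

(** * Lattice points near a nonsingular real zero *)

Section RealValued.
Variable R : realType.

Lemma real_valued : valued (fun x : R => `|x|).
Proof.
split.
- by move=> x; split => [/eqP|->]; [rewrite normr_eq0 => /eqP | rewrite normr0].
- by move=> x; exact: normr_ge0.
- by move=> x y; exact: normrM.
- by move=> x y; exact: ler_normD.
move=> u A h; have A0 : 0 <= A by have := h 0; rewrite expr0 divr1; apply: le_trans.
have c m k : (k <= m)%N -> `|u m - u k| <= 2 * A / 2 ^+ k.
 move=> /subnK <-; move: (m - k)%N => d.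
 suff H : `|u (d + k)%N - u k| <= 2 * A / 2 ^+ k - 2 * A / 2 ^+ (d + k).
  by apply: le_trans H _; rewrite gerBl divr_ge0 ?mulr_ge0 // exprn_ge0.
 elim: d => [|d IH]; first by rewrite add0n !subrr normr0.
 rewrite addSn; have -> : u (d + k).+1 - u k = (u (d + k).+1 - u (d + k)%N) + (u (d + k)%N - u k) by ring.
 apply: le_trans (ler_normD _ _) _; apply: le_trans (lerD (h _) IH) _.
 rewrite exprS; set p := 2 ^+ (d + k); have p0 : 0 < p by rewrite /p exprn_gt0.
 apply: eqle; field; rewrite (lt0r_neq0 p0) expf_neq0 //.
have h1 (m k : nat) : (k <= m)%N -> cabs (((u m)%:C)%C - ((u k)%:C)%C) <= 2 * A / 2 ^+ k.
 by move=> km; rewrite -rmorphB cabs_real; exact: c.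
have h2 (e : R) : 0 < e -> exists k, 2 * A / 2 ^+ k < e.
 move=> e0; have e2 : 0 < e / 2 by rewrite divr_gt0.
 have [k hk] := half_pow_small (2 * A) e2; exists k; apply: le_lt_trans hk _.
 by rewrite ltr_pdivrMr // ltr_pMr // ltr1n.
have [l [_ hk]] := complex_cauchy h1 h2.
exists (Re l) => k; apply: le_trans (hk k).
by have := cabs_Re (l - ((u k)%:C)%C); rewrite raddfB.
Qed.

End RealValued.

Section NearZero.
Variables (R : realType) (n s : nat) (A : 'I_n -> 'M[R]_s) (x : 'rV[R]_s).
Hypothesis hx : forall i, qd (A i) x = 0.
Hypothesis rk : \rank (jac A x) = n.

Lemma gradient_bil (W : 'M[R]_(n, s)) :
 (forall i (u : 'rV[R]_n), (u *m W *m (\matrix_(i, j) (x *m pol (A i)) 0 j)^T) 0 i = u 0 i) ->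
 forall i u, bil (pol (A i)) x (u *m W) = u 0 i.
Proof.
move=> h i u; rewrite -[RHS]h /bil !mxE; apply: eq_bigr => k _.
by rewrite !mxE mulrC.
Qed.

End NearZero.

Lemma card_prod_ffun s m (F : 'I_s -> pred 'I_m) :
 #|[pred p : pts s m | [forall j, F j (p j)]]| = (\prod_j #|F j|)%N.
Proof.
transitivity (\sum_(p : pts s m) \prod_j (F j (p j) : nat))%N.
 rewrite -sum1_card big_mkcond /=; apply: eq_bigr => p _; rewrite inE.
 case: forallP => [h|/forallP]; first by rewrite big1 // => j _; rewrite h.
 by rewrite negb_forall => /existsP[j /negbTE hj]; rewrite (bigD1 j) //= hj mul0n.
rewrite -(bigA_distr_bigA (fun j k => (F j k : nat))) /=; apply: eq_bigr => j _.
rewrite -sum1_card [RHS]big_mkcond /=; apply: eq_bigr => k _.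
by rewrite unfold_in; case: (F j k).
Qed.

Lemma card_predC (T : finType) (P : pred T) : #|predC P| = (#|T| - #|P|)%N.
Proof. by rewrite -(cardC P) addKn. Qed.
Lemma lat_count (R : realType) (c0 sg y dl : R) m : 0 < sg -> 2 * sg <= dl -> c0 <= y - dl -> y + dl <= c0 + sg * m%:R ->
 dl / sg <= #|[pred p : 'I_m | `|c0 + sg * p%:R - y| <= dl]|%:R.
Proof.
move=> s0 sd h1 h2; pose x := dl / sg.
have dl0 : 0 < dl by apply: lt_le_trans sd; rewrite mulr_gt0.
have x2 : 2 <= x by rewrite /x ler_pdivlMr.
have xE : dl = x * sg by rewrite /x divfK // lt0r_neq0.
pose a := (y - dl - c0) / sg.
have aE : y - dl - c0 = a * sg by rewrite /a divfK // lt0r_neq0.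
have a0 : 0 <= a by rewrite /a divr_ge0 ?(ltW s0) // subr_ge0.
pose N0 := (truncn a).+1; pose t := truncn (2 * x - 1).
have N1 : a < N0%:R by exact: truncnS_gt.
have N2 : N0%:R <= a + 1 by rewrite /N0 -natr1 lerD2r truncn_le.
have t0 : 0 <= 2 * x - 1 by lra.
have t1 : t%:R <= 2 * x - 1 by rewrite truncn_le.
have t2 : 2 * x - 1 < t%:R + 1 by rewrite natr1; exact: truncnS_gt.
have lm (i : 'I_t) : (N0 + i < m)%N.
 rewrite -(ltr_nat R) -(ltr_pM2l s0) natrD.
 have hi : i.+1%:R <= t%:R :> R by rewrite ler_nat.
 rewrite -natr1 in hi.
 have : (N0%:R + i%:R) * sg < m%:R * sg.
  apply: (@lt_le_trans _ _ ((a + 2 * x) * sg)); first by rewrite ltr_pM2r //; lra.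
  by rewrite mulrDl -aE; move: h2; rewrite xE; lra.
 by rewrite ![sg * _]mulrC.
pose g (i : 'I_t) : 'I_m := Ordinal (lm i).
have gi : injective g by move=> i j /(congr1 val) /= /addnI /val_inj.
have : (#|codom g| <= #|[pred p : 'I_m | (`|c0 + sg * p%:R - y| <= dl)%R]|)%N.
 apply: subset_leq_card; apply/fintype.subsetP => _ /codomP[i ->]; rewrite inE /= natrD.
 have hi : i.+1%:R <= t%:R :> R by rewrite ler_nat.
 rewrite -natr1 in hi; have i0 : 0 <= i%:R :> R by [].
 have -> : c0 + sg * (N0%:R + i%:R) - y = (N0%:R + i%:R - a) * sg - dl by rewrite mulrBl -aE; ring.
 rewrite xE ler_norml; apply/andP; split.
  by rewrite lerBrDr addrC subrr mulr_ge0 ?(ltW s0) //; lra.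
 by rewrite lerBlDr -mulrDl ler_pM2r //; lra.
rewrite card_codom // card_ord -(ler_nat R); apply: le_trans; rewrite -/x; lra.
Qed.

Section LatticeCount.
Variables (R : realType) (n s : nat) (A : 'I_n -> 'M[R]_s) (x : 'rV[R]_s).
Hypothesis hx : forall i, qd (A i) x = 0.
Hypothesis rk : \rank (jac A x) = n.
Local Notation hvR := (real_valued R).
Local Notation vleR := (vle (fun x : R => `|x|)).

(* Free coordinates are moved along the lattice; the pivot coordinates [f i] then range over a cube
  of side [eps] around the zero furnished by [solve_near]. *)
Lemma lattice_near_zero : exists c e0 : R, [/\ 0 < c, 0 < e0 & forall (rho eps : R), 0 < rho -> rho <= e0 ->
 (forall j, `|x 0 j| + 2 * rho <= 1) -> 0 < eps -> eps <= rho ->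
 exists k0 : nat, (0 < k0)%N /\ forall k : nat, (k0 <= k)%N ->
  c * rho ^+ (s - n) * eps ^+ n * k%:R ^+ s <=
  #|[pred p : pts s (3 * k) | [forall j, `|tnth (lat (fun=> -1) k%:R^-1 p) j - x 0 j| <= 2 * rho] &&
   [forall i, `|qd (A i) (\row_j tnth (lat (fun=> -1) k%:R^-1 p) j)| <= eps]]|%:R].
Proof.
have [f [W [fi hW Wf]]] := pivot_inverse rk.
have [e [ep He]] := solve_near hvR (gradient_bil hW).
have [cW [cW1 hcW]] := vle_ex hvR W.
have [cA' [cA1 hA']] := vle_family hvR A; have [cP [cP1 hP']] := vle_family hvR (fun i => pol (A i)).
pose cA : R := cA' + cP; have cAp : 0 <= cA by rewrite /cA; lra.
have hA i : vleR (A i) cA by apply: vle_trans (hA' i) _; rewrite /cA; lra.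
have hP i : vleR (pol (A i)) cA by apply: vle_trans (hP' i) _; rewrite /cA; lra.
pose C1 : R := 1 + 2 * s%:R ^+ 2 * cA.
have C11 : 1 <= C1 by rewrite /C1 lerDl; pos.
pose C2 : R := 4 * (n%:R + 1) * cW * C1.
have n1 : 1 <= n%:R + 1 :> R by rewrite lerDr.
have C21 : 4 <= C2.
 have h1 : 1 <= (n%:R + 1) * cW * C1 by rewrite !mulr_ege1.
 by rewrite /C2 -[4 * _ * _]mulrA -[4 * _ * _]mulrA; lra.
pose C3 : R := 2 + 4 * s%:R ^+ 2 * cA.
have C32 : 2 <= C3 by rewrite /C3 lerDl; pos.
have C2p : 0 < C2 by lra.
have C3p : 0 < C3 by lra.
(* [C2] limits the motion of the free coordinates so that the zero stays within [rho / 2] of [x];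
   [C3] bounds the variation of the forms, so that pivots within [eps / C3] of the zero keep them
   below [eps]. *)
exists (C2 ^- (s - n) * C3 ^- n), (Num.min e 1); split; [by rewrite mulr_gt0 // invr_gt0 exprn_gt0 | by rewrite lt_min ep ltr01 |].
move=> rho eps r0; rewrite le_min => /andP[re r1] hr eps0 er.
pose rp := rho / C2; pose dl := eps / C3.
have rp0 : 0 < rp by rewrite divr_gt0.
have dl0 : 0 < dl by rewrite divr_gt0.
have rpE : rho = rp * C2 by rewrite /rp divfK // lt0r_neq0.
have dlE : eps = dl * C3 by rewrite /dl divfK // lt0r_neq0.
have rp4 : 4 * rp <= rho by rewrite rpE mulrC; apply: ler_wpM2l => //; exact: ltW.
have dl2 : 2 * dl <= rho by apply: le_trans er; rewrite dlE mulrC; apply: ler_wpM2l => //; exact: ltW.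
have xb j : `|x 0 j| <= 1 by have := hr j; lra.
pose eta := C1 * rp.
have etaE : C2 * rp = 4 * (n%:R + 1) * cW * eta by rewrite /C2 /eta; ring.
have eta0 : 0 <= eta by rewrite /eta mulr_ge0 ?(ltW rp0) //; lra.
have rpeta : rp <= eta by rewrite /eta ler_peMl // ltW.
have etar : 4 * (n%:R * (eta * cW)) + 4 * eta <= rho.
 have -> : rho = 4 * (n%:R + 1) * cW * eta by rewrite rpE -etaE mulrC.
 have h1 : eta <= cW * eta by rewrite ler_peMl.
 have -> : 4 * (n%:R + 1) * cW * eta = 4 * (n%:R * (eta * cW)) + 4 * (cW * eta) by ring.
 by rewrite lerD2l; apply: ler_wpM2l.
have etae : eta <= e.
 have : 0 <= n%:R * (eta * cW) by pos.
 lra.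
pose k0 := (truncn (2 / rp) + truncn (2 / dl)).+1.
exists k0; split=> // k kk0.
have kp : 0 < k%:R :> R by rewrite ltr0n; apply: leq_trans kk0.
have kr : 2 * k%:R^-1 <= rp.
 rewrite ler_pdivrMr // mulrC -ler_pdivrMr //; apply: le_trans (ltW (truncnS_gt _)) _.
 by rewrite ler_nat; apply: leq_trans kk0; rewrite /k0 ltnS leq_addr.
have kd : 2 * k%:R^-1 <= dl.
 rewrite ler_pdivrMr // mulrC -ler_pdivrMr //; apply: le_trans (ltW (truncnS_gt _)) _.
 by rewrite ler_nat; apply: leq_trans kk0; rewrite /k0 ltnS leq_addl.
have m0 : (0 < 3 * k)%N by rewrite muln_gt0 /= -(ltr_nat R).
pose p0 : 'I_(3 * k) := Ordinal m0.
pose la (p : 'I_(3 * k)) : R := -1 + k%:R^-1 * p%:R.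
have laE p j : tnth (lat (fun _ : 'I_s => -1) k%:R^-1 p) j = la (p j) by rewrite tnth_mktuple.
pose pv j := j \in codom f.
(* The pivot entries are frozen at [p0], so that a member of [G] codes the free coordinates only. *)
pose G : pred (pts s (3 * k)) := [pred g : pts s (3 * k) |
 [forall j, if pv j then g j == p0 else `|la (g j) - x 0 j| <= rp]].
have zex (g : pts s (3 * k)) : exists z : 'rV[R]_s, G g ->
  [/\ forall i, qd (A i) z = 0, forall j, `|z 0 j - x 0 j| <= rho / 2 & forall j, ~~ pv j -> z 0 j = la (g j)].
 case: (boolP (G g)) => [/forallP hg|]; last by exists 0.
 pose h : 'rV[R]_s := \row_j (if pv j then 0 else la (g j) - x 0 j).
 have hh : vleR h rp.
  move=> i j; rewrite mxE; have := hg j; case: (pv j) => // _; by rewrite normr0 ltW.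
 have hxX : vleR x 1 by move=> i j; rewrite ord1.
 have Fh i : `|qd (A i) (x + h) - 0| <= eta.
  rewrite subr0 qdD hx add0r; apply: le_trans (ler_normD _ _) _.
  have b1 := bil_le hvR (hP i) cAp ler01 hxX hh (ltW rp0).
  have b2 := bil_le hvR (hA i) cAp (ltW rp0) hh hh (ltW rp0).
  apply: le_trans (lerD b1 b2) _; rewrite /eta /C1.
  have -> : (1 + 2 * s%:R ^+ 2 * cA) * rp = rp + (s%:R ^+ 2 * cA * rp + s%:R ^+ 2 * cA * rp) by ring.
  have : s%:R ^+ 2 * cA * rp * rp <= s%:R ^+ 2 * cA * rp.
   by rewrite ler_piMr //; [pos; exact: ltW | move: rp4 rp0 r1 r0; clear; lra].
  rewrite mulr1; move: rp0; clear; lra.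
 have [u [hu Hu]] := He eta h (fun=> 0) eta0 etae (vle_trans hh (le_trans (ltac:(move: rp4 rp0; clear; lra) : rp <= rho) re)) Fh.
 exists (x + h + u *m W) => _; split.
 - by move=> i; exact: Hu.
 - move=> j; have w := vleM hvR (mulr_ge0 (ler0n R 2) eta0) hu hcW 0 j.
  have -> : (x + h + u *m W) 0 j - x 0 j = h 0 j + (u *m W) 0 j by rewrite mxE [(x + h) 0 j]mxE; ring.
  apply: le_trans (ler_normD _ _) _; apply: le_trans (lerD (hh 0 j) w) _.
  have : n%:R * (2 * eta * cW) = 2 * (n%:R * (eta * cW)) by ring.
  by move: etar rpeta eta0; clear; lra.
 - move=> j /negbTE npv; rewrite mxE [(x + h) 0 j]mxE [h 0 j]mxE npv.
  have -> : (u *m W) 0 j = 0.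
   rewrite mxE big1 // => i _; rewrite Wf ?mulr0 // => i'; apply/eqP => e1.
   by move: npv; rewrite /pv -e1 codom_f.
  by rewrite addr0 addrC subrK.
have /choice[z hz] := zex.
pose T g : pred (pts s (3 * k)) := [pred p : pts s (3 * k) |
 [forall j, if pv j then `|la (p j) - z g 0 j| <= dl else p j == g j]].
set S := [pred p : {ffun _ -> _} | _].
pose rest (p : pts s (3 * k)) := [ffun j => if pv j then p0 else p j].
have Gr g p : G g -> T g p -> rest p = g.
 move=> /forallP hg /forallP hp; apply/ffunP => j; rewrite ffunE.
 by have := hg j; have := hp j; case: (pv j) => [_ /eqP|/eqP].
have TS g p : G g -> T g p -> S p.
 move=> Gg Tp; have [z1 z2 z3] := hz g Gg; move/forallP: Tp => hp.
 have near j : `|la (p j) - z g 0 j| <= dl.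
  have := hp j; case: (boolP (pv j)) => // npv /eqP ->.
  by rewrite z3 // subrr normr0 ltW.
 rewrite inE; apply/andP; split.
  apply/forallP => j; rewrite laE.
  have -> : la (p j) - x 0 j = (la (p j) - z g 0 j) + (z g 0 j - x 0 j) by ring.
  by apply: le_trans (ler_normD _ _) _; apply: le_trans (lerD (near j) (z2 j)) _; move: dl2 r0; clear; lra.
 apply/forallP => i; set y := \row_j _.
 have yE j : y 0 j = la (p j) by rewrite mxE laE.
 have hd : vleR (y - z g) dl by move=> a j; rewrite !mxE ord1 laE; exact: near.
 have zb : vleR (z g) 2.
  move=> a j; rewrite ord1; have -> : z g 0 j = (z g 0 j - x 0 j) + x 0 j by ring.
  apply: le_trans (ler_normD _ _) _; have := z2 j; have := xb j; move: r1 r0; clear; lra.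
 have yb : vleR y 2.
  move=> a j; rewrite ord1 yE; have -> : la (p j) = (la (p j) - z g 0 j) + (z g 0 j - x 0 j) + x 0 j by ring.
  apply: le_trans (ler_normD _ _) _; apply: le_trans (lerD (ler_normD _ _) (lexx _)) _.
  have := z2 j; have := xb j; have := near j; move: dl2 r1 r0; clear; lra.
 rewrite (qd_near_zero y (z1 i)).
 apply: le_trans (ler_normD _ _) _.
 have b1 := bil_le hvR (hA i) cAp (ler0n R 2) yb hd (ltW dl0).
 have b2 := bil_le hvR (hA i) cAp (ltW dl0) hd zb (ler0n R 2).
 apply: le_trans (lerD b1 b2) _; rewrite dlE /C3.
 have -> : dl * (2 + 4 * s%:R ^+ 2 * cA) = 2 * dl + 4 * (s%:R ^+ 2 * cA * dl) by ring.
 have -> : s%:R ^+ 2 * cA * 2 * dl = 2 * (s%:R ^+ 2 * cA * dl) by ring.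
 have -> : s%:R ^+ 2 * cA * dl * 2 = 2 * (s%:R ^+ 2 * cA * dl) by ring.
 by move: dl0; clear; lra.
(* [rest] recovers [g] from the free coordinates of a point of [T g], so the sets [T g] are
   disjoint. *)
have cardS : (\sum_(g | G g) #|T g| <= #|S|)%N.
 have -> : #|S| = (\sum_(g : pts s (3 * k)) \sum_(p | (p \in S) && (rest p == g)) 1)%N.
  by rewrite -sum1_card (partition_big rest xpredT).
 rewrite [leqRHS](bigID G) /=.
 apply: leq_trans (leq_addr _ _); apply: leq_sum => g Gg.
 rewrite sum1_card; apply: subset_leq_card; apply/fintype.subsetP => p Tp.
 rewrite unfold_in; apply/andP; split; first exact: (TS g).
 by apply/eqP; apply: Gr.
have cpv : #|pv| = n by rewrite (eq_card (_ : pv =i codom f)) // card_codom // card_ord.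
have cpv' : #|predC pv| = (s - n)%N by rewrite card_predC card_ord cpv.
have prodif (F : 'I_s -> nat) (a b : R) : 0 <= a -> 0 <= b -> (forall j, pv j -> a <= (F j)%:R) -> (forall j, ~~ pv j -> b <= (F j)%:R) ->
  a ^+ n * b ^+ (s - n) <= (\prod_j F j)%:R.
 move=> a0 b0 h1 h2; rewrite natr_prod.
 apply: (@le_trans _ _ (\prod_j (if pv j then a else b))).
  rewrite (bigID pv) /= (eq_bigr (fun=> a)) => [|j ->] //; rewrite prodr_const cpv.
  rewrite [X in _ <= _ * X](eq_bigr (fun=> b)) => [|j /negbTE ->] //; rewrite prodr_const.
  by rewrite (eq_card (_ : _ =i predC pv)) ?cpv'.
 apply: ler_prod => j _; case: (boolP (pv j)) => hj; [by rewrite a0 h1 | by rewrite b0 h2].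
have mk : k%:R^-1 * (3 * k)%:R = 3 :> R by rewrite natrM mulrCA mulVf ?mulr1 // lt0r_neq0.
have cnt (y d : R) : 2 * k%:R^-1 <= d -> `|y| + d <= 1 -> d * k%:R <= #|[pred p : 'I_(3 * k) | `|la p - y| <= d]|%:R.
 move=> d2 yd; have := @lat_count R (-1) k%:R^-1 y d (3 * k) _ d2.
 rewrite mk invrK invr_gt0 => /(_ kp); apply.
  by have := ler_norm (- y); rewrite normrN; lra.
 by have := ler_norm y; lra.
have cG : (rp * k%:R) ^+ (s - n) <= #|G|%:R.
 have -> : (rp * k%:R) ^+ (s - n) = 1 ^+ n * (rp * k%:R) ^+ (s - n) by rewrite expr1n mul1r.
 rewrite [#|_|](card_prod_ffun (fun j q => if pv j then q == p0 else `|la q - x 0 j| <= rp)); apply: prodif => //; first by rewrite mulr_ge0 // ltW.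
  by move=> j hj; rewrite ler1n; apply/card_gt0P; exists p0; rewrite unfold_in hj.
 move=> j /negbTE hj; have h := cnt (x 0 j) rp kr _.
 apply: le_trans (h _) _; first by move: rp4 rp0 (hr j); clear; lra.
 by rewrite ler_nat; apply: subset_leq_card; apply/fintype.subsetP => p; rewrite !unfold_in hj.
have cT g : G g -> (dl * k%:R) ^+ n <= #|T g|%:R.
 move=> Gg; have [z1 z2 z3] := hz g Gg.
 have -> : (dl * k%:R) ^+ n = (dl * k%:R) ^+ n * 1 ^+ (s - n) by rewrite expr1n mulr1.
 rewrite [#|_|](card_prod_ffun (fun j q => if pv j then `|la q - z g 0 j| <= dl else q == g j)); apply: prodif => //; first by rewrite mulr_ge0 // ltW.
  move=> j hj; have h := cnt (z g 0 j) dl kd _.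
  apply: le_trans (h _) _.
   have := hr j; have := z2 j; have -> : z g 0 j = (z g 0 j - x 0 j) + x 0 j by ring.
   by have := ler_normD (z g 0 j - x 0 j) (x 0 j); rewrite addrK; move: dl2 r0; clear; lra.
  by rewrite ler_nat; apply: subset_leq_card; apply/fintype.subsetP => p; rewrite !unfold_in hj.
 by move=> j /negbTE hj; rewrite ler1n; apply/card_gt0P; exists (g j); rewrite unfold_in hj.
apply: (@le_trans _ _ (\sum_(g | G g) #|T g|)%:R); last by rewrite ler_nat.
rewrite natr_sum; apply: (@le_trans _ _ (\sum_(g | G g) (dl * k%:R) ^+ n)).
 rewrite sumr_const -[leRHS]mulr_natl.
 apply: le_trans (ler_wpM2r _ cG); last by rewrite exprn_ge0 // mulr_ge0 // ltW.
 have ns : (n <= s)%N by rewrite -cpv -[leqRHS]card_ord max_card.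
 have -> : k%:R ^+ s = k%:R ^+ (s - n) * k%:R ^+ n :> R by rewrite -exprD subnK.
 rewrite /rp /dl [(rho / C2 * k%:R) ^+ _]exprMn [(rho / C2) ^+ _]exprMn [(eps / C3 * k%:R) ^+ _]exprMn
  [(eps / C3) ^+ _]exprMn !exprVn; apply: eqle.
 by move: (rho ^+ _) (eps ^+ _) (k%:R ^+ _) (k%:R ^+ _) (C2 ^- _) (C3 ^- _) => u1 u2 u3 u4 u5 u6; ring.
by apply: ler_sum => g; exact: cT.
Qed.

End LatticeCount.

(** * A Fejer kernel for the singular integral *)

Section JPositive.
Variables (R : realType) (n s : nat) (C : 'I_n -> 'M[int]_s) (J : 'I_s -> interval R).
Hypothesis hJ : box_le 1 J.

Definition dgrid (tau : R) (L : nat) (a b : pts n L) : 'I_n -> R := fun i => tau * ((a i)%:R - (b i)%:R).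
(** Fejer's identity: summing over all differences of frequencies gives the squared modulus of the
    sum over the frequencies. *)
Lemma square_sum (tau : R) L (t : s.-tuple R) :
 \sum_(a : pts n L) \sum_(b : pts n L) expi2pi (osc C (dgrid tau a b) t) =
 ((cabs (\prod_i \sum_(a < L) expi2pi (tau * a%:R * qf (C i) (tnth t)))) ^+ 2)%:C%C.
Proof.
set z := \prod_i _.
have zE : z = \sum_(a : pts n L) expi2pi (\sum_i tau * (a i)%:R * qf (C i) (tnth t)).
 by rewrite /z bigA_distr_bigA; apply: eq_bigr => a _; rewrite e2pi_sum.
have -> : ((cabs z ^+ 2)%:C)%C = z * (z^*)%C.
 rewrite rmorphXn /= -cabsE; exact: sqr_normc.
rewrite {1}zE mulr_suml; apply: eq_bigr => a _.
have cS (I : finType) (f : I -> R[i]) : ((\sum_i f i)^*)%C = \sum_i ((f i)^*)%C by exact: raddf_sum.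
rewrite zE cS mulr_sumr; apply: eq_bigr => b _; rewrite -e2piN -e2piD; congr expi2pi.
by rewrite /osc /phase -sumrN -big_split; apply: eq_bigr => i _; rewrite /dgrid /=; ring.
Qed.

Lemma near_one_sum (tau v : R) (L : nat) : 0 < tau -> `|v| <= (16 * L%:R * tau)^-1 ->
 L%:R / 2 <= cabs (\sum_(a < L) expi2pi (tau * a%:R * v)).
Proof.
move=> t0 hv; apply: le_trans (cabs_Re _); apply: le_trans (ler_norm _); rewrite raddf_sum /=.
have -> : L%:R / 2 = \sum_(a < L) (2^-1 : R) by rewrite sumr_const card_ord -[RHS]mulr_natl.
apply: ler_sum => a _; have L0 : 0 < L%:R :> R by rewrite ltr0n; case: (L) a => [[]|].
have h1 : `|2 * pi * (tau * a%:R * v)| <= 2^-1.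
 rewrite !normrM (ger0_norm (ltW t0)) (ger0_norm (pi_ge0 R)) !(ger0_norm (ler0n _ _)).
 have p4 : pi <= 4 :> R by have := pihalf_lt2 R; lra.
 have al : a%:R <= L%:R :> R by rewrite ler_nat ltnW.
 apply: (@le_trans _ _ (2 * 4 * (tau * L%:R * (16 * L%:R * tau)^-1))).
  apply: ler_pM; [by rewrite mulr_ge0 ?pi_ge0|by rewrite !mulr_ge0 // ltW|by apply: ler_wpM2l|].
  apply: ler_pM => //; first by rewrite mulr_ge0 // ltW.
  by apply: ler_wpM2l => //; exact: ltW.
 apply: eqle; field; apply/andP; split; exact: lt0r_neq0.
have := cos_lip (2 * pi * (tau * a%:R * v)) 0; rewrite cos0 subr0 => h2.
have := le_trans h2 h1; rewrite ler_norml => /andP[h3 _]; lra.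
Qed.

Variable x : 'rV[R]_s.
Hypothesis hx : forall i, qd (map_mx intr (C i)) x = 0.
Hypothesis rk : \rank (jac (fun i => map_mx intr (C i)) x) = n.
Variable rho0 : R.
Hypothesis rho00 : 0 < rho0.
Hypothesis xJ : forall j y, `|y - x 0 j| <= rho0 -> y \in J j.

(** By [square_sum] the double sum is the integral of a square over the box, hence real, and the
    square is at least [(L / 2) ^ (2n)] where all forms are below [eps]. By [lattice_near_zero] such
    points have measure at least a constant times [eps ^ n]. *)
Lemma grid_lower : exists c X0 : R, [/\ 0 < c, 0 < X0 & forall (tau : R) (L : nat), 0 < tau -> (0 < L)%N -> X0 <= tau * L%:R ->
 let T := \sum_(a : pts n L) \sum_(b : pts n L) Ig C J (dgrid tau a b) in
 Im T = 0 /\ c * (L%:R / tau) ^+ n <= Re T].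
Proof.
have [c [e0 [c0 e00 Hc]]] := lattice_near_zero hx rk.
pose rho := Num.min e0 (rho0 / 2).
have r0 : 0 < rho by rewrite lt_min e00 divr_gt0.
have re : rho <= e0 by rewrite ge_min lexx.
have r2 : 2 * rho <= rho0.
 have : rho <= rho0 / 2 by rewrite ge_min lexx orbT.
 lra.
have hr j : `|x 0 j| + 2 * rho <= 1.
 have [xp|xn] := leP 0 (x 0 j).
  have /hJ : x 0 j + 2 * rho \in J j by apply: xJ; rewrite addrC addKr ger0_norm // mulr_ge0 // ltW.
  by rewrite (ger0_norm xp) ger0_norm // addr_ge0 // mulr_ge0 // ltW.
 have /hJ : x 0 j - 2 * rho \in J j by apply: xJ; rewrite addrC addKr normrN ger0_norm // mulr_ge0 // ltW.
 by rewrite (ltr0_norm xn) ltr0_norm; [move=> h; lra | lra].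
exists (c * rho ^+ (s - n) / 64 ^+ n), (16 * rho)^-1; split=> //.
- by rewrite divr_gt0 ?mulr_gt0 ?exprn_gt0.
- by rewrite invr_gt0 mulr_gt0.
move=> tau L t0 L0 hX T.
have Lr : 0 < L%:R :> R by rewrite ltr0n.
(* At this size all angles in [near_one_sum] are at most 1/2, and no cancellation occurs. *)
pose eps := (16 * L%:R * tau)^-1.
have eps0 : 0 < eps by rewrite invr_gt0 !mulr_gt0.
have er : eps <= rho.
 have t1 : 0 < tau * L%:R by rewrite mulr_gt0.
 have -> : eps = (16 * (tau * L%:R))^-1 by rewrite /eps; congr (_^-1); ring.
 rewrite -[_^-1]mul1r ler_pdivrMr ?mulr_gt0 //.
 move: hX; rewrite -[(16 * rho)^-1]mul1r ler_pdivrMr ?mulr_gt0 // => /le_trans; apply.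
 by apply: eqle; ring.
have [k0 [k00 Hk]] := Hc rho eps r0 re hr eps0 er.
pose G := \sum_(a : pts n L) \sum_(b : pts n L) (1 + \sum_i `|dgrid tau a b i|).
pose K := 2 * rcst R C * G.
have G0 : 0 <= G by rewrite /G; apply: sumr_ge0 => a _; apply: sumr_ge0 => b _; pos.
have K0 : 0 <= K by rewrite /K; pos; exact: rcst_ge0.
pose la k : pts s (3 * k) -> s.-tuple R := fun p => lat (fun=> -1) k%:R^-1 p.
(* [V k] is the Riemann sum of step [1 / k] for the integral of the square; by [VT] it tends to
   [T]. *)
pose V k : R := k%:R^-1 ^+ s * \sum_(p : pts s (3 * k) | inb J (la k p))
  (cabs (\prod_i \sum_(a < L) expi2pi (tau * a%:R * qf (C i) (tnth (la k p))))) ^+ 2.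
have VT k : (k0 <= k)%N -> cabs ((V k)%:C%C - T) <= K / k%:R.
 move=> hk; have kp : 0 < k%:R :> R by rewrite ltr0n; apply: leq_trans hk.
 have -> : ((V k)%:C)%C = \sum_(a : pts n L) \sum_(b : pts n L)
   ((k%:R^-1 ^+ s)%:C%C * \sum_(p : pts s (3 * k) | inb J (la k p)) expi2pi (osc C (dgrid tau a b) (la k p))).
  rewrite /V rmorphM rmorph_sum /=.
  under eq_bigr => p _ do rewrite -square_sum.
  rewrite mulr_sumr [LHS](eq_bigr _ (fun p _ => mulr_sumr _ _ _ _)) exchange_big /=; apply: eq_bigr => a _.
  rewrite [LHS](eq_bigr _ (fun p _ => mulr_sumr _ _ _ _)) exchange_big /=; apply: eq_bigr => b _.
  by rewrite mulr_sumr.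
 rewrite /T -sumrB; apply: le_trans (cabs_sum _ _ _) _; rewrite /K /G mulr_sumr mulr_suml; apply: ler_sum => a _.
 rewrite -sumrB; apply: le_trans (cabs_sum _ _ _) _; rewrite mulr_sumr mulr_suml; apply: ler_sum => b _.
 have mk : k%:R^-1 * (3 * k)%:R = 3 :> R by rewrite natrM mulrCA mulVf ?mulr1 // lt0r_neq0.
 apply: Ig_riemann => //.
 - by rewrite invr_gt0.
 - by rewrite mk; lra.
 - by move=> j y /hJ; rewrite mk ler_norml => /andP[h1 h2]; apply/andP; split => //; lra.
have Vlow k : (k0 <= k)%N -> c * rho ^+ (s - n) / 64 ^+ n * (L%:R / tau) ^+ n <= V k.
 move=> hk; have kp : 0 < k%:R :> R by rewrite ltr0n; apply: leq_trans hk.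
 have := Hk k hk; set S := #|_| => hS.
 apply: (@le_trans _ _ (k%:R^-1 ^+ s * (S%:R * ((L%:R / 2) ^+ n) ^+ 2))); last first.
  apply: ler_wpM2l; first by rewrite exprn_ge0 // invr_ge0.
  rewrite mulr_natl -sumr_const; rewrite [leRHS](bigID (fun p => [forall j, `|tnth (la k p) j - x 0 j| <= 2 * rho] &&
   [forall i, `|qd (map_mx intr (C i)) (\row_j tnth (la k p) j)| <= eps])) /=.
  apply: ler_wpDr; first by apply: sumr_ge0 => p _; exact: sqr_ge0.
  rewrite [leLHS](eq_bigl (fun p => inb J (la k p) && ([forall j, `|tnth (la k p) j - x 0 j| <= 2 * rho] &&
   [forall i, `|qd (map_mx intr (C i)) (\row_j tnth (la k p) j)| <= eps]))); last first.
   move=> p; rewrite unfold_in /=; apply/esym/andb_idl => /andP[/forallP h _].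
   by apply/forallP => j; apply: xJ; apply: le_trans (h j) r2.
  apply: ler_sum => p /andP[_ /andP[_ /forallP hp]].
  apply: lerXn2r; rewrite ?nnegrE ?cabs_ge0 ?exprn_ge0 ?divr_ge0 //.
  rewrite cabs_prod -[n in (L%:R / 2) ^+ n](card_ord n) -prodr_const.
  apply: ler_prod => i _; rewrite divr_ge0 //=; apply: near_one_sum => //.
  have := hp i; rewrite qd_int; congr (`|qf _ _| <= _); by apply/funext => j; rewrite mxE.
 have -> : k%:R^-1 ^+ s * (S%:R * ((L%:R / 2) ^+ n) ^+ 2) = S%:R * (k%:R^-1 ^+ s * ((L%:R / 2) ^+ n) ^+ 2) :> R by ring.
 apply: le_trans (ler_wpM2r _ hS); last by rewrite mulr_ge0 ?sqr_ge0 // exprn_ge0 // invr_ge0.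
 have ks : k%:R ^+ s * k%:R^-1 ^+ s = 1 :> R by rewrite -exprMn mulfV ?expr1n // lt0r_neq0.
 have -> : c * rho ^+ (s - n) * eps ^+ n * k%:R ^+ s * (k%:R^-1 ^+ s * ((L%:R / 2) ^+ n) ^+ 2) =
   (k%:R ^+ s * k%:R^-1 ^+ s) * (c * rho ^+ (s - n)) * (eps ^+ n * ((L%:R / 2) ^+ n) ^+ 2) by ring.
 rewrite ks mul1r -!mulrA; do 2! (apply: ler_wpM2l; first by rewrite ?exprn_ge0 ?ltW).
 rewrite -exprM mulnC exprM -exprMn -exprVn -exprMn; apply: eqle; congr (_ ^+ _).
 rewrite /eps; field; rewrite !lt0r_neq0 //.
have lim (z y : R) : (forall k, (k0 <= k)%N -> z <= y + K / k%:R) -> z <= y.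
 move=> h; apply/ler_addgt0Pr => e ep.
 pose k := (k0 + (truncn (K / e)).+1)%N; apply: le_trans (h k (leq_addr _ _)) _; rewrite lerD2l.
 have kp : 0 < k%:R :> R by rewrite ltr0n /k addnS.
 rewrite ler_pdivrMr // mulrC -ler_pdivrMr //; apply: le_trans (ltW (truncnS_gt _)) _.
 by rewrite ler_nat leq_addl.
split.
 apply/normr0_eq0/eqP; rewrite eq_le normr_ge0 andbT; apply: lim => k hk; rewrite add0r; apply: le_trans (VT k hk).
 by have := cabs_Im ((V k)%:C%C - T); rewrite raddfB /= sub0r normrN.
apply: lim => k hk; apply: le_trans (Vlow k hk) _; rewrite -lerBlDl; apply: le_trans (VT k hk).
apply: le_trans (ler_norm _) _; by have := cabs_Re ((V k)%:C%C - T); rewrite raddfB.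
Qed.

End JPositive.

(** * Positivity of the singular integral *)

Section SingularIntegralPositive.
Variables (R : realType) (r s : nat) (C : 'I_r.+1 -> 'M[int]_s) (J : 'I_s -> interval R).
Hypothesis hrank : rank_cond C.
Hypothesis hJ : box_le 1 J.
Local Notation n := r.+1.

(** For fixed [a] the differences [a - b] fill the grid of a translated cube, so the row is a
    Riemann sum for the integral over [J']. If [a] stays away from the boundary, [J'] contains a
    large centred cube. *)
Lemma grid_row (tau : R) L (a : pts n L) : (0 < L)%N -> exists J' : 'I_n -> interval R,
 [/\ forall K : R, box_riemann C J K J' -> 0 < tau -> 1 <= 2 * (tau * L%:R) ->
   cabs ((tau ^+ n)%:C%C * (\sum_(b : pts n L) Ig C J (dgrid tau a b)) - sintegral_box C J J') <=
    K * (2 * (tau * L%:R)) ^+ n.+1 * tau &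
  forall L' : nat, 0 < tau -> (forall i, (L' <= a i)%N && (a i + L' < L)%N) -> box (cube (tau * L'%:R)) `<=` box J'].
Proof.
move=> L0; pose c (j : 'I_n) : R := tau * ((a j)%:R - L%:R + 1).
(* Half-open, so that it contains exactly the [L] grid values [a j - L + 1, ..., a j], scaled by
   [tau]. *)
pose J' (j : 'I_n) : interval R := `[c j, c j + tau * L%:R[.
have aL j : (a j)%:R + 1 <= L%:R :> R by rewrite natr1 ler_nat.
have a0 j : 0 <= (a j)%:R :> R by [].
exists J'; split.
 move=> K HK t0 Y1; have tL0 : 0 <= tau * L%:R by rewrite mulr_ge0 // ltW.
 have := HK (tau * L%:R) tau L (2 * (tau * L%:R)) c tL0 t0 (lexx _) Y1.
 set S1 := \sum_(p | _) _; set S2 := \sum_b _.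
 have -> : S1 = S2.
  pose rv (b : pts n L) : pts n L := [ffun j => rev_ord (b j)].
  have rvK : involutive rv by move=> b; apply/ffunP => j; rewrite !ffunE rev_ordK.
  rewrite /S1 (reindex_inj (inv_inj rvK)) /=; apply: eq_big => b.
   apply/forallP => j; have := ltn_ord (rev_ord (b j)).
   rewrite tnth_mktuple ffunE in_itv /= => h; rewrite lerDl ltrD2l ltr_pM2l // ltr_nat h andbT.
   by rewrite mulr_ge0 // ltW.
  move=> _; congr (Ig C J _); apply/funext => j; rewrite tnth_mktuple ffunE /= natrB // /c /dgrid -[_.+1%:R]natr1; ring.
 apply.
 - by rewrite ler_peMl // ler1n.
 - move=> j x; rewrite in_itv /= => /andP[h1 h2]; rewrite ler_norml; have b1 := aL j; have b2 := a0 j.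
  have : 0 <= tau * (a j)%:R by rewrite mulr_ge0 // ltW.
  have : tau * ((a j)%:R + 1) <= tau * L%:R by apply: ler_wpM2l => //; exact: ltW.
  by move: h1 h2; rewrite /c !mulrDr mulrN mulr1; move: (tau * L%:R) (tau * (a j)%:R) => u v; move=> h1 h2 h3 h4; apply/andP; split; lra.
 - by move=> j x; rewrite in_itv.
move=> L' t0 ha g /cubeP hg j; have /andP[h1 h2] := ha j.
have := hg j; rewrite ler_norml in_itv /= => /andP[g1 g2].
have k1 : tau * L'%:R <= tau * (a j)%:R by rewrite ler_pM2l // ler_nat.
have k2 : tau * ((a j)%:R + L'%:R + 1) <= tau * L%:R by rewrite ler_pM2l // -natrD natr1 ler_nat.
move: k1 k2 g1 g2; rewrite /c !mulrDr mulrN mulr1; move: (tau * L%:R) (tau * (a j)%:R) (tau * L'%:R) => u v w; move=> k1 k2 g1 g2.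
by apply/andP; split; lra.
Qed.

Lemma bad_points L L' : (\sum_(a : pts n L | ~~ [forall i, (L' <= a i)%N && (a i + L' < L)%N]) 1 <=
 n * (2 * L') * L ^ r)%N.
Proof.
pose bad (k : 'I_L) : bool := ~~ ((L' <= k)%N && (k + L' < L)%N).
apply: (@leq_trans (\sum_(a : pts n L) \sum_i bad (a i))%N).
 rewrite big_mkcond /=; apply: leq_sum => a _; case: forallP => // /forallP.
 by rewrite negb_forall => /existsP[i hi]; rewrite (bigD1 i) //= /bad hi.
rewrite exchange_big /= -mulnA.
apply: (@leq_trans (\sum_(i < n) 2 * L' * L ^ r)%N); last by rewrite sum_nat_const card_ord.
apply: leq_sum => i _.
rewrite (eq_bigr (fun a : pts n L => \prod_j (if j == i then bad (a j) : nat else 1)))%N; last first.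
 by move=> a _; rewrite (bigD1 i) //= eqxx big1 ?muln1 // => j /negbTE ->.
rewrite -(bigA_distr_bigA (fun j (k : 'I_L) => if j == i then bad k : nat else 1))%N (bigD1 i) //= eqxx.
rewrite [X in (_ * X <= _)%N](eq_bigr (fun=> L)); last by move=> j /negbTE ->; rewrite sum_nat_const card_ord muln1.
rewrite prod_nat_const cardC1 card_ord /= leq_mul2r; apply/orP; right.
have b1 m : (\sum_(k < m) (k < L') <= L')%N.
 suff -> : (\sum_(k < m) (k < L') = minn m L')%N by exact: geq_minr.
 elim: m => [|m IH]; first by rewrite big_ord0 min0n.
 by rewrite big_ord_recr /= IH; case: ltnP; lia.
have b2 N m : (\sum_(k < m) (N <= k) = m - N)%N.
 elim: m => [|m IH]; first by rewrite big_ord0.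
 by rewrite big_ord_recr /= IH; case: leqP; lia.
apply: (@leq_trans (\sum_(k < L) ((k < L') + (L - L' <= k)))%N).
 by apply: leq_sum => k _; have := ltn_ord k; rewrite /bad; case: leqP; case: ltnP; case: leqP => //=; lia.
by rewrite big_split /= b2 mul2n -addnn leq_add ?b1 //; lia.
Qed.

(** The normalized double sum is an average over [a] of Riemann sums for almost the whole integral,
    except for a small share of [a] near the boundary, where boundedness suffices. By [grid_lower]
    it is real and at least [c], and this passes to the limit. *)
Lemma singular_integral_pos (x : 'rV[R]_s) (rho0 : R) :
 (forall i, qd (map_mx intr (C i)) x = 0) ->
 \rank (jac (fun i => map_mx intr (C i)) x) = n -> 0 < rho0 ->
 (forall j y, `|y - x 0 j| <= rho0 -> y \in J j) -> 0 < sintegral C J.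
Proof.
move=> hx rk r0 xJ.
have [c [X0 [c0 X00 Hlow]]] := grid_lower hJ hx rk r0 xJ.
have [K1 [K11 Htail]] := sintegral_tail hrank hJ.
have [K2 [K20 Hbd]] := sintegral_bounded hrank hJ.
have [K3 [K30 Hrie]] := sintegral_riemann_box C hJ.
suff H (e : R) : 0 < e -> exists z : R[i], [/\ Im z = 0, c <= Re z & cabs (z - sintegral C J) <= e].
 have [hIm hRe] : Im (sintegral C J) = 0 /\ c <= Re (sintegral C J).
  split.
   apply/normr0_eq0/eqP; rewrite eq_le normr_ge0 andbT; apply/ler_addgt0Pr => e e0.
   have [z [z1 z2 z3]] := H e e0; rewrite add0r; apply: le_trans z3.
   by have := cabs_Im (z - sintegral C J); rewrite raddfB /= z1 sub0r normrN.
  apply/ler_addgt0Pr => e e0; have [z [z1 z2 z3]] := H e e0.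
  apply: le_trans z2 _; rewrite -lerBlDl; apply: le_trans (le_trans (ler_norm _) _) z3.
  by have := cabs_Re (z - sintegral C J); rewrite raddfB.
 move: hIm hRe; case: (sintegral C J) => a b /= -> hRe.
 by rewrite ltcE /= eqxx /=; exact: lt_le_trans hRe.
move=> e0; have e3 : 0 < e / 3 by rewrite divr_gt0.
have large (A : R) : exists m : nat, (0 < m)%N /\ A <= m%:R.
 by exists (truncn A).+1; split=> //; exact: ltW (truncnS_gt _).
(* [T] makes the share of boundary rows small, [Z] is a radius beyond which the tail is small, and
   [L'] refines the step [Z / L']. *)
have [T [T0 hT]] := large (n%:R * 2 * K2 / (e / 3)).
have [Z [Zp hZ]] := large (X0 + K1 / (e / 3)).
have Zr : 0 < Z%:R :> R by rewrite ltr0n.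
have Tr : 0 < T%:R :> R by rewrite ltr0n.
have [L' [L'0 hL']] := large (K3 * (2 * (T%:R * Z%:R)) ^+ n.+1 * Z%:R / (e / 3)).
have L'r : 0 < L'%:R :> R by rewrite ltr0n.
pose tau : R := Z%:R / L'%:R; pose L := (T * L')%N.
have t0 : 0 < tau by rewrite divr_gt0.
have L0 : (0 < L)%N by rewrite muln_gt0 T0.
have Lr : 0 < L%:R :> R by rewrite ltr0n.
have tL : tau * L%:R = T%:R * Z%:R by rewrite /tau /L natrM; field; exact: lt0r_neq0.
have tL' : tau * L'%:R = Z%:R by rewrite /tau divfK // lt0r_neq0.
have T1 : 1 <= T%:R :> R by rewrite ler1n.
have Z1 : 1 <= Z%:R :> R by rewrite ler1n.
have TZ : Z%:R <= T%:R * Z%:R :> R by rewrite ler_peMl // ltW.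
have XT : X0 <= tau * L%:R.
 rewrite tL; apply: le_trans TZ; apply: le_trans hZ; rewrite lerDl.
 by rewrite divr_ge0 ?(ltW e3) //; lra.
have := Hlow tau L t0 L0 XT; set D := \sum_a \sum_b _; move=> [D1 D2].
pose w : R := (tau / L%:R) ^+ n.
have w0 : 0 < w by rewrite exprn_gt0 // divr_gt0.
exists (w%:C%C * D); split.
- have -> : Im (w%:C%C * D) = w * Im D by case: (D) => a b /=; ring.
 by rewrite D1 mulr0.
- have -> : Re (w%:C%C * D) = w * Re D by case: (D) => a b /=; ring.
 have wE : w * (c * (L%:R / tau) ^+ n) = c.
  by rewrite /w mulrCA -exprMn (_ : tau / L%:R * (L%:R / tau) = 1) ?expr1n ?mulr1 //; field; rewrite !lt0r_neq0.
 by rewrite -[leLHS]wE ler_pM2l.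
have Y1 : 1 <= 2 * (tau * L%:R) by rewrite tL; have h := le_trans Z1 TZ; lra.
have /choice[Jf hJf] := fun a : pts n L => grid_row tau a L0.
pose E1 := K3 * (2 * (tau * L%:R)) ^+ n.+1 * tau.
pose good (a : pts n L) := [forall i, (L' <= a i)%N && (a i + L' < L)%N].
pose row (a : pts n L) : R[i] := (tau ^+ n)%:C%C * (\sum_(b : pts n L) Ig C J (dgrid tau a b)).
have hrow a : cabs (row a - sintegral C J) <= E1 + K1 / Z%:R + (if good a then 0 else K2).
 have [h1 h2] := hJf a.
 have -> : row a - sintegral C J = (row a - sintegral_box C J (Jf a)) - (sintegral C J - sintegral_box C J (Jf a)) by ring.
 apply: le_trans (cabsB _ _) _; rewrite -addrA; apply: lerD; first exact: h1.
 have K1Z : 0 <= K1 / Z%:R by rewrite divr_ge0 ?(ltW Zr) //; lra.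
 case: (boolP (good a)) => [/forallP ga|_]; last by apply: le_trans (Hbd (Jf a)) _; rewrite lerDr.
 by rewrite addr0 -tL'; apply: Htail; [rewrite tL' | exact: h2].
have cardL : #|pts n L| = (L ^ n)%N by rewrite card_ffun !card_ord.
have -> : w%:C%C * D - sintegral C J = ((L%:R ^- n)%:C)%C * \sum_a (row a - sintegral C J).
 rewrite sumrB sumr_const cardL mulrBr; congr (_ - _).
  by rewrite /row -mulr_sumr mulrA -rmorphM /w exprMn exprVn [_ * tau ^+ n]mulrC.
 rewrite -[_ *+ (L ^ n)]mulr_natl mulrA.
 have -> : ((L ^ n)%:R : R[i]) = ((L%:R ^+ n)%:C)%C by rewrite natrX rmorphXn rmorph_nat.
 by rewrite -rmorphM mulVf ?rmorph1 ?mul1r // expf_neq0 // lt0r_neq0.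
have Ln0 : 0 < L%:R ^+ n :> R by rewrite exprn_gt0.
rewrite cabsM cabs_real ger0_norm ?invr_ge0 ?(ltW Ln0) // mulrC ler_pdivrMr //.
apply: le_trans (cabs_sum _ _ _) _; apply: le_trans (ler_sum _ (fun a _ => hrow a)) _.
rewrite big_split /= sumr_const cardL -[_ *+ (L ^ n)]mulr_natr natrX.
have hE1 : E1 <= e / 3.
 have -> : E1 = K3 * (2 * (T%:R * Z%:R)) ^+ n.+1 * Z%:R / L'%:R by rewrite /E1 tL /tau !mulrA.
 by rewrite ler_pdivrMr // [e / 3 * _]mulrC -ler_pdivrMr.
have hK1 : K1 / Z%:R <= e / 3.
 by rewrite ler_pdivrMr // mulrC -ler_pdivrMr //; apply: le_trans hZ; rewrite lerDr ltW.
have hK2 : \sum_a (if good a then 0 else K2) <= e / 3 * L%:R ^+ n.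
 apply: (@le_trans _ _ (K2 * (\sum_(a : pts n L | ~~ good a) 1)%N%:R)).
  rewrite natr_sum mulr_sumr [leRHS]big_mkcond /=; apply: ler_sum => a _.
  by case: (good a); rewrite /= ?mulr1.
 apply: (@le_trans _ _ (K2 * (n * (2 * L') * L ^ r)%:R)).
  by apply: ler_wpM2l => //; rewrite ler_nat; exact: bad_points.
 have LE : L%:R = T%:R * L'%:R :> R by rewrite natrM.
 rewrite natrM natrX natrM (natrM _ 2) exprS.
 have -> : K2 * (n%:R * (2 * L'%:R) * L%:R ^+ r) = n%:R * 2 * K2 * (L'%:R * L%:R ^+ r) by ring.
 have -> : e / 3 * (L%:R * L%:R ^+ r) = e / 3 * T%:R * (L'%:R * L%:R ^+ r) by rewrite LE; ring.
 by apply: ler_wpM2r; [rewrite mulr_ge0 ?exprn_ge0 | rewrite [e / 3 * _]mulrC -ler_pdivrMr].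
have -> : e * L%:R ^+ n = (e / 3 + e / 3) * L%:R ^+ n + e / 3 * L%:R ^+ n by field.
by apply: lerD hK2; apply: ler_wpM2r; [exact: ltW | exact: lerD].
Qed.

End SingularIntegralPositive.

(** * Densities modulo [N] and positivity of the singular series *)

Lemma nsum_const (V : pzRingType) X n (c : V) : nsum X (fun _ : 'I_n -> int => c) = (size X)%:R ^+ n * c.
Proof.
elim: n => [|n IH] /=; first by rewrite mul1r.
rewrite (eq_bigr (fun=> (size X)%:R ^+ n * c)) // big_const_seq count_predT -[LHS]/(iter _ _ _).
by rewrite iter_addr_0 exprS -mulrA mulr_natl.
Qed.

Lemma perm_split_residues (q d : nat) : (0 < q)%N ->
 perm_eq [seq (nat_of_ord i).+1%:Z | i <- enum 'I_(q * d)]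
  [seq q%:Z * y + z | z <- [seq (nat_of_ord i).+1%:Z | i <- enum 'I_q], y <- [seq (nat_of_ord i)%:Z | i <- enum 'I_d]].
Proof.
move=> q0; apply: uniq_perm.
- by rewrite map_inj_uniq ?enum_uniq // => i j e; apply/val_inj => /=; lia.
- apply: allpairs_uniq.
 + by rewrite map_inj_uniq ?enum_uniq // => i j e; apply/val_inj => /=; lia.
 + by rewrite map_inj_uniq ?enum_uniq // => i j e; apply/val_inj => /=; lia.
 move=> [z y] [z' y'] /allpairsP[[z1 y1] /= [/mapP[i _ ->] /mapP[k _ ->] [-> ->]]].
 move=> /allpairsP[[z2 y2] /= [/mapP[i' _ ->] /mapP[k' _ ->] [-> ->]]] e.
 have hi := ltn_ord i; have hi' := ltn_ord i'.
 have ek : (k : nat) = k'.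
  apply/eqP; rewrite eqn_leq; apply/andP; split; rewrite leqNgt; apply/negP => h.
   have : (q * k' + q <= q * k)%N by rewrite -mulnSr leq_mul2l h orbT.
   lia.
  have : (q * k + q <= q * k')%N by rewrite -mulnSr leq_mul2l h orbT.
  lia.
 by rewrite ek in e *; congr (_, _); lia.
move=> x; apply/mapP/allpairsP => [[i _ ->]|[[z y] /= [/mapP[i _ ->] /mapP[k _ ->] ->]]].
 have hd : (i %/ q < d)%N by rewrite ltn_divLR // [(d * q)%N]mulnC; exact: ltn_ord.
 have hm : (i %% q < q)%N by rewrite ltn_mod.
 exists ((i %% q).+1%:Z, (i %/ q)%:Z); split => /=.
 - by apply/mapP; exists (Ordinal hm) => //; rewrite mem_enum.
 - by apply/mapP; exists (Ordinal hd) => //; rewrite mem_enum.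
 - by rewrite {1}(divn_eq i q); lia.
have hk : (q * k + i < q * d)%N.
 apply: (@leq_trans (q * k + q)%N); first by rewrite ltn_add2l.
 by rewrite -mulnSr leq_mul2l ltn_ord orbT.
by exists (Ordinal hk); rewrite ?mem_enum //=; lia.
Qed.

Lemma frac_arith x y q d N : N = (q * d)%N -> (0 < q)%N -> (x * q == y * N)%N = (x == y * d)%N.
Proof. by move=> -> q0; rewrite [(q * d)%N]mulnC mulnA eqn_pmul2r. Qed.

Section LocalDensities.
Variables (R : realType) (r s : nat) (C : 'I_r.+1 -> 'M[int]_s).
Local Notation n := r.+1.

Definition nsols (N : nat) : nat :=
 #|[pred p : pts s N | [forall i, (N%:Z %| qf (C i) (fun j => (p j)%:Z))%Z]]|.

(** The normalized complete sum at [a / N], reduced or not; by [gmean_scale] it depends on the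
    fraction alone. *)
Definition gmean (N : nat) (a : 'I_n -> int) : R[i] := N%:R ^- s *
 nsum [seq (nat_of_ord i).+1%:Z | i <- enum 'I_N] (fun x : 'I_s -> int => expi2pi (iphase C (fun i => (a i)%:~R / N%:R) x)).

Lemma gmean_gsum q (a : pts n q) :
 q%:R ^- s * gsum R C a = gmean q (fun i => (a i).+1%:Z).
Proof. by rewrite /gsum /esum gauss_nsum. Qed.
Lemma gmean_scale q d (a : 'I_n -> int) : (0 < q)%N -> (0 < d)%N ->
 gmean (q * d) (fun i => a i * d%:Z) = gmean q a.
Proof.
move=> q0 d0; rewrite /gmean (nsum_split _ (perm_split_residues d q0)).
have qn : q%:R != 0 :> R by rewrite pnatr_eq0 -lt0n.
have dn : d%:R != 0 :> R by rewrite pnatr_eq0 -lt0n.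
have E (z : 'I_s -> int) : nsum [seq (nat_of_ord i)%:Z | i <- enum 'I_d]
   (fun y : 'I_s -> int => expi2pi (iphase C (fun i => (a i * d%:Z)%:~R / (q * d)%:R : R) (fun j => q%:Z * y j + z j))) =
   d%:R ^+ s * expi2pi (iphase C (fun i => (a i)%:~R / q%:R : R) z) :> R[i].
 rewrite -[d in d%:R ^+ s](size_enum_ord d) -(size_map (fun i : 'I_d => (nat_of_ord i)%:Z)) -nsum_const.
 apply: eq_nsum => y; have h := iphase_modq R C a z y q0; rewrite -[RHS]h; congr (expi2pi (iphase _ _ _)); apply/funext => i.
 by rewrite intrM natrM -[d%:Z%:~R]/(d%:R) -mulf_div divff // mulr1.
rewrite (eq_nsum _ E).
have mulS (X : seq int) m (c : R[i]) (u : ('I_m -> int) -> R[i]) : nsum X (fun x => c * u x) = c * nsum X u.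
 elim: m u => [|m IH] u //=; rewrite mulr_sumr; apply: eq_bigr => x _; exact: IH.
rewrite mulS mulrA; congr (_ * _); rewrite natrM exprMn invfM -mulrA mulVf ?mulr1 // expf_neq0 // pnatr_eq0 -lt0n //.
Qed.

Lemma geometric_mod N (c : int) : (0 < N)%N ->
 \sum_(k < N) expi2pi ((k : nat).+1%:R / N%:R * c%:~R) = (if (N%:Z %| c)%Z then N%:R else 0) :> R[i].
Proof.
move=> N0; have Nr : N%:R != 0 :> R by rewrite pnatr_eq0 -lt0n.
(* [c0] is the centred residue of [c], small enough for [geometric_int]. *)
have [c0 [t [hc cE]]] : exists c0 t : int, 2 * `|c0| <= N%:Z /\ c = c0 + t * N%:Z.
 have Nz : N%:Z != 0 by lia.
 have e := divz_eq c N%:Z; have h1 := modz_ge0 c Nz; have h2 := ltz_mod c Nz.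
 set d := (c %/ N)%Z in e; set m := (c %% N)%Z in e h1 h2.
 have [le|gt] := lerP (2 * m) N%:Z; first by exists m, d; split; [lia | lia].
 by exists (m - N%:Z), (d + 1); split; [lia | rewrite e mulrDl; lia].
have dE : (N%:Z %| c)%Z = (c0 == 0).
 rewrite cE rpredDr ?dvdz_mull //; apply/idP/eqP => [/dvdzP[u hu]|->]; last exact: dvdz0.
 case: (eqVneq u 0) => [u0|u0]; first by rewrite hu u0 mul0r.
 have : N%:Z <= `|c0|; last by lia.
 have u1 : 1 <= `|u| by lia.
 by rewrite hu normrM [ `|N%:Z|]ger0_norm // ler_peMl.
have sh k : expi2pi ((k : nat).+1%:R / N%:R * c%:~R) = expi2pi (c0%:~R / N%:R) * expi2pi (k%:R / N%:R * c0%:~R) :> R[i].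
 rewrite -e2piD -[RHS](e2piDint _ (k.+1%:Z * t)); congr expi2pi.
 rewrite cE rmorphD /= !intrM -[N%:Z%:~R]/(N%:R) -[k.+1%:Z%:~R]/(k.+1%:R) -natr1.
 by field.
under eq_bigr => k _ do rewrite sh.
rewrite -mulr_sumr geometric_int // dE.
by case: eqP => [->|_]; rewrite ?mul0r ?mulr0 // e2pi0 mul1r.
Qed.

Lemma sum_gmean N : (0 < N)%N ->
 \sum_(a : pts n N) gmean N (fun i => (a i).+1%:Z) = (N%:R ^+ n / N%:R ^+ s) * (nsols N)%:R.
Proof.
move=> N0; rewrite /gmean -mulr_sumr [_ / _]mulrC -mulrA; congr (_ * _).
rewrite (nsum_sum (index_enum _)).
pose u (x : 'I_s -> int) : R[i] := if [forall i, (N%:Z %| qf (C i) x)%Z] then N%:R ^+ n else 0.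
rewrite (eq_nsum _ (v := u)) => [|x]; last first.
 rewrite (eq_bigr (fun a : pts n N => \prod_i expi2pi ((a i : nat).+1%:R / N%:R * (qf (C i) x)%:~R))); last first.
  move=> a _; rewrite -e2pi_sum /iphase /phase; congr expi2pi; apply: eq_bigr => i _.
  by rewrite qf_intr.
 rewrite -(bigA_distr_bigA (fun i (k : 'I_N) => expi2pi ((k : nat).+1%:R / N%:R * (qf (C i) x)%:~R))) /=.
 rewrite (eq_bigr _ (fun i _ => geometric_mod _ N0)) /u; case: forallP => [h|/forallP].
  rewrite (eq_bigr (fun=> N%:R)); last by move=> i _; rewrite h.
  by rewrite prodr_const card_ord.
 by rewrite negb_forall => /existsP[i hi]; rewrite (bigD1 i) //= (negbTE hi) mul0r.
have per (x y : 'I_s -> int) : (forall j, exists m : int, x j = y j + m * N%:Z) -> u x = u y.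
 move=> /choice[m hm]; rewrite /u; congr (if _ then _ else _); apply: eq_forallb => i.
 have [t ht] := qf_modq (C i) N%:Z y m.
 have -> : x = (fun j => N%:Z * m j + y j) by apply/funext => j; rewrite hm; ring.
 by rewrite ht rpredDr // dvdz_mulr.
have -> : nsum [seq (nat_of_ord i).+1%:Z | i <- enum 'I_N] u = nsum (residues N) u.
 rewrite -(nsum_period (fun=> 1) per) /residues -!nsum_ffun; apply: eq_bigr => p _.
 by congr u; apply/funext => j; lia.
rewrite /residues -nsum_ffun /u -big_mkcond /= sumr_const -[LHS]mulr_natr; congr (_ * _%:R).
Qed.

Lemma frac_unique N (a : pts n N) : (0 < N)%N ->
 (\sum_(1 <= q < N.+1 | q %| N) \sum_(b : pts n q | cop b)
   [forall i, (a i).+1 * q == (b i).+1 * N] = 1)%N.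
Proof.
move=> N0; pose g := gcdn (\big[gcdn/0]_(i < n) (a i).+1)%N N.
have gN : (g %| N)%N by exact: dvdn_gcdr.
have ga i : (g %| (a i).+1)%N by apply: dvdn_trans (dvdn_gcdl _ _) _; exact: (@biggcdn_inf _ i).
have g0 : (0 < g)%N by rewrite gcdn_gt0 N0 orbT.
pose q0 := (N %/ g)%N.
have NE : N = (q0 * g)%N by rewrite /q0 divnK.
have q00 : (0 < q0)%N by rewrite divn_gt0 // dvdn_leq.
rewrite big_mkcond (bigD1_seq q0) /= ?iota_uniq //; last by rewrite mem_index_iota q00 ltnS leq_div.
rewrite dvdn_div // [X in (_ + X)%N]big1_seq ?addn0; last first.
 move=> q /andP[qq0]; rewrite mem_index_iota => /andP[q1 _]; case: ifP => // qN.
 rewrite big1 // => b hb; apply/eqP; rewrite eqb0; apply/negP => /forallP h.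
 pose d := (N %/ q)%N; have dE : N = (q * d)%N by rewrite mulnC divnK.
 have ab i : (a i).+1 = ((b i).+1 * d)%N.
  by apply/eqP; rewrite -(frac_arith _ _ dE q1).
 have d0 : (0 < d)%N by rewrite divn_gt0 // dvdn_leq.
 have dg : (d %| g)%N.
  rewrite dvdn_gcd; apply/andP; split; first by apply/dvdn_biggcdP => i _; rewrite ab dvdn_mull.
  by have := dvdn_mull q (dvdnn d); rewrite -dE.
 have gd : (g = g %/ d * d)%N by rewrite divnK.
 have /(copP _ q1) hc := hb.
 have h1 : (g %/ d)%N = 1%N.
  apply: hc; first by rewrite -(dvdn_pmul2r d0) -gd -dE.
  by move=> i; rewrite /= -(dvdn_pmul2r d0) -gd -ab.
 have gd' : g = d by have := gd; rewrite h1 mul1n.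
 have : (q0 * g = q * d)%N by rewrite -NE.
 by rewrite gd' => /eqP; rewrite eqn_pmul2r // => /eqP e; rewrite e eqxx in qq0.
have ag i : (((a i).+1 %/ g).-1 < q0)%N.
 have h : (0 < (a i).+1 %/ g)%N by rewrite divn_gt0 // dvdn_leq.
 by rewrite prednK // -(leq_pmul2r g0) divnK // -NE; exact: ltn_ord.
pose b0 : pts n q0 := [ffun i => Ordinal (ag i)].
have b0E i : ((b0 i).+1 * g)%N = (a i).+1 by rewrite ffunE /= prednK ?divnK // divn_gt0 // dvdn_leq.
have cb0 : cop b0.
 apply/copP => // d dq da.
 have : (d * g %| g)%N.
  rewrite {2}/g dvdn_gcd; apply/andP; split.
   by apply/dvdn_biggcdP => i _; rewrite -b0E dvdn_pmul2r //; exact: da.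
  by have : (d * g %| q0 * g)%N; [rewrite dvdn_pmul2r | rewrite -NE].
 by rewrite -{2}[g]mul1n dvdn_pmul2r // dvdn1 => /eqP.
rewrite (bigD1 b0) //= big1 ?addn0 => [|b /andP[_ bb0]].
 by apply/eqP; rewrite eqb1; apply/forallP => i; rewrite (frac_arith _ _ NE q00) b0E eqxx.
apply/eqP; rewrite eqb0; apply/negP => /forallP h; move/eqP: bb0; apply; apply/ffunP => i; apply/val_inj/succn_inj.
have := h i; rewrite (frac_arith _ _ NE q00) -b0E eqn_pmul2r // => /eqP -> //.
Qed.

(** The fractions [a / N] are grouped by their reduced denominators, and orthogonality modulo [N]
    turns the sum over all numerators into the number of solutions. *)
Lemma sum_Aq N : (0 < N)%N ->
 \sum_(1 <= q < N.+1 | (q %| N)%N) Aq R C q = (N%:R ^+ n / N%:R ^+ s) * (nsols N)%:R.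
Proof.
move=> N0; rewrite -sum_gmean //.
transitivity (\sum_(1 <= q < N.+1 | (q %| N)%N) \sum_(b : pts n q | cop b) \sum_(a : pts n N)
  gmean N (fun i => (a i).+1%:Z) *+ [forall i, (a i).+1 * q == (b i).+1 * N]%N).
 rewrite [LHS]big_seq_cond [RHS]big_seq_cond; apply: eq_bigr => q /andP[]; rewrite mem_index_iota => /andP[q0 _] qN.
 apply: eq_bigr => b _; pose d := (N %/ q)%N; have NE : N = (q * d)%N by rewrite mulnC divnK.
 have d0 : (0 < d)%N by rewrite divn_gt0 // dvdn_leq.
 have lt i : (((b i).+1 * d).-1 < N)%N.
  have h : ((b i).+1 * d <= q * d)%N by rewrite leq_mul2r ltn_ord orbT.
  by rewrite prednK ?muln_gt0 // NE.
 pose a0 : pts n N := [ffun i => Ordinal (lt i)].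
 have a0E i : (a0 i).+1 = ((b i).+1 * d)%N by rewrite ffunE /= prednK // muln_gt0.
 rewrite (bigD1 a0) //= [X in _ + X]big1 ?addr0 => [|a aa0]; last first.
  rewrite (_ : [forall i, _] = false) //; apply/negP => /forallP h; move/eqP: aa0; apply; apply/ffunP => i.
  apply/val_inj/succn_inj; rewrite a0E; apply/eqP.
  by rewrite -(frac_arith _ _ NE q0); exact: h.
 rewrite (_ : [forall i, _] = true) ?mulr1n; last by apply/forallP => i; rewrite (frac_arith _ _ NE q0) a0E.
 rewrite gmean_gsum -(gmean_scale _ q0 d0) -NE; congr (gmean N _); apply/funext => i.
 by rewrite a0E PoszM.
under eq_bigr do rewrite exchange_big /=.
rewrite exchange_big /=; apply: eq_bigr => a _.
transitivity (gmean N (fun i => (a i).+1%:Z) *+ (\sum_(1 <= q < N.+1 | q %| N) \sum_(b : pts n q | cop b)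
   [forall i, (a i).+1 * q == (b i).+1 * N])%N); last by rewrite frac_unique.
rewrite -[RHS]sumrMnr; apply: eq_bigr => q _.
by rewrite -[RHS]sumrMnr.
Qed.

Lemma nsols1 : nsols 1 = 1%N.
Proof.
rewrite /nsols (eq_card (B := predT)) ?card_ffun ?card_ord ?exp1n // => p.
by rewrite unfold_in /=; apply/forallP => i; rewrite dvd1z.
Qed.

(** The Chinese remainder theorem glues solutions injectively; this inequality is all that a lower
    bound for the series requires. *)
Lemma solutions_mul N1 N2 : (0 < N1)%N -> (0 < N2)%N -> coprime N1 N2 ->
 (nsols N1 * nsols N2 <= nsols (N1 * N2))%N.
Proof.
move=> N10 N20 co; have N0 : (0 < N1 * N2)%N by rewrite muln_gt0 N10.
pose f (xy : pts s N1 * pts s N2) : pts s (N1 * N2) :=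
 [ffun j => Ordinal (ltn_pmod (chinese N1 N2 (xy.1 j) (xy.2 j)) N0)].
have f1 xy j : (f xy j %% N1 = xy.1 j)%N.
 by rewrite ffunE /= modn_dvdm ?dvdn_mulr // chinese_modl // modn_small.
have f2 xy j : (f xy j %% N2 = xy.2 j)%N.
 by rewrite ffunE /= modn_dvdm ?dvdn_mull // chinese_modr // modn_small.
have fi : injective f.
 move=> [x y] [x' y'] e; congr (_, _); apply/ffunP => j; apply/val_inj.
  by have := f1 (x, y) j; rewrite e f1.
 by have := f2 (x, y) j; rewrite e f2.
have qm (M : nat) (i : 'I_n) (z x : 'I_s -> nat) : (forall j, z j %% M = x j)%N ->
  (M%:Z %| qf (C i) (fun j => (x j)%:Z))%Z -> (M%:Z %| qf (C i) (fun j => (z j)%:Z))%Z.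
 move=> h d; have [t ht] := qf_modq (C i) M%:Z (fun j => (x j)%:Z) (fun j => (z j %/ M)%N%:Z).
 have -> : (fun j => (z j)%:Z) = (fun j => M%:Z * (z j %/ M)%N%:Z + (x j)%:Z).
  by apply/funext => j; rewrite {1}(divn_eq (z j) M) h; lia.
 by rewrite ht rpredDl // dvdz_mulr.
rewrite /nsols -cardX -(fintype.card_image fi); apply: subset_leq_card; apply/fintype.subsetP => _ /fintype.imageP[[x y] /= h ->].
move: h; rewrite !unfold_in /= => /andP[/forallP hx /forallP hy].
apply/forallP => i; rewrite PoszM Gauss_dvdz ?coprimezE //; apply/andP; split.
 by apply: qm (hx i) => j; rewrite f1.
by apply: qm (hy i) => j; rewrite f2.
Qed.

Definition density (N : nat) : R := N%:R ^+ n / N%:R ^+ s * (nsols N)%:R.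
Lemma densityE N : (0 < N)%N -> \sum_(1 <= q < N.+1 | (q %| N)%N) Aq R C q = ((density N)%:C)%C.
Proof. by move=> N0; rewrite sum_Aq // /density !rmorphM fmorphV !rmorphXn !rmorph_nat. Qed.
Lemma density_mul N1 N2 : (0 < N1)%N -> (0 < N2)%N -> coprime N1 N2 ->
 density N1 * density N2 <= density (N1 * N2).
Proof.
move=> h1 h2 h3; rewrite /density natrM !exprMn.
have -> : N1%:R ^+ n / N1%:R ^+ s * (nsols N1)%:R * (N2%:R ^+ n / N2%:R ^+ s * (nsols N2)%:R) =
 N1%:R ^+ n / N1%:R ^+ s * (N2%:R ^+ n / N2%:R ^+ s) * (nsols N1 * nsols N2)%:R :> R.
 by rewrite natrM; ring.
rewrite invfM; have -> : N1%:R ^+ n * N2%:R ^+ n * (N1%:R ^- s * N2%:R ^- s) =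
 N1%:R ^+ n / N1%:R ^+ s * (N2%:R ^+ n / N2%:R ^+ s) :> R by ring.
apply: ler_wpM2l; first by rewrite mulr_ge0 // divr_ge0 // exprn_ge0.
by rewrite ler_nat; exact: solutions_mul.
Qed.

Lemma density1 : density 1 = 1.
Proof. by rewrite /density nsols1 !expr1n divr1 mulr1. Qed.
Lemma Aq1 : Aq R C 1 = 1.
Proof. by have := @densityE 1 isT; rewrite big_mkcond big_nat1 /= density1. Qed.
Lemma sum_divisors_pfactor (p v : nat) (f : nat -> R[i]) : prime p ->
 \sum_(1 <= q < (p ^ v).+1 | (q %| p ^ v)%N) f q = \sum_(m < v.+1) f (p ^ m)%N.
Proof.
move=> pp; have p1 := prime_gt1 pp.
rewrite -(big_mkord xpredT (fun m => f (p ^ m)%N)) -[RHS](big_map (fun m => (p ^ m)%N) xpredT) -[LHS]big_filter.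
apply: perm_big; apply: uniq_perm; first by rewrite filter_uniq // iota_uniq.
 by rewrite map_inj_uniq ?iota_uniq // => a b /eqP; rewrite eqn_exp2l // => /eqP.
move=> q; rewrite mem_filter mem_index_iota; apply/idP/mapP => [/andP[/(dvdn_pfactor _ _ pp)[m mv ->] _]|[m]].
 by exists m => //; rewrite mem_index_iota.
rewrite mem_index_iota ltnS => /andP[_ mv] ->; have h : (p ^ m %| p ^ v)%N by rewrite dvdn_exp2l.
by rewrite h expn_gt0 (ltnW p1) ltnS dvdn_leq // expn_gt0 (ltnW p1).
Qed.

Hypothesis hrank : rank_cond C.
Local Notation d0 := (delta0 R r).

(** The divisors of [p ^ v] contribute 1 and then terms bounded by a geometric series of ratio at
    most 1/2, whose first term is of order [p ^ -(1 + delta0)]. *)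
Lemma density_big_prime : exists K : R, 1 <= K /\ forall p v, prime p ->
 1 - 2 * K * p%:R `^ (- (1 + d0)) <= density (p ^ v).
Proof.
have [K [K1 HK]] := Aq_bound R hrank; exists K; split=> // p v pp.
have dp := delta0_gt0 R r; have p1 := prime_gt1 pp; have p0 := prime_gt0 pp.
have pr : 0 < p%:R :> R by rewrite ltr0n.
pose x : R := p%:R `^ (- (1 + d0)).
have x0 : 0 <= x by exact: powR_ge0.
have x2 : x <= 2^-1.
 apply: (@le_trans _ _ (p%:R `^ (- 1))).
  by rewrite /x ler_powR ?ler1n // lerN2 lerDl ltW.
 by rewrite powR_inv1 ?(ltW pr) // lef_pV2 ?posrE ?ler_nat.
have := @densityE (p ^ v)%N; rewrite expn_gt0 p0 => /(_ isT); rewrite sum_divisors_pfactor // big_ord_recl expn0 Aq1 => h.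
have b (m : nat) : cabs (\sum_(i < m) Aq R C (p ^ bump 0 i)) <= 2 * K * x * (1 - 2^-1 ^+ m).
 elim: m => [|m IH]; first by rewrite big_ord0 cabs0 expr0 subrr mulr0.
 rewrite big_ord_recr /=; apply: le_trans (cabsD _ _) _.
 apply: le_trans (lerD IH (HK _ _)) _; first by rewrite expn_gt0 p0.
 have -> : (p ^ bump 0 m)%:R `^ (- (1 + d0)) = x ^+ m.+1.
  rewrite natrX -powR_mulrn ?(ltW pr) // -powRrM mulrC powRrM powR_mulrn //.
 have e : x ^+ m.+1 <= x * 2^-1 ^+ m by rewrite exprS; apply: ler_wpM2l => //; apply: lerXn2r; rewrite ?nnegrE.
 have := ler_wpM2l (le_trans ler01 K1) e; rewrite [2^-1 ^+ m.+1]exprS; move: (2^-1 ^+ m) (x ^+ m.+1) => u w h'.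
 have -> : 2 * K * x * (1 - 2^-1 * u) = 2 * K * x * (1 - u) + K * (x * u) by field.
 by rewrite lerD2l.
have := cabs_Re (\sum_(i < v) Aq R C (p ^ bump 0 i)).
have -> : Re (\sum_(i < v) Aq R C (p ^ bump 0 i)) = density (p ^ v) - 1.
 by move/(congr1 (fun z : R[i] => Re z)): h; rewrite raddfD /= => <-; rewrite addrC addKr.
move=> /le_trans/(_ (b v)); rewrite ler_norml => /andP[h1 _].
have : 2 * K * x * (1 - 2^-1 ^+ v) <= 2 * K * x.
 apply: ler_piMr; last by rewrite gerBl exprn_ge0.
 by rewrite !mulr_ge0 //; exact: le_trans K1.
rewrite -/x; lra.
Qed.

Hypothesis local_zero : forall p, prime p -> exists c : R, 0 < c /\ forall v, c <= density (p ^ v).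

(** Primes up to [Q] contribute their local constants. Beyond [Q] the product of the factors
    [1 - e q] is at least 1 minus the sum of the [e q], hence at least 1/2, because that series
    converges. *)
Lemma density_lower : exists c : R, 0 < c /\ forall N, (0 < N)%N -> c <= density N.
Proof.
have [K [K1 HK]] := density_big_prime; have dp := delta0_gt0 R r.
pose e (q : nat) : R := 2 * K * q%:R `^ (- (1 + d0)).
have e0 q : 0 <= e q by rewrite !mulr_ge0 ?powR_ge0 //; exact: le_trans K1.
have [Q [Q0 hQ]] : exists Q : nat, (0 < Q)%N /\ 2 * K * (d0^-1 * Q%:R `^ (- d0)) <= 2^-1.
 pose A : R := 4 * K / d0; have A0 : 0 < A by rewrite divr_gt0 // mulr_gt0 // (lt_le_trans _ K1).
 pose x : R := A `^ d0^-1; have x0 : 0 < x by exact: pw_gt0.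
 exists (truncn x).+1; split=> //; set k : R := (truncn x).+1%:R.
 have xk : x <= k by apply: ltW; exact: truncnS_gt.
 have kp : 0 < k by exact: lt_le_trans xk.
 have Ak : A <= k `^ d0.
  have -> : A = x `^ d0 by rewrite /x -powRrM mulVf ?lt0r_neq0 // powRr1 // ltW.
  by apply: ge0_ler_powR; rewrite ?nnegrE ?(ltW dp) ?(ltW x0) ?(ltW kp).
 rewrite pwN // mulrA ler_pdivrMr ?pw_gt0 //.
 have : 2 * K / d0 = 2^-1 * A by rewrite /A; field; exact: lt0r_neq0.
 move=> ->; lra.
have /choice[lc hlc] : forall p, exists c : R, prime p -> [/\ 0 < c, c <= 1 & forall v, c <= density (p ^ v)].
 move=> p; case: (boolP (prime p)) => [pp|]; last by exists 1.
 have [c [c0 hc]] := local_zero pp; exists c => _; split=> //.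
 by have := hc 0%N; rewrite expn0 density1.
pose cc q : R := if prime q then (if (q <= Q)%N then lc q else 1 - e q) else 1.
have tail m : (Q <= m)%N -> \sum_(Q.+1 <= q < m.+1) e q <= 2^-1.
 move=> Qm; rewrite -mulr_sumr; apply: le_trans hQ; apply: ler_wpM2l; first by rewrite mulr_ge0 //; exact: le_trans K1.
 exact: zeta_tail.
have e1 q : (Q < q)%N -> e q <= 2^-1.
 case: q => // q Qq; apply: le_trans (tail q.+1 (ltnW Qq)); rewrite big_nat_recr //= lerDr; exact: sumr_ge0.
have cc0 q : 0 < cc q.
 rewrite /cc; case: ifP => // pq; case: leqP => [_|h]; first by have [] := hlc q pq.
 have := e1 q h; lra.
have cc1 q : cc q <= 1.
 rewrite /cc; case: ifP => // pq; case: leqP => [_|h]; first by have [] := hlc q pq.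
 by rewrite gerBl.
have ccd q v : prime q -> cc q <= density (q ^ v).
 by move=> pq; rewrite /cc pq; case: leqP => h; [have [_ _] := hlc q pq; apply | exact: HK].
pose Pi m : R := \prod_(0 <= q < m) cc q.
have Pi0 m : 0 < Pi m by rewrite /Pi; elim: m => [|m IH]; [rewrite big_geq | rewrite big_nat_recr //= mulr_gt0].
have PiS m : Pi m.+1 = Pi m * cc m by rewrite /Pi big_nat_recr.
have low N m : (0 < N)%N -> (forall p, prime p -> (p %| N)%N -> (p < m)%N) -> Pi m <= density N.
 elim: m N => [|m IH] N N0 hN.
  have -> : N = 1%N by apply/eqP; apply: contraT => N1; have := hN _ (pdiv_prime _) (pdiv_dvd N); rewrite ltn_neqAle eq_sym N1 N0 => /(_ isT).
  by rewrite /Pi big_geq // density1.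
 rewrite PiS.
 case: (boolP (prime m)) => [pm|npm]; last first.
  rewrite [cc m]/cc (negbTE npm) mulr1; apply: IH => // p pp pN.
  by have := hN p pp pN; rewrite ltnS leq_eqVlt => /orP[/eqP pm|//]; rewrite -pm pp in npm.
 have [N' co NE] := pfactor_coprime pm N0; set v := logn m N in NE.
 have N'0 : (0 < N')%N by move: N0; rewrite {1}NE muln_gt0 => /andP[].
 rewrite {1}NE; have mv0 : (0 < m ^ v)%N by rewrite expn_gt0 prime_gt0.
 have cov : coprime N' (m ^ v) by rewrite coprime_sym coprimeXl.
 apply: le_trans (density_mul N'0 mv0 cov).
 apply: ler_pM; [exact: ltW | exact: ltW | | exact: ccd].
 apply: IH => // p pp pN'.
 have : (p < m.+1)%N by apply: hN => //; rewrite NE dvdn_mulr.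
 rewrite ltnS leq_eqVlt => /orP[/eqP pm'|//].
 by move: co; rewrite prime_coprime // -pm' pN'.
have Plow m : (Q <= m)%N -> Pi Q.+1 * (1 - \sum_(Q.+1 <= q < m.+1) e q) <= Pi m.+1.
 elim: m => [|m IH]; first by rewrite leqn0 => /eqP Q00; rewrite Q00 in Q0.
 rewrite leq_eqVlt => /orP[/eqP <-|Qm]; first by rewrite big_geq // subr0 mulr1.
 rewrite big_nat_recr //= [Pi m.+2]PiS.
 have h := IH Qm; have t := tail m Qm.
 have c1 : 1 - e m.+1 <= cc m.+1.
  by rewrite /cc leqNgt Qm /=; case: ifP => // _; rewrite gerBl.
 have em := e1 m.+1 Qm.
 set t1 := \sum_(_ <= _ < _) _ in h t *.
 apply: (@le_trans _ _ (Pi Q.+1 * (1 - t1) * (1 - e m.+1))).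
  rewrite -mulrA ler_pM2l // mulrBr mulr1 mulrBl mul1r opprB.
  have : 0 <= t1 * e m.+1 by rewrite mulr_ge0 // sumr_ge0.
  lra.
 apply: ler_pM => //; [by apply: mulr_ge0; [exact: ltW | rewrite subr_ge0; lra] | by rewrite subr_ge0; lra].
exists (Pi Q.+1 / 2); split; first by rewrite divr_gt0.
move=> N N0; pose m := maxn Q N; have Qm : (Q <= m)%N by exact: leq_maxl.
apply: le_trans (low N m.+1 N0 _); last first.
 by move=> p pp pN; rewrite ltnS; apply: leq_trans (dvdn_leq N0 pN) (leq_maxr _ _).
apply: le_trans (Plow m Qm); rewrite ler_pM2l //; have := tail m Qm; lra.
Qed.

(** The divisors of [k!] include all [q <= k], so the density of [k!], which is real and bounded
    below, differs from a partial sum of the series by a tail that tends to zero. *)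
Lemma singular_series_pos (S : R[i]) :
 (exists K : R, 1 <= K /\ forall Q, (0 < Q)%N -> cabs (S - Spart R C Q) <= K * Q%:R `^ (- d0)) -> 0 < S.
Proof.
move=> [K1 [K11 HS]]; have [K [K0 HK]] := Aq_bound R hrank.
have [c [c0 hc]] := density_lower; have dp := delta0_gt0 R r.
suff H (e : R) : 0 < e -> exists y : R, c <= y /\ cabs (S - (y%:C)%C) <= e.
 have [hIm hRe] : Im S = 0 /\ c <= Re S.
  split.
   apply/normr0_eq0/eqP; rewrite eq_le normr_ge0 andbT; apply/ler_addgt0Pr => e e0.
   have [y [y1 y2]] := H e e0; rewrite add0r; apply: le_trans y2.
   by have := cabs_Im (S - (y%:C)%C); rewrite raddfB /= subr0.
  apply/ler_addgt0Pr => e e0; have [y [y1 y2]] := H e e0.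
  apply: le_trans y1 _; rewrite -lerBlDl; apply: le_trans y2.
  have := cabs_Re (S - (y%:C)%C); rewrite raddfB /= distrC; apply: le_trans; exact: ler_norm.
 move: hIm hRe; case: (S) => a b /= -> hRe.
 by rewrite ltcE /= eqxx /=; exact: lt_le_trans hRe.
move=> e0; pose A : R := (K1 + K / d0) / e.
have A0 : 0 < A by rewrite divr_gt0 // addr_gt0 ?divr_gt0 //; lra.
pose x : R := A `^ d0^-1; have x0 : 0 < x by exact: pw_gt0.
pose k := (truncn x).+1.
have xk : x <= k%:R by apply: ltW; exact: truncnS_gt.
have kp : 0 < k%:R :> R by rewrite ltr0n.
have Ak : A <= k%:R `^ d0.
 have -> : A = x `^ d0 by rewrite /x -powRrM mulVf ?lt0r_neq0 // powRr1 // ltW.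
 by apply: ge0_ler_powR; rewrite ?nnegrE ?(ltW dp) ?(ltW x0) ?(ltW kp).
have N0 : (0 < k`!)%N by exact: fact_gt0.
exists (density k`!); split; first exact: hc.
have kN : (k <= k`!)%N by apply: dvdn_leq => //; apply: dvdn_fact; rewrite leqnn.
have := densityE N0; rewrite (big_cat_nat (n := k.+1)) //= => <-.
have -> : \sum_(1 <= q < k.+1 | (q %| k`!)%N) Aq R C q = Spart R C k.
 rewrite /Spart [LHS]big_nat_cond [RHS]big_nat_cond; apply: eq_bigl => q.
 by case: (boolP (0 < q < k.+1)%N) => //= /andP[q1 qk]; rewrite dvdn_fact // q1 -ltnS.
rewrite opprD addrA; apply: le_trans (cabsB _ _) _.
apply: (@le_trans _ _ (K1 * k%:R `^ (- d0) + K * (d0^-1 * k%:R `^ (- d0)))).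
 apply: lerD; first exact: HS.
 apply: le_trans (cabs_sum _ _ _) _.
 apply: (@le_trans _ _ (\sum_(k.+1 <= q < k`!.+1) cabs (Aq R C q))).
  by rewrite big_mkcond /=; apply: ler_sum => q _; case: ifP => // _; exact: cabs_ge0.
 apply: (@le_trans _ _ (K * \sum_(k.+1 <= q < k`!.+1) q%:R `^ (- (1 + d0)))).
  rewrite mulr_sumr big_nat_cond [leRHS]big_nat_cond; apply: ler_sum => q /andP[/andP[h _] _].
  by apply: HK; move: h; clear; lia.
 by apply: ler_wpM2l; [lra | exact: zeta_tail].
rewrite mulrA -mulrDl pwN // ler_pdivrMr ?pw_gt0 // [e * _]mulrC -ler_pdivrMr //.
Qed.

End LocalDensities.

Lemma size_aux (a b c : nat) : (1 < b)%N -> c = (a + b).-1 -> ~~ (c <= a)%N.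
Proof. lia. Qed.

(** * Transfer of rank conditions from the complex numbers *)

Section Transfer.
Variables (R : realType) (K : fieldType).

(** Polynomials over a countable ring have countably many real roots altogether, a set of measure
    zero, whereas [[0, 1]] has measure one. *)
Lemma outside_countable_roots (A : countNzRingType) (v : {rmorphism A -> R[i]}) :
 exists z : R[i], forall P : {poly A}, map_poly v P != 0 -> (map_poly v P).[z] != 0.
Proof.
pose F (P : {poly A}) : set R := [set y | map_poly v P != 0 /\ root (map_poly v P) (y%:C)%C].
have hF P : countable (F P).
 case: (eqVneq (map_poly v P) 0) => [P0|P0].
  by rewrite (_ : F P = set0) // /F; apply/seteqP; split => // y []; rewrite P0 eqxx.
 have [rs hrs] := closed_field_poly_normal (map_poly v P).
 apply: (@sub_countable _ _ _ [set` [seq Re z | z <- rs]]); last exact: countable_finpred || exact: finite_set_countable.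
 apply: subset_card_le => y [_]; rewrite hrs rootZ ?lead_coef_eq0 // root_prod_XsubC => hy.
 by apply/mapP; exists (y%:C)%C.
have c : countable (\bigcup_(P in [set: {poly A}]) F P) by apply: bigcup_countable => [|P _]; [exact: countableP | exact: hF].
have [y hy] : exists y, ~ (\bigcup_(P in [set: {poly A}]) F P) y.
 apply/existsNP => h.
 have e : \bigcup_(P in [set: {poly A}]) F P = setT.
  by apply/seteqP; split => // y _; apply: boolp.contrapT; exact: h.
 have := @le_measure _ R (measurableTypeR R) (@lebesgue_measure R) [set` `[0, 1]%R] setT.
 rewrite !inE => /(_ (measurable_itv _) measurableT (@subsetT _ _)).
 have c0 : lebesgue_measure [set: measurableTypeR R] = 0%E by rewrite -e; exact: countable_lebesgue_measure0.
 rewrite [X in (_ <= X)%E]c0 => h0.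
 have e1 := lebesgue_measure_itv (R := R) `[0, 1]; rewrite /= lte_fin ltr01 oppr0 adde0 in e1.
 have h1 : (1%:E <= 0 :> \bar R)%E by rewrite -e1; exact: h0.
 by move: h1; rewrite lee_fin ler10.
by exists (y%:C)%C => P P0; apply/negP => h; apply: hy; exists P.
Qed.

(** If [x] is transcendental over the image of [u], [z] only has to avoid countably many roots.
    Otherwise a polynomial [Q] of least degree that kills [x] is moved along [v], and [z] is one of
    its roots. That no further polynomial vanishes at [z] expresses the irreducibility of [Q],
    obtained by comparison with a polynomial [W] of least degree that kills [z]. *)
Lemma embed_step (A : countIdomainType) (u : {rmorphism A -> K}) (v : {rmorphism A -> R[i]}) (x : K) :
 (forall a, (u a == 0) = (v a == 0)) ->
 exists z : R[i], forall P : {poly A}, ((map_poly u P).[x] == 0) = ((map_poly v P).[z] == 0).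
Proof.
move=> ker.
have ker0 (P : {poly A}) : (map_poly u P == 0) = (map_poly v P == 0).
 apply/eqP/eqP => /polyP h; apply/polyP => i; have := h i; rewrite !coef_map !coef0 /= => /eqP; first by rewrite ker => /eqP.
 by rewrite -ker => /eqP.
(* Deleting the leading coefficients killed by [u] changes neither image of a polynomial. *)
have trim (P : {poly A}) : map_poly u P != 0 -> exists Q : {poly A},
  [/\ map_poly u Q = map_poly u P, map_poly v Q = map_poly v P, u (lead_coef Q) != 0 & (size Q <= size P)%N].
 have [m] := ubnP (size P); elim: m P => // m IH P sP P0.
 case: (eqVneq (u (lead_coef P)) 0) => [l0|l0]; last by exists P.
 have Pn0 : P != 0 by apply: contraNneq P0 => ->; rewrite rmorph0.
 pose P' := P - lead_coef P *: 'X^((size P).-1).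
 have sP' : (size P' < size P)%N.
  have sp : (0 < size P)%N by rewrite size_poly_gt0.
  rewrite -[X in (_ < X)%N](prednK sp) ltnS; apply/leq_sizeP => j; rewrite leq_eqVlt => /orP[/eqP <-|hj].
   by rewrite /P' coefB coefZ coefXn eqxx mulr1 subrr.
  rewrite /P' coefB coefZ coefXn gtn_eqF // mulr0 subr0; apply/eqP/negPn/negP => h.
  by move: (leq_sizeP P (size P) (leqnn _) j); rewrite -(prednK sp) => /(_ hj) h'; rewrite h' eqxx in h.
 have vl0 : v (lead_coef P) = 0 by apply/eqP; rewrite -ker l0.
 have e1 : map_poly u P' = map_poly u P by rewrite rmorphB /= map_polyZ l0 scale0r subr0.
 have e2 : map_poly v P' = map_poly v P by rewrite rmorphB /= map_polyZ vl0 scale0r subr0.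
 have [|//|Q [h1 h2 h3 h4]] := IH P'; first by move: sP sP'; lia.
  by rewrite e1.
 by exists Q; rewrite h1 h2 e1 e2; split=> //; apply: leq_trans h4 (ltnW sP').
have [nalg|] := boolp.pselect (forall P : {poly A}, map_poly u P != 0 -> (map_poly u P).[x] != 0).
 have [z hz] := outside_countable_roots v; exists z => P.
 case: (eqVneq (map_poly u P) 0) => [P0|P0].
  by rewrite P0; move/eqP: P0; rewrite ker0 => /eqP ->; rewrite !horner0 !eqxx.
 by rewrite (negbTE (nalg P P0)) (negbTE (hz P _)) // -ker0.
move=> /boolp.existsNP[P0 hP0].
have ex : exists m, `[< exists Q : {poly A}, [/\ size Q = m, u (lead_coef Q) != 0 & (map_poly u Q).[x] = 0] >].
 have [h0 h1] : map_poly u P0 != 0 /\ (map_poly u P0).[x] = 0.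
  by apply: boolp.contrapT => h; apply: hP0 => h2; apply/negP => /eqP h3; apply: h.
 have [Q [q1 q2 q3 q4]] := trim P0 h0.
 by exists (size Q); apply/boolp.asboolP; exists Q; rewrite q1.
case: (ex_minnP ex) => m /boolp.asboolP[Q [sQ lQ Qx]] hmin.
have mapP0 (P : {poly A}) : (size P < m)%N -> (map_poly u P).[x] = 0 -> map_poly u P = 0.
 move=> sP Px; apply/eqP; apply: boolp.contrapT => /negP h.
 have [Q' [q1 q2 q3 q4]] := trim P h.
 have : (m <= size Q')%N by apply: hmin; apply/boolp.asboolP; exists Q'; rewrite q1.
 by move: q4 sP; clear; lia.
have Qn0 : Q != 0 by apply: contraNneq lQ => ->; rewrite lead_coef0 rmorph0.
have lvQ : v (lead_coef Q) != 0 by rewrite -ker.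
have szv : size (map_poly v Q) = m by rewrite size_map_poly_id0 // sQ.
have szu : size (map_poly u Q) = m by rewrite size_map_poly_id0 // sQ.
have m1 : (1 < m)%N.
 rewrite ltnNge; apply/negP => m1; have : size (map_poly u Q) == 1%N.
  by rewrite szu eqn_leq m1 /= -sQ size_poly_gt0.
 move/size_poly1P => [c c0 e]; move: Qx; rewrite e hornerC => c00; by rewrite c00 eqxx in c0.
have [z /eqP Qz] : exists z, root (map_poly v Q) z by apply: closed_rootP; rewrite szv; case: (m) m1 => [|[]].
exists z.
have pdiv (P B : {poly A}) : exists k D, lead_coef B ^+ k *: P = D * B + Pdiv.Idomain.modp P B.
 by exists (scalp P B), (Pdiv.Idomain.divp P B); exact: Pdiv.Idomain.divp_eq.
have ev (w : {rmorphism A -> K}) : True by [].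
have fwd (P : {poly A}) : (map_poly u P).[x] = 0 -> (map_poly v P).[z] = 0.
 move=> Px; have [k [D e]] := pdiv P Q.
 have sr : (size (Pdiv.Idomain.modp P Q) < m)%N by rewrite -sQ Pdiv.Idomain.ltn_modp.
 have r0 : map_poly u (Pdiv.Idomain.modp P Q) = 0.
  apply: mapP0 => //; have := congr1 (fun p => (map_poly u p).[x]) e.
  by rewrite map_polyZ rmorphD rmorphM /= hornerZ hornerD hornerM Px Qx !mulr0 add0r => <-.
 have rv : map_poly v (Pdiv.Idomain.modp P Q) = 0 by apply/eqP; rewrite -ker0 r0.
 have := congr1 (fun p => (map_poly v p).[z]) e.
 rewrite map_polyZ rmorphD rmorphM /= hornerZ hornerD hornerM Qz rv horner0 mulr0 addr0 => /eqP.
 by rewrite mulf_eq0 rmorphXn expf_eq0 (negbTE lvQ) andbF /= => /eqP.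
have exW : exists l, `[< exists W : {poly A}, [/\ size W = l, u (lead_coef W) != 0 & (map_poly v W).[z] = 0] >].
 by exists m; apply/boolp.asboolP; exists Q; rewrite Qz.
case: (ex_minnP exW) => l /boolp.asboolP[W [sW lW Wz]] hminW.
have Wn0 : W != 0 by apply: contraNneq lW => ->; rewrite lead_coef0 rmorph0.
have mapW (P : {poly A}) : (size P < l)%N -> (map_poly v P).[z] = 0 -> map_poly u P = 0.
 move=> sP Pz; apply/eqP; apply: boolp.contrapT => /negP h.
 have [Q' [q1 q2 q3 q4]] := trim P h.
 have : (l <= size Q')%N by apply: hminW; apply/boolp.asboolP; exists Q'; rewrite q2.
 by move: q4 sP; clear; lia.
have remW (P : {poly A}) : (map_poly v P).[z] = 0 -> exists k D, lead_coef W ^+ k *: P = D * W + Pdiv.Idomain.modp P W /\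
  map_poly u (Pdiv.Idomain.modp P W) = 0.
 move=> Pz; have [k [D e]] := pdiv P W; exists k, D; split=> //.
 apply: mapW; first by rewrite -sW Pdiv.Idomain.ltn_modp.
 have := congr1 (fun p => (map_poly v p).[z]) e.
 by rewrite map_polyZ rmorphD rmorphM /= hornerZ hornerD hornerM Pz Wz !mulr0 add0r => <-.
(* [W] divides [Q] up to constants. If [W] did not vanish at [x], the cofactor [D] would, and its
   degree is below that of [Q]. *)
have Wx : (map_poly u W).[x] = 0.
 apply/eqP; apply: boolp.contrapT => /negP Wx0.
 have [k [D [e r0]]] := remW Q Qz.
 have eu : u (lead_coef W) ^+ k *: map_poly u Q = map_poly u D * map_poly u W.
  by have := congr1 (map_poly u) e; rewrite map_polyZ rmorphD rmorphM /= r0 addr0 rmorphXn.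
 have Dx : (map_poly u D).[x] = 0.
  have := congr1 (fun p => p.[x]) eu; rewrite hornerZ hornerM Qx mulr0 => /esym/eqP.
  by rewrite mulf_eq0 (negbTE Wx0) orbF => /eqP.
 have lk : u (lead_coef W) ^+ k != 0 by rewrite expf_neq0.
 have Wu0 : map_poly u W != 0 by rewrite map_poly_eq0_id0.
 have Du0 : map_poly u D != 0.
  apply/eqP => D0; move: eu; rewrite D0 mul0r => /eqP; rewrite scaler_eq0 (negbTE lk) /=.
  by rewrite -size_poly_eq0 szu; case: (m) m1.
 have sz := congr1 (fun p : {poly K} => size p) eu; rewrite size_scale // size_mul // szu (@size_map_poly_id0 _ _ u W) // sW in sz.
 have l1 : (1 < l)%N.
  rewrite ltnNge; apply/negP => l1; have : size (map_poly v W) == 1%N.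
   rewrite size_map_poly_id0 -?ker // sW eqn_leq l1 /= -sW size_poly_gt0 //.
  move/size_poly1P => [c c0 e']; move: Wz; rewrite e' hornerC => c00; by rewrite c00 eqxx in c0.
 have [D' [d1 d2 d3 d4]] := trim D Du0.
 have sD' : size D' = size (map_poly u D) by rewrite -d1 size_map_poly_id0.
 have : (m <= size D')%N by apply: hmin; apply/boolp.asboolP; exists D'; rewrite d1.
 by rewrite sD'; apply/negP; exact: size_aux l1 sz.
move=> P; apply/eqP/eqP => [|Pz]; first exact: fwd.
have [k [D [e r0]]] := remW P Pz.
have := congr1 (fun p => (map_poly u p).[x]) e.
rewrite map_polyZ rmorphD rmorphM /= hornerZ hornerD hornerM Wx r0 horner0 mulr0 addr0 => /eqP.
by rewrite mulf_eq0 rmorphXn expf_eq0 (negbTE lW) andbF /= => /eqP.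
Qed.

Hypothesis char0 : forall m : nat, (m%:R == 0 :> K) = (m == 0)%N.

Lemma embed_seq (t : seq K) : exists (A : countIdomainType) (u : {rmorphism A -> K}) (v : {rmorphism A -> R[i]}),
 (forall a, (u a == 0) = (v a == 0)) /\ forall x, x \in t -> exists a, u a = x.
Proof.
elim: t => [|x t [A [u [v [ker hA]]]]].
 (* Characteristic zero makes the integers embed on both sides; the elements are then adjoined one
    by one. *)
 exists int, (intmul 1 : {rmorphism int -> K}), (intmul 1 : {rmorphism int -> R[i]}); split=> // a.
 rewrite intr_eq0; case: a => m /=; first by rewrite -pmulrn char0.
 by rewrite NegzE mulrNz !oppr_eq0 -pmulrn char0.
have [z hz] := embed_step x ker.
pose u' : {rmorphism {poly A} -> K} := horner_eval x \o map_poly u.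
pose v' : {rmorphism {poly A} -> R[i]} := horner_eval z \o map_poly v.
exists {poly A}, u', v'; split; first exact: hz.
move=> y; rewrite inE => /orP[/eqP ->|/hA[a <-]].
 by exists 'X; rewrite /u' /= /horner_eval map_polyX hornerX.
by exists a%:P; rewrite /u' /= /horner_eval map_polyC hornerC.
Qed.

(* A rank factorization of [\sum_i b i *: B i] over [K], normalized so that some [b i] is 1, only involves
  finitely many elements of [K], hence can be moved to the complex numbers. *)
Lemma pencil_rank_transfer n s (B : 'I_n -> 'M[int]_s) (d : nat) :
 (forall b : 'I_n -> R[i], (exists i, b i != 0) -> (d < \rank (\sum_i b i *: map_mx intr (B i))%R)%N) ->
 forall b : 'I_n -> K, (exists i, b i != 0) -> (d < \rank (\sum_i b i *: map_mx intr (B i))%R)%N.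
Proof.
move=> h b [i0 bi0]; rewrite ltnNge; apply/negP => rk.
set N := (X in (\rank X <= _)%N) in rk; pose k := \rank N.
pose L := col_base N; pose M := row_base N.
have LM : N = L *m M by rewrite mulmx_base.
pose t := [seq b i | i <- enum 'I_n] ++ [seq L p.1 p.2 | p <- enum {: 'I_s * 'I_k}] ++ [seq M p.1 p.2 | p <- enum {: 'I_k * 'I_s}].
have [A [u [v [ker hA]]]] := embed_seq t.
have /choice[b' hb'] : forall i, exists a, u a = b i.
 by move=> i; apply: hA; rewrite mem_cat map_f ?mem_enum.
have /choice[L' hL'] : forall p : 'I_s * 'I_k, exists a, u a = L p.1 p.2.
 by move=> p; apply: hA; rewrite !mem_cat (map_f (fun p => L p.1 p.2)) ?mem_enum ?orbT.
have /choice[M' hM'] : forall p : 'I_k * 'I_s, exists a, u a = M p.1 p.2.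
 by move=> p; apply: hA; rewrite !mem_cat (map_f (fun p => M p.1 p.2)) ?mem_enum ?orbT.
have := h (fun i => v (b' i)) (ex_intro _ i0 _); rewrite -ker hb' => /(_ bi0).
set Z := (X in (_ < \rank X)%N).
have -> : Z = (\matrix_(i, j) v (L' (i, j))) *m (\matrix_(i, j) v (M' (i, j))).
 apply/matrixP => i j; rewrite /Z summxE mxE.
 have e : u (\sum_l b' l * (B l i j)%:~R) = u (\sum_l L' (i, l) * M' (l, j)).
  have := congr1 (fun X : 'M[K]_s => X i j) LM; rewrite /N summxE mxE !rmorph_sum /= => e.
  rewrite [LHS](eq_bigr (fun l => (b l *: map_mx intr (B l)) i j)); last first.
   by move=> l _; rewrite rmorphM /= hb' rmorph_int !mxE.
  by rewrite e; apply: eq_bigr => l _; rewrite rmorphM /= hL' hM'.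
 have /eqP : v (\sum_l b' l * (B l i j)%:~R - \sum_l L' (i, l) * M' (l, j)) == 0.
  by rewrite -ker rmorphB /= e subrr.
 rewrite rmorphB /= => /eqP; rewrite subr_eq0 !rmorph_sum /= => /eqP e2.
 transitivity (\sum_l v (b' l * (B l i j)%:~R)); first by apply: eq_bigr => l _; rewrite rmorphM /= rmorph_int !mxE.
 by rewrite e2; apply: eq_bigr => l _; rewrite rmorphM /= !mxE.
move=> hd; have := leq_trans hd (leq_trans (mulmx_max_rank _ _) rk).
by rewrite ltnn.
Qed.

End Transfer.

(** * Common zeros of several quadratic forms *)

Section CommonZero.
Variable K : fieldType.

Lemma qd_mulmx s d (A : 'M[K]_s) (B : 'M[K]_(d, s)) y : qd A (y *m B) = qd (B *m A *m B^T) y.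
Proof. by rewrite /qd /bil trmx_mul !mulmxA. Qed.
Lemma pol_mulmx s d (A : 'M[K]_s) (B : 'M[K]_(d, s)) : pol (B *m A *m B^T) = B *m pol A *m B^T.
Proof. by rewrite /pol !trmx_mul trmxK mulmxA mulmxDr mulmxDl. Qed.
Lemma qdZ s (A : 'M[K]_s) a y : qd A (a *: y) = a ^+ 2 * qd A y.
Proof. by rewrite /qd bilZl bilZr mulrA expr2. Qed.
Lemma qd0 s (A : 'M[K]_s) : qd A 0 = 0.
Proof. by rewrite -(scale0r 0) qdZ expr0n mul0r. Qed.
Lemma kermx_family (I : finType) s t (E : I -> 'M[K]_(s, t)) : exists T : 'M[K]_s,
 [/\ (s - #|I| * t <= \rank T)%N & forall x : 'rV[K]_s, (x <= T)%MS <-> forall i, x *m E i = 0].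
Proof.
pose F : 'M[K]_(s, #|{: I * 'I_t}|) := \matrix_(a, c) E (enum_val c).1 a (enum_val c).2.
exists (kermx F); split.
 by rewrite mxrank_ker leq_sub2l // (leq_trans (rank_leq_col _)) // card_prod card_ord.
move=> x; split=> [/sub_kermxP h i|h].
 apply/matrixP => a k; rewrite ord1 !mxE.
 have := congr1 (fun M : 'M[K]_(1, _) => M 0 (enum_rank (i, k))) h; rewrite !mxE => e.
 by rewrite -[RHS]e; apply: eq_bigr => b _; rewrite mxE enum_rankK.
apply/sub_kermxP/matrixP => a c; rewrite ord1 !mxE.
have := congr1 (fun M : 'M[K]_(1, t) => M 0 (enum_val c).2) (h (enum_val c).1); rewrite !mxE => e.
by rewrite -[RHS]e; apply: eq_bigr => b _; rewrite mxE.
Qed.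

Hypothesis iso : forall s (A : 'M[K]_s), (4 < s)%N -> exists x : 'rV[K]_s, x != 0 /\ qd A x = 0.

(** On a space of dimension five where the first [n] forms vanish identically, the last form is
    isotropic. Such a space is enlarged by one vector at a time: by induction the first [n] forms
    have a common zero in the space orthogonal to the vectors already found, outside their span. *)
Lemma common_zero n : forall s (A : 'I_n -> 'M[K]_s), (2 * n * n.+1 < s)%N ->
 exists x : 'rV[K]_s, x != 0 /\ forall i, qd (A i) x = 0.
Proof.
elim: n => [|n IH] s A hs.
 exists (delta_mx 0 (Ordinal hs)); split; last by case.
 by apply/eqP => /matrixP/(_ 0 (Ordinal hs))/eqP; rewrite !mxE !eqxx oner_eq0.
pose A' (i : 'I_n) := A (widen_ord (leqnSn n) i).
have tower m : (m <= 5)%N -> exists U : 'M[K]_(m, s), row_free U /\ forall i y, qd (A' i) (y *m U) = 0.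
 elim: m => [|m IHm] m5.
  exists 0; split; first by rewrite /row_free mxrank0.
  by move=> i y; rewrite mulmx0 qd0.
 have [U [Uf hU]] := IHm (ltnW m5).
 have [T [rT hT]] := kermx_family (fun i => pol (A' i) *m U^T).
 rewrite card_ord in rT; pose V := (T :\: U)%MS.
 (* Orthogonality to at most four vectors for [n] forms costs [4 * n] dimensions and the complement
    of [U] at most four: together the difference [2(n+1)(n+2) - 2n(n+1)]. *)
 have rV : (2 * n * n.+1 < \rank V)%N.
  have h1 := mxrank_cap_compl T U; rewrite -/V in h1.
  have h2 : (\rank (T :&: U) <= m)%N by apply: leq_trans (mxrankS (capmxSr _ _)) (rank_leq_row _).
  have h3 : (n * m <= n * 4)%N by rewrite leq_mul2l; apply/orP; right.
  by move: h1 h2 rT hs m5 h3; move: (\rank V) (\rank (T :&: U)) (\rank T) (n * m)%N => a b c d; nia.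
 have [y [y0 hy]] := IH _ (fun i => row_base V *m A' i *m (row_base V)^T) rV.
 pose x := y *m row_base V.
 have xV : (x <= V)%MS by rewrite (submx_trans (submxMl _ _)) // eq_row_base.
 have x0 : x != 0.
  apply: contraNneq y0 => e; apply/eqP/(row_free_inj (row_base_free V)); by rewrite mul0mx.
 have xT : (x <= T)%MS by rewrite (submx_trans xV) // diffmxSl.
 have xU : ~~ (x <= U)%MS.
  apply: contraNN x0 => xU; have : (x <= V :&: U)%MS by rewrite sub_capmx xV.
  by rewrite capmx_diff submx0.
 have f1 : row_free (col_mx x U).
  apply: (@inj_row_free _ (1 + m)) => v; rewrite -(hsubmxK v) mul_row_col => e.
  have a0 : lsubmx v = 0.
   rewrite [lsubmx v]mx11_scalar; case: (eqVneq (lsubmx v 0 0) 0) => [->|n0]; first by rewrite raddf0.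
   case/negP: xU; have -> : x = (- (lsubmx v 0 0)^-1 *: rsubmx v) *m U.
    apply: (scalerI n0); rewrite -scalemxAl scalerA mulrN mulfV // scaleN1r.
    by apply/eqP; rewrite -addr_eq0 -mul_scalar_mx -mx11_scalar e.
   exact: submxMl.
  move: e; rewrite a0 mul0mx add0r => e; rewrite (_ : rsubmx v = 0) ?row_mx0 //.
  by apply: (row_free_inj Uf); rewrite e mul0mx.
 have f2 i (v : 'rV[K]_(1 + m)) : qd (A' i) (v *m col_mx x U) = 0.
  rewrite -(hsubmxK v) mul_row_col qdD hU addr0 [lsubmx v]mx11_scalar mul_scalar_mx qdZ.
  have -> : qd (A' i) x = 0 by rewrite /x qd_mulmx.
  rewrite mulr0 add0r bilZl /bil trmx_mul mulmxA -[x *m _ *m _]mulmxA.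
  by rewrite ((hT x).1 xT i) mul0mx [X in _ * X]mxE mulr0.
 by exists (col_mx x U).
have [U [Uf hU]] := tower 5 isT.
have [y [y0 hy]] := iso (U *m A ord_max *m U^T) isT.
exists (y *m U); split.
 apply: contraNneq y0 => e; apply/eqP/(row_free_inj Uf); by rewrite mul0mx.
move=> i; case: (unliftP ord_max i) => [j ->|->]; last by rewrite qd_mulmx.
rewrite -(hU j y) /A'; congr (qd (A _) _); apply/val_inj => /=; by rewrite /bump leqNgt (ltn_ord j).
Qed.

End CommonZero.

(** * From zeros to nonsingular zeros *)

Section Nonsingular.
Variables (R : realType) (K : fieldType) (nu : K -> R).
Hypothesis hv : valued nu.
Hypothesis small : forall e : R, 0 < e -> exists t : K, t != 0 /\ nu t <= e.
Hypothesis zero : forall n s (A : 'I_n -> 'M[K]_s), (2 * n * n.+1 < s)%N ->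
 exists x : 'rV[K]_s, x != 0 /\ forall i, qd (A i) x = 0.

Lemma row_jac n s (A : 'I_n -> 'M[K]_s) x i : row i (jac A x) = x *m pol (A i).
Proof. by apply/matrixP => a j; rewrite ord1 !mxE. Qed.
Lemma jac_scale n s (A : 'I_n -> 'M[K]_s) (t : K) (x : 'rV[K]_s) : jac A (t *: x) = t *: jac A x.
Proof. by apply/row_matrixP => i; rewrite row_jac linearZ /= row_jac scalemxAl. Qed.
Lemma jac_bil n s (A : 'I_n -> 'M[K]_s) x (w : 'rV[K]_s) i : bil (pol (A i)) x w = (w *m (jac A x)^T) 0 i.
Proof. by rewrite /bil !mxE; apply: eq_bigr => j _; rewrite !mxE mulrC. Qed.
(** Small coefficients make the right side a contraction near [kap]; the radius [rho] and the bound
    [e] are independent of [a] and [b], so the small parameter can be chosen afterwards. *)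
Lemma small_fixpoint m s (P Q : 'I_m -> 'M[K]_s) (y : 'rV[K]_s) (W : 'M[K]_(m, s)) (kap : 'rV[K]_m) :
 exists rho e : R, [/\ 0 <= rho, 0 < e & forall a b : 'I_m -> K, (forall i, nu (a i) <= e) -> (forall i, nu (b i) <= e) ->
  exists u, vle nu u rho /\ forall i, u 0 i = kap 0 i + a i * bil (P i) y (u *m W) + b i * qd (Q i) (u *m W)].
Proof.
have [c1 [c11 hP]] := vle_family hv P; have [c2 [c21 hQ]] := vle_family hv Q.
have [c3 [c31 hy]] := vle_ex hv y; have [c4 [c41 hW]] := vle_ex hv W; have [c5 [c51 hk]] := vle_ex hv kap.
pose rho := c5 + 1; pose g := m%:R * (rho * c4).
have rho0 : 0 <= rho by rewrite /rho; lra.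
have g0 : 0 <= g by rewrite /g !mulr_ge0 //; lra.
pose D1 := s%:R ^+ 2 * c1 * c3; pose D2 := s%:R ^+ 2 * c2.
have D10 : 0 <= D1 by rewrite /D1 !mulr_ge0 //; lra.
have D20 : 0 <= D2 by rewrite /D2 !mulr_ge0 //; lra.
pose X := D1 * g + D2 * g * g; pose Y := D1 * (m%:R * c4) + 2 * (D2 * g * (m%:R * c4)).
have mc : 0 <= m%:R * c4 by rewrite mulr_ge0 //; lra.
have X0 : 0 <= X by apply: addr_ge0; [exact: mulr_ge0 | apply: mulr_ge0 => //; exact: mulr_ge0].
have Y0 : 0 <= Y.
 by apply: addr_ge0; [exact: mulr_ge0 | apply: mulr_ge0 => //; apply: mulr_ge0 => //; exact: mulr_ge0].
pose e := (1 + X + 2 * Y)^-1.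
have E0 : 0 < 1 + X + 2 * Y by lra.
have e0 : 0 < e by rewrite invr_gt0.
have eX : e * X <= 1 by rewrite /e mulrC ler_pdivrMr // mul1r; lra.
have eY : e * Y <= 2^-1 by rewrite /e mulrC ler_pdivrMr //; lra.
exists rho, e; split=> // a b ha hb.
pose Phi (u : 'rV[K]_m) : 'rV[K]_m := \row_i (kap 0 i + a i * bil (P i) y (u *m W) + b i * qd (Q i) (u *m W)).
have wb (u : 'rV[K]_m) d : 0 <= d -> vle nu u d -> vle nu (u *m W) (m%:R * (d * c4)).
 by move=> d0 hu; apply: (vleM hv).
have bound (u : 'rV[K]_m) : vle nu u rho -> vle nu (Phi u) rho.
 move=> hu i j; rewrite mxE; have hw : vle nu (u *m W) g := wb u rho rho0 hu.
 apply: le_trans (valD hv _ _) _; apply: le_trans (lerD (valD hv _ _) (lexx _)) _.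
 rewrite !(valM hv).
 have b1 := bil_le hv (hP j) (le_trans ler01 c11) (le_trans ler01 c31) hy hw g0.
 have b2 := bil_le hv (hQ j) (le_trans ler01 c21) g0 hw hw g0.
 have k1 := hk 0 j.
 have t1 := ler_pM (val_ge0 hv _) (val_ge0 hv _) (ha j) b1.
 have t2 := ler_pM (val_ge0 hv _) (val_ge0 hv _) (hb j) b2.
 have : e * (s%:R ^+ 2 * c1 * c3 * g) + e * (s%:R ^+ 2 * c2 * g * g) <= 1 by rewrite -mulrDr.
 rewrite /rho; rewrite /qd in t2 *; lra.
have contr (u v : 'rV[K]_m) d : vle nu u rho -> vle nu v rho -> vle nu (u - v) d -> vle nu (Phi u - Phi v) (d / 2).
 move=> hu hv' hd i j; have d0 : 0 <= d by apply: le_trans (hd 0 j); exact: (val_ge0 hv).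
 have hw : vle nu (u *m W) g := wb u rho rho0 hu; have hw' : vle nu (v *m W) g := wb v rho rho0 hv'; have hwd := wb _ d d0 hd.
 have gd0 : 0 <= m%:R * (d * c4) by rewrite !mulr_ge0 //; lra.
 have -> : (Phi u - Phi v) i j = a j * bil (P j) y ((u - v) *m W) +
   b j * (bil (Q j) (u *m W) ((u - v) *m W) + bil (Q j) ((u - v) *m W) (v *m W)).
  have bN : bil (Q j) (- (v *m W)) (v *m W) = - bil (Q j) (v *m W) (v *m W) by rewrite -scaleN1r bilZl mulN1r.
  by rewrite !mxE mulmxBl !bilDr !bilNr bilDl bN /qd; ring.
 apply: le_trans (valD hv _ _) _; rewrite !(valM hv).
 have b1 := bil_le hv (hP j) (le_trans ler01 c11) (le_trans ler01 c31) hy hwd gd0.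
 have b2 := bil_le hv (hQ j) (le_trans ler01 c21) g0 hw hwd gd0.
 have b3 := bil_le hv (hQ j) (le_trans ler01 c21) gd0 hwd hw' g0.
 have t1 := ler_pM (val_ge0 hv _) (val_ge0 hv _) (ha j) b1.
 have t2 := ler_pM (val_ge0 hv _) (val_ge0 hv _) (hb j) (le_trans (valD hv _ _) (lerD b2 b3)).
 apply: le_trans (lerD t1 t2) _; rewrite -mulrDr.
 have -> : e * (s%:R ^+ 2 * c1 * c3 * (m%:R * (d * c4)) +
   (s%:R ^+ 2 * c2 * g * (m%:R * (d * c4)) + s%:R ^+ 2 * c2 * (m%:R * (d * c4)) * g)) = d * (e * Y).
  by rewrite /Y /D1 /D2; ring.
 by apply: ler_wpM2l.
have [u [hu fu]] := banach hv rho0 bound contr.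
by exists u; split=> // i; rewrite -{1}fu mxE.
Qed.

(** A vector of the kernel satisfies [v = - v *m M], so its size can be halved indefinitely. *)
Lemma near_identity m (M : 'M[K]_m) c : 0 <= c -> m%:R * c <= 2^-1 -> vle nu M c -> row_free (1%:M + M).
Proof.
move=> c0 mc hM; apply: inj_row_free => v; rewrite mulmxDr mulmx1 => e.
have ev : v = - (v *m M) by apply/eqP; rewrite -addr_eq0 e.
have [d [d1 hd]] := vle_ex hv v.
have step k : vle nu v (d / 2 ^+ k).
 elim: k => [|k IH]; first by rewrite expr0 divr1.
 have dk : 0 <= d / 2 ^+ k by rewrite divr_ge0 ?exprn_ge0 //; lra.
 have h := vleM hv dk IH hM.
 move=> i j; rewrite ev mxE (valN hv); apply: le_trans (h i j) _.
 have -> : m%:R * (d / 2 ^+ k * c) = m%:R * c * (d / 2 ^+ k) by ring.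
 have -> : d / 2 ^+ k.+1 = 2^-1 * (d / 2 ^+ k) by rewrite exprS invfM; ring.
 exact: ler_wpM2r.
apply/matrixP => i j; rewrite [RHS]mxE; apply: (val_small hv) => eps eps0.
by have [k hk] := half_pow_small d eps0; apply: le_trans (step k i j) hk.
Qed.

Lemma pol_sum n s (A : 'I_n -> 'M[K]_s) (b : 'I_n -> K) : pol (\sum_i b i *: A i) = \sum_i b i *: pol (A i).
Proof.
rewrite /pol raddf_sum -big_split /=; apply: eq_bigr => i _; by rewrite linearZ scalerDr.
Qed.

Lemma bil_sum n s (A : 'I_n -> 'M[K]_s) (b : 'I_n -> K) x y : bil (\sum_i b i *: A i) x y = \sum_i b i * bil (A i) x y.
Proof.
rewrite /bil mulmx_sumr mulmx_suml summxE; apply: eq_bigr => i _.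
by rewrite -scalemxAr -scalemxAl mxE.
Qed.

Lemma bil_pol_sym s (A : 'M[K]_s) x y : bil (pol A) x y = bil (pol A) y x.
Proof. by rewrite -[LHS]bil_tr /pol linearD /= trmxK addrC. Qed.

(* [x] is a zero whose Jacobian matrix has kernel [Bm] and row space [H *m jac A x]; [y] is a zero of the forms of
  the kernel, nonsingular on the orthogonal [T] of [x]. The zero is sought as [x + t y + t^2 w] with [t] small. *)
Lemma lift_zero n s k l (A : 'I_n -> 'M[K]_s) (x y : 'rV[K]_s) (H : 'M[K]_(k, n)) (Bm : 'M[K]_(l, n)) d (T : 'M[K]_(d, s)) :
 (forall i, qd (A i) x = 0) -> Bm *m jac A x = 0 -> row_full (col_mx H Bm) ->
 jac A x *m T^T = 0 -> (y <= T)%MS ->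
 let G := fun j : 'I_l => \sum_i Bm j i *: A i in
 (forall j, qd (G j) y = 0) -> row_free (H *m jac A x) -> row_free (jac G y *m T^T) ->
 exists z, (forall i, qd (A i) z = 0) /\ (k + l <= \rank (jac A z))%N.
Proof.
move=> hx hB fP hT yT G hG fN fY.
pose P := col_mx H Bm; pose Q (e : 'I_(k + l)) := \sum_i P e i *: A i.
have QG j : Q (rshift k j) = G j by apply: eq_bigr => i _; rewrite /P col_mxEd.
pose L := col_mx (H *m jac A x) (jac G y).
have fL : row_free L.
 apply: inj_row_free => v; rewrite -(hsubmxK v) mul_row_col => e.
 have r0 : rsubmx v = 0.
  apply: (row_free_inj fY); rewrite mul0mx mulmxA.
  have := congr1 (fun M => M *m T^T) e; rewrite mulmxDl -!mulmxA hT !mulmx0 add0r mul0mx; exact.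
 move: e; rewrite r0 mul0mx addr0 => e; rewrite (_ : lsubmx v = 0) ?row_mx0 //.
 by apply: (row_free_inj fN); rewrite e mul0mx.
have /row_freeP[W' hW'] := fL.
pose W := W'^T; have hW (u : 'rV[K]_(k + l)) : u *m W *m L^T = u.
 by rewrite -mulmxA -trmx_mul hW' trmx1 mulmx1.
have jacQ z : jac Q z = P *m jac A z.
 apply/row_matrixP => e; rewrite row_jac row_mul /Q pol_sum mulmx_sumr; apply/matrixP => a j.
 rewrite ord1 summxE !mxE; apply: eq_bigr => i _; by rewrite -scalemxAr !mxE.
have bx (e : 'I_(k + l)) w : bil (pol (Q e)) x w = (w *m (jac Q x)^T) 0 e by exact: jac_bil.
have jQx : jac Q x = col_mx (H *m jac A x) 0 by rewrite jacQ mul_col_mx hB.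
have xy e : bil (pol (Q e)) x y = 0.
 rewrite bx; case/submxP: yT => c ->; rewrite jacQ trmx_mul mulmxA -[c *m T *m _]mulmxA.
 have -> : T *m (jac A x)^T = 0 by rewrite -[LHS]trmxK trmx_mul trmxK hT trmx0.
 by rewrite mulmx0 mul0mx mxE.
pose isH (e : 'I_(k + l)) := (e < k)%N.
have isHl a : isH (lshift l a) by exact: (ltn_ord a).
have isHr j : isH (rshift k j) = false by rewrite /isH /= ltnNge leq_addr.
have xw e (u : 'rV[K]_(k + l)) : bil (pol (Q e)) x (u *m W) = if isH e then u 0 e else 0.
 rewrite bx jQx tr_col_mx mul_mx_row trmx0 mulmx0.
 have := hW u; rewrite /L tr_col_mx mul_mx_row => h.
 case: (split_ordP e) => a ->; rewrite ?isHl ?isHr ?row_mxEl ?row_mxEr ?mxE //.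
 by rewrite -[in RHS]h row_mxEl mxE.
have yw j (u : 'rV[K]_(k + l)) : bil (pol (G j)) y (u *m W) = u 0 (rshift k j).
 by rewrite jac_bil; have := hW u; rewrite /L tr_col_mx mul_mx_row => h; rewrite -[in RHS]h row_mxEr.
pose kap : 'rV[K]_(k + l) := \row_e (if isH e then - qd (Q e) y else 0).
have [rho [e0 [r0 e00 Hfix]]] := small_fixpoint (fun e => pol (Q e)) Q y W kap.
have [c1 [c11 hP1]] := vle_family hv (fun e => pol (Q e)).
have [c2 [c21 hW1]] := vle_ex hv W; have [c3 [c31 hy1]] := vle_ex hv y.
pose g := (k + l)%:R * (rho * c2); have g0 : 0 <= g by rewrite /g !mulr_ge0 //; lra.
pose B0 := s%:R ^+ 2 * c1 * (c3 + g) * c2; have B00 : 0 <= B0 by rewrite /B0 !mulr_ge0 //; lra.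
pose e1 := (2 * ((k + l)%:R * B0) + 1)^-1.
have kB0 : 0 <= (k + l)%:R * B0 by rewrite mulr_ge0.
have D0 : 0 < 2 * ((k + l)%:R * B0) + 1 by lra.
have e10 : 0 < e1 by rewrite invr_gt0.
have [t [t0 ht]] := small (e := Num.min (Num.min e0 e1) 1) (ltac:(by rewrite !lt_min e00 e10 ltr01)).
move: ht; rewrite !le_min => /andP[/andP[te0 te1] t1].
have tt : nu (t * t) <= e0.
 rewrite (valM hv); apply: le_trans te0; rewrite -[leRHS]mul1r; apply: ler_wpM2r => //; exact: (val_ge0 hv).
(* Dividing the equations by [t ^ 2] for the forms of [H] and by [t ^ 3] for those of [Bm] isolates
   the coordinates of [u]; the remaining terms carry [t] or [t ^ 2]. *)
pose al (e : 'I_(k + l)) : K := if isH e then - t else 0.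
pose be (e : 'I_(k + l)) : K := if isH e then - (t * t) else - t.
have hal e : nu (al e) <= e0 by rewrite /al; case: (isH e); rewrite ?(val0 hv) ?(valN hv) // ltW.
have hbe e : nu (be e) <= e0 by rewrite /be; case: (isH e); rewrite (valN hv).
have [u [hu fu]] := Hfix al be hal hbe.
pose w := u *m W; pose z := x + t *: (y + t *: w).
have qQz e : qd (Q e) z = 0.
 have Qx : qd (Q e) x = 0.
  by rewrite /qd /Q bil_sum big1 // => i _; rewrite -/(qd (A i) x) hx mulr0.
 rewrite /z qdD Qx add0r bilZr qdZ bilDr xy add0r bilZr qdD bilZr qdZ xw.
 have fe := fu e; rewrite /al /be mxE in fe.
 case: (split_ordP e) fe => a ->; rewrite ?isHl ?isHr => fe; first by rewrite fe -/w; ring.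
 by rewrite QG in fe *; rewrite hG yw fe -/w; ring.
exists z; split.
 case/row_fullP: fP => X hX i.
 have -> : qd (A i) z = \sum_e X i e * qd (Q e) z.
  rewrite /qd; have h (e : 'I_(k + l)) : X i e * bil (Q e) z z = \sum_j (X i e * P e j) * bil (A j) z z.
   by rewrite /Q bil_sum mulr_sumr; apply: eq_bigr => j _; rewrite mulrA.
  rewrite (eq_bigr _ (fun e _ => h e)) exchange_big /=.
  have h' j : \sum_e X i e * P e j * bil (A j) z z = (1%:M : 'M[K]_n) i j * bil (A j) z z.
   by rewrite -hX mxE mulr_suml.
  rewrite (eq_bigr _ (fun j _ => h' j)) (bigD1 i) //= big1 ?addr0 => [|j ji]; first by rewrite mxE eqxx mul1r.
  by rewrite mxE eq_sym (negbTE ji) mul0r.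
 by rewrite big1 // => e _; rewrite qQz mulr0.
(* The gradients of the forms of [Bm] are only of order [t] at [z]; after division by [t] the
   Jacobian matrix, tested along [W], is close to the identity. *)
pose D : 'M[K]_(k + l) := diag_mx (\row_e (if isH e then 1 else t^-1)).
pose E : 'M[K]_(k + l) := \matrix_(e, f) (if isH e then bil (pol (Q e)) (y + t *: w) (row f W) else bil (pol (Q e)) w (row f W)).
have DE : D *m jac Q z *m W^T = 1%:M + t *: E.
 apply/matrixP => e f; rewrite -mulmxA mul_diag_mx !mxE.
 have -> : \sum_j jac Q z e j * W^T j f = bil (pol (Q e)) z (row f W).
  rewrite /bil mxE; apply: eq_bigr => j _; by rewrite !mxE.
 rewrite /z bilDl bilZl.
 have rf : row f W = delta_mx 0 f *m W by rewrite rowE.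
 have -> : bil (pol (Q e)) x (row f W) = if isH e then (e == f)%:R else 0.
  by rewrite rf xw; case: ifP => // _; rewrite mxE eqxx /= eq_sym.
 case: (split_ordP e) => a ->; rewrite ?isHl ?isHr; first by rewrite mul1r.
 rewrite add0r mulKf // bilDl bilZl; congr (_ + _).
 rewrite QG rf yw mxE eqxx /= eq_sym //.
have rk : row_free (1%:M + t *: E).
 have hw : vle nu w g by apply: (vleM hv).
 have hyw : vle nu (y + t *: w) (c3 + g).
  apply: (vleD hv hy1) => i j; rewrite mxE (valM hv) -[leRHS]mul1r; apply: ler_pM; rewrite ?(val_ge0 hv) //.
 have hE : vle nu E B0.
  move=> e f; rewrite mxE.
  have hr : vle nu (row f W) c2 by move=> i j; rewrite mxE.
  have q1 : 0 <= c3 + g by lra.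
  have q2 : vle nu w (c3 + g) by apply: vle_trans hw _; lra.
  case: ifP => _; apply: (bil_le hv (hP1 e)) => //; lra.
 apply: (near_identity (c := nu t * B0)); first by rewrite mulr_ge0 // (val_ge0 hv).
  have -> : (k + l)%:R * (nu t * B0) = nu t * ((k + l)%:R * B0) by ring.
  apply: (@le_trans _ _ (e1 * ((k + l)%:R * B0))); first by apply: ler_wpM2r => //; rewrite mulr_ge0.
  by rewrite /e1 mulrC ler_pdivrMr //; lra.
 by move=> i j; rewrite mxE (valM hv); apply: ler_wpM2l => //; exact: (val_ge0 hv).
apply: (@leq_trans (\rank (1%:M + t *: E)%R)); first by rewrite (eqP rk).
by rewrite -DE jacQ; apply: leq_trans (mxrankM_maxl _ _) _; apply: leq_trans (mxrankM_maxr _ _) (mxrankM_maxr _ _).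
Qed.

(** If the Jacobian matrix at a zero [x] has rank [k < n], the [l = n - k] combinations with
    vanishing gradient at [x] are restricted to the space orthogonal to [x], of dimension [s - k].
    Restriction lowers ranks by at most [2k], and [2n(n+1) - 2k >= 2l(l+1)], so induction gives a
    nonsingular zero there; [lift_zero] combines it with [x]. *)
Lemma nonsingular_zero n : forall s (A : 'I_n -> 'M[K]_s),
 (forall b : 'rV[K]_n, b != 0 -> (2 * n * n.+1 < \rank (\sum_i b 0 i *: pol (A i))%R)%N) ->
 exists x, (forall i, qd (A i) x = 0) /\ \rank (jac A x) = n.
Proof.
have [m] := ubnP n; elim: m n => // m IH n nm s A hA.
case: (posnP n) => [n0|np].
 subst n; exists 0; split; first by case.
 by apply/eqP; rewrite -leqn0 rank_leq_row.
(* The zero is sought in a complement of the common kernel [T] of the polar forms, so that its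
   Jacobian matrix does not vanish and the number of forms decreases. *)
have [x [hx jx0]] : exists x, (forall i, qd (A i) x = 0) /\ jac A x != 0.
 have [T [_ hT]] := kermx_family (fun i => pol (A i)).
 pose i0 := Ordinal np; pose V := (T^C)%MS.
 have rV : (2 * n * n.+1 < \rank V)%N.
  have d0 : delta_mx 0 i0 != 0 :> 'rV[K]_n.
   by apply/eqP => /matrixP/(_ 0 i0)/eqP; rewrite !mxE !eqxx oner_eq0.
  have := hA _ d0; rewrite (bigD1 i0) //= big1 => [|i ii0]; last first.
   by rewrite mxE eqxx /= (negbTE ii0) scale0r.
  rewrite mxE !eqxx scale1r addr0 => /leq_trans; apply.
  rewrite mxrank_compl -[\rank (pol _)](subKn (rank_leq_col _)) leq_sub2l // -mxrank_ker; apply: mxrankS.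
  apply/rV_subP => v /(hT v).1 h'; apply/sub_kermxP; exact: h'.
 have [y [y0 hy]] := zero (fun i => row_base V *m A i *m (row_base V)^T) rV.
 exists (y *m row_base V); split; first by move=> i; rewrite qd_mulmx.
 apply: contraNneq y0 => j0.
 have xV : (y *m row_base V <= V)%MS by rewrite (submx_trans (submxMl _ _)) // eq_row_base.
 have xT : (y *m row_base V <= T)%MS.
  by apply/(hT _).2 => i; rewrite -row_jac j0 row0.
 have : (y *m row_base V <= T :&: V)%MS by rewrite sub_capmx xT.
 rewrite capmx_compl submx0 => /eqP e; apply/eqP/(row_free_inj (row_base_free V)); by rewrite e mul0mx.
pose N := jac A x; pose k := \rank N.
case: (eqVneq k n) => [kn|kn]; first by exists x.
have k1 : (0 < k)%N by rewrite lt0n mxrank_eq0.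
have kln : (k < n)%N by rewrite ltn_neqAle kn rank_leq_row.
pose l := \rank (kermx N); have lE : l = (n - k)%N by rewrite /l mxrank_ker.
pose Bm : 'M[K]_(l, n) := row_base (kermx N).
have hB : Bm *m N = 0 by apply/sub_kermxP; rewrite eq_row_base.
have [H hH] : exists H : 'M[K]_(k, n), row_base N = H *m N by apply/submxP; rewrite eq_row_base.
pose T := row_base (kermx N^T); have hT : N *m T^T = 0.
 by rewrite -[LHS]trmxK trmx_mul trmxK; have /sub_kermxP -> : (T <= kermx N^T)%MS; rewrite ?eq_row_base ?trmx0.
pose G (j : 'I_l) := \sum_i Bm j i *: A i.
pose G' j := T *m G j *m T^T.
have dT : \rank (kermx N^T) = (s - k)%N by rewrite mxrank_ker mxrank_tr.
have ks : (k <= s)%N by exact: rank_leq_col.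
have rkG (c : 'rV[K]_l) : c != 0 -> (2 * l * l.+1 < \rank (\sum_j c 0 j *: pol (G' j))%R)%N.
 move=> c0; have cB : c *m Bm != 0.
  by apply: contraNneq c0 => e; apply/eqP/(row_free_inj (row_base_free (kermx N))); rewrite e mul0mx.
 have := hA _ cB; set X := (\sum_i _)%R => hX.
 have -> : (\sum_j c 0 j *: pol (G' j))%R = T *m X *m T^T.
  have -> : X = (\sum_j c 0 j *: pol (G j))%R.
   rewrite /X (eq_bigr (fun j => \sum_i (c 0 j * Bm j i) *: pol (A i))%R) => [|j _]; last first.
    by rewrite /G pol_sum scaler_sumr; apply: eq_bigr => i _; rewrite scalerA.
   by rewrite exchange_big /=; apply: eq_bigr => i _; rewrite mxE scaler_suml.
  rewrite mulmx_sumr mulmx_suml; apply: eq_bigr => j _.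
  by rewrite /G' pol_mulmx -scalemxAr -scalemxAl.
 have h1 := mxrank_mul_min T X; have h2 := mxrank_mul_min (T *m X) T^T.
 have rT : \rank T = (s - k)%N by rewrite /T eq_row_base dT.
 rewrite mxrank_tr rT in h2; rewrite rT in h1; move: h1 h2 hX.
 move: (\rank (T *m X *m T^T)) (\rank (T *m X)) (\rank X) => a b r; rewrite lE; nia.
have lm : (l < m)%N by lia.
have [y' [hy' jy']] := IH l lm _ G' rkG.
have fP : row_full (col_mx H Bm).
 rewrite /row_full; have : row_free (col_mx H Bm).
  apply: inj_row_free => v; rewrite -(hsubmxK v) mul_row_col => e.
  have l0 : lsubmx v = 0.
   apply: (row_free_inj (row_base_free N)); rewrite mul0mx hH mulmxA.
   by have := congr1 (mulmx^~ N) e; rewrite /= mulmxDl -[rsubmx v *m _ *m _]mulmxA hB mulmx0 addr0 mul0mx.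
  move: e; rewrite l0 mul0mx add0r => e; rewrite (_ : rsubmx v = 0) ?row_mx0 //.
  by apply: (row_free_inj (row_base_free (kermx N))); rewrite e mul0mx.
 by rewrite /row_free => /eqP ->; rewrite lE subnKC // ltnW.
have fN : row_free (H *m N) by rewrite -hH row_base_free.
have fY : row_free (jac G (y' *m T) *m T^T).
 have -> : jac G (y' *m T) *m T^T = jac G' y'.
  by apply/row_matrixP => j; rewrite row_mul !row_jac /G' pol_mulmx !mulmxA.
 by rewrite /row_free jy'.
have hG j : qd (G j) (y' *m T) = 0 by rewrite qd_mulmx; exact: hy'.
have [z [z1 z2]] := lift_zero hx hB fP hT (submxMl _ _) hG fN fY.
exists z; split=> //; apply/eqP; rewrite eqn_leq rank_leq_row /=.
by apply: leq_trans z2; rewrite lE subnKC // ltnW.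
Qed.

End Nonsingular.

(** * Finite checks modulo 8 and modulo odd primes *)

Fixpoint dvd8 (n : nat) : bool :=
 match n with 0 => true | n'.+4.+4 => dvd8 n' | _ => false end.

Lemma dvd8P n : dvd8 n -> (8 %| n)%N.
Proof.
elim/ltn_ind: n => -[|[|[|[|[|[|[|[|n]]]]]]]] IH //= h.
by rewrite -[n.+4.+4]addn0 -[n.+4.+4]/(8 + n)%N addn0 dvdn_addr // IH //; lia.
Qed.

(** The list [l] holds the residues modulo 8 of units and of twice units. The check asserts that
    with at least three units among the coefficients the diagonal form vanishes modulo 8 at a vector
    having the entry 1 at a unit coefficient, which is what 2-adic lifting needs. *)
Definition residue_check : bool :=
 let l := [:: 1; 2; 3; 5; 6; 7]%N in let t := [:: 1; 0; 2]%N in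
 (all (fun a => all (fun b => all (fun c => all (fun d => all (fun e =>
  (2 < odd a + odd b + odd c + odd d + odd e) ==>
  has (fun x => has (fun y => has (fun z => has (fun u => has (fun w =>
   dvd8 (a * (x * x) + b * (y * y) + c * (z * z) + d * (u * u) + e * (w * w)) &&
   [|| odd a && (x == 1), odd b && (y == 1), odd c && (z == 1), odd d && (u == 1) | odd e && (w == 1)])
  t) t) t) t) t) l) l) l) l) l)%N.

Lemma residue_checkT : residue_check.
Proof. by lazy. Qed.
(** [k1 * x ^ 2] and [-(k2 * y ^ 2 + k3)] each take at least [(p + 1) / 2] values modulo [p], so
    they share one. *)
Lemma conic_mod p k1 k2 k3 : prime p -> odd p -> ~~ (p %| k1)%N -> ~~ (p %| k2)%N ->
 exists x y, (p %| k1 * x ^ 2 + k2 * y ^ 2 + k3)%N.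
Proof.
move=> pp op h1 h2; have ch := pchar_Fp pp.
pose im (h : 'F_p -> 'F_p) := (h @: [set: 'F_p])%SET.
have nz k : ~~ (p %| k)%N -> k%:R != 0 :> 'F_p by rewrite (dvdn_pcharf ch).
pose f (x : 'F_p) : 'F_p := k1%:R * x ^+ 2; pose g (y : 'F_p) : 'F_p := - (k2%:R * y ^+ 2 + k3%:R).
have big (h : 'F_p -> 'F_p) : (forall x y, h x = h y -> x ^+ 2 = y ^+ 2) -> (p.+1 <= 2 * #|im h|)%N.
 move=> hh; have le : (p <= 2 * #|im h|)%N.
  rewrite -[leqLHS](card_Fp pp) -[leqLHS]sum1_card [leqLHS](partition_big h (mem (im h))) /=; last first.
   by move=> x _; apply: imset_f; rewrite inE.
  rewrite [leqRHS]mulnC -[leqRHS]sum_nat_const; apply: leq_sum => _ /imsetP[x0 _ ->].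
  rewrite sum1_card; apply: (@leq_trans #|[set x0; - x0]%SET|); last by rewrite cards2; case: eqP.
  apply: subset_leq_card; apply/fintype.subsetP => x; rewrite unfold_in => /eqnP /val_inj /hh /eqP.
  by rewrite -subr_eq0 subr_sqr mulf_eq0 subr_eq0 addr_eq0 !inE.
 rewrite ltn_neqAle le andbT; apply: contraTneq op => ->; by rewrite oddM.
have bf : (p.+1 <= 2 * #|im f|)%N by apply: big => x y /(mulfI (nz _ h1)).
have bg : (p.+1 <= 2 * #|im g|)%N by apply: big => x y /oppr_inj /addIr /(mulfI (nz _ h2)).
have : ~~ [disjoint im f & im g].
 rewrite -setI_eq0; apply/negP => /eqP e.
 have := cardsUI (im f) (im g); rewrite e cards0 addn0 => eU.
 have := max_card (mem (im f :|: im g)); rewrite card_Fp //.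
 by move: eU bf bg; move: #|_| #|_| #|_| => a b c; lia.
rewrite -setI_eq0 => /set0Pn[z]; rewrite inE => /andP[/imsetP[x _ zx] /imsetP[y _ zy]].
exists (x : nat), (y : nat); rewrite (dvdn_pcharf ch) !natrD !natrM !natr_Zp -!expr2.
by rewrite -/(f x) -zx zy /g -addrA addNr.
Qed.

(** * Isotropy of quadratic forms in five variables over Q_p *)

Section Padic.
Variables (R : realType) (p : nat) (K : fieldType) (nu : K -> R).

(** The properties of Q_p used in the argument, apart from its construction; [pad_dense] passes from
    integral elements to residues modulo [p ^ v]. *)
Record padic : Prop := Padic {
 pad_valued : valued nu;
 pad_ultra : forall x y, nu (x + y) <= Num.max (nu x) (nu y);
 pad_disc : forall x, x != 0 -> exists k : int, nu x = p%:R ^ k;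
 pad_p : nu p%:R = p%:R^-1;
 pad_dense : forall x v, nu x <= 1 -> exists k : nat, nu (x - k%:R) <= p%:R ^- v }.

Hypothesis pp : prime p.
Hypothesis H : padic.
Local Notation hv := (pad_valued H).

Let pR_gt0 : 0 < p%:R :> R. Proof. by rewrite ltr0n prime_gt0. Qed.
Let pR_ge2 : 2 <= p%:R :> R. Proof. by rewrite ler_nat prime_gt1. Qed.
Let pRinv_le : p%:R^-1 <= 2^-1 :> R. Proof. by rewrite lef_pV2 ?posrE. Qed.
Lemma nu_leD x y c : nu x <= c -> nu y <= c -> nu (x + y) <= c.
Proof. by move=> hx hy; apply: le_trans (pad_ultra H x y) _; rewrite ge_max hx. Qed.
Lemma nu_leB x y c : nu x <= c -> nu y <= c -> nu (x - y) <= c.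
Proof. by move=> hx hy; apply: nu_leD => //; rewrite (valN hv). Qed.
Lemma nu_le_sum I (r : seq I) (P : pred I) (F : I -> K) c : 0 <= c -> (forall i, P i -> nu (F i) <= c) ->
 nu (\sum_(i <- r | P i) F i) <= c.
Proof.
move=> c0 h; elim/big_rec: _ => [|i x Pi hx]; first by rewrite (val0 hv).
by apply: nu_leD => //; exact: h.
Qed.

Lemma nu_leM x y c d : nu x <= c -> nu y <= d -> nu (x * y) <= c * d.
Proof. by move=> hx hy; rewrite (valM hv); apply: ler_pM => //; exact: (val_ge0 hv). Qed.
Lemma nu_nat m : nu m%:R <= 1.
Proof. by elim: m => [|m IH]; [rewrite (val0 hv) | rewrite -natr1; apply: nu_leD => //; rewrite (val1 hv)]. Qed.
Lemma nu_int (m : int) : nu m%:~R <= 1.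
Proof. by case: m => m; rewrite ?NegzE ?mulrNz ?(valN hv) -pmulrn; exact: nu_nat. Qed.
Lemma nu_pX v : nu (p%:R ^+ v) = p%:R ^- v.
Proof. by elim: v => [|v IH]; rewrite ?expr0 ?invr1 ?(val1 hv) // !exprS (valM hv) IH (pad_p H) invfM. Qed.
(** Otherwise Bezout's identity would write 1 as a combination of two elements of absolute value
    below 1. *)
Lemma nu_coprime m : ~~ (p %| m)%N -> nu m%:R = 1.
Proof.
move=> pm; apply/eqP; rewrite eq_le nu_nat /= leNgt; apply/negP => h.
have m0 : (0 < m)%N by case: (m) pm => //; rewrite dvdn0.
have [a b e _] := egcdnP p m0.
have g1 : gcdn m p = 1%N by apply/eqP; rewrite -/(coprime m p) coprime_sym prime_coprime.
have : nu (1 : K) < 1; last by rewrite (val1 hv) ltxx.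
have -> : 1 = a%:R * m%:R - b%:R * p%:R :> K by rewrite -!natrM e g1 natrD addrAC subrr add0r.
pose c := Num.max (nu m%:R) (p%:R^-1); have c1 : c < 1.
 by rewrite gt_max h /=; apply: le_lt_trans pRinv_le _; rewrite invf_lt1 // ltr1n.
apply: le_lt_trans c1; apply: nu_leB; rewrite -[leRHS]mul1r; apply: nu_leM; rewrite ?nu_nat //.
 by rewrite le_max lexx.
by rewrite (pad_p H) le_max lexx orbT.
Qed.

Lemma nu_dvd v m : nu m%:R <= p%:R ^- v -> (p ^ v %| m)%N.
Proof.
elim: v m => [|v IH] m h; first by rewrite expn0 dvd1n.
case: (boolP (p %| m)%N) => [/dvdnP[m' e]|pm].
 rewrite e expnSr dvdn_pmul2r ?prime_gt0 //; apply: IH.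
 by move: h; rewrite e natrM (valM hv) (pad_p H) exprSr invfM ler_pM2r // invr_gt0.
move: h; rewrite nu_coprime // exprS invfM => h.
have v1 : p%:R ^- v <= 1 :> R by rewrite invf_le1 ?exprn_gt0 ?pR_gt0 //; apply: exprn_ege1; have := pR_ge2; lra.
have : p%:R^-1 * p%:R ^- v <= 2^-1 * 1 :> R by apply: ler_pM => //; rewrite invr_ge0 ?exprn_ge0.
by move=> h'; have := le_trans h h'; lra.
Qed.

Lemma nu_dvdz v (m : int) : nu m%:~R <= p%:R ^- v -> ((p ^ v)%N%:Z %| m)%Z.
Proof.
by case: m => m; rewrite ?NegzE ?mulrNz ?(valN hv) -pmulrn => /nu_dvd; rewrite dvdzE.
Qed.

Lemma padic_char0 m : (m%:R == 0 :> K) = (m == 0)%N.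
Proof.
apply/eqP/eqP => [e|->//]; apply/eqP; rewrite -leqn0 leqNgt; apply/negP => m0.
have : (p ^ m %| m)%N by apply: nu_dvd; rewrite e (val0 hv) invr_ge0 exprn_ge0 // ltW.
by move/(dvdn_leq m0); rewrite leqNgt ltn_expl // prime_gt1.
Qed.

Lemma padic_pow_small (e : R) : 0 < e -> exists k, p%:R ^- k <= e.
Proof.
move=> e0; have [k hk] := half_pow_small 1 e0; exists k; apply: le_trans hk.
rewrite mul1r lef_pV2 ?posrE ?exprn_gt0 //; by apply: lerXn2r; rewrite ?nnegrE // ltW.
Qed.

Lemma small_padic (e : R) : 0 < e -> exists t : K, t != 0 /\ nu t <= e.
Proof.
move=> e0; have [k hk] := padic_pow_small e0; exists (p%:R ^+ k); split.
 by rewrite expf_neq0 // padic_char0 -lt0n prime_gt0.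
by rewrite nu_pX.
Qed.

Let four0 : nu 4%:R != 0.
Proof. by apply/eqP => /(val_eq0 hv)/eqP; rewrite padic_char0. Qed.
(** With [z = 1 + 2 * u] the equation becomes [u = b - u ^ 2] for [b = (w - 1) / 4], a contraction
    on the ball of radius [1 / p], for [p = 2] as well. *)
Lemma sqrt_near1 w : nu (w - 1) <= nu (4 * p%:R) -> exists z, z ^+ 2 = w /\ z != 0.
Proof.
move=> hw.
have w0 : w != 0.
 apply/eqP => w0; move: hw; rewrite w0 sub0r (valN hv) (val1 hv) => h.
 have : nu (4 * p%:R) <= 1 * p%:R^-1 by apply: nu_leM; rewrite ?(pad_p H) // (nu_nat 4).
 by rewrite mul1r => h'; have := le_trans h (le_trans h' pRinv_le); lra.
have f0 : 4%:R != 0 :> K by rewrite padic_char0.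
have f4 : 0 < nu 4%:R by rewrite lt_neqAle eq_sym four0 (val_ge0 hv).
pose b := (w - 1) / 4; have hb : nu b <= p%:R^-1.
 rewrite /b (valM hv) (valV hv) ler_pdivrMr //; apply: le_trans hw _.
 by rewrite (valM hv) (pad_p H) mulrC.
have pi0 : 0 <= p%:R^-1 :> R by rewrite invr_ge0 ltW.
pose Phi (u : 'rV[K]_1) : 'rV[K]_1 := const_mx (b - u 0 0 ^+ 2).
have h1 u : vle nu u p%:R^-1 -> vle nu (Phi u) p%:R^-1.
 move=> hu i j; rewrite mxE; apply: nu_leB => //; rewrite expr2.
 apply: le_trans (nu_leM (hu 0 0) (hu 0 0)) _; rewrite -[leRHS]mul1r; apply: ler_wpM2r => //; by apply: le_trans pRinv_le _; rewrite invf_le1 // ler1n.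
have h2 u v d : vle nu u p%:R^-1 -> vle nu v p%:R^-1 -> vle nu (u - v) d -> vle nu (Phi u - Phi v) (d / 2).
 move=> hu hv' hd i j; rewrite !mxE.
 have -> : b - u 0 0 ^+ 2 - (b - v 0 0 ^+ 2) = - ((u - v) 0 0 * (u 0 0 + v 0 0)) by rewrite !mxE; ring.
 rewrite (valN hv); apply: le_trans (nu_leM (hd 0 0) (nu_leD (hu 0 0) (hv' 0 0))) _.
 apply: ler_wpM2l => //; exact: le_trans (val_ge0 hv _) (hd 0 0).
have [u [_ fu]] := banach hv pi0 h1 h2.
have eu : u 0 0 = b - u 0 0 ^+ 2 by rewrite -{1}fu mxE.
exists (1 + 2 * u 0 0); have e : (1 + 2 * u 0 0) ^+ 2 = w.
 have -> : (1 + 2 * u 0 0) ^+ 2 = 1 + 4 * (u 0 0 + u 0 0 ^+ 2) by ring.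
 by rewrite {1}eu subrK /b mulrC divfK // addrC subrK.
by split=> //; move: w0; rewrite -e expf_eq0.
Qed.

(** All coordinates but [j] are kept; coordinate [j] is multiplied by a square root of [- b / a],
    which is close to 1. *)
Lemma diag_lift m (c y : 'I_m -> K) j : nu (c j * y j ^+ 2) = 1 ->
 nu (\sum_i c i * y i ^+ 2) <= nu (4 * p%:R) ->
 exists Y, (exists i, Y i != 0) /\ \sum_i c i * Y i ^+ 2 = 0.
Proof.
move=> h1 h2; pose a := c j * y j ^+ 2.
have a0 : a != 0 by apply/eqP => e; move: h1; rewrite -/a e (val0 hv) => /eqP; rewrite eq_sym oner_eq0.
pose b := \sum_(i | i != j) c i * y i ^+ 2.
have sE : \sum_i c i * y i ^+ 2 = a + b by rewrite (bigD1 j).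
have [z [z2 z0]] : exists z, z ^+ 2 = - b / a /\ z != 0.
 apply: sqrt_near1; have -> : - b / a - 1 = - ((a + b) / a) by field.
 by rewrite (valN hv) (valM hv) (valV hv) h1 invr1 mulr1 -sE.
have y0 : y j != 0 by apply: contraNneq a0 => e; rewrite /a e expr0n mulr0.
exists (fun i => if i == j then z * y j else y i); split.
 by exists j; rewrite eqxx mulf_neq0.
rewrite (bigD1 j) //= eqxx exprMn z2 (eq_bigr (fun i => c i * y i ^+ 2)) => [|i /negbTE -> //].
by rewrite -/b mulrCA -/a divfK // addNr.
Qed.

Lemma residue_unit (c : K) k : nu c = 1 -> nu (c - k%:R) <= p%:R^-1 -> ~~ (p %| k)%N.
Proof.
move=> c1 h; apply/negP => /dvdnP[k' e].
have : nu c <= p%:R^-1.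
 rewrite -[c](subrK k%:R); apply: nu_leD => //; rewrite e natrM -[leRHS]mul1r.
 by apply: nu_leM; rewrite ?nu_nat // (pad_p H).
by rewrite c1 => h'; have := le_trans h' pRinv_le; lra.
Qed.

(** For odd [p], three unit coefficients give a conic with a zero modulo [p]; for [p = 2] the table
    [residue_check] gives a zero modulo 8. Both are lifted by [diag_lift]. *)
Lemma diag_units (c : 'I_5 -> K) : (forall i, nu (c i) = 1 \/ nu (c i) = p%:R^-1) ->
 (2 < #|[pred i | (nu (c i) == 1)%R]|)%N -> exists Y, (exists i, Y i != 0) /\ \sum_i c i * Y i ^+ 2 = 0.
Proof.
move=> hc hu.
have ci i : nu (c i) <= 1 by case: (hc i) => ->; rewrite ?lexx // invf_le1 ?pR_gt0 //; have := pR_ge2; lra.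
have [op|ep] := boolP (odd p).
 have [i1 [i2 [i3 [[u1 u2 u3] [d1 d2 d3]]]]] : exists x y z, [/\ x \in [pred i | nu (c i) == 1], y \in [pred i | nu (c i) == 1] &
   z \in [pred i | nu (c i) == 1]] /\ [/\ x != y, y != z & z != x] by apply/card_gt2P.
 move: u1 u2 u3; rewrite !inE => /eqP u1 /eqP u2 /eqP u3.
 have dn i : exists k : nat, nu (c i - k%:R) <= p%:R^-1 by have := pad_dense H 1 (ci i); rewrite expr1.
 have [k1 e1] := dn i1; have [k2 e2] := dn i2; have [k3 e3] := dn i3.
 have [x [y d]] := conic_mod k3 pp op (residue_unit u1 e1) (residue_unit u2 e2).
 pose Y (i : 'I_5) : K := if i == i1 then x%:R else if i == i2 then y%:R else if i == i3 then 1 else 0.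
 have Y1 : Y i1 = x%:R by rewrite /Y eqxx.
 have Y2 : Y i2 = y%:R by rewrite /Y eq_sym (negbTE d1) eqxx.
 have Y3 : Y i3 = 1 by rewrite /Y (negbTE d3) eq_sym (negbTE d2) eqxx.
 apply: (@diag_lift _ c Y i3); first by rewrite Y3 expr1n mulr1.
 rewrite (bigD1 i1) //= (bigD1 i2) 1?eq_sym //= (bigD1 i3) /=; last by rewrite d3 eq_sym d2.
 rewrite big1 ?addr0; last first.
  by move=> i /andP[/andP[n1 n2] n3]; rewrite /Y (negbTE n1) (negbTE n2) (negbTE n3) expr0n mulr0.
 rewrite Y1 Y2 Y3 expr1n mulr1.
 have n4 : nu 4%:R = 1.
  apply: nu_coprime; rewrite -[4%N]/(2 ^ 2)%N Euclid_dvdX // dvdn_prime2 //; apply/negP => /andP[/eqP e _].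
  by rewrite e in op.
 rewrite (valM hv) n4 mul1r (pad_p H).
 have -> : c i1 * x%:R ^+ 2 + (c i2 * y%:R ^+ 2 + c i3) =
  (c i1 - k1%:R) * x%:R ^+ 2 + ((c i2 - k2%:R) * y%:R ^+ 2 + ((c i3 - k3%:R) + (k1 * x ^ 2 + k2 * y ^ 2 + k3)%:R)).
  by rewrite !natrD !natrM; ring.
 have sq m : nu (m%:R ^+ 2) <= 1 by rewrite -natrX nu_nat.
 apply: nu_leD; first by rewrite -[leRHS]mulr1; apply: nu_leM.
 apply: nu_leD; first by rewrite -[leRHS]mulr1; apply: nu_leM.
 apply: nu_leD => //; case/dvdnP: d => q ->; rewrite natrM -[leRHS]mul1r; apply: nu_leM; rewrite ?nu_nat // (pad_p H) //.
have p2 : p = 2%N by case: (even_prime pp) => // op; rewrite op in ep.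
have n2 : nu 2%:R = 2^-1 by have := pad_p H; rewrite p2.
have /choice[k hk] : forall i, exists k : nat, nu (c i - k%:R) <= p%:R ^- 3 /\ (k < 8)%N.
 move=> i; have [k e] := pad_dense H 3 (ci i); exists (k %% 8)%N; split; last by rewrite ltn_mod.
 have -> : c i - (k %% 8)%N%:R = (c i - k%:R) + (k %/ 8)%N%:R * p%:R ^+ 3.
  by rewrite {2}(divn_eq k 8) natrD natrM p2; ring.
 by apply: nu_leD => //; rewrite -[leRHS]mul1r; apply: nu_leM; rewrite ?nu_nat // nu_pX.
have h8 i : nu (c i - (k i)%:R) <= 8^-1 by have [h _] := hk i; move: h; rewrite p2 -natrX.
(* An element of absolute value 1 or 1/2 is neither 0 nor 4 modulo 8, and its residue is odd exactly
   for a unit. *)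
have kl i : k i \in [:: 1; 2; 3; 5; 6; 7]%N /\ odd (k i) = (nu (c i) == 1).
 have k8 := (hk i).2; have e := h8 i.
 have nk : nu (k i)%:R <= Num.max (nu (c i)) 8^-1.
  rewrite -[(k i)%:R](subKr (c i)); apply: nu_leB; rewrite le_max ?lexx ?e ?orbT //.
 have nc : nu (c i) <= Num.max (nu (k i)%:R) 8^-1.
  by rewrite -[c i](subrK (k i)%:R); apply: nu_leD; rewrite le_max ?lexx ?e ?orbT.
 have q (m : nat) : ~~ (2 %| m)%N -> nu m%:R = 1 by move=> h; apply: nu_coprime; rewrite p2.
 have n6 : nu 6%:R = 2^-1 by rewrite (natrM _ 2 3) (valM hv) n2 q // mulr1.
 have n4 : nu 4%:R = 4^-1 by rewrite (natrM _ 2 2) (valM hv) n2 -invfM -natrM.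
 move: nk nc; case: (hc i) => ->; rewrite ?p2.
  rewrite eqxx; case: (k i) k8 => [|[|[|[|[|[|[|[|]]]]]]]] //= _;
   rewrite ?(val0 hv) ?n2 ?n4 ?n6 !le_max; move=> _ /orP[] h1; exfalso; clear p2; lra.
 have -> : (2%:R^-1 == 1 :> R) = false by apply/negbTE/eqP; lra.
 case: (k i) k8 => [|[|[|[|[|[|[|[|]]]]]]]] //= _; rewrite ?(val0 hv) ?n4 ?q // !le_max; move=> /orP[] h1 /orP[] h2; exfalso; clear p2; lra.
pose o i := inord i : 'I_5.
have s5 (V : nmodType) (F : 'I_5 -> V) : \sum_i F i = F (o 0%N) + F (o 1%N) + F (o 2%N) + F (o 3%N) + F (o 4%N).
 rewrite !big_ord_recl big_ord0 addr0 !addrA.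
 by do !congr (_ + _); congr F; apply/val_inj; rewrite /o /= inordK.
have cnt : (2 < odd (k (o 0)) + odd (k (o 1)) + odd (k (o 2)) + odd (k (o 3)) + odd (k (o 4)))%N.
 move: hu; rewrite -sum1_card big_mkcond (eq_bigr (fun i => (odd (k i) : nat))) => [|i _].
  by rewrite -[X in (_ < X)%N -> _]/(\sum_i (odd (k i) : nat))%R s5.
 by rewrite inE (kl i).2; case: eqP.
have := residue_checkT; rewrite /residue_check.
move=> /allP/(_ _ (kl (o 0%N)).1)/allP/(_ _ (kl (o 1%N)).1)/allP/(_ _ (kl (o 2%N)).1)/allP/(_ _ (kl (o 3%N)).1)/allP/(_ _ (kl (o 4%N)).1).
rewrite cnt => /hasP[y0 _ /hasP[y1 _ /hasP[y2 _ /hasP[y3 _ /hasP[y4 _ /andP[/dvd8P d8 hj]]]]]].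
pose Y (i : 'I_5) : K := (nth 0 [:: y0; y1; y2; y3; y4] i)%N%:R.
have YE : [/\ Y (o 0%N) = y0%:R, Y (o 1%N) = y1%:R, Y (o 2%N) = y2%:R, Y (o 3%N) = y3%:R & Y (o 4%N) = y4%:R].
 by rewrite /Y /o !inordK.
case: YE => Y0 Y1 Y2 Y3 Y4.
have n8 : nu (4 * p%:R) = 8^-1 by rewrite p2 -natrM (natrM _ 2 4) (natrM _ 2 2) !(valM hv) n2 -!invfM -!natrM.
have hs : nu (\sum_i c i * Y i ^+ 2) <= nu (4 * p%:R).
 rewrite n8; have -> : \sum_i c i * Y i ^+ 2 = \sum_i (c i - (k i)%:R) * Y i ^+ 2 + \sum_i (k i)%:R * Y i ^+ 2.
  by rewrite -big_split; apply: eq_bigr => i _ /=; ring.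
 apply: nu_leD.
  apply: nu_le_sum => [|i _]; first by rewrite invr_ge0.
  by rewrite -[leRHS]mulr1; apply: nu_leM => //; rewrite /Y -natrX nu_nat.
 have -> : \sum_i (k i)%:R * Y i ^+ 2 = (k (o 0) * (y0 * y0) + k (o 1) * (y1 * y1) + k (o 2) * (y2 * y2) + k (o 3) * (y3 * y3) + k (o 4) * (y4 * y4))%N%:R :> K.
  by rewrite s5 Y0 Y1 Y2 Y3 Y4 !natrD !natrM; ring.
 case/dvdnP: d8 => t ->; rewrite natrM -[leRHS]mul1r; apply: nu_leM; rewrite ?nu_nat //.
 by rewrite -n8 p2 -natrM.
have go i : odd (k i) -> Y i = 1 -> exists Z, (exists i, Z i != 0) /\ \sum_i c i * Z i ^+ 2 = 0.
 by move=> oi Yi; apply: (diag_lift (j := i) _ hs); rewrite Yi expr1n mulr1; apply/eqP; rewrite -(kl i).2.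
case/or4P: hj => [/andP[w1 /eqP e]|/andP[w1 /eqP e]|/andP[w1 /eqP e]|/orP[] /andP[w1 /eqP e]].
- by apply: (go _ w1); rewrite Y0 e.
- by apply: (go _ w1); rewrite Y1 e.
- by apply: (go _ w1); rewrite Y2 e.
- by apply: (go _ w1); rewrite Y3 e.
- by apply: (go _ w1); rewrite Y4 e.
Qed.

(** Squares of powers of [p] reduce all valuations to 0 or 1. If at most two coefficients are units,
    multiplying the form by [p] and removing [p ^ 2] from the others exchanges the two classes, so
    that at least three become units. *)
Lemma diag_zero (c : 'I_5 -> K) : (forall i, c i != 0) -> exists Y, (exists i, Y i != 0) /\ \sum_i c i * Y i ^+ 2 = 0.
Proof.
move=> c0; have p0 : p%:R != 0 :> K by rewrite padic_char0 -lt0n prime_gt0.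
have pn0 : p%:R != 0 :> R by exact: lt0r_neq0.
have /choice[t ht] : forall i, exists t, t != 0 /\ (nu (c i * t ^+ 2) = 1 \/ nu (c i * t ^+ 2) = p%:R^-1).
 move=> i; have [k hk] := pad_disc H (c0 i).
 have nuX (t : K) : nu (t ^+ 2) = nu t ^+ 2 by rewrite !expr2 (valM hv).
 have fin (z : R) (b : bool) : z = (p%:R ^+ b)^-1 -> z = 1 \/ z = p%:R^-1.
  by case: b => ->; [right; rewrite expr1 | left; rewrite expr0 invr1].
 case: k hk => m hk.
  have e : p%:R ^+ (uphalf m * 2) = p%:R ^+ m * p%:R ^+ odd m :> R.
   by rewrite -exprD; congr (_ ^+ _); have := odd_double_half m; rewrite uphalf_half muln2 doubleD; case: (odd m); lia.
  exists (p%:R ^+ uphalf m); split; first by rewrite expf_neq0.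
  apply: (fin _ (odd m)); rewrite (valM hv) nuX nu_pX hk exprVn -exprM e invfM mulrA mulfV ?mul1r // expf_neq0 //.
 have e : p%:R ^+ m.+1 = p%:R ^+ (m.+1./2 * 2) * p%:R ^+ odd m.+1 :> R.
  by rewrite -exprD; congr (_ ^+ _); have := odd_double_half m.+1; rewrite muln2 addnC.
 exists (p%:R ^- m.+1./2); split; first by rewrite invr_neq0 // expf_neq0.
 apply: (fin _ (odd m.+1)); rewrite (valM hv) nuX (valV hv) nu_pX invrK hk -[_ ^ Negz m]/(_ ^- m.+1) e -exprM invfM.
 by rewrite mulrAC mulVf ?mul1r // expf_neq0.
have scale (d a : 'I_5 -> K) : (forall i, a i != 0) -> (exists Y, (exists i, Y i != 0) /\ \sum_i (d i * a i ^+ 2) * Y i ^+ 2 = 0) ->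
  exists Y, (exists i, Y i != 0) /\ \sum_i d i * Y i ^+ 2 = 0.
 move=> a0 [Y [[i Yi] e]]; exists (fun i => a i * Y i); split; first by exists i; rewrite mulf_neq0.
 by rewrite -[RHS]e; apply: eq_bigr => j _; rewrite exprMn mulrA.
apply: (scale c t) => [i|]; first by have [] := ht i.
set d := fun i => c i * t i ^+ 2; have hd i : nu (d i) = 1 \/ nu (d i) = p%:R^-1 by have [] := ht i.
case: (ltnP 2 #|[pred i | (nu (d i) == 1)%R]|) => [|few]; first exact: diag_units.
pose a i : K := if nu (d i) == 1 then 1 else p%:R^-1.
have [Y [Y0 e]] : exists Y, (exists i, Y i != 0) /\ \sum_i (p%:R * d i) * Y i ^+ 2 = 0.
 apply: (scale _ a) => [i|]; first by rewrite /a; case: ifP => _; rewrite ?oner_neq0 ?invr_neq0.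
 have ne : (p%:R^-1 == 1 :> R) = false by apply/negbTE/eqP; have := pRinv_le; lra.
 have nd i : nu (p%:R * d i * a i ^+ 2) = if nu (d i) == 1 then p%:R^-1 else 1.
  rewrite /a; case: (hd i) => h; rewrite h ?eqxx ?ne.
   by rewrite expr1n mulr1 (valM hv) h mulr1 (pad_p H).
  have -> : p%:R * d i * p%:R^-1 ^+ 2 = d i / p%:R by field.
  by rewrite (valM hv) (valV hv) h (pad_p H) invrK mulVf.
 apply: diag_units => [i|]; first by rewrite nd; case: ifP; [right | left].
 have -> : #|[pred i | (nu (p%:R * d i * a i ^+ 2) == 1)%R]| = #|[predC [pred i | (nu (d i) == 1)%R]]|.
  by apply: eq_card => i; rewrite !inE nd; case: ifP; rewrite ?ne ?eqxx.
 rewrite -(ltn_add2l #|[pred i | (nu (d i) == 1)%R]|) cardC card_ord.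
 exact: leq_ltn_trans (leq_add few (leqnn 2)) _.
exists Y; split=> //; apply: (mulfI p0); rewrite mulr0 mulr_sumr -[RHS]e; apply: eq_bigr => i _; by rewrite mulrA.
Qed.

(** In an anisotropic form, a Gram-Schmidt process yields five nonzero orthogonal vectors with
    nonzero values, and [diag_zero] applies to these values. *)
Lemma isotropic s (A : 'M[K]_s) : (4 < s)%N -> exists x : 'rV[K]_s, x != 0 /\ qd A x = 0.
Proof.
move=> s5; have two0 : 2%:R != 0 :> K by rewrite padic_char0.
apply: boolp.contrapT => ani.
have an (x : 'rV[K]_s) : x != 0 -> qd A x != 0.
 by move=> x0; apply/eqP => e; apply: ani; exists x.
have polxx x : bil (pol A) x x = 2 * qd A x by rewrite /pol bilA bil_tr /qd; ring.
have [E [E1 E2]] : exists E : nat -> 'rV[K]_s, (forall i, (i < 5)%N -> E i != 0) /\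
  forall i j, (i < 5)%N -> (j < i)%N -> bil (pol A) (E i) (E j) = 0.
 have : (5 <= 5)%N by []; move: {1 3 4}5%N => d; elim: d => [|d IH] d5; first by exists (fun=> 0).
 have [E [E1 E2]] := IH (ltnW d5).
 have [T [rT hT]] := kermx_family (fun i : 'I_d => pol A *m (E i)^T).
 rewrite card_ord muln1 in rT.
 have T0 : T != 0 by rewrite -mxrank_eq0 -lt0n; apply: leq_trans rT; rewrite subn_gt0; lia.
 have [x xT x0] := rowV0Pn T0.
 exists (fun k => if k == d then x else E k); split=> [i|i j].
  by rewrite ltnS leq_eqVlt => /orP[/eqP ->|id]; [rewrite eqxx | rewrite ltn_eqF // E1].
 rewrite ltnS leq_eqVlt => /orP[/eqP -> jd|id ji].
  rewrite eqxx ltn_eqF //; have := (hT x).1 xT (Ordinal jd).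
  by rewrite /bil mulmxA => ->; rewrite mxE.
 by rewrite !ltn_eqF ?E2 // (ltn_trans ji).
have [Y [[j Yj] e]] := diag_zero (fun i : 'I_5 => an _ (E1 i (ltn_ord i))).
have orth (i k : 'I_5) : i != k -> bil (pol A) (E i) (E k) = 0.
 rewrite neq_ltn => /orP[h|h]; last exact: E2.
 by rewrite bil_pol_sym E2.
have bsum (I : finType) (F : I -> 'rV[K]_s) (M : 'M[K]_s) y : bil M (\sum_i F i) y = \sum_i bil M (F i) y.
 by rewrite /bil !mulmx_suml summxE.
pose x := \sum_(i < 5) Y i *: E i.
have xE (k : 'I_5) : bil (pol A) x (E k) = Y k * (2 * qd A (E k)).
 rewrite /x bsum (bigD1 k) //= bilZl polxx big1 ?addr0 // => i ik; by rewrite bilZl orth // mulr0.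
apply: ani; exists x; split.
 apply/eqP => x0; have := xE j; rewrite x0 -(scale0r 0) bilZl mul0r => /esym/eqP.
 by rewrite !mulf_eq0 (negbTE Yj) (negbTE two0) (negbTE (an _ (E1 j (ltn_ord j)))).
apply: (mulfI two0); rewrite mulr0 -polxx.
have -> : bil (pol A) x x = \sum_i Y i * bil (pol A) x (E i).
 rewrite {1}/x bsum; apply: eq_bigr => i _; by rewrite bilZl bil_pol_sym.
transitivity (2 * \sum_(i < 5) qd A (E i) * Y i ^+ 2); last by rewrite e mulr0.
by rewrite mulr_sumr; apply: eq_bigr => i _; rewrite xE; ring.
Qed.

Lemma padic_nonsingular_zero n s (A : 'I_n -> 'M[K]_s) :
 (forall b : 'rV[K]_n, b != 0 -> (2 * n * n.+1 < \rank (\sum_i b 0 i *: pol (A i))%R)%N) ->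
 exists x, (forall i, qd (A i) x = 0) /\ \rank (jac A x) = n.
Proof.
apply: (nonsingular_zero hv) => [e e0|m t B hB]; first exact: small_padic.
by apply: common_zero hB => u M; exact: isotropic.
Qed.

End Padic.

(** * Local densities from a nonsingular p-adic zero *)

Section LocalDensity.
Variables (R : realType) (p : nat) (K : fieldType) (nu : K -> R).
Hypothesis pp : prime p.
Hypothesis H : padic p nu.
Local Notation hv := (pad_valued H).

Lemma dist_lt (a b m : nat) : (a < m)%N -> (b < m)%N -> ~~ (m%:Z <= `|a%:Z - b%:Z|).
Proof. by move=> h1 h2; rewrite -ltNge; lia. Qed.
Lemma bil_ultra s (A : 'M[K]_s) (x y : 'rV[K]_s) a b : 0 <= a -> 0 <= b -> vle nu A 1 -> vle nu x a -> vle nu y b ->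
 nu (bil A x y) <= a * b.
Proof.
move=> a0 b0 hA hx hy; rewrite /bil mxE; apply: (nu_le_sum H) => [|i _]; first exact: mulr_ge0.
apply: (nu_leM H); last by rewrite mxE.
rewrite mxE; apply: (nu_le_sum H) => // j _; rewrite -[leRHS]mulr1; exact: (nu_leM H).
Qed.

Variables (r s : nat) (C : 'I_r.+1 -> 'M[int]_s).
Local Notation n := r.+1.
Let A (i : 'I_n) : 'M[K]_s := map_mx intr (C i).
Let A1 i : vle nu (A i) 1. Proof. by move=> a b; rewrite mxE (nu_int H). Qed.
Let P1 i : vle nu (pol (A i)) 1.
Proof. by move=> a b; rewrite !mxE; apply: (nu_leD H); exact: (nu_int H). Qed.
(** The free coordinates are moved by multiples of [p ^ e0] and [solve_near] adjusts the pivots. The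
    resulting zeros stay distinct modulo [p ^ v] in their [s - n] free coordinates, which gives
    [p ^ ((v - e0)(s - n))] solutions once [v >= e0]; smaller [v] have the zero solution. *)
Lemma integral_local_density (x : 'rV[K]_s) : (forall i, qd (A i) x = 0) -> \rank (jac A x) = n -> vle nu x 1 ->
 exists c : R, 0 < c /\ forall v, c <= density R C (p ^ v).
Proof.
move=> hx rk x1.
have pR : 0 < p%:R :> R by rewrite ltr0n prime_gt0.
have [f [W [fi hW Wf]]] := pivot_inverse rk.
have grad i (u : 'rV[K]_n) : bil (pol (A i)) x (u *m W) = u 0 i by rewrite jac_bil hW.
have [e [ep He]] := solve_near hv grad.
have [cW [cW1 hcW]] := vle_ex hv W.
(* [e0] must bring the perturbation within reach of [solve_near] and keep the correction [u *m W]
   integral. *)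
have [e0 he0] : exists k, p%:R ^- k <= Num.min e (2 * cW)^-1.
 by apply: (padic_pow_small pp); rewrite lt_min ep invr_gt0; lra.
move: he0; rewrite le_min => /andP[pe pW].
pose q0 : R := p%:R ^- e0; have q00 : 0 <= q0 by rewrite invr_ge0 exprn_ge0 // ltW.
have q1 : q0 <= 1 by apply: le_trans pW _; rewrite invf_le1; lra.
have qW : 2 * q0 * cW <= 1.
 by have : q0 * (2 * cW) <= (2 * cW)^-1 * (2 * cW); [apply: ler_wpM2r => //; lra | rewrite mulVf; [lra | apply: lt0r_neq0; lra]].
pose pv j := j \in codom f.
have cpv : #|pv| = n by rewrite (eq_card (_ : pv =i codom f)) // card_codom // card_ord.
have ns : (n <= s)%N by rewrite -cpv -[leqRHS]card_ord max_card.
have cpv' : #|predC pv| = (s - n)%N by rewrite card_predC card_ord cpv.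
pose c : R := ((p%:R ^+ e0) ^+ (s - n))^-1.
have pe0 : 1 <= p%:R ^+ e0 :> R by rewrite exprn_ege1 // ler1n prime_gt0.
exists c; split; first by rewrite invr_gt0 !exprn_gt0.
move=> v; set N := (p ^ v)%N; have N0 : (0 < N)%N by rewrite expn_gt0 prime_gt0.
have NR : 0 < N%:R :> R by rewrite ltr0n.
have dE : density R C N = (N%:R ^+ (s - n))^-1 * (nsols C N)%:R.
 have N1 : N%:R ^+ n != 0 :> R by rewrite expf_neq0 // lt0r_neq0.
 have Ns : N%:R ^+ s = N%:R ^+ (s - n) * N%:R ^+ n :> R by rewrite -exprD subnK.
 by rewrite /density; congr (_ * _); rewrite Ns invfM mulrCA mulfV ?mulr1.
rewrite dE; case: (ltnP v e0) => [ve|ve].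
 apply: (@le_trans _ _ ((N%:R ^+ (s - n))^-1 * 1)); last first.
  apply: ler_wpM2l; first by rewrite invr_ge0 exprn_ge0.
  rewrite ler1n; apply/card_gt0P; exists [ffun=> Ordinal N0]; rewrite unfold_in /=; apply/forallP => i.
  by rewrite /qf big1 ?dvdz0 // => j _; rewrite big1 // => k _; rewrite !ffunE mulr0.
 rewrite mulr1 /c lef_pV2 ?posrE ?exprn_gt0 //; apply: lerXn2r; rewrite ?nnegrE ?exprn_ge0 ?(ltW pR) //.
 by rewrite natrX ler_eXn2l ?ltr1n ?prime_gt1 // ltnW.
pose M := (p ^ (v - e0))%N; have M0 : (0 < M)%N by rewrite expn_gt0 prime_gt0.
have NM : N = (M * p ^ e0)%N by rewrite /N /M -expnD subnK.
have /choice[z hz] : forall g : pts s M, exists z : 'rV[K]_s,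
  [/\ forall i, qd (A i) z = 0, vle nu z 1 & forall j, ~~ pv j -> z 0 j = x 0 j + p%:R ^+ e0 * (g j)%:R].
 move=> g; pose h : 'rV[K]_s := \row_j (p%:R ^+ e0 * (g j)%:R).
 have hh : vle nu h q0.
  by move=> a j; rewrite mxE -[leRHS]mulr1; apply: (nu_leM H); rewrite ?(nu_nat H) // (nu_pX H).
 have Fh i : nu (qd (A i) (x + h) - 0) <= q0.
  rewrite subr0 qdD hx add0r; apply: (nu_leD H).
   by rewrite -[leRHS]mul1r; apply: bil_ultra.
  apply: (@le_trans _ _ (q0 * q0)); first exact: bil_ultra.
  by rewrite -[leRHS]mul1r; apply: ler_wpM2r.
 have [u [hu Hu]] := He q0 h (fun=> 0) q00 pe (vle_trans hh pe) Fh.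
 exists (x + h + u *m W); split=> //.
  move=> a j; rewrite !mxE; apply: (nu_leD H).
   by rewrite ord1; apply: (nu_leD H); [exact: x1 | have := hh 0 j; rewrite mxE => /le_trans; apply].
  apply: (nu_le_sum H) => // k _; apply: le_trans qW; apply: (nu_leM H); [exact: hu | exact: hcW].
 move=> j /negbTE npv; rewrite !mxE big1 ?addr0 // => i _; rewrite Wf ?mulr0 // => i'; apply/eqP => e1.
 by move: npv; rewrite /pv -e1 codom_f.
have /choice[k hk] : forall gj : pts s M * 'I_s, exists k : 'I_N, nu (z gj.1 0 gj.2 - k%:R) <= p%:R ^- v.
 move=> [g j] /=; have [_ z1 _] := hz g; have [k hk] := pad_dense H v (z1 0 j).
 exists (Ordinal (ltn_pmod k N0)) => /=.
 have -> : z g 0 j - (k %% N)%N%:R = (z g 0 j - k%:R) + (k %/ N)%N%:R * p%:R ^+ v.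
  by rewrite {2}(divn_eq k N) natrD natrM /N natrX; ring.
 by apply: (nu_leD H) => //; rewrite -[leRHS]mul1r; apply: (nu_leM H); rewrite ?(nu_nat H) // (nu_pX H).
pose q (g : pts s M) : pts s N := [ffun j => k (g, j)].
have pv0 : 0 <= p%:R ^- v :> R by rewrite invr_ge0 exprn_ge0 // ltW.
pose G : pred (pts s M) := [pred g : pts s M | [forall j, if pv j then g j == Ordinal M0 else true]].
have sol g : q g \in [pred p0 : pts s N | [forall i, (N%:Z %| qf (C i) (fun j => (p0 j : nat)%:Z))%Z]].
 rewrite inE; apply/forallP => i; apply: (nu_dvdz pp H); rewrite -qf_intr.
 pose y : 'rV[K]_s := \row_j ((q g j : nat)%:R).
 have -> : qf (C i) (fun j => (q g j : nat)%:Z%:~R) = qd (A i) y :> K.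
  by rewrite qd_int; congr qf; apply/funext => j; rewrite mxE.
 have [z0 z1 _] := hz g.
 have d1 : vle nu (y - z g) (p%:R ^- v).
  by move=> a j; rewrite !mxE ord1 (valBC hv) ffunE; exact: (hk (g, j)).
 have y1 : vle nu y 1 by move=> a j; rewrite mxE (nu_nat H).
 rewrite (qd_near_zero y (z0 i)).
 apply: (nu_leD H); first by rewrite -[leRHS]mul1r; apply: bil_ultra.
 by rewrite -[leRHS]mulr1; apply: bil_ultra.
have qi : {in G &, injective q}.
 move=> g g' /forallP hg /forallP hg' e1; apply/ffunP => j.
 have := hg j; have := hg' j; case: (boolP (pv j)) => [_ /eqP -> /eqP -> //|npv _ _].
 have [_ _ z2] := hz g; have [_ _ z2'] := hz g'.
 have kj : k (g, j) = k (g', j) by have := congr1 (fun f : pts s N => f j) e1; rewrite !ffunE.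
 have : nu (p%:R ^+ e0 * ((g j)%:Z - (g' j)%:Z)%:~R) <= p%:R ^- v.
  have -> : p%:R ^+ e0 * ((g j)%:Z - (g' j)%:Z)%:~R = (z g 0 j - (k (g, j) : nat)%:R) - (z g' 0 j - (k (g', j) : nat)%:R).
   by rewrite z2 // z2' // kj rmorphB /= -!pmulrn; ring.
  by apply: (nu_leB H); [exact: (hk (g, j)) | exact: (hk (g', j))].
 rewrite (valM hv) (nu_pX H) -{1}(subnK ve) exprD invfM mulrC ler_pM2r ?invr_gt0 ?exprn_gt0 // => /(nu_dvdz pp H).
 have := ltn_ord (g j); have := ltn_ord (g' j); rewrite -/M => l1 l2 d.
 apply/val_inj => /=; have : (g j)%:Z - (g' j)%:Z = 0; last by move=> /eqP; rewrite subr_eq0 => /eqP [].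
 apply/eqP; apply: contraT => ne; have /dvdzP[t tE] := d.
 have t0 : t != 0 by apply: contraNneq ne => t0; rewrite tE t0 mul0r.
 have : M%:Z <= `|(g j)%:Z - (g' j)%:Z|.
  by rewrite tE normrM [ `|M%:Z|]ger0_norm // ler_peMl //; move: t0; case: t {tE} => [[|t]|t].
 by rewrite (negbTE (dist_lt l2 l1)).
have cG : #|G| = (M ^ (s - n))%N.
 rewrite [#|_|](card_prod_ffun (fun j g => if pv j then g == Ordinal M0 else true)).
 rewrite (bigID pv) /= big1 ?mul1n => [|j pj].
  rewrite (eq_bigr (fun=> M)) ?prod_nat_const => [|j /negbTE ->]; last by rewrite (eq_card (B := predT)) ?card_ord.
  by rewrite (eq_card (B := predC pv)) ?cpv'.
 rewrite pj (eq_card (B := pred1 (Ordinal M0))) ?card1 //.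
have : (#|G| <= nsols C N)%N.
 rewrite -(card_in_image qi) /nsols; apply: subset_leq_card; apply/fintype.subsetP => _ /fintype.imageP[g _ ->].
 exact: sol.
rewrite cG -(ler_nat R) => hM.
apply: (@le_trans _ _ ((N%:R ^+ (s - n))^-1 * (M ^ (s - n))%:R)); last by apply: ler_wpM2l => //; rewrite invr_ge0 exprn_ge0.
rewrite NM natrM natrX natrX exprMn invfM -mulrA mulrCA mulVf ?mulr1 // expf_neq0 // pnatr_eq0 -lt0n //.
Qed.

Lemma local_density (x : 'rV[K]_s) : (forall i, qd (A i) x = 0) -> \rank (jac A x) = n ->
 exists c : R, 0 < c /\ forall v, c <= density R C (p ^ v).
Proof.
move=> hx rk; have [c [c1 hc]] := vle_ex hv x.
have c0 : 0 < c by lra.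
have [t [t0 ht]] := small_padic pp H (e := c^-1) (ltac:(by rewrite invr_gt0)).
apply: (@integral_local_density (t *: x)).
- by move=> i; rewrite qdZ hx mulr0.
- by rewrite jac_scale (eqmx_scale (jac A x) t0) rk.
- move=> i j; rewrite mxE; apply: le_trans (nu_leM H ht (hc i j)) _; rewrite mulVf //; exact: lt0r_neq0.
Qed.

End LocalDensity.

(** * The p-adic integers as compatible sequences, [digit f k] being the residue of [f] modulo
    [p ^ k] *)

Record pint (p : nat) (pp : prime p) := Pint { digit : nat -> nat; digitP : forall k, digit k = (digit k.+1 %% p ^ k)%N }.

HB.instance Definition _ p (pp : prime p) := gen_eqMixin (pint pp).
HB.instance Definition _ p (pp : prime p) := gen_choiceMixin (pint pp).

Section Pint.
Variables (p : nat) (pp : prime p).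
Local Notation Zp := (pint pp).
Local Open Scope nat_scope.

Lemma pX_gt0 k : (0 < p ^ k)%N. Proof. by rewrite expn_gt0 prime_gt0. Qed.
Lemma pX_dvd k m : (k <= m)%N -> (p ^ k %| p ^ m)%N. Proof. exact: dvdn_exp2l. Qed.
Lemma pint_ext (f g : Zp) : (forall k, digit f k = digit g k) -> f = g.
Proof.
case: f g => [f fP] [g gP] /= /funext e; case: _ / e in gP *; congr Pint; exact: Prop_irrelevance.
Qed.

Lemma digit_small (f : Zp) k : digit f k %% p ^ k = digit f k.
Proof. by rewrite digitP modn_mod. Qed.
Lemma digit_mod (f : Zp) k m : (k <= m)%N -> digit f m %% p ^ k = digit f k.
Proof.
move=> /subnKC <-; elim: (m - k)%N => [|d IH]; first by rewrite addn0 digit_small.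
by rewrite -IH addnS [digit f (k + d)]digitP modn_dvdm // pX_dvd // leq_addr.
Qed.

Lemma pint_of_seq (f : nat -> nat) : (forall k, f k.+1 = f k %[mod p ^ k]) -> forall k, f k %% p ^ k = (f k.+1 %% p ^ k.+1) %% p ^ k.
Proof. by move=> h k; rewrite modn_dvdm ?pX_dvd // h. Qed.
Definition pint_mk (f : nat -> nat) (h : forall k, f k.+1 = f k %[mod p ^ k]) : Zp := Pint pp (pint_of_seq h).
Lemma digitS (f : Zp) k : digit f k.+1 = digit f k %[mod p ^ k].
Proof. by rewrite [digit f k]digitP modn_mod. Qed.
Lemma padd_subproof (f g : Zp) k : (digit f k.+1 + digit g k.+1 = digit f k + digit g k %[mod p ^ k])%N.
Proof. by rewrite -modnDm !digitS modnDm. Qed.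
Definition padd f g := pint_mk (padd_subproof f g).
Lemma pmul_subproof (f g : Zp) k : (digit f k.+1 * digit g k.+1 = digit f k * digit g k %[mod p ^ k])%N.
Proof. by rewrite -modnMm !digitS modnMm. Qed.
Definition pmul f g := pint_mk (pmul_subproof f g).
(** Modulo [p ^ k] the factor [p ^ k - 1] is [-1], which expresses the opposite within the natural
    numbers. *)
Lemma popp_subproof (f : Zp) k : ((p ^ k.+1 - 1) * digit f k.+1 = (p ^ k - 1) * digit f k %[mod p ^ k])%N.
Proof.
rewrite -modnMm digitS modnMm; apply/eqP.
rewrite -(eqn_modDr (digit f k)) -!mulSnr -!subSn ?pX_gt0 // !subn1 /= expnS -mulnA.
by rewrite mulnCA !modnMr.
Qed.
Definition popp f := pint_mk (popp_subproof f).
Definition pzero : Zp := @pint_mk (fun=> 0) (fun=> erefl).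
Definition pone : Zp := @pint_mk (fun=> 1) (fun=> erefl).
Lemma paddA : associative padd.
Proof. by move=> f g h; apply: pint_ext => k /=; rewrite modnDml modnDmr addnA. Qed.
Lemma paddC : commutative padd.
Proof. by move=> f g; apply: pint_ext => k /=; rewrite addnC. Qed.
Lemma padd0 : left_id pzero padd.
Proof. by move=> f; apply: pint_ext => k /=; rewrite mod0n add0n digit_small. Qed.
Lemma paddN : left_inverse pzero popp padd.
Proof.
move=> f; apply: pint_ext => k /=; rewrite modnDml -mulSnr -subSn ?pX_gt0 // subn1 /=.
by rewrite mulnC modnMl mod0n.
Qed.
Local Close Scope nat_scope.
HB.instance Definition _ := GRing.isZmodule.Build Zp paddA paddC padd0 paddN.

Local Open Scope nat_scope.
Lemma pmulA : associative pmul.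
Proof. by move=> f g h; apply: pint_ext => k /=; rewrite modnMml modnMmr mulnA. Qed.
Lemma pmulC : commutative pmul.
Proof. by move=> f g; apply: pint_ext => k /=; rewrite mulnC. Qed.
Lemma pmul1 : left_id pone pmul.
Proof. by move=> f; apply: pint_ext => k /=; rewrite modnMml mul1n digit_small. Qed.
Lemma pmulD : left_distributive pmul padd.
Proof. by move=> f g h; apply: pint_ext => k /=; rewrite modnMml modnDm mulnDl. Qed.
Local Close Scope nat_scope.
Lemma pone_neq0 : pone != 0.
Proof. by apply/eqP => /(congr1 (fun f : Zp => digit f 1)) /=; rewrite mod0n modn_small // expn1 prime_gt1. Qed.
HB.instance Definition _ := GRing.Zmodule_isComNzRing.Build Zp pmulA pmulC pmul1 pmulD pone_neq0.

Lemma digit_nat n k : digit (n%:R : Zp) k = (n %% p ^ k)%N.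
Proof.
elim: n => [//|n IH]; rewrite -natr1 /= IH.
by rewrite modnDm addn1.
Qed.

Lemma digit_eq0 (f : Zp) k m : (k <= m)%N -> (digit f k == 0%N) = (p ^ k %| digit f m)%N.
Proof. by move=> km; rewrite /dvdn digit_mod. Qed.
Lemma digit_sub_eq0 (f g : Zp) k : (digit (f - g) k == 0%N) = (digit f k == digit g k).
Proof.
have -> : digit f k = ((digit (f - g)%R k + digit g k) %% p ^ k)%N by rewrite -{1}(subrK g f).
move: (f - g) => h; rewrite -{2}(digit_small g k) -{2}[digit g k]add0n.
by rewrite -[RHS]/(digit h k + digit g k == 0 + digit g k %[mod p ^ k])%N eqn_modDr mod0n digit_small.
Qed.

Lemma pint_neq0 (f : Zp) : f != 0 -> exists k, digit f k != 0%N.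
Proof.
move=> f0; apply: contrapT => /forallNP h; move: f0 => /eqP; apply.
by apply: pint_ext => k /=; rewrite mod0n; apply/eqP; apply: contrapT => /negP; exact: h.
Qed.

(** The first nonzero residue of an element of valuation [d] occurs at index [d + 1], whence the
    predecessor; the value at 0 is a default. *)
Definition pord (f : Zp) : nat := if pselect (exists k, digit f k != 0%N) is left h then (ex_minn h).-1 else 0%N.
Lemma pordP (f : Zp) k : f != 0 -> (digit f k == 0%N) = (k <= pord f)%N.
Proof.
move=> f0; rewrite /pord; case: pselect => [h|/(_ (pint_neq0 f0))//]; case: ex_minnP => m m0 hm.
have m1 : (0 < m)%N by case: m m0 {hm} => //; rewrite -digit_small modn1.
rewrite -ltnS prednK //; apply/idP/idP => [/eqP fk|]; last by apply: contraTT => /hm; rewrite leqNgt.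
rewrite ltnNge; apply: contra m0 => mk; by rewrite (digit_eq0 _ mk) fk dvdn0.
Qed.

Lemma digit_logn (f : Zp) m : f != 0 -> (pord f < m)%N -> (0 < digit f m)%N /\ logn p (digit f m) = pord f.
Proof.
move=> f0 hm; have g0 : (0 < digit f m)%N by rewrite lt0n pordP // -ltnNge.
split=> //; apply/eqP; rewrite eqn_leq -(pfactor_dvdn _ pp) // -digit_eq0 ?pordP ?leqnn ?(ltnW hm) // andbT.
by rewrite leqNgt -(pfactor_dvdn _ pp) // -digit_eq0 ?pordP ?ltnn.
Qed.

Lemma pord_mul (f g : Zp) k : f != 0 -> g != 0 -> (digit (f * g) k == 0%N) = (k <= pord f + pord g)%N.
Proof.
move=> f0 g0; pose M := (k + (pord f + pord g).+1)%N.
rewrite (@digit_eq0 _ _ M) ?leq_addr // (_ : digit (f * g) M = (digit f M * digit g M %% p ^ M)%N) //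
 /dvdn modn_dvdm ?pX_dvd ?leq_addr // -/(dvdn _ _).
have [f1 fl] := @digit_logn f M f0 (ltac:(rewrite /M; lia)).
have [g1 gl] := @digit_logn g M g0 (ltac:(rewrite /M; lia)).
by rewrite pfactor_dvdn ?muln_gt0 ?f1 // lognM // fl gl.
Qed.

Lemma pint_integral (f g : Zp) : f * g = 0 -> (f == 0) || (g == 0).
Proof.
move=> e; apply: contraT; rewrite negb_or => /andP[f0 g0].
have := pord_mul (pord f + pord g).+1 f0 g0; by rewrite e /= mod0n ltnn.
Qed.

Definition punit : pred Zp := fun f => `[< exists g, g * f = 1 >].
Definition pinv (f : Zp) : Zp := if pselect (exists g, g * f = 1) is left h then projT1 (cid h) else f.
Lemma pmulV : {in punit, left_inverse 1 pinv *%R}.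
Proof. by move=> f /asboolP h; rewrite /pinv; case: pselect => // h'; case: cid. Qed.
Lemma punitP (f g : Zp) : g * f = 1 -> punit f.
Proof. by move=> h; apply/asboolP; exists g. Qed.
Lemma pinv_out : {in [predC punit], pinv =1 id}.
Proof. by move=> f /asboolP h; rewrite /pinv; case: pselect. Qed.
HB.instance Definition _ := GRing.ComNzRing_hasMulInverse.Build Zp pmulV punitP pinv_out.
HB.instance Definition _ := GRing.ComUnitRing_isIntegral.Build Zp pint_integral.

Lemma digit_sub0 (f g : Zp) k : digit f k = 0%N -> digit g k = 0%N -> digit (f + g) k = 0%N.
Proof. by move=> /= -> ->; rewrite mod0n. Qed.
(** After division by the power of [p] in [g], the residue [u] of [g] is prime to [p], and the
    Chinese remainder theorem supplies a multiple of [u] congruent to the corresponding residue [w]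
    of [f]. *)
Lemma pint_bezout (f g : Zp) v : g != 0 -> (f != 0 -> (pord g <= pord f)%N) ->
 exists n : nat, digit (f - n%:R * g) (v + pord g) = 0%N.
Proof.
move=> g0 hfg; set m := (v + pord g)%N.
have [v0|v0] := posnP v.
 exists 0%N; rewrite mul0r subr0 /m v0 add0n; have [->|f0] := eqVneq f 0; first by rewrite /= mod0n.
 by apply/eqP; rewrite pordP // hfg.
have [gm gl] := @digit_logn g m g0 (ltac:(by rewrite /m -{1}[pord g]add0n ltn_add2r)).
have [u gu] : exists u, digit g m = (u * p ^ pord g)%N by apply/dvdnP; rewrite pfactor_dvdn // gl.
have [w fw] : exists w, digit f m = (w * p ^ pord g)%N.
 apply/dvdnP; rewrite -digit_eq0 ?leq_addl //; have [->|f0] := eqVneq f 0; first by rewrite /= mod0n.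
 by rewrite pordP // hfg.
have u0 : (0 < u)%N by move: gm; rewrite gu muln_gt0 => /andP[].
have cu : coprime (p ^ m) u.
 rewrite coprimeXl // prime_coprime // -[p]expn1 pfactor_dvdn // -leqNgt leqn0.
 by move: gl; rewrite gu lognM ?pX_gt0 // pfactorK // -{2}[pord g]add0n => /addIn ->.
have [n nE] : exists n, chinese (p ^ m) u w 0 = (n * u)%N.
 by apply/dvdnP; rewrite /dvdn chinese_modr // mod0n.
exists n; have e : digit (n%:R * g) m = digit f m.
 rewrite /= digit_nat modnMml gu mulnA -nE -modnMml chinese_modl // modnMml -fw digit_small //.
by apply/eqP; rewrite digit_sub_eq0 e.
Qed.

End Pint.

Local Open Scope quotient_scope.
Lemma frac_repr (A : idomainType) (x : {fraction A}) :
 exists a b : A, b != 0 /\ x = FracField.tofrac a / FracField.tofrac b.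
Proof.
elim/quotW: x => f; exists (frac f).1, (frac f).2; split; first exact: denom_ratioP.
have d0 : FracField.tofrac (frac f).2 != 0 by rewrite tofrac_eq0 denom_ratioP.
apply: (mulIf d0); rewrite divfK //.
rewrite -[LHS]/(FracField.mul _ _).
rewrite ![FracField.tofrac _](piE) !piE.
apply/eqmodP; rewrite /= FracField.equivfE /FracField.mulf !numden_Ratio ?oner_eq0 ?mulf_neq0 ?denom_ratioP ?oner_neq0 //.
by rewrite !mulr1 mulrC.
Qed.
Local Close Scope quotient_scope.

(** * The field Q_p and its absolute value *)

Section Qp.
Variables (R : realType) (p : nat) (pp : prime p).
Local Notation Zp := (pint pp).
Local Notation K := {fraction Zp}.
Local Notation i := (@FracField.tofrac Zp).

Let pR : 1 < p%:R :> R. Proof. by rewrite ltr1n prime_gt1. Qed.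
Let pX k : 0 < p%:R ^- k :> R. Proof. by rewrite invr_gt0 exprn_gt0 // (lt_trans ltr01). Qed.
Lemma pX_le j k : (p%:R ^- j <= p%:R ^- k :> R) = (k <= j)%N.
Proof.
have h m : 0 < p%:R ^+ m :> R by rewrite exprn_gt0 // (lt_trans ltr01).
by rewrite lef_pV2 ?posrE // ler_eXn2l.
Qed.

Definition pabs (f : Zp) : R := if f == 0 then 0 else p%:R ^- pord f.
Lemma pabs_le f k : (pabs f <= p%:R ^- k) = (digit f k == 0%N).
Proof.
rewrite /pabs; case: eqVneq => [->|f0]; last by rewrite pX_le pordP.
by rewrite ltW //= mod0n.
Qed.

Lemma pabs_ge0 f : 0 <= pabs f. Proof. by rewrite /pabs; case: ifP => // _; exact: ltW. Qed.
Lemma pabs_eq0 f : (pabs f == 0) = (f == 0).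
Proof.
rewrite /pabs; case: (eqVneq f 0) => _; first by rewrite eqxx.
by rewrite gt_eqF.
Qed.

Lemma pabsM f g : pabs (f * g) = pabs f * pabs g.
Proof.
rewrite {2 3}/pabs; case: (eqVneq f 0) => [->|f0]; first by rewrite mul0r /pabs eqxx mul0r.
case: (eqVneq g 0) => [->|g0]; first by rewrite mulr0 /pabs eqxx mulr0.
have fg0 : f * g != 0 by rewrite mulf_neq0.
rewrite /pabs (negbTE fg0) -invfM -exprD; congr (_ ^- _).
have h k : (k <= pord (f * g)%R)%N = (k <= pord f + pord g)%N by rewrite -pordP // pord_mul.
by apply/eqP; rewrite eqn_leq -h leqnn h leqnn.
Qed.

Lemma pabsD f g : pabs (f + g) <= Num.max (pabs f) (pabs g).
Proof.
have [f0|f0] := eqVneq f 0; first by rewrite f0 add0r le_max lexx orbT.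
have [g0|g0] := eqVneq g 0; first by rewrite g0 addr0 le_max lexx.
have key (a : Zp) (a0 : a != 0) : pabs a = p%:R ^- pord a by rewrite /pabs (negbTE a0).
have [h|/ltW h] := leP (pabs f) (pabs g).
 rewrite [leRHS]key // pabs_le; apply/eqP/digit_sub0; apply/eqP; rewrite -pabs_le -key //.
by rewrite [leRHS]key // pabs_le; apply/eqP/digit_sub0; apply/eqP; rewrite -pabs_le -key.
Qed.

Lemma frac_choice : exists c : K -> Zp * Zp, forall x, (c x).2 != 0 /\ x = i (c x).1 / i (c x).2.
Proof.
have /choice[c hc] : forall x : K, exists c : Zp * Zp, c.2 != 0 /\ x = i c.1 / i c.2.
 by move=> x; have [a [b [b0 e]]] := frac_repr x; exists (a, b).
by exists c.
Qed.

(** Computed on a chosen representation as a fraction; [qabsE] shows independence of the choice. *)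
Definition qabs (x : K) : R := let c := sval (cid frac_choice) x in pabs c.1 / pabs c.2.
Lemma qabsE (a b : Zp) : b != 0 -> qabs (i a / i b) = pabs a / pabs b.
Proof.
move=> b0; rewrite /qabs; case: cid => c h /=; have [d0 e] := h (i a / i b).
move: (c _) d0 e => [a' b'] /= b'0 /eqP; rewrite eqr_div ?tofrac_eq0 // -!tofracM tofrac_eq => /eqP e.
by apply/eqP; rewrite eqr_div ?pabs_eq0 // -!pabsM e.
Qed.

Lemma pabs1 : pabs 1 = 1.
Proof.
have h : pabs 1 != 0 by rewrite pabs_eq0 oner_neq0.
by apply: (mulIf h); rewrite mul1r -pabsM mulr1.
Qed.

Lemma qabs_tofrac a : qabs (i a) = pabs a.
Proof. by rewrite -[i a]divr1 -tofrac1 qabsE ?oner_neq0 // pabs1 divr1. Qed.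
Lemma qabs_int_le a k : (qabs (i a) <= p%:R ^- k) = (digit a k == 0%N).
Proof. by rewrite qabs_tofrac pabs_le. Qed.
Lemma qabsM x y : qabs (x * y) = qabs x * qabs y.
Proof.
have [a [b [b0 ->]]] := frac_repr x; have [c [d [d0 ->]]] := frac_repr y.
by rewrite mulf_div -!tofracM !qabsE ?mulf_neq0 // !pabsM mulf_div.
Qed.

Lemma qabs_ge0 x : 0 <= qabs x.
Proof. by have [a [b [b0 ->]]] := frac_repr x; rewrite qabsE // divr_ge0 ?pabs_ge0. Qed.
Lemma qabs_eq0 x : qabs x = 0 <-> x = 0.
Proof.
have [a [b [b0 ->]]] := frac_repr x; rewrite qabsE //.
split=> /eqP; rewrite mulf_eq0 invr_eq0 ?pabs_eq0 ?tofrac_eq0 (negbTE b0) orbF => /eqP ->.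
 by rewrite tofrac0 mul0r.
by rewrite /pabs eqxx mul0r.
Qed.

Lemma qabsD x y : qabs (x + y) <= Num.max (qabs x) (qabs y).
Proof.
have [a [b [b0 ->]]] := frac_repr x; have [c [d [d0 ->]]] := frac_repr y.
rewrite addf_div ?tofrac_eq0 // -!tofracM -tofracD !qabsE ?mulf_neq0 // pabsM.
have bp : 0 < pabs b by rewrite lt_def pabs_eq0 b0 pabs_ge0.
have dp : 0 < pabs d by rewrite lt_def pabs_eq0 d0 pabs_ge0.
rewrite ler_pdivrMr ?mulr_gt0 // maxr_pMl ?mulr_ge0 ?pabs_ge0 //.
have -> : pabs a / pabs b * (pabs b * pabs d) = pabs a * pabs d by rewrite mulrA divfK ?gt_eqF.
have -> : pabs c / pabs d * (pabs b * pabs d) = pabs c * pabs b.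
 by rewrite [pabs b * _]mulrC mulrA divfK ?gt_eqF.
by rewrite -!pabsM pabsD.
Qed.

Lemma qabs_disc x : x != 0 -> exists k : int, qabs x = p%:R ^ k.
Proof.
have [a [b [b0 ->]]] := frac_repr x; rewrite mulf_eq0 invr_eq0 !tofrac_eq0 negb_or => /andP[a0 _].
exists ((pord b)%:Z - (pord a)%:Z); rewrite qabsE // /pabs (negbTE a0) (negbTE b0) invrK.
by rewrite expfzDr ?pnatr_eq0 -?lt0n ?prime_gt0 // mulrC -exprnP -exprnN.
Qed.

(** The value is an integral power of [p], at most [p ^ -1] and above [p ^ -2]. *)
Lemma qabs_p : qabs p%:R = p%:R^-1.
Proof.
have e : (p%:R : K) = i p%:R by rewrite rmorph_nat.
have h k : (qabs p%:R <= p%:R ^- k) = (k <= 1)%N.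
 rewrite e qabs_int_le digit_nat; case: k => [|[|k]]; rewrite ?modn1 ?expn1 ?modnn //.
 have pk : (p < p ^ k.+2)%N by rewrite -{1}[p]expn1 ltn_exp2l // prime_gt1.
 by rewrite (modn_small pk) (gtn_eqF (prime_gt0 pp)).
have p0 : (p%:R : K) != 0.
 apply/eqP => p0; have := h 2%N; rewrite p0 (iffRL (qabs_eq0 0) erefl) => /esym; by rewrite ltW.
have [k kE] := qabs_disc p0; move: h; rewrite kE => h.
have p1 : p%:R ^ k <= p%:R ^ (-1) :> R by have := h 1%N; rewrite expr1 => ->.
have p2 : ~~ (p%:R ^ k <= p%:R ^ (-2%:Z) :> R) by have := h 2%N; rewrite -exprnN => ->.
rewrite -[RHS]/(p%:R ^ (-1)); congr (_ ^ _).
by move: p1 p2; rewrite !ler_eXz2l //; lia.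
Qed.

Lemma qabs_dense x v : qabs x <= 1 -> exists k : nat, qabs (x - k%:R) <= p%:R ^- v.
Proof.
have [a [b [b0 ->]]] := frac_repr x; rewrite qabsE // => h.
have bp : 0 < pabs b by rewrite lt_def pabs_eq0 b0 pabs_ge0.
have [|k hk] := @pint_bezout _ pp a b v b0.
 by move: h; rewrite ler_pdivrMr // mul1r {2}/pabs (negbTE b0) pabs_le => h a0; rewrite -pordP.
exists k; have ib : i b != 0 by rewrite tofrac_eq0.
have -> : i a / i b - k%:R = i (a - k%:R * b) / i b by rewrite tofracB tofracM rmorph_nat mulrBl mulfK.
rewrite qabsE // ler_pdivrMr // {2}/pabs (negbTE b0) -invfM -exprD pabs_le; exact/eqP.
Qed.

Lemma qabs_nat_le m n k : (qabs (m%:R - n%:R) <= p%:R ^- k) = (m == n %[mod p ^ k])%N.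
Proof. by rewrite -!(rmorph_nat i) -tofracB qabs_int_le digit_sub_eq0 !digit_nat. Qed.
Lemma qabs1 : qabs 1 = 1. Proof. by rewrite -tofrac1 qabs_tofrac pabs1. Qed.
Lemma qabsN x : qabs (- x) = qabs x.
Proof.
rewrite -mulN1r qabsM; have /eqP := qabsM (-1) (-1).
rewrite mulrNN mulr1 qabs1 eq_sym -expr2 sqrf_eq1 => /orP[/eqP ->|/eqP e]; first by rewrite mul1r.
by have := qabs_ge0 (-1); rewrite e; lra.
Qed.

Lemma qabsB x y : qabs (x - y) <= Num.max (qabs x) (qabs y).
Proof.
by rewrite -[qabs y]qabsN; exact: qabsD.
Qed.

(* A Cauchy sequence in the unit ball is approximated modulo p^j by an integer
  n_j, and the integers n_j are the truncations of its limit. *)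
Lemma pint_complete (y : nat -> K) : (forall k, qabs (y k) <= 1) ->
 (forall j : nat, exists N, forall k l, (N <= k)%N -> (N <= l)%N -> qabs (y k - y l) <= p%:R ^- j) ->
 exists L : K, forall j : nat, exists N, forall k, (N <= k)%N -> qabs (L - y k) <= p%:R ^- j.
Proof.
move=> y1 hy.
have /choice[c hc] : forall j : nat, exists c : nat * nat, forall k, (c.2 <= k)%N -> qabs (y k - c.1%:R) <= p%:R ^- j.
 move=> j; have [N hN] := hy j; have [n hn] := qabs_dense j (y1 N); exists (n, N) => k /= Nk.
 rewrite -(subrK (y N) (y k)) -addrA; apply: le_trans (qabsD _ _) _.
 by rewrite ge_max hn andbT hN.
have hm j : (c j.+1).1 = (c j).1 %[mod p ^ j].
 apply/eqP; rewrite -qabs_nat_le; set k := maxn (c j).2 (c j.+1).2.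
 have -> : (c j.+1).1%:R - (c j).1%:R = (y k - (c j).1%:R) - (y k - (c j.+1).1%:R) by ring.
 apply: le_trans (qabsB _ _) _; rewrite ge_max hc ?leq_maxl //=.
 by apply: le_trans (hc j.+1 k (leq_maxr _ _)) _; rewrite pX_le.
pose L := @pint_mk p pp (fun j => (c j).1) hm.
exists (i L) => j; exists (c j).2 => k hk.
have -> : i L - y k = (i L - (c j).1%:R) - (y k - (c j).1%:R) by ring.
apply: le_trans (qabsB _ _) _; rewrite ge_max hc // andbT.
by rewrite -(rmorph_nat i) -tofracB qabs_int_le digit_sub_eq0 digit_nat.
Qed.

Lemma pX_small (e : R) : 0 < e -> exists k : nat, p%:R ^- k <= e.
Proof. exact: padic_pow_small. Qed.
(** A power of [p] brings the bounded sequence into the unit ball, where [pint_complete] applies;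
    the ultrametric inequality bounds the tails by their first step. *)
Lemma qabs_complete (u : nat -> K) (A : R) : (forall k, qabs (u k.+1 - u k) <= A / 2 ^+ k) ->
 exists l, forall k, qabs (l - u k) <= 2 * A / 2 ^+ k.
Proof.
move=> hu; have A0 : 0 <= A by have := le_trans (qabs_ge0 _) (hu 0%N); rewrite expr0 divr1.
have t0 k : 0 < 2 ^+ k :> R by rewrite exprn_gt0.
have tail k d : qabs (u (k + d)%N - u k) <= A / 2 ^+ k.
 elim: d => [|d IH]; first by rewrite addn0 subrr (iffRL (qabs_eq0 0) erefl) divr_ge0 // ltW.
 rewrite addnS -(subrK (u (k + d)%N) (u _)) -addrA; apply: le_trans (qabsD _ _) _.
 rewrite ge_max IH andbT; apply: le_trans (hu _) _; apply: ler_wpM2l => //.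
 by rewrite lef_pV2 ?posrE // ler_eXn2l ?ltr1n // leq_addr.
have tail' k l : (k <= l)%N -> qabs (u l - u k) <= A / 2 ^+ k by move=> /subnKC <-.
have half_small (e : R) : 0 < e -> exists k, A / 2 ^+ k <= e.
 move=> e0; have [k hk] := pX_small (e := e / (A + 1)) (ltac:(by rewrite divr_gt0 //; lra)).
 have [m hm] : exists m : nat, (p ^ k <= 2 ^ m)%N by exists (p ^ k)%N; exact/ltnW/ltn_expl.
 exists m; apply: (@le_trans _ _ ((A + 1) * p%:R ^- k)); last by move: hk; rewrite ler_pdivlMr; lra.
 apply: ler_pM; [exact: A0 | by rewrite invr_ge0 ltW | lra | ].
 by rewrite -!natrX lef_pV2 ?posrE ?ltr0n ?expn_gt0 ?prime_gt0 // ler_nat.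
have [M0 [M1 hM]] : exists M : R, 0 < M /\ forall k, qabs (u k) <= M.
 exists (qabs (u 0%N) + A + 1); split; first by have := qabs_ge0 (u 0%N); lra.
 move=> k; rewrite -(subrK (u 0%N) (u k)); apply: le_trans (qabsD _ _) _.
 have := tail' 0%N k isT; have := qabs_ge0 (u 0%N); rewrite expr0 divr1 ge_max => h1 h2; apply/andP; lra.
have [e he] := pX_small (e := M0^-1) (ltac:(by rewrite invr_gt0)).
pose P : K := p%:R ^+ e.
have qP : qabs P = p%:R ^- e.
 rewrite /P; elim: e {he P} => [|e IH]; first by rewrite !expr0 invr1 qabs1.
 by rewrite !exprS qabsM qabs_p IH invfM.
have P0 : P != 0 by apply/eqP => /qabs_eq0; rewrite qP => /eqP; rewrite gt_eqF.
have [||L hL] := @pint_complete (fun k => P * u k).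
- move=> k; rewrite qabsM qP; apply: (@le_trans _ _ (M0^-1 * M0)); last by rewrite mulVf // gt_eqF.
 by apply: ler_pM; [exact: ltW | exact: qabs_ge0 | exact: he | exact: hM].
- move=> j; have [N hN] := half_small (p%:R ^- j) (pX j).
 have e1 : p%:R ^- e <= 1 :> R by have := pX_le e 0; rewrite expr0 invr1 leq0n.
 suff key k l : (N <= k)%N -> (k <= l)%N -> qabs (P * u l - P * u k) <= p%:R ^- j.
  exists N => k l Nk Nl; have [kl|/ltnW kl] := leqP k l; last exact: key.
  by rewrite -opprB qabsN; exact: key.
 move=> Nk kl; rewrite -mulrBr qabsM qP -[leRHS]mul1r; apply: ler_pM; [exact: ltW | exact: qabs_ge0 | exact: e1 | ].
 apply: le_trans (tail' _ _ kl) _; apply: le_trans hN; apply: ler_wpM2l => //.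
 by rewrite lef_pV2 ?posrE // ler_eXn2l ?ltr1n.
have [A00|A0'] := eqVneq A 0.
 exists (u 0%N) => k; rewrite A00 mulr0 mul0r -opprB qabsN; apply: le_trans (tail' 0%N k isT) _.
 by rewrite A00 mul0r.
exists (P^-1 * L) => k.
have Ap : 0 < A by rewrite lt_def A0'.
have [j hj] := pX_small (e := p%:R ^- e * (A / 2 ^+ k)) (ltac:(by rewrite mulr_gt0 // divr_gt0)).
have [N hN] := hL j; set l := maxn N k.
rewrite -(subrK (u l) (_ * _)) -addrA; apply: le_trans (qabsD _ _) _.
have : A / 2 ^+ k <= 2 * A / 2 ^+ k by rewrite -mulrA; have : 0 <= A / 2 ^+ k; [rewrite divr_ge0 // ltW | lra].
rewrite ge_max => h; rewrite (le_trans (tail' k l (leq_maxr _ _)) h) andbT; apply: le_trans h.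
have -> : P^-1 * L - u l = P^-1 * (L - P * u l) by rewrite mulrBr mulKf.
rewrite -(@ler_pM2l _ (p%:R ^- e)) // -{1}qP -qabsM mulVKf //; apply: le_trans hj; apply: hN; exact: leq_maxl.
Qed.

Lemma Qp_padic : padic p qabs.
Proof.
split.
- split=> //; [exact: qabs_eq0 | exact: qabs_ge0 | exact: qabsM | | exact: qabs_complete].
 move=> x y; apply: le_trans (qabsD x y) _; rewrite ge_max lerDl lerDr; by rewrite !qabs_ge0.
- exact: qabsD.
- exact: qabs_disc.
- exact: qabs_p.
- exact: qabs_dense.
Qed.

End Qp.

(** * Quadratic polynomials and their coefficient matrices *)

Section QuadraticPolynomials.
Variables (s : nat) (K : comNzRingType).

(** Triangular rather than symmetric, so that integral coefficients give an integral matrix, without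
    halves. *)
Definition qtri (p : {mpoly K[s]}) : 'M[K]_s :=
 \matrix_(j, k) if (j <= k)%N then p@_(U_(j) + U_(k))%MM else 0.

Lemma mnm_deg2 (m : 'X_{1..s}) : mdeg m = 2%N -> exists a b : 'I_s, (a <= b)%N /\ m = (U_(a) + U_(b))%MM.
Proof.
move=> dm; have [a ma] : exists a, (0 < m a)%N.
 apply: contrapT => /forallNP h; move: dm; rewrite mdegE big1 // => i _; apply/eqP; rewrite -leqn0 leqNgt; exact/negP/h.
have e : m = (U_(a) + (m - U_(a)))%MM by rewrite addmC submK // lep1mP -lt0n.
have /eqP/mdeg1P[b /eqP mb] : mdeg (m - U_(a)) = 1%N by move: dm; rewrite {1}e mdegD mdeg1 => -[].
rewrite mb in e; have [ab|/ltnW ab] := leqP a b; first by exists a, b.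
by exists b, a; rewrite [RHS]addmC.
Qed.

Lemma mnm2_inj (a b j k : 'I_s) : (a <= b)%N -> (j <= k)%N -> (U_(j) + U_(k) = U_(a) + U_(b))%MM -> j = a /\ k = b.
Proof.
move=> ab jk /mnmP h; have hj := h j; have hk := h k; have ha := h a; have hb := h b.
move: hj hk ha hb; rewrite !mnmDE !mnm1E !eqxx.
rewrite -!val_eqE /= => hj hk ha hb; split; apply/val_inj => /=; move: ab jk hj hk ha hb;
 move: (a : nat) (b : nat) (j : nat) (k : nat) => x y z w.
- lia.
- lia.
Qed.

Lemma quad_decomp (p : {mpoly K[s]}) : p \is 2.-homog ->
 p = \sum_j \sum_k qtri p j k *: ('X_j * 'X_k).
Proof.
move=> hp; apply/mpolyP => m; rewrite raddf_sum /=.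
under eq_bigr => j _ do rewrite raddf_sum /=; under eq_bigr => j _ do under eq_bigr => k _ do rewrite mcoeffZ -mpolyXD mcoeffX.
have [dm|dm] := eqVneq (mdeg m) 2%N; last first.
 rewrite (dhomog_nemf_coeff hp dm) big1 // => j _; rewrite big1 // => k _.
 by case: eqP => [e|_]; rewrite ?mulr0 //; move: dm; rewrite -e mdegD !mdeg1.
have [a [b [ab ->]]] := mnm_deg2 dm.
rewrite (bigD1 a) //= (bigD1 b) //= mxE ab eqxx mulr1 big1 ?addr0 => [|k kb].
 rewrite big1 ?addr0 // => j ja; rewrite big1 // => k _; rewrite mxE; case: ifP => jk; last by rewrite mul0r.
 by case: eqP => [/(mnm2_inj ab jk)[ea _]|_]; rewrite ?mulr0 //; move: ja; rewrite ea eqxx.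
rewrite mxE; case: ifP => jk; last by rewrite mul0r.
by case: eqP => [/(mnm2_inj ab jk)[_ ek]|_]; rewrite ?mulr0 //; move: kb; rewrite ek eqxx.
Qed.

Lemma mderiv_var (j l : 'I_s) : ('X_j : {mpoly K[s]})^`M(l) = (j == l)%:R%:MP.
Proof.
rewrite mderivX mnm1E; case: eqVneq => [->|_]; last by rewrite scale0r mpolyC0.
by rewrite scale1r (_ : U_(l) - U_(l) = 0)%MM ?mpolyX0 //; apply/mnmP => i; rewrite mnmBE subnn mnm0E.
Qed.

Lemma quad_deriv (p : {mpoly K[s]}) l : p \is 2.-homog ->
 p^`M(l) = \sum_k (qtri p + (qtri p)^T) l k *: 'X_k.
Proof.
move=> hp; rewrite {1}(quad_decomp hp) linear_sum /=.
under eq_bigr => j _ do rewrite linear_sum /=.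
under eq_bigr => j _ do under eq_bigr => k _ do rewrite linearZ /= mderivM !mderiv_var scalerDr.
under eq_bigr => j _ do rewrite big_split /=.
rewrite big_split /=; under [RHS]eq_bigr => k _ do rewrite !mxE scalerDl.
rewrite big_split /=; congr (_ + _).
- rewrite (bigD1 l) //= [X in _ + X]big1 ?addr0 => [|j jl].
  by apply: eq_bigr => k _; rewrite eqxx mpolyC1 mul1r mxE.
 by rewrite big1 // => k _; rewrite (negbTE jl) mpolyC0 mul0r scaler0.
- apply: eq_bigr => j _; rewrite (bigD1 l) //= big1 ?addr0 => [|k kl].
  by rewrite eqxx mpolyC1 mulr1 mxE.
 by rewrite (negbTE kl) mpolyC0 mulr0 scaler0.
Qed.

End QuadraticPolynomials.

Section QuadraticEval.
Variables (s : nat).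

Lemma map_quad_eval (K L : comNzRingType) (f : {rmorphism L -> K}) (p : {mpoly L[s]}) (v : 'I_s -> K) : p \is 2.-homog ->
 (map_mpoly f p).@[v] = \sum_j \sum_k f (qtri p j k) * v j * v k.
Proof.
move=> hp; rewrite {1}(quad_decomp hp) [map_mpoly _ _]raddf_sum [LHS]raddf_sum /=; apply: eq_bigr => j _.
rewrite [map_mpoly _ _]raddf_sum [LHS]raddf_sum /=; apply: eq_bigr => k _.
by rewrite map_mpolyZ mevalZ rmorphM /= !map_mpolyX mevalM !mevalXU mulrA.
Qed.

Lemma qevalr_quad (K : numFieldType) (p : {mpoly rat[s]}) (v : 'I_s -> K) : p \is 2.-homog ->
 qevalr p v = \sum_j \sum_k ratr (qtri p j k) * v j * v k.
Proof. exact: (map_quad_eval (ratr : {rmorphism rat -> K})). Qed.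
Lemma map_quad_deriv (K L : comNzRingType) (f : {rmorphism L -> K}) (p : {mpoly L[s]}) (v : 'I_s -> K) l : p \is 2.-homog ->
 (map_mpoly f p^`M(l)).@[v] = \sum_k f ((qtri p + (qtri p)^T) l k) * v k.
Proof.
move=> hp; rewrite (quad_deriv l hp) [map_mpoly _ _]raddf_sum [LHS]raddf_sum /=; apply: eq_bigr => k _.
by rewrite map_mpolyZ mevalZ map_mpolyX mevalXU.
Qed.

Lemma qevalr_deriv (K : numFieldType) (p : {mpoly rat[s]}) (v : 'I_s -> K) l : p \is 2.-homog ->
 qevalr p^`M(l) v = \sum_k ratr ((qtri p + (qtri p)^T) l k) * v k.
Proof. exact: (map_quad_deriv (ratr : {rmorphism rat -> K})). Qed.
Lemma qform_mx_qtri (K : numFieldType) (p : {mpoly K[s]}) : qform_mx p = 2^-1 *: (qtri p + (qtri p)^T).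
Proof.
apply/matrixP => j k; rewrite !mxE; case: (ltngtP j k) => [jk|kj|/val_inj ->].
- by rewrite addr0 -val_eqE (ltn_eqF jk) mulrC.
- by rewrite add0r -val_eqE (gtn_eqF kj) addmC mulrC.
- by rewrite eqxx; field.
Qed.

End QuadraticEval.

Lemma polar_intr (K : fieldType) s (C : 'M[int]_s) : map_mx intr (polar C) = pol (map_mx intr C : 'M[K]_s).
Proof. by rewrite /polar /pol map_mxD map_trmx. Qed.
Lemma common_denominator (T : finType) (f : T -> rat) : exists m : nat, (0 < m)%N /\ forall t, m%:R * f t \is a Num.int.
Proof.
exists (\prod_t absz (denq (f t)))%N; split.
 by apply: prodn_gt0 => t; rewrite absz_gt0 denq_neq0.
move=> t; rewrite (bigD1 t) //= natrM mulrC mulrA natr_absz gtr0_norm ?denq_gt0 //.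
by rewrite -{1}[f t]divq_num_den divfK ?intr_eq0 ?denq_neq0 // rpredM ?intr_int ?natr_int.
Qed.

Lemma rank_cond_dim r s (C : 'I_r.+1 -> 'M[int]_s) : rank_cond C -> (2 * r.+1 < s)%N.
Proof.
move=> hr; have := rank_leq_row (pencil_mx C (fun=> 1 : rat)).
by have := hr (fun=> 1) (ex_intro _ ord0 (oner_neq0 _)); move: (\rank _) => k; nia.
Qed.

(** * Integral zeros from the asymptotic formula *)

Section RationalPencil.
Variables (R : realType) (r s : nat) (C : 'I_r.+1 -> 'M[int]_s).
Local Notation n := r.+1.
Hypothesis pencilC : forall b : 'I_n -> R[i], (exists i, b i != 0) ->
 (2 * n * n.+1 < \rank (\sum_i b i *: map_mx intr (polar (C i)))%R)%N.

Lemma rational_rank_cond : rank_cond C.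
Proof.
move=> b hb; apply: (@pencil_rank_transfer R rat _ n s (fun i => polar (C i))) => // m.
by rewrite pnatr_eq0.
Qed.

Lemma local_density_pos p : prime p -> exists c : R, 0 < c /\ forall v, c <= density R C (p ^ v).
Proof.
move=> pp; have H := Qp_padic R pp.
have [|x [hx rk]] := @padic_nonsingular_zero R p _ _ pp H n s (fun i => map_mx intr (C i)).
 move=> b /rV0Pn hb; under eq_bigr => i _ do rewrite -polar_intr.
 by apply: (pencil_rank_transfer (padic_char0 pp H) pencilC (b := b 0)).
exact: (local_density pp H hx rk).
Qed.

(** The real zero is scaled into the unit cube, over which the main term is positive. As [s - 2n] is
    at least 1, [n = r.+1], a large [P] leaves more than one integral zero in the dilated cube, and
    one of them is not the origin. *)
Lemma integral_zero_exists (x : 'rV[R]_s) : (forall i, qd (map_mx intr (C i)) x = 0) ->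
 \rank (jac (fun i => map_mx intr (C i)) x) = n ->
 exists z : 'I_s -> int, (exists j, z j != 0) /\ forall i, qf (C i) z = 0.
Proof.
move=> hx rk; have hr := rational_rank_cond.
pose J := fun _ : 'I_s => `[(-1 : R), 1].
have hJ : box_le 1 J by move=> j y; rewrite in_itv /= ler_norml.
have [X [X1 hX]] : exists X : R, 1 <= X /\ forall j, `|x 0 j| <= X.
 exists (1 + \sum_j `|x 0 j|); split; first by rewrite lerDl sumr_ge0.
 by move=> j; rewrite (bigD1 j) //= addrCA lerDl addr_ge0 // sumr_ge0.
pose t := (2 * X)^-1; have t0 : 0 < t by rewrite invr_gt0; lra.
have ht j : `|(t *: x) 0 j| <= 2^-1.
 rewrite mxE normrM gtr0_norm // /t invfM -mulrA ler_piMr // mulrC ler_pdivrMr ?mul1r //; lra.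
have Jp : 0 < sintegral C J.
 apply: (@singular_integral_pos R r s C J hr hJ (t *: x) 2^-1) => //.
 - by move=> i; rewrite qdZ hx mulr0.
 - by rewrite jac_scale (eqmx_scale _ (lt0r_neq0 t0)).
 - move=> j y; have := ht j; rewrite /J in_itv /= !ler_norml => /andP[h1 h2] /andP[h3 h4]; apply/andP; lra.
have [S [K [K1 HK]]] : exists S : R[i], exists K : R, 1 <= K /\
  forall Q, (0 < Q)%N -> cabs (S - Spart R C Q) <= K * Q%:R `^ (- delta0 R r).
 by have [S [_ hS]] := sseries_cvg R hr; exists S.
have Sp : 0 < S by apply: (singular_series_pos hr local_density_pos); exists K.
have [d [c [d0 c0 H]]] := asymptotic_formula hr hJ K1 HK.
have sn := rank_cond_dim hr.
pose a := Re (S * sintegral C J).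
have ap : 0 < a by have := mulr_gt0 Sp Jp; rewrite ltcE => /andP[].
(* The first bound keeps the error below half of the main term, the second makes that half at least
   2. *)
have [P [P1 hP1 hP2]] : exists P : R, [/\ 1 <= P, c * P `^ (- d) <= a / 2 & 4 / a <= P].
 set B := 2 * c / a + 1; have B0 : 0 < B by rewrite ltr_wpDl // divr_ge0 ?mulr_ge0 // ltW.
 have b0 : 0 <= B `^ d^-1 by exact: powR_ge0.
 have a4 : 0 < 4 / a by rewrite divr_gt0.
 exists (1 + 4 / a + B `^ d^-1); split; [lra | | lra].
 set P := _ + _; have Pd : B <= P `^ d.
  rewrite -{1}[B](powRr1 (ltW B0)) -(mulVf (lt0r_neq0 d0)) powRrM.
  by apply: ge0_ler_powR; rewrite ?nnegrE ?(ltW d0) // /P; lra.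
 rewrite powRN ler_pdivrMr ?(lt_le_trans B0) //; apply: (@le_trans _ _ (a / 2 * B)).
  have -> : a / 2 * B = c + a / 2 by rewrite /B; field; exact: lt0r_neq0.
  lra.
 by apply: ler_wpM2l => //; lra.
have P0 : 0 < P by lra.
have W1 : P <= P ^+ s / P ^+ (2 * n).
 rewrite -[s](subnK (ltnW sn)) exprD mulfK ?gt_eqF ?exprn_gt0 //.
 by rewrite -{1}[P]expr1 ler_weXn2l // subn_gt0.
have := H P P1; set W := _ / _ in W1 *; move=> /= /(le_trans (cabs_Re _)).
set Z := zcount _ _ _.
have -> : Re (Z%:R - W%:C%C * S * sintegral C J) = Z%:R - W * a.
 rewrite -mulrA /a -(rmorph_nat (real_complex R)); case: (S * _) => u v /=; ring.
rewrite ler_norml => /andP[h _].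
have Z2 : 1 < Z%:R :> R.
 have Wc : c * W * P `^ (- d) <= W * (a / 2) by rewrite mulrAC mulrC; apply: ler_wpM2l => //; lra.
 have Wa : 4 / a * (a / 2) <= W * (a / 2) by apply: ler_wpM2r; lra.
 have e4 : 4 / a * (a / 2) = 2 by field; exact: lt0r_neq0.
 lra.
move: Z2; rewrite ltr1n => /card_gt1P[f [g [hf hg fg]]].
have [z [hz0 hz]] : exists z : pts s (2 * truncn P).+1, (exists j, pt z j != 0) /\ forall i, qf (C i) (pt z) = 0.
 have zero (z : pts s (2 * truncn P).+1) : (exists j, pt z j != 0) \/ pt z = (fun=> 0).
  case: (pselect (exists j, pt z j != 0)); [by left | move=> /forallNP h0; right].
  by apply/funext => j; apply/eqP/negPn/negP; exact: h0.
 have [h0|e1] := zero f; first by exists f; split=> // i; move: hf => /andP[_ /forallP/(_ i)/eqP].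
 have [h0|e2] := zero g; first by exists g; split=> // i; move: hg => /andP[_ /forallP/(_ i)/eqP].
 by move: fg; rewrite (pt_inj (etrans e1 (esym e2))) eqxx.
by exists (pt z).
Qed.

End RationalPencil.

(** * From polynomials to integral matrices *)

Section Reduction.
Variables (R : realType) (r s : nat) (G : 'I_r.+1 -> {mpoly rat[s]}) (C : 'I_r.+1 -> 'M[int]_s).
Local Notation n := r.+1.
Hypothesis hG : forall i, G i \is 2.-homog.
Hypothesis hC : forall i, qtri (G i) = map_mx intr (C i).

Lemma qevalr_qf (K : numFieldType) (v : 'I_s -> K) i : qevalr (G i) v = qf (C i) v.
Proof.
rewrite qevalr_quad // hC; apply: eq_bigr => j _; apply: eq_bigr => k _.
by rewrite mxE ratr_int.
Qed.

Lemma meval_qf (x : 'I_s -> int) i : (G i).@[fun j => (x j)%:~R] = (qf (C i) x)%:~R.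
Proof.
rewrite -qf_intr -qevalr_qf /qevalr; congr meval.
by apply/mpolyP => m; rewrite (mcoeff_map_mpoly (ratr : {rmorphism rat -> rat})) /= /ratr divq_num_den.
Qed.

Lemma jacobian_jac (x : s.-tuple R) : jacobian_mx G x = jac (fun i => map_mx intr (C i)) (\row_j tnth x j).
Proof.
apply/matrixP => i l; rewrite mxE qevalr_deriv // hC !mxE; apply: eq_bigr => k _.
by rewrite !mxE mulrC rmorphD /= !ratr_int [in RHS]addrC.
Qed.

Lemma cpencil_rank (a : 'I_n -> R[i]) :
 qform_rank (cpencil G a) = \rank (\sum_i a i *: map_mx intr (polar (C i)))%R.
Proof.
rewrite /qform_rank qform_mx_qtri (eqmx_scale _ (lt0r_neq0 _)) ?invr_gt0 ?ltr0n //; congr (\rank _).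
have e : qtri (cpencil G a) = \sum_i a i *: map_mx intr (C i).
 apply/matrixP => j k; rewrite summxE mxE /cpencil raddf_sum /=.
 transitivity (\sum_i a i * (ratr (qtri (G i) j k) : R[i])).
  case: ifP => jk; last by rewrite big1 // => i _; rewrite mxE jk rmorph0 mulr0.
  by apply: eq_bigr => i _; rewrite mcoeffZ (mcoeff_map_mpoly (ratr : {rmorphism rat -> R[i]})) mxE jk.
 by apply: eq_bigr => i _; rewrite hC !mxE ratr_int.
rewrite e linear_sum -big_split /=; apply: eq_bigr => i _.
by rewrite linearZ /= -scalerDr polar_intr.
Qed.

Lemma singular_integrand_Ig (I : 'I_s -> interval R) (g : n.-tuple R) :
 singular_integrand G (box I) g = Ig C I (tnth g).
Proof.
rewrite /singular_integrand /Ig /Cintegral /hint; congr Complex; congr Rintegral; apply/funext => t /=;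
 rewrite /hosc /osc /phase; congr (_ (2 * pi * _)); by apply: eq_bigr => i _; rewrite qevalr_qf.
Qed.

Lemma singular_integral_sintegral (I : 'I_s -> interval R) : singular_integral G (box I) = sintegral C I.
Proof.
have e : singular_integrand G (box I) = fun g => Ig C I (tnth g).
 by apply/funext => g; exact: singular_integrand_Ig.
by rewrite /singular_integral e.
Qed.

Lemma singular_series_term_Aq q : singular_series_term R G q = Aq R C q.
Proof.
rewrite /singular_series_term /Aq.
have tK m k : cancel (fun x : m.-tuple 'I_k => [ffun j => tnth x j]) (fun f : pts m k => [tuple f j | j < m]).
 by move=> x; apply: eq_from_tnth => j; rewrite tnth_mktuple ffunE.
have Kt m k : cancel (fun f : pts m k => [tuple f j | j < m]) (fun x : m.-tuple 'I_k => [ffun j => tnth x j]).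
 by move=> f; apply/ffunP => j; rewrite ffunE tnth_mktuple.
rewrite (reindex (fun f : pts n q => [tuple f j | j < n])) /=; last first.
 by exists (fun x : n.-tuple 'I_q => [ffun j => tnth x j]) => ? _; [exact: Kt | exact: tK].
apply: eq_big => [a|a _].
 by rewrite /cop; congr (gcdn _ _ == _); apply: eq_bigr => i _; rewrite tnth_mktuple.
congr (_ * _); rewrite /gsum /esum gauss_nsum.
rewrite -(nsum_ffun (fun i : 'I_q => (nat_of_ord i).+1%:Z)).
rewrite (reindex (fun f : pts s q => [tuple f j | j < s])) /=; last first.
 by exists (fun x : s.-tuple 'I_q => [ffun j => tnth x j]) => ? _; [exact: Kt | exact: tK].
apply: eq_bigr => x _; congr expi2pi; rewrite mulr_sumr /iphase /phase; apply: eq_bigr => i _.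
rewrite tnth_mktuple qevalr_qf mulrA [_^-1 * _]mulrC; congr (_ * qf _ _).
by apply/funext => j; rewrite tnth_mktuple.
Qed.

Lemma count_zcount (I : 'I_s -> interval R) P : box_le 1 I -> 1 <= P ->
 count_zeros G (dilate P (box I)) = zcount C (truncn P) (Dbox I P).
Proof.
move=> hI P1; have P0 : P != 0 by apply: lt0r_neq0; lra.
set N := truncn P; rewrite /count_zeros /zcount.
set Q : pred (pts s (2 * N).+1) := fun f => _.
pose tup (f : pts s (2 * N).+1) : s.-tuple int := [tuple pt f j | j < s].
have ti : injective tup.
 by move=> f g e; apply: (@pt_inj s N); apply/funext => j; have := congr1 (fun t => tnth t j) e; rewrite !tnth_mktuple.
set A := [set x | _].
have -> : A = [set` seq_fset tt [seq tup f | f <- enum Q]].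
 apply/seteqP; split=> x.
  move=> [[y hy yx] hx]; rewrite -[[set` _] x]/(is_true (x \in _)) seq_fsetE.
  have yj j : (tnth x j)%:~R = P * tnth y j by have := congr1 (fun t => tnth t j) yx; rewrite !tnth_mktuple.
  have Dx j : Dbox I P j (tnth x j) by rewrite /Dbox yj mulrAC mulfV // mul1r; exact: hy.
  have [f fE] : exists f : pts s (2 * N).+1, pt f = tnth x.
   by apply: pt_surj => j; have [_ h] := good_Dbox hI P1; exact: (h _ _ (Dx j)).
  apply/mapP; exists f; last by apply: eq_from_tnth => j; rewrite tnth_mktuple fE.
  rewrite mem_enum unfold_in /Q fE; apply/andP; split; first by apply/forallP.
  by apply/forallP => i; have := hx i; rewrite meval_qf => /eqP; rewrite intr_eq0.
 rewrite -[[set` _] x]/(is_true (x \in _)) seq_fsetE => /mapP[f]; rewrite mem_enum unfold_in => /andP[/forallP hf /forallP hz] ->; split.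
  exists [tuple (pt f j)%:~R / P | j < s]; first by move=> j; rewrite tnth_mktuple; exact: hf.
  by apply: eq_from_tnth => j; rewrite !tnth_mktuple mulrCA mulfV // mulr1.
 move=> i; rewrite -[RHS](mulr0z 1) -(eqP (hz i)) -meval_qf; apply: meval_eq => j; by rewrite tnth_mktuple.
rewrite set_fsetK size_seq_fset undup_id ?size_map -?cardE //.
by rewrite map_inj_uniq // enum_uniq.
Qed.

End Reduction.

(** A nonempty box reveals each side by varying one coordinate of a point. An empty box may have
    unbounded sides and is replaced by a product of empty intervals. *)
Lemma bounded_box (R : realType) s (I : 'I_s -> interval R) : (0 < s)%N -> box I `<=` unit_box R s ->
 exists I' : 'I_s -> interval R, [/\ box I' = box I, box_le 1 I' & forall x, box_interior I x -> box_interior I' x].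
Proof.
move=> s0 hI; have [[x0 hx0]|h0] := pselect (exists x, box I x).
 exists I; split=> // j y yj.
 have := hI [tuple if k == j then y else tnth x0 k | k < s]; rewrite /unit_box /box /= => h.
 have := h _ j; rewrite tnth_mktuple eqxx in_itv /= ler_norml; apply=> k; rewrite tnth_mktuple.
 by case: eqP => [->|_].
exists (fun=> `]0, 0[); split.
- apply/seteqP; split=> x hx; last by case: h0; exists x.
 by have := hx (Ordinal s0); rewrite in_itv /= => /andP[h1 h2]; have := lt_trans h1 h2; rewrite ltxx.
- by move=> j x; rewrite in_itv /= => /andP[h1 h2]; have := lt_trans h1 h2; rewrite ltxx.
- by move=> x hx; case: h0; exists x => j; exact: (interior_subset (hx j)).
Qed.

Lemma powR_sub (R : realType) (P a b : R) : 0 < P -> P `^ a * P `^ (- b) = P `^ (a - b).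
Proof. by move=> P0; rewrite powRD // lt0r_neq0 // implybT. Qed.
Lemma powR_sub_nat (R : realType) (P : R) a b : 0 < P -> P ^+ a / P ^+ (2 * b) = P `^ (a%:R - 2 * b%:R).
Proof. by move=> P0; rewrite -powR_sub // powRN -natrM !powR_mulrn ?(ltW P0). Qed.

(** * Multiplication of the forms by a positive integer *)

Section Scaling.
Variables (r s : nat) (F : 'I_r -> {mpoly rat[s]}) (m : nat).
Hypothesis m0 : (0 < m)%N.
Local Notation G := (fun i => m%:R *: F i).

Lemma integer_matrix (H : 'I_r -> {mpoly rat[s]}) : (forall i j k, qtri (H i) j k \is a Num.int) ->
 exists C : 'I_r -> 'M[int]_s, forall i, qtri (H i) = map_mx intr (C i).
Proof.
move=> hH; exists (fun i => \matrix_(j, k) Num.floor (qtri (H i) j k)) => i.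
by apply/matrixP => j k; rewrite [RHS]mxE [X in _ = X%:~R]mxE floorK.
Qed.

Lemma qevalr_scale (K : numFieldType) (p : {mpoly rat[s]}) (v : 'I_s -> K) : qevalr (m%:R *: p) v = m%:R * qevalr p v.
Proof.
rewrite /qevalr (map_mpolyZ (ratr : {rmorphism rat -> K})) mevalZ.
by rewrite (rmorph_nat (ratr : {rmorphism rat -> K})).
Qed.

Lemma nonsingular_zero_scale (R : realType) (x : s.-tuple R) :
 nonsingular_real_zero F x -> nonsingular_real_zero G x.
Proof.
move=> [hx rk]; split=> [i|]; first by rewrite qevalr_scale hx mulr0.
have -> : jacobian_mx G x = m%:R *: jacobian_mx F x.
 by apply/matrixP => i j; rewrite !mxE linearZ /= qevalr_scale.
by rewrite (eqmx_scale _ _) // pnatr_eq0 -lt0n.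
Qed.

Lemma count_zeros_scale (R : realType) (A : set (s.-tuple R)) : count_zeros G A = count_zeros F A.
Proof.
rewrite /count_zeros; congr (#|` fset_set _|)%fset.
apply/seteqP; split=> x [h1 h2]; split=> // i; have := h2 i; rewrite mevalZ; last by move=> ->; rewrite mulr0.
by move=> /eqP; rewrite mulf_eq0 pnatr_eq0 gtn_eqF //= => /eqP.
Qed.

Lemma cpencil_scale (R : realType) (b : 'I_r -> R[i]) : cpencil G b = cpencil F (fun i => m%:R * b i).
Proof.
apply: eq_bigr => i _; rewrite (map_mpolyZ (ratr : {rmorphism rat -> R[i]})) scalerA.
by rewrite (rmorph_nat (ratr : {rmorphism rat -> R[i]})) mulrC.
Qed.

End Scaling.

Theorem corollary1 (R : realType) (r s : nat) (F : 'I_r -> {mpoly rat[s]})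
    (I : 'I_s -> interval R)
    (r_gt0 : (0 < r)%N)
    (F_quadratic : forall i, F i \is 2.-homog)
    (pencil_rank : forall a : 'I_r -> R[i], (exists i, a i != 0) ->
       (2 * r ^ 2 + 2 * r < qform_rank (cpencil F a))%N)
    (real_zero : exists x : s.-tuple R, nonsingular_real_zero F x)
    (box_unit : box I `<=` unit_box R s) :
  (forall m : nat, (0 < m)%N ->
     let G := fun i => m%:R *: F i in
     integer_coeffs G ->
     let J := singular_integral G (box I) in
     let S := singular_series R G in
     [/\ singular_integral_converges G (box I),
         singular_series_converges R G,
         exists delta : R, 0 < delta /\
           exists C : R, forall P : R, 1 <= P ->
             `| (count_zeros F (dilate P (box I)))%:R
                - J * S * (P `^ (s%:R - 2 * r%:R))%:C%C |
             <= (C * P `^ (s%:R - 2 * r%:R - delta))%:C%C,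
         0 < S &
         (exists x : s.-tuple R,
            box_interior I x /\ nonsingular_real_zero F x) -> 0 < J]) /\
  (exists z : s.-tuple rat,
     (exists j, tnth z j != 0) /\ forall i, (F i).@[tnth z] = 0).
Proof.
case: r F r_gt0 F_quadratic pencil_rank real_zero => // r F _ hF hp [x0 hx0].
have hG m i : m%:R *: F i \is 2.-homog by exact: rpredZ.
have pencilC m (C : 'I_r.+1 -> 'M[int]_s) : (0 < m)%N -> (forall i, qtri (m%:R *: F i) = map_mx intr (C i)) ->
  forall b : 'I_r.+1 -> R[i], (exists i, b i != 0) ->
  (2 * r.+1 * r.+2 < \rank (\sum_i b i *: map_mx intr (polar (C i)))%R)%N.
 move=> m0 hC b [i bi]; rewrite -(cpencil_rank hC) cpencil_scale.
 have -> : (2 * r.+1 * r.+2 = 2 * r.+1 ^ 2 + 2 * r.+1)%N by rewrite expnS expn1 [LHS]mulnS addnC mulnA.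
 by apply: hp; exists i; rewrite mulf_neq0 // pnatr_eq0 -lt0n.
have nonsing m (C : 'I_r.+1 -> 'M[int]_s) (x : s.-tuple R) : (0 < m)%N -> (forall i, qtri (m%:R *: F i) = map_mx intr (C i)) ->
  nonsingular_real_zero F x ->
  (forall i, qd (map_mx intr (C i)) (\row_j tnth x j) = 0) /\
  \rank (jac (fun i => map_mx intr (C i)) (\row_j tnth x j)) = r.+1.
 move=> m0 hC /(nonsingular_zero_scale m0)[h rk]; split; last by rewrite -(jacobian_jac (hG m) hC).
 move=> i; rewrite -(h i) (qevalr_qf (hG m) hC) qd_int; congr qf; by apply/funext => j; rewrite mxE.
split; last first.
 (* The rational zero is found with a multiplier of its own, a common denominator of all
    coefficients. *)
 have [m [m0 hm]] := common_denominator (fun t : 'I_r.+1 * 'I_s * 'I_s => qtri (F t.1.1) t.1.2 t.2).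
 have [|C hC] := @integer_matrix r.+1 s (fun i => m%:R *: F i).
  move=> i j k; have := hm (i, j, k); rewrite !mxE /=; case: ifP => _; last by rewrite rpred0.
  by rewrite mcoeffZ.
 have [h rk] := nonsing m C x0 m0 hC hx0.
 have [z [[j zj] hz]] := integral_zero_exists (pencilC m C m0 hC) h rk.
 exists [tuple (z j)%:~R | j < s]; split; first by exists j; rewrite tnth_mktuple intr_eq0.
 move=> i; have := meval_qf (hG m) hC z i; rewrite hz mevalZ => /eqP.
 rewrite mulf_eq0 pnatr_eq0 gtn_eqF //= => /eqP <-; apply: meval_eq => k; by rewrite tnth_mktuple.
move=> m m0 G hint.
have [C hC] : exists C : 'I_r.+1 -> 'M[int]_s, forall i, qtri (G i) = map_mx intr (C i).
 apply: integer_matrix => i j k; rewrite mxE; case: ifP => _; last exact: rpred0.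
 by have /mpolyOverP := hint i; apply.
have hpen := pencilC m C m0 hC; have hr := rational_rank_cond hpen.
have sn := rank_cond_dim hr.
have [I' [eI hI intI]] := bounded_box (leq_ltn_trans (leq0n _) sn) box_unit.
have eJ : singular_integral G (box I) = sintegral C I' by rewrite -eI (singular_integral_sintegral (hG m) hC).
have eP : singular_partial_sum R G = Spart R C.
 by apply/funext => Q; apply: eq_bigr => q _; exact: (singular_series_term_Aq R (hG m) hC).
have [l [hl [K [K1 HK]]]] := sseries_cvg R hr.
have eS : singular_series R G = l by rewrite /singular_series eP; apply: cvg_lim hl; exact: norm_hausdorff.
rewrite eJ eS; split.
- have e : singular_integrand G (box I) = fun g => Ig C I' (tnth g).
  by apply/funext => g; rewrite -eI; exact: (singular_integrand_Ig (hG m) hC).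
 rewrite /singular_integral_converges e; split; [exact: IRe_integrable | exact: IIm_integrable].
- by rewrite /singular_series_converges eP; apply/cvg_ex; exists l.
- have [d [c [d0 c0 H]]] := asymptotic_formula hr hI K1 HK.
 exists d; split; first exact: d0.
 exists c => P P1; have P0 := lt_le_trans ltr01 P1.
 have := H P P1; cbv zeta; rewrite -(count_zcount (hG m) hC hI P1) eI (count_zeros_scale F m0) cabsE lecR.
 rewrite (powR_sub_nat s r.+1 P0).
 rewrite -[P `^ (_ - d)](powR_sub _ _ P0); set W := P `^ (_ - _).
 by rewrite [_ * W%:C%C]mulrC [sintegral _ _ * _]mulrC !mulrA.
- exact: (singular_series_pos hr (local_density_pos hpen) (ex_intro _ K (conj K1 HK))).
- move=> [x [hx nx]]; have [h rk] := nonsing m C x m0 hC nx.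
 have /choice[e he] : forall j, exists e : R, 0 < e /\ forall y, `|y - tnth x j| < e -> y \in I' j.
  move=> j; have := intI x hx j => /nbhs_ballP[e /= e0 hb]; exists e; split=> // y hy; apply: hb.
  by rewrite /ball /= distrC.
 (* Every coordinate has open room [e j] around it; half of the smallest one gives the closed
    neighbourhood required below. *)
 pose rho := \big[Num.min/1]_j e j.
 have rho0 : 0 < rho by apply: lt_bigmin => // j _; have [] := he j.
 apply: (singular_integral_pos hr hI h rk (rho0 := rho / 2)); first by rewrite divr_gt0.
 move=> j y; rewrite mxE => hy; have [_] := he j; apply; apply: le_lt_trans hy _.
 by have : rho <= e j by [exact: bigmin_le]; lra.
Qed.
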